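(* Let $M\in[1,\infty[$ and let $\Delta\in[1,M]$ be such that $\Delta\ll M^{2/3}$. Then, uniformly for $\alpha\in\mathbb R$, \[\sum_{M\leqslant n\leqslant M+\Delta}t(n)\,e(n\alpha)\ll\Delta^{1/6-\vartheta}\,M^{1/3+\vartheta+\varepsilon}.\]
   Context: Let $\psi$ be a fixed Maass cusp form for the full modular group $\mathrm{SL}_2(\mathbb Z)$, with eigenvalue $1/4+\kappa^2$ of the hyperbolic Laplacian and Fourier expansion $\psi(x+yi)=y^{1/2}\sum_{n\neq0}t(n)K_{i\kappa}(2\pi|n|y)e(nx)$; $\psi$ is assumed even or odd, i.e. $t(-n)=t(n)$ for all $n\geqslant1$ or $t(-n)=-t(n)$ for all $n\geqslant1$. Here $e(x)=e^{2\pi ix}$. The number $\vartheta\in[0,\infty[$ is a fixed exponent such that $t(n)\ll n^{\vartheta+\varepsilon}$ for every $\varepsilon>0$ (e.g. $\vartheta=7/64$ is admissible). $\varepsilon$ denotes an arbitrarily small fixed positive number; implicit constants in $\ll$ (in hypotheses and conclusions) may depend on $\psi$, $\vartheta$ and $\varepsilon$. *)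

(* Defs.v *)
From Stdlib Require Import Reals ZArith Zfloor.
From Coquelicot Require Import Coquelicot.
Open Scope R_scope.

Definition e (x : R) : C := (cos (2 * PI * x), sin (2 * PI * x)).

(* [K_imag kappa y] is K_{i kappa}(y) for real kappa and y > 0: the Macdonald
   integral of exp(- y cosh u) cosh(nu u) over [0, +oo[ at nu = i kappa, where
   cosh(i kappa u) = cos(kappa u). *)
Definition K_imag (kappa y : R) : R :=
  RInt_gen (V := R_CompleteNormedModule)
    (fun u : R => exp (- y * cosh u) * cos (kappa * u))
    (at_point 0) (Rbar_locally p_infty).

Definition smooth_upper (f : R -> R -> R) : Prop :=
  forall (n : nat) (x y : R), 0 < y -> ex_diff_n f n x y.

Definition hyp_laplacian (f : R -> R -> R) (x y : R) : R :=
  - (y ^ 2) * (partial_derive 2 0 f x y + partial_derive 0 2 f x y).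

Definition re_part (psi : C -> C) (x y : R) : R := Re (psi (x, y)).
Definition im_part (psi : C -> C) (x y : R) : R := Im (psi (x, y)).

(* Functions on the upper half-plane are total functions [C -> C] whose values
   outside {Im z > 0} are irrelevant; the zero form is not excluded. *)
Record maass_cusp_form (kappa : R) (psi : C -> C) : Prop := {
  mcf_smooth : smooth_upper (re_part psi) /\ smooth_upper (im_part psi);
  mcf_invariant : forall (a b c d : Z) (z : C),
    (a * d - b * c = 1)%Z -> 0 < Im z ->
    psi ((RtoC (IZR a) * z + RtoC (IZR b)) /
         (RtoC (IZR c) * z + RtoC (IZR d)))%C = psi z;
  mcf_eigen : forall x y : R, 0 < y ->
    hyp_laplacian (re_part psi) x y = (1 / 4 + kappa ^ 2) * re_part psi x y /\
    hyp_laplacian (im_part psi) x y = (1 / 4 + kappa ^ 2) * im_part psi x y;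
  mcf_growth : exists (N : nat) (B : R), forall x y : R, 1 <= y ->
    Cmod (psi (x, y)) <= B * y ^ N;
  mcf_cuspidal : forall y : R, 0 < y ->
    is_RInt (V := C_R_NormedModule) (fun x : R => psi (x, y)) 0 1 (RtoC 0)
}.

Definition fourier_term (kappa : R) (t : Z -> C) (x y : R) (n : Z) : C :=
  (t n * RtoC (K_imag kappa (2 * PI * Rabs (IZR n) * y)) * e (IZR n * x))%C.

(* The sum over n <> 0 is split into its parts over n >= 1 and n <= -1, both
   required to converge; the value [t 0] plays no role. *)
Definition fourier_expansion (kappa : R) (psi : C -> C) (t : Z -> C) : Prop :=
  forall x y : R, 0 < y ->
    exists Sp Sn : C,
      is_series (V := C_R_NormedModule)
        (fun k : nat => fourier_term kappa t x y (Z.of_nat (S k))) Sp /\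
      is_series (V := C_R_NormedModule)
        (fun k : nat => fourier_term kappa t x y (- Z.of_nat (S k))%Z) Sn /\
      psi (x, y) = (RtoC (sqrt y) * (Sp + Sn))%C.

Definition even_or_odd (t : Z -> C) : Prop :=
  (forall n : Z, (1 <= n)%Z -> t (- n)%Z = t n) \/
  (forall n : Z, (1 <= n)%Z -> t (- n)%Z = (- t n)%C).

Definition admissible_exponent (t : Z -> C) (theta : R) : Prop :=
  forall eps : R, 0 < eps -> exists B : R, forall n : Z, (1 <= n)%Z ->
    Cmod (t n) <= B * Rpower (IZR n) (theta + eps).

(* The sum of t(n) e(n alpha) over the integers n in [M, M + Delta], M >= 0. *)
Definition short_sum (t : Z -> C) (M Delta alpha : R) : C :=
  sum_n_m (G := C_AbelianMonoid)
    (fun n : nat => (t (Z.of_nat n) * e (INR n * alpha))%C)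
    (Z.to_nat (Zceil M)) (Z.to_nat (Zfloor (M + Delta))).

(* Main.v *)
(** Finite Fourier inversion on intervals of length 1/Delta and partial summation recover the short sum
    from averages over x near -alpha of e(-Mx) times a mean of psi(x + iy) over heights y of order 1/M.
    A modular transformation that moves a rational close to the point to infinity makes the latter an
    oscillatory integral with phase M/w. If a rational with a small denominator is very close to
    alpha, the Fourier expansion at that cusp and the first and second derivative tests suffice.
    Otherwise the interval is dissected into Farey arcs; transported to a fixed height they are
    paired by the Cauchy-Schwarz inequality along a horizontal line, pairs of arcs with separated
    phases contribute little, and the close pairs are counted as lattice points in a box. In the
    ranges left over the trivial bound is enough. *)

Require Import Defs.
From Stdlib Require Import Reals ZArith Znumtheory Lra Lia List Classical.
From Coquelicot Require Import Coquelicot.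
Import ListNotations.
Open Scope R_scope.

(** Put Delta = [s ^ 2] and M = [s ^ 2 * q ^ 6]. The averages then have to be bounded by about q^(6
    theta - 1), the trivial bound being of order 1. It is the mean over heights y that makes a fixed
    height available: the modular map sends the point with parameter w to about (a - w)/K + i y w^2,
    a curve that depends on the arc. Taking y w^2 as a new variable turns these curves into
    horizontal segments, so that all arcs share one factor psi, which Cauchy-Schwarz discards at the
    cost of its sup norm. No bound for individual t(n) enters there; instead the denominators must
    not be small, which forces the distinction of cases. The threshold is 1/(q z)^2. Above it the
    Farey arcs give z^2/q. Below it the frequencies at the cusp reach about q^8, the coefficients
    lose q^(8 theta), and the bound is q^(8 theta - 1)/z. The choice z = q^(2 theta) brings the
    second bound to the target and leaves the first one below it. The condition Delta << M^(2/3)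
    controls the case in which only boundedly many frequencies are stationary at the cusp. *)

Ltac pos :=
  first [ assumption | lra |
   lazymatch goal with
   | |- _ /\ _ => split; pos
   | |- _ < _ * _ => apply Rmult_lt_0_compat; pos
   | |- _ < _ / _ => apply Rdiv_lt_0_compat; pos
   | |- _ < / _ => apply Rinv_0_lt_compat; pos
   | |- _ < _ ^ _ => apply pow_lt; pos
   | |- _ < sqrt _ => apply sqrt_lt_R0; pos
   | |- _ < exp _ => apply exp_pos
   | |- _ < Rpower _ _ => apply exp_pos
   | |- _ < INR _ => apply lt_0_INR; lia
   | |- _ < PI => apply PI_RGT_0
   | |- _ < _ + _ => apply Rplus_lt_0_compat; pos
   | |- _ <= _ * _ => apply Rmult_le_pos; pos
   | |- _ <= _ / _ => apply Rmult_le_pos; pos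
   | |- _ <= _ ^ 2 => apply pow2_ge_0
   | |- _ <= _ ^ _ => apply pow_le; pos
   | |- _ <= sqrt _ => apply sqrt_pos
   | |- _ <= Rabs _ => apply Rabs_pos
   | |- _ <= Cmod _ => apply Cmod_ge_0
   | |- _ <= INR _ => apply pos_INR
   | |- _ <= _ + _ => apply Rplus_le_le_0_compat; pos
   | |- _ <= _ => left; pos
   | |- _ <> _ => apply Rgt_not_eq; pos
   end ].

Ltac mul_l := apply Rmult_le_compat_l; [pos|].
Ltac mul_r := apply Rmult_le_compat_r; [pos|].
Tactic Notation "via" uconstr(t) := eapply Rle_trans; [apply t|].
Ltac cont := apply (ex_derive_continuous (V:=R_NormedModule)); auto_derive; easy.

(** * Complex integrals and oscillation *)

Lemma Cmod_e x : Cmod (e x) = 1.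
Proof.
  unfold Cmod, e; simpl. replace (_ + _) with (Rsqr (sin (2*PI*x)) + Rsqr (cos (2*PI*x))) by (unfold Rsqr; ring).
  rewrite sin2_cos2; apply sqrt_1.
Qed.

Lemma e_plus x y : e (x + y) = (e x * e y)%C.
Proof.
  unfold e, Cmult; simpl. replace (2*PI*(x+y)) with (2*PI*x + 2*PI*y) by ring. rewrite cos_plus, sin_plus; f_equal; ring.
Qed.

Lemma e_opp x : e (- x) = Cconj (e x).
Proof.
  unfold e, Cconj; simpl. replace (2*PI*-x) with (-(2*PI*x)) by ring. now rewrite cos_neg, sin_neg.
Qed.

Lemma e_0 : e 0 = RtoC 1.
Proof. unfold e, RtoC. now rewrite Rmult_0_r, cos_0, sin_0. Qed.

Lemma e_INR n : e (INR n) = RtoC 1.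
Proof.
  unfold e, RtoC. replace (2*PI*INR n) with (0 + 2*INR n*PI) by ring. now rewrite cos_period, sin_period, cos_0, sin_0.
Qed.

Lemma e_IZR n : e (IZR n) = RtoC 1.
Proof.
  destruct (Z_le_dec 0 n).
  - rewrite <- (Z2Nat.id n) by lia. rewrite <- INR_IZR_INZ. apply e_INR.
  - replace (IZR n) with (- INR (Z.to_nat (-n))).
   + rewrite e_opp, e_INR. unfold Cconj, RtoC; simpl. now rewrite Ropp_0.
   + rewrite INR_IZR_INZ, Z2Nat.id by lia. rewrite opp_IZR. ring.
Qed.

Lemma e_conj_mult x y : (e x * Cconj (e y))%C = e (x - y).
Proof. unfold Rminus. now rewrite e_plus, e_opp. Qed.

Lemma Cmult_minus a b c : (a * b - a * c = a * (b - c))%C.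
Proof. ring. Qed.

Lemma nat_ceil x : 0 <= x -> x <= INR (Z.to_nat (up x)) <= x + 1.
Proof.
  intros Hx. destruct (archimed x) as [a1 a2]. rewrite INR_IZR_INZ, Z2Nat.id; [lra|]. apply le_IZR; lra.
Qed.

(** Integrability and value are stated by components, so that the criteria for real Riemann
    integrals apply to complex integrands. *)
Definition is_CInt (f : R -> C) (a b : R) (l : C) : Prop :=
  is_RInt (V := R_NormedModule) (fun x => fst (f x)) a b (fst l) /\
  is_RInt (V := R_NormedModule) (fun x => snd (f x)) a b (snd l).

Definition CInt (f : R -> C) (a b : R) : C :=
  (RInt (V := R_CompleteNormedModule) (fun x => fst (f x)) a b,
  RInt (V := R_CompleteNormedModule) (fun x => snd (f x)) a b).

(** [CInt] is a total function whose value means nothing without integrability; this predicate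
    certifies it. *)
Definition exC f a b := is_CInt f a b (CInt f a b).

Definition ccont (f : R -> C) (x : R) : Prop :=
  continuous (fun x => fst (f x)) x /\ continuous (fun x => snd (f x)) x.

Lemma is_CInt_unique f a b l : is_CInt f a b l -> CInt f a b = l.
Proof.
  intros [H1 H2]. unfold CInt. destruct l as [l1 l2]; simpl in *. f_equal; now apply is_RInt_unique.
Qed.

Lemma is_CInt_exC f a b l : is_CInt f a b l -> exC f a b.
Proof. intros H. unfold exC. now rewrite (is_CInt_unique _ _ _ _ H). Qed.

Lemma exC_cont f a b : a <= b -> (forall x, a <= x <= b -> ccont f x) -> exC f a b.
Proof.
  intros Hab H. split; apply (RInt_correct (V:=R_CompleteNormedModule));
  apply (ex_RInt_continuous (V:=R_CompleteNormedModule)); intros z Hz;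
  rewrite Rmin_left, Rmax_right in Hz by easy; apply H, Hz.
Qed.

Lemma is_RInt_lin (f g : R -> R) a b (l m p q : R) :
  is_RInt (V:=R_NormedModule) f a b l -> is_RInt (V:=R_NormedModule) g a b m ->
  is_RInt (V:=R_NormedModule) (fun x => p * f x + q * g x) a b (p * l + q * m).
Proof.
  intros H1 H2. apply (is_RInt_plus (V:=R_NormedModule) (fun x => p * f x) (fun x => q * g x));
  now apply (is_RInt_scal (V:=R_NormedModule)).
Qed.

Lemma is_CInt_ext f g a b l :
  a <= b -> (forall x, a < x < b -> f x = g x) -> is_CInt f a b l -> is_CInt g a b l.
Proof.
  intros Hab H [H1 H2]; split; [apply is_RInt_ext with (2 := H1)|apply is_RInt_ext with (2 := H2)];
  intros x Hx; rewrite Rmin_left, Rmax_right in Hx by easy; now rewrite H.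
Qed.

Lemma is_RInt_eq (f g : R -> R) a b l m :
  is_RInt (V:=R_NormedModule) f a b l -> (forall x, f x = g x) -> l = m ->
  is_RInt (V:=R_NormedModule) g a b m.
Proof. intros H E <-. eapply is_RInt_ext; [|exact H]. intros; apply E. Qed.

Lemma is_CInt_plus f g a b l m :
  is_CInt f a b l -> is_CInt g a b m -> is_CInt (fun x => f x + g x)%C a b (l + m)%C.
Proof.
  intros [H1 H2] [H3 H4]; split.
  - eapply is_RInt_eq; [apply (is_RInt_lin _ _ _ _ _ _ 1 1 H1 H3)| |]; intros; simpl; ring.
  - eapply is_RInt_eq; [apply (is_RInt_lin _ _ _ _ _ _ 1 1 H2 H4)| |]; intros; simpl; ring.
Qed.

Lemma is_CInt_scal c f a b l : is_CInt f a b l -> is_CInt (fun x => c * f x)%C a b (c * l)%C.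
Proof.
  intros [H1 H2]; split.
  - eapply is_RInt_eq; [apply (is_RInt_lin _ _ _ _ _ _ (fst c) (- snd c) H1 H2)| |]; intros; simpl; ring.
  - eapply is_RInt_eq; [apply (is_RInt_lin _ _ _ _ _ _ (snd c) (fst c) H1 H2)| |]; intros; simpl; ring.
Qed.

Lemma is_CInt_minus f g a b l m :
  is_CInt f a b l -> is_CInt g a b m -> is_CInt (fun x => f x - g x)%C a b (l - m)%C.
Proof.
  intros [H1 H2] [H3 H4]; split.
  - eapply is_RInt_eq; [apply (is_RInt_lin _ _ _ _ _ _ 1 (-1) H1 H3)| |]; intros; simpl; ring.
  - eapply is_RInt_eq; [apply (is_RInt_lin _ _ _ _ _ _ 1 (-1) H2 H4)| |]; intros; simpl; ring.
Qed.

Lemma is_CInt_Chasles f a b c l m :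
  is_CInt f a b l -> is_CInt f b c m -> is_CInt f a c (l + m)%C.
Proof.
  intros [H1 H2] [H3 H4]; split; [exact (is_RInt_Chasles _ _ _ _ _ _ H1 H3)|exact (is_RInt_Chasles _ _ _ _ _ _ H2 H4)].
Qed.

Lemma is_CInt_point f a : is_CInt f a a (RtoC 0).
Proof. split; apply (is_RInt_point (V:=R_NormedModule)). Qed.

Lemma is_CInt_const c a b : is_CInt (fun _ => c) a b (RtoC (b - a) * c)%C.
Proof.
  split.
  - eapply is_RInt_eq; [apply (is_RInt_const (V:=R_NormedModule))|reflexivity|].
   simpl. unfold scal; simpl; unfold mult; simpl. ring.
  - eapply is_RInt_eq; [apply (is_RInt_const (V:=R_NormedModule))|reflexivity|].
   simpl. unfold scal; simpl; unfold mult; simpl. ring.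
Qed.

Lemma exC_sub f a b c d : a <= c -> c <= d -> d <= b -> exC f a b -> exC f c d.
Proof.
  intros Hac Hcd Hdb [H1 H2]. split; apply (RInt_correct (V:=R_CompleteNormedModule)).
  - apply (ex_RInt_Chasles_1 (V:=R_CompleteNormedModule)) with b; [lra|].
   apply (ex_RInt_Chasles_2 (V:=R_CompleteNormedModule)) with a; [lra|]. eexists; exact H1.
  - apply (ex_RInt_Chasles_1 (V:=R_CompleteNormedModule)) with b; [lra|].
   apply (ex_RInt_Chasles_2 (V:=R_CompleteNormedModule)) with a; [lra|]. eexists; exact H2.
Qed.

Lemma CInt_Chasles f a b c : a <= b -> b <= c -> exC f a c ->
  CInt f a c = (CInt f a b + CInt f b c)%C.
Proof.
  intros Hab Hbc H. apply is_CInt_unique, is_CInt_Chasles with b.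
  - now apply (exC_sub f a c).
  - now apply (exC_sub f a c).
Qed.

Lemma Re_mult_le c d : fst (c * d)%C <= Cmod c * Cmod d.
Proof.
  rewrite <- Cmod_mult. via Rle_abs. apply re_le_Cmod.
Qed.

(* Rotating the integral onto the positive real axis reduces to the real case. *)
Lemma is_CInt_norm f g a b l m : a <= b ->
  (forall x, a <= x <= b -> Cmod (f x) <= g x) ->
  is_CInt f a b l -> is_RInt (V:=R_NormedModule) g a b m -> Cmod l <= m.
Proof.
  intros Hab Hfg Hf Hg. destruct (Req_dec (Cmod l) 0) as [E|E].
  { rewrite E. apply (is_RInt_le (fun _ => 0) g a b); try easy.
   - eapply is_RInt_eq; [apply (is_RInt_const (V:=R_NormedModule) a b 0)|reflexivity|].
    unfold scal; simpl; unfold mult; simpl; ring.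
   - intros x Hx. eapply Rle_trans; [apply Cmod_ge_0|apply Hfg; lra]. }
  assert (P : 0 < Cmod l) by (generalize (Cmod_ge_0 l); lra). destruct (is_CInt_scal (Cconj l) f a b l Hf) as [H1 _].
  assert (H : fst (Cconj l * l)%C <= Cmod l * m).
  { apply (is_RInt_le (fun x => fst (Cconj l * f x)%C) (fun x => Cmod l * g x) a b); try easy.
   - apply (is_RInt_scal (V:=R_NormedModule)); exact Hg.
   - intros x Hx. via Re_mult_le. rewrite Cmod_conj. mul_l; (apply Hfg; lra). }
  replace (fst (Cconj l * l)%C) with (Cmod l ^ 2) in H by (rewrite Cmod2_alt; unfold Re, Im; simpl; ring).
  apply Rmult_le_reg_l with (Cmod l); [easy|]. simpl. lra.
Qed.

Lemma is_CInt_norm_const f a b l K : a <= b ->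
  (forall x, a <= x <= b -> Cmod (f x) <= K) -> is_CInt f a b l -> Cmod l <= K * (b - a).
Proof.
  intros Hab H Hf. apply (is_CInt_norm f (fun _ => K) a b); try easy.
  eapply is_RInt_eq; [apply (is_RInt_const (V:=R_NormedModule) a b K)|reflexivity|].
  unfold scal; simpl; unfold mult; simpl; ring.
Qed.

Lemma CInt_norm_const f a b K : a <= b ->
  (forall x, a <= x <= b -> Cmod (f x) <= K) -> exC f a b -> Cmod (CInt f a b) <= K * (b - a).
Proof. intros. eapply is_CInt_norm_const; eassumption. Qed.

Lemma CInt_point f a : CInt f a a = RtoC 0.
Proof. apply is_CInt_unique, is_CInt_point. Qed.

Lemma CInt_ext f g a b : a <= b -> (forall x, a < x < b -> f x = g x) -> CInt f a b = CInt g a b.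
Proof.
  intros Hab H. unfold CInt. f_equal; apply RInt_ext; intros x Hx;
  rewrite Rmin_left, Rmax_right in Hx by easy; now rewrite H.
Qed.

Lemma continuous_Rmult (f g : R -> R) x :
  continuous f x -> continuous g x -> continuous (fun x => f x * g x) x.
Proof. apply (continuous_mult (K:=R_AbsRing)). Qed.
Lemma continuous_Rplus (f g : R -> R) x :
  continuous f x -> continuous g x -> continuous (fun x => f x + g x) x.
Proof. apply (continuous_plus (V:=R_NormedModule)). Qed.
Lemma continuous_Rminus (f g : R -> R) x :
  continuous f x -> continuous g x -> continuous (fun x => f x - g x) x.
Proof. apply (continuous_minus (V:=R_NormedModule)). Qed.

Lemma ccont_mult f g x : ccont f x -> ccont g x -> ccont (fun x => f x * g x)%C x.
Proof.
  intros [H1 H2] [H3 H4]; split; simpl.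
  - now apply continuous_Rminus; apply continuous_Rmult.
  - now apply continuous_Rplus; apply continuous_Rmult.
Qed.
Lemma ccont_RtoC (f : R -> R) x : continuous f x -> ccont (fun x => RtoC (f x)) x.
Proof. intros H; split; simpl; [exact H|apply continuous_const]. Qed.
Lemma ccont_const c x : ccont (fun _ => c) x.
Proof. split; apply continuous_const. Qed.
Lemma ccont_conj f x : ccont f x -> ccont (fun x => Cconj (f x)) x.
Proof. intros [H1 H2]; split; simpl; [exact H1|]. now apply (continuous_opp (V:=R_NormedModule)). Qed.
Lemma ccont_e (f : R -> R) x : continuous f x -> ccont (fun x => e (f x)) x.
Proof.
  intros H; split; simpl.
  - apply (continuous_comp (fun y => 2*PI*f y) cos).
   + apply continuous_Rmult; [apply continuous_const|easy].
   + apply (ex_derive_continuous cos). eexists; apply is_derive_cos.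
  - apply (continuous_comp (fun y => 2*PI*f y) sin).
   + apply continuous_Rmult; [apply continuous_const|easy].
   + apply (ex_derive_continuous sin). eexists; apply is_derive_sin.
Qed.
Lemma ccont_comp (f : R -> C) (g : R -> R) x :
  ccont f (g x) -> continuous g x -> ccont (fun x => f (g x)) x.
Proof.
  intros [H1 H2] Hg; split.
  - apply (continuous_comp g (fun y => fst (f y))); easy.
  - apply (continuous_comp g (fun y => snd (f y))); easy.
Qed.

Lemma continuous_lip (f : R -> R) x L d : 0 < d ->
  (forall y, Rabs (y - x) < d -> Rabs (f y - f x) <= L * Rabs (y - x)) -> continuous f x.
Proof.
  intros Hd H. apply continuity_pt_filterlim. intros eps He. assert (HL : 0 < Rabs L + 1) by (generalize (Rabs_pos L); lra).
  exists (Rmin d (eps / (Rabs L + 1))). split.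
  - apply Rmin_pos; [easy|]. now apply Rdiv_lt_0_compat.
  - intros y [_ Hy]. unfold dist in *; simpl in *; unfold Rdist in *.
   eapply Rle_lt_trans; [apply H; eapply Rlt_le_trans; [exact Hy|apply Rmin_l]|].
   assert (Hy' : Rabs (y - x) < eps / (Rabs L + 1)) by (eapply Rlt_le_trans; [exact Hy|apply Rmin_r]).
   apply Rle_lt_trans with ((Rabs L + 1) * Rabs (y - x)).
   + mul_r. generalize (Rle_abs L); lra.
   + apply (Rmult_lt_compat_l (Rabs L + 1)) in Hy'; [|easy].
    replace ((Rabs L + 1) * (eps / (Rabs L + 1))) with eps in Hy' by (field; lra). exact Hy'.
Qed.

Lemma im_le_Cmod c : Rabs (snd c) <= Cmod c.
Proof. eapply Rle_trans; [apply Rmax_r|apply Rmax_Cmod]. Qed.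

Lemma ccont_lip (f : R -> C) x L d : 0 < d ->
  (forall y, Rabs (y - x) < d -> Cmod (f y - f x)%C <= L * Rabs (y - x)) -> ccont f x.
Proof.
  intros Hd H; split; apply (continuous_lip _ x L d Hd); intros y Hy; (eapply Rle_trans; [|apply (H y Hy)]).
  - apply (re_le_Cmod (f y - f x)%C).
  - apply (im_le_Cmod (f y - f x)%C).
Qed.

(** * Finite sums over lists *)

Definition rsum {A} (f : A -> R) (l : list A) : R := fold_right (fun x s => f x + s) 0 l.
Definition csum {A} (f : A -> C) (l : list A) : C := fold_right (fun x s => (f x + s)%C) (RtoC 0) l.

Lemma csum_norm {A} (f : A -> C) (g : A -> R) l :
  (forall x, In x l -> Cmod (f x) <= g x) -> Cmod (csum f l) <= rsum g l.
Proof.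
  induction l as [|x l IH]; intros H; simpl.
  - rewrite Cmod_0; lra.
  - via Cmod_triangle. apply Rplus_le_compat; [apply H; now left|apply IH; intros; apply H; now right].
Qed.
Lemma rsum_le {A} (f g : A -> R) l :
  (forall x, In x l -> f x <= g x) -> rsum f l <= rsum g l.
Proof.
  induction l as [|x l IH]; intros H; simpl; [lra|].
  apply Rplus_le_compat; [apply H; now left|apply IH; intros; apply H; now right].
Qed.
Lemma rsum_scal {A} (f : A -> R) c l : rsum (fun x => c * f x) l = c * rsum f l.
Proof. induction l as [|x l IH]; simpl; [ring|rewrite IH; ring]. Qed.
Lemma rsum_plus {A} (f g : A -> R) l : rsum (fun x => f x + g x) l = rsum f l + rsum g l.
Proof. induction l as [|x l IH]; simpl; [ring|rewrite IH; ring]. Qed.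
Lemma rsum_nonneg {A} (f : A -> R) l : (forall x, In x l -> 0 <= f x) -> 0 <= rsum f l.
Proof.
  induction l as [|x l IH]; intros H; simpl; [lra|].
  apply Rplus_le_le_0_compat; [apply H; now left|apply IH; intros; apply H; now right].
Qed.
Lemma rsum_const {A} c (l : list A) : rsum (fun _ => c) l = c * INR (length l).
Proof. induction l as [|x l IH]; [simpl; ring|]. change (length (x::l)) with (S (length l)).
  rewrite S_INR; simpl. rewrite IH; ring. Qed.
Lemma rsum_ext {A} (f g : A -> R) l : (forall x, In x l -> f x = g x) -> rsum f l = rsum g l.
Proof. intros H; apply Rle_antisym; apply rsum_le; intros x Hx; rewrite (H x Hx); lra. Qed.
Lemma csum_ext {A} (f g : A -> C) l : (forall x, In x l -> f x = g x) -> csum f l = csum g l.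
Proof. induction l as [|x l IH]; intros H; simpl; [easy|].
  rewrite (H x) by now left. rewrite IH; [easy|intros; apply H; now right]. Qed.
Lemma csum_plus {A} (f g : A -> C) l : csum (fun x => f x + g x)%C l = (csum f l + csum g l)%C.
Proof. induction l as [|x l IH]; simpl; [ring|rewrite IH; ring]. Qed.
Lemma csum_minus {A} (f g : A -> C) l : csum (fun x => f x - g x)%C l = (csum f l - csum g l)%C.
Proof. induction l as [|x l IH]; simpl; [ring|rewrite IH; ring]. Qed.
Lemma csum_scal {A} (f : A -> C) c l : csum (fun x => c * f x)%C l = (c * csum f l)%C.
Proof. induction l as [|x l IH]; simpl; [ring|rewrite IH; ring]. Qed.
Lemma csum_app {A} (f : A -> C) l m : csum f (l ++ m) = (csum f l + csum f m)%C.
Proof. induction l as [|x l IH]; simpl; [ring|rewrite IH; ring]. Qed.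
Lemma rsum_app {A} (f : A -> R) l m : rsum f (l ++ m) = rsum f l + rsum f m.
Proof. induction l as [|x l IH]; simpl; [ring|rewrite IH; ring]. Qed.
Lemma is_CInt_csum {A} (f : A -> R -> C) (I : A -> C) a b l :
  (forall x, In x l -> is_CInt (f x) a b (I x)) ->
  is_CInt (fun t => csum (fun x => f x t) l) a b (csum I l).
Proof.
  induction l as [|x l IH]; intros H; simpl.
  - generalize (is_CInt_const (RtoC 0) a b). now rewrite Cmult_0_r.
  - apply is_CInt_plus; [apply H; now left|apply IH; intros; apply H; now right].
Qed.

(** * Amplitudes of bounded variation and the first derivative test *)

Definition bv (A : R -> R) (a b s : R) : Prop :=
  (forall x, a <= x <= b -> Rabs (A x) <= s) /\
  exists V : R -> R,
   (forall x y, a <= x -> x <= y -> y <= b -> Rabs (A y - A x) <= V y - V x) /\ V b - V a <= s.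

Lemma bv_nonneg A a b s : a <= b -> bv A a b s -> 0 <= s.
Proof. intros Hab [H _]. eapply Rle_trans; [apply Rabs_pos|apply (H a); lra]. Qed.

(** One constant bounds both the size and the variation of each factor, so the variation of the
    product is at most s t + s t; this is the only loss. *)
Lemma bv_mult A B a b s t : a <= b -> bv A a b s -> bv B a b t -> bv (fun x => A x * B x) a b (2 * s * t).
Proof.
  intros Hab HA HB. pose proof (bv_nonneg _ _ _ _ Hab HA) as Hs. pose proof (bv_nonneg _ _ _ _ Hab HB) as Ht.
  destruct HA as [SA [V [HV TV]]], HB as [SB [W [HW TW]]]. split.
  - intros x Hx. rewrite Rabs_mult. apply Rle_trans with (s * t).
   + apply Rmult_le_compat; auto using Rabs_pos.
   + nra.
  - exists (fun x => t * V x + s * W x). split.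
   + intros x y Hx Hxy Hy. replace (A y * B y - A x * B x) with ((A y - A x) * B y + A x * (B y - B x)) by ring.
    via Rabs_triang. rewrite !Rabs_mult.

    assert (Rabs (A y - A x) * Rabs (B y) <= (V y - V x) * t).
    { apply Rmult_le_compat; auto using Rabs_pos; apply SB; lra. }
    assert (Rabs (A x) * Rabs (B y - B x) <= s * (W y - W x)).
    { apply Rmult_le_compat; auto using Rabs_pos; apply SA; lra. }
    lra.
   + nra.
Qed.

Lemma bv_sub A a b c d s : a <= c -> c <= d -> d <= b -> bv A a b s -> bv A c d s.
Proof.
  intros Hac Hcd Hdb [S [V [HV TV]]]. split; [intros; apply S; lra|]. exists V. split; [intros; apply HV; lra|].
  pose proof (HV a c (Rle_refl a) Hac ltac:(lra)). pose proof (HV d b ltac:(lra) Hdb ltac:(lra)).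
  generalize (Rabs_pos (A c - A a)) (Rabs_pos (A b - A d)); lra.
Qed.

Lemma bv_le A a b s t : s <= t -> bv A a b s -> bv A a b t.
Proof.
  intros H [S [V [HV TV]]]. split; [intros x Hx; generalize (S x Hx); lra|]. exists V; split; [easy|lra].
Qed.

Lemma bv_ext A B a b s : (forall x, a <= x <= b -> A x = B x) -> bv A a b s -> bv B a b s.
Proof.
  intros H [S [V [HV TV]]]. split; [intros x Hx; rewrite <- H by easy; now apply S|].
  exists V; split; [|easy]. intros x y H1 H2 H3. rewrite <- !H by lra. now apply HV.
Qed.

Lemma bv_scal A a b s c : bv A a b s -> bv (fun x => c * A x) a b (Rabs c * s).
Proof.
  intros [S [V [HV TV]]]. split.
  - intros x Hx. rewrite Rabs_mult. apply Rmult_le_compat_l; auto using Rabs_pos.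
  - exists (fun x => Rabs c * V x); split.
   + intros x y H1 H2 H3. rewrite <- !Rmult_minus_distr_l, Rabs_mult. apply Rmult_le_compat_l; auto using Rabs_pos.
   + rewrite <- Rmult_minus_distr_l. apply Rmult_le_compat_l; auto using Rabs_pos.
Qed.

Lemma bv_lip A a b s L : (forall x, a <= x <= b -> Rabs (A x) <= s) ->
  (forall x y, a <= x -> x <= y -> y <= b -> Rabs (A y - A x) <= L * (y - x)) -> L * (b - a) <= s ->
  bv A a b s.
Proof.
  intros H1 H2 H3. split; [easy|]. exists (fun x => L * x). split; [|lra].
  intros x y Hx Hxy Hy. generalize (H2 x y Hx Hxy Hy); lra.
Qed.

Lemma bv_decr A a b s : a <= b -> (forall x y, a <= x -> x <= y -> y <= b -> 0 <= A y <= A x) -> A a <= s ->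
  bv A a b s.
Proof.
  intros Hab H Hs. split.
  - intros x Hx. pose proof (H a x ltac:(lra) ltac:(lra) ltac:(lra)). rewrite Rabs_pos_eq; lra.
  - exists (fun x => - A x). split.
   + intros x y H1 H2 H3. pose proof (H x y H1 H2 H3). rewrite Rabs_left1; lra.
   + pose proof (H a b ltac:(lra) ltac:(lra) ltac:(lra)). lra.
Qed.

Lemma bv_incr A a b s : a <= b -> (forall x y, a <= x -> x <= y -> y <= b -> 0 <= A x <= A y) -> A b <= s ->
  bv A a b s.
Proof.
  intros Hab H Hs. split.
  - intros x Hx. pose proof (H x b ltac:(lra) ltac:(lra) ltac:(lra)). rewrite Rabs_pos_eq; lra.
  - exists A. split.
   + intros x y H1 H2 H3. pose proof (H x y H1 H2 H3). rewrite Rabs_pos_eq; lra.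
   + pose proof (H a b ltac:(lra) ltac:(lra) ltac:(lra)). lra.
Qed.

Lemma bv_opp A a b s : bv A a b s -> bv (fun x => - A x) a b s.
Proof.
  intros H. apply (bv_ext (fun x => (-1) * A x)); [intros; ring|].
  replace s with (Rabs (-1) * s); [now apply bv_scal|]. rewrite Rabs_left; lra.
Qed.

(** The function is monotone with values between 0 and 1/mu, so that 1/mu bounds its size and its
    variation. *)
Lemma bv_inv_linear p k a b mu : a <= b -> 0 < mu ->
  (forall x, a <= x <= b -> mu <= p + k * x) -> bv (fun x => / (p + k * x)) a b (/ mu).
Proof.
  intros Hab Hmu H. destruct (Rle_dec 0 k) as [Hk|Hk].
  - apply bv_decr; [easy| |].
   + intros x y H1 H2 H3. pose proof (H x ltac:(lra)). split.
    * apply Rlt_le, Rinv_0_lt_compat. generalize (H y ltac:(lra)); lra.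
    * apply Rinv_le_contravar; [lra|]. nra.
   + apply Rinv_le_contravar; [easy|apply H; lra].
  - apply bv_incr; [easy| |].
   + intros x y H1 H2 H3. pose proof (H y ltac:(lra)). split.
    * apply Rlt_le, Rinv_0_lt_compat. generalize (H x ltac:(lra)); lra.
    * apply Rinv_le_contravar; [lra|]. nra.
   + apply Rinv_le_contravar; [easy|apply H; lra].
Qed.

(** Passage to the limit in an approximation with error O(1/n); it serves for partitions, Riemann
    sums and truncated series alike. *)
Lemma Rle_of_forall_div x B K : (forall n : nat, (1 <= n)%nat -> x <= B + K / INR n) -> x <= B.
Proof.
  intros H. apply Rnot_lt_le. intros Hlt. destruct (INR_unbounded (Rmax 1 (K / (x - B)))) as [n Hn].
  assert (H1 : 1 < INR n) by (eapply Rle_lt_trans; [apply Rmax_l|exact Hn]).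
  assert (H2 : K / (x - B) < INR n) by (eapply Rle_lt_trans; [apply Rmax_r|exact Hn]).
  assert (Hn1 : (1 <= n)%nat) by (apply INR_le; simpl; lra). specialize (H n Hn1).
  apply (Rmult_lt_compat_r (x - B)) in H2; [|lra]. replace (K / (x - B) * (x - B)) with K in H2 by (field; lra).
  assert (K / INR n < x - B); [|lra].
  apply Rmult_lt_reg_r with (INR n); [lra|]. replace (K / INR n * INR n) with K by (field; lra). lra.
Qed.

Lemma ccont_amp (A : R -> R) h x : continuous A x -> ccont h x -> ccont (fun x => RtoC (A x) * h x)%C x.
Proof. intros; apply ccont_mult; [now apply ccont_RtoC|easy]. Qed.

(* Partial summation: on a fine partition the amplitude may be frozen at the right end points. *)
Lemma abel_bv A h a b s Hm hm : a <= b -> bv A a b s ->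
  exC h a b -> exC (fun x => RtoC (A x) * h x)%C a b ->
  (forall x, a <= x <= b -> Cmod (h x) <= hm) ->
  (forall x, a <= x <= b -> Cmod (CInt h a x) <= Hm) ->
  Cmod (CInt (fun x => RtoC (A x) * h x)%C a b) <= 2 * s * Hm.
Proof.
  intros Hab HA Hh HAh Hhm HHm.

  destruct HA as [SA [V [HV TV]]]. assert (HHm0 : 0 <= Hm) by (eapply Rle_trans; [apply Cmod_ge_0|apply (HHm a); lra]).
  assert (Hhm0 : 0 <= hm) by (eapply Rle_trans; [apply Cmod_ge_0|apply (Hhm a); lra]).
  apply Rle_of_forall_div with (K := s * hm * (b - a)). intros n Hn. assert (Hn0 : 0 < INR n) by pos.
  set (d := (b - a) / INR n). set (x := fun m : nat => a + INR m * d).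
  assert (Hd : 0 <= d) by (apply Rmult_le_pos; [lra|pos]). assert (Hx : forall m, (m <= n)%nat -> a <= x m <= b).
  { intros m Hm'. unfold x. apply le_INR in Hm'. split.
   - generalize (Rmult_le_pos _ _ (pos_INR m) Hd); lra.
   - apply Rle_trans with (a + INR n * d); [nra|]. unfold d. right; field; lra. }
  assert (Hxn : x n = b) by (unfold x, d; field; lra). assert (P : forall m, (m <= n)%nat ->
   Cmod (CInt (fun x => RtoC (A x) * h x)%C a (x m) - RtoC (A (x m)) * CInt h a (x m))%C
    <= (V (x m) - V a) * (Hm + hm * d)).
  { induction m as [|m IH]; intros Hmn.
   - replace (x 0%nat) with a by (unfold x; simpl; ring). rewrite !CInt_point.
    replace (RtoC 0 - RtoC (A a) * RtoC 0)%C with (RtoC 0) by ring. rewrite Cmod_0; lra.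
   - assert (Hm1 : a <= x m <= b) by (apply Hx; lia). assert (Hm2 : a <= x (S m) <= b) by (apply Hx; lia).
    assert (Hm3 : x m <= x (S m)) by (unfold x; rewrite S_INR; lra).
    assert (E1 : exC (fun x => RtoC (A x) * h x)%C (x m) (x (S m))) by (apply (exC_sub _ a b); easy).
    assert (E2 : exC h (x m) (x (S m))) by (apply (exC_sub _ a b); easy).
    rewrite (CInt_Chasles (fun x => RtoC (A x) * h x)%C a (x m) (x (S m))) by
     (try easy; apply (exC_sub _ a b); easy || lra).
    rewrite (CInt_Chasles h a (x m) (x (S m))) by (try easy; apply (exC_sub _ a b); easy || lra).
    assert (E3 : Cmod (CInt (fun t => RtoC (A t) * h t)%C (x m) (x (S m)) -
     RtoC (A (x (S m))) * CInt h (x m) (x (S m)))%C <= (V (x (S m)) - V (x m)) * hm * (x (S m) - x m)).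
    { apply (is_CInt_norm_const (fun t => RtoC (A t) * h t - RtoC (A (x (S m))) * h t)%C (x m) (x (S m))); [easy| |].
     - intros t Ht. replace (RtoC (A t) * h t - RtoC (A (x (S m))) * h t)%C with
       (RtoC (A t - A (x (S m))) * h t)%C by (rewrite RtoC_minus; ring).
      rewrite Cmod_mult, Cmod_R. apply Rmult_le_compat; auto using Rabs_pos, Cmod_ge_0.
      + pose proof (HV t (x (S m)) ltac:(lra) ltac:(lra) ltac:(lra)).
       pose proof (HV (x m) t ltac:(lra) ltac:(lra) ltac:(lra)).
       rewrite Rabs_minus_sym. generalize (Rabs_pos (A t - A (x m))); lra.
      + apply Hhm; lra.
     - apply is_CInt_minus; [exact E1|]. now apply is_CInt_scal. }
    specialize (IH ltac:(lia)). pose proof (HV (x m) (x (S m)) ltac:(lra) ltac:(lra) ltac:(lra)) as HVm.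
    assert (E4 : Cmod (RtoC (A (x m) - A (x (S m))) * CInt h a (x m))%C <= (V (x (S m)) - V (x m)) * Hm).
    { rewrite Cmod_mult, Cmod_R. apply Rmult_le_compat; auto using Rabs_pos, Cmod_ge_0. now rewrite Rabs_minus_sym. }
    assert (Ed : x (S m) - x m = d) by (unfold x; rewrite S_INR; ring). rewrite Ed in E3.
    set (I1 := CInt (fun x => RtoC (A x) * h x)%C a (x m)) in *.
    set (I2 := CInt (fun x => RtoC (A x) * h x)%C (x m) (x (S m))) in *.
    set (J1 := CInt h a (x m)) in *. set (J2 := CInt h (x m) (x (S m))) in *.
    replace (I1 + I2 - RtoC (A (x (S m))) * (J1 + J2))%C with
     ((I1 - RtoC (A (x m)) * J1) + ((I2 - RtoC (A (x (S m))) * J2) + RtoC (A (x m) - A (x (S m))) * J1))%C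
     by (rewrite RtoC_minus; ring).
    via Cmod_triangle. eapply Rle_trans; [apply Rplus_le_compat; [exact IH|eapply Rle_trans; [apply Cmod_triangle|
     apply Rplus_le_compat; [exact E3|exact E4]]]|]. right; ring. }
  specialize (P n (le_n n)). rewrite Hxn in P. set (I := CInt (fun x => RtoC (A x) * h x)%C a b) in *.
  replace I with ((I - RtoC (A b) * CInt h a b) + RtoC (A b) * CInt h a b)%C by ring.
  via Cmod_triangle. rewrite (Cmod_mult (RtoC _)), Cmod_R. assert (H1 : Rabs (A b) * Cmod (CInt h a b) <= s * Hm).
  { apply Rmult_le_compat; auto using Rabs_pos, Cmod_ge_0; [apply SA|apply HHm]; lra. }
  assert (H2 : (V b - V a) * (Hm + hm * d) <= s * (Hm + hm * d)).
  { mul_r; easy. }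
  replace (s * hm * (b - a) / INR n) with (s * hm * d) by (unfold d; field; lra). lra.
Qed.

(** The value is (e(f b) - e(f a))/(2 pi i), written by components. *)
Lemma is_CInt_e (f f1 : R -> R) a b : a <= b ->
  (forall x, a <= x <= b -> is_derive f x (f1 x)) ->
  (forall x, a <= x <= b -> continuous f1 x) ->
  is_CInt (fun x => RtoC (f1 x) * e (f x))%C a b
   ((sin (2*PI*f b) - sin (2*PI*f a)) / (2*PI), (cos (2*PI*f a) - cos (2*PI*f b)) / (2*PI)).
Proof.
  intros Hab Hd Hc. pose proof PI_RGT_0 as HPI. assert (Cf : forall x, a <= x <= b -> continuous f x).
  { intros x Hx. apply (ex_derive_continuous f). eexists; now apply Hd. }
  split.
  - eapply is_RInt_eq; [apply (is_RInt_derive (V:=R_CompleteNormedModule)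
    (fun x => sin (2*PI*f x) / (2*PI)) (fun x => f1 x * cos (2*PI*f x)))| |].
   + intros x Hx; rewrite Rmin_left, Rmax_right in Hx by easy.
    assert (D := Hd x Hx). auto_derive; [eexists; exact D|]. replace (Derive (fun y => f y) x) with (f1 x) by (symmetry; now apply is_derive_unique). field; lra.
   + intros x Hx; rewrite Rmin_left, Rmax_right in Hx by easy.
    apply continuous_Rmult; [now apply Hc|]. exact (proj1 (ccont_e f x (Cf x Hx))).
   + intros x; simpl; ring.
   + unfold minus, plus, opp; simpl. field; lra.
  - eapply is_RInt_eq; [apply (is_RInt_derive (V:=R_CompleteNormedModule)
    (fun x => - cos (2*PI*f x) / (2*PI)) (fun x => f1 x * sin (2*PI*f x)))| |].
   + intros x Hx; rewrite Rmin_left, Rmax_right in Hx by easy.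
    assert (D := Hd x Hx). auto_derive; [eexists; exact D|]. replace (Derive (fun y => f y) x) with (f1 x) by (symmetry; now apply is_derive_unique). field; lra.
   + intros x Hx; rewrite Rmin_left, Rmax_right in Hx by easy.
    apply continuous_Rmult; [now apply Hc|]. exact (proj2 (ccont_e f x (Cf x Hx))).
   + intros x; simpl; ring.
   + unfold minus, plus, opp; simpl. field; lra.
Qed.

Lemma cont_bounded (f : R -> R) a b : a <= b -> (forall x, a <= x <= b -> continuous f x) ->
  exists K, forall x, a <= x <= b -> Rabs (f x) <= K.
Proof.
  intros Hab H. destruct (continuity_ab_maj (fun x => Rabs (f x)) a b Hab) as [m [Hm _]].
  - intros c Hc. apply continuity_pt_filterlim. apply (continuous_comp f Rabs); [now apply H|apply continuous_Rabs].
  - exists (Rabs (f m)). exact Hm.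
Qed.

(* Writing the amplitude as [B f'] turns the first derivative test into one partial integration. *)
Lemma vdc (f f1 B : R -> R) a b s : a <= b ->
  (forall x, a <= x <= b -> is_derive f x (f1 x)) ->
  (forall x, a <= x <= b -> continuous f1 x) ->
  (forall x, a <= x <= b -> continuous B x) -> bv B a b s ->
  Cmod (CInt (fun x => RtoC (B x) * (RtoC (f1 x) * e (f x)))%C a b) <= 2 * s.
Proof.
  intros Hab Hd Hc HcB HB. assert (Cf : forall x, a <= x <= b -> continuous f x).
  { intros x Hx. apply (ex_derive_continuous f). eexists; now apply Hd. }
  destruct (cont_bounded f1 a b Hab Hc) as [K HK]. replace (2 * s) with (2 * s * 1) by ring.
  apply (abel_bv B (fun x => RtoC (f1 x) * e (f x))%C a b s 1 K Hab HB).
  - eapply is_CInt_exC. now apply is_CInt_e.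
  - apply exC_cont; [easy|]. intros x Hx. apply ccont_amp; [now apply HcB|].
   apply ccont_amp; [now apply Hc|apply ccont_e; now apply Cf].
  - intros x Hx. rewrite Cmod_mult, Cmod_R, Cmod_e, Rmult_1_r. now apply HK.
  - intros x Hx. rewrite (is_CInt_unique _ _ _ _ (is_CInt_e f f1 a x ltac:(lra)
    ltac:(intros; apply Hd; lra) ltac:(intros; apply Hc; lra))).
   (* The primitive has modulus at most 1, since each of its components is at most 2/(2 pi) <
      1/3. *)
   assert (H : forall y z, Rabs y <= 2 -> Rabs z <= 2 -> Cmod (y / (2*PI), z / (2*PI)) <= 1).
   { intros y z Hy Hz. via Cmod_2Rmax. simpl fst; simpl snd. assert (HP : 3 < PI) by (generalize PI2_3_2; unfold PI2; lra).
    assert (HS : sqrt 2 <= 3/2). { apply Rsqr_incr_0_var; [|lra]. rewrite Rsqr_sqrt by lra. unfold Rsqr; lra. }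
    assert (HM : Rmax (Rabs (y / (2*PI))) (Rabs (z / (2*PI))) <= 1/3).
    { apply Rmax_lub; unfold Rdiv; rewrite Rabs_mult, (Rabs_pos_eq (/ _)); try (left; apply Rinv_0_lt_compat; lra).
     - apply Rmult_le_reg_r with (2*PI); [lra|]. rewrite Rmult_assoc, Rinv_l by lra. lra.
     - apply Rmult_le_reg_r with (2*PI); [lra|]. rewrite Rmult_assoc, Rinv_l by lra. lra. }
    assert (0 <= Rmax (Rabs (y / (2*PI))) (Rabs (z / (2*PI)))).
    { eapply Rle_trans; [apply Rabs_pos|apply Rmax_l]. }
    generalize (sqrt_pos 2); nra. }
   apply H; apply Rabs_le.
   + generalize (SIN_bound (2*PI*f x)) (SIN_bound (2*PI*f a)); lra.
   + generalize (COS_bound (2*PI*f x)) (COS_bound (2*PI*f a)); lra.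
Qed.

Lemma is_CInt_swap f a b l : is_CInt f a b l -> is_CInt f b a (- l)%C.
Proof. intros [H1 H2]; split; now apply (is_RInt_swap (V:=R_NormedModule)). Qed.

Lemma is_CInt_comp_lin f u v a b l : is_CInt f (u * a + v) (u * b + v) l ->
  is_CInt (fun y => RtoC u * f (u * y + v)%R)%C a b l.
Proof.
  intros [H1 H2]; split.
  - eapply is_RInt_eq; [apply (is_RInt_comp_lin (V:=R_NormedModule) _ u v a b _ H1)| |reflexivity].
   intros; simpl; unfold scal; simpl; unfold mult; simpl; ring.
  - eapply is_RInt_eq; [apply (is_RInt_comp_lin (V:=R_NormedModule) _ u v a b _ H2)| |reflexivity].
   intros; simpl; unfold scal; simpl; unfold mult; simpl; ring.
Qed.

Lemma is_CInt_subst f (g dg : R -> R) a b : a <= b ->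
  (forall x, a <= x <= b -> ccont f (g x)) ->
  (forall x, a <= x <= b -> is_derive g x (dg x) /\ continuous dg x) ->
  is_CInt (fun y => RtoC (dg y) * f (g y))%C a b (CInt f (g a) (g b)).
Proof.
  intros Hab Hf Hg. split.
  - eapply is_RInt_eq; [apply (is_RInt_comp (V:=R_CompleteNormedModule) (fun x => fst (f x)) g dg a b)| |reflexivity].
   + intros x Hx; rewrite Rmin_left, Rmax_right in Hx by easy. now apply Hf.
   + intros x Hx; rewrite Rmin_left, Rmax_right in Hx by easy. now apply Hg.
   + intros; simpl; unfold scal; simpl; unfold mult; simpl; ring.
  - eapply is_RInt_eq; [apply (is_RInt_comp (V:=R_CompleteNormedModule) (fun x => snd (f x)) g dg a b)| |reflexivity].
   + intros x Hx; rewrite Rmin_left, Rmax_right in Hx by easy. now apply Hf.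
   + intros x Hx; rewrite Rmin_left, Rmax_right in Hx by easy. now apply Hg.
   + intros; simpl; unfold scal; simpl; unfold mult; simpl; ring.
Qed.

Lemma csum_seq_S (f : nat -> C) n : csum f (seq 0 (S n)) = (csum f (seq 0 n) + f n)%C.
Proof. rewrite seq_S, csum_app. simpl. ring. Qed.
Lemma rsum_seq_S (f : nat -> R) n : rsum f (seq 0 (S n)) = rsum f (seq 0 n) + f n.
Proof. rewrite seq_S, rsum_app. simpl. ring. Qed.

Lemma riemann_bound (F : R -> C) c d n L : c <= d -> (1 <= n)%nat -> 0 <= L ->
  (forall s t, c <= s <= d -> c <= t <= d -> Cmod (F s - F t)%C <= L * Rabs (s - t)) ->
  exC F c d ->
  Cmod (CInt F c d - RtoC ((d - c) / INR n) *
   csum (fun i => F (c + INR i * ((d - c) / INR n))%R) (seq 0 n))%C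
   <= L * (d - c) * ((d - c) / INR n).
Proof.
  intros Hcd Hn HL0 HL HF. assert (Hn0 : 0 < INR n) by pos. set (h := (d - c) / INR n).
  assert (Hh : 0 <= h) by (apply Rmult_le_pos; [lra|pos]). assert (Hnh : INR n * h = d - c) by (unfold h; field; lra).
  assert (Hx : forall m, (m <= n)%nat -> c <= c + INR m * h <= d).
  { intros m Hm. apply le_INR in Hm. generalize (pos_INR m); nra. }
  assert (P : forall m, (m <= n)%nat -> Cmod (CInt F c (c + INR m * h) - RtoC h *
   csum (fun i => F (c + INR i * h)%R) (seq 0 m))%C <= INR m * (L * h * h)).
  { induction m as [|m IH]; intros Hm.
   - simpl. replace (c + 0 * h) with c by ring. rewrite CInt_point.
    replace (RtoC 0 - RtoC h * RtoC 0)%C with (RtoC 0) by ring. rewrite Cmod_0; lra.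
   - specialize (IH ltac:(lia)). pose proof (Hx m ltac:(lia)). pose proof (Hx (S m) Hm).
    assert (Hs : c + INR (S m) * h = c + INR m * h + h) by (rewrite S_INR; ring).
    rewrite (CInt_Chasles F c (c + INR m * h)) by (try lra; apply (exC_sub F c d); first [exact HF | lra]).
    rewrite csum_seq_S.
    assert (E : Cmod (CInt F (c + INR m * h) (c + INR (S m) * h) - RtoC h * F (c + INR m * h)%R)%C <= L * h * h).
    { via (is_CInt_norm_const (fun t => F t - F (c + INR m * h)%R)%C (c + INR m * h) (c + INR (S m) * h) _ (L * h)).
     - lra.
     - intros t Ht. eapply Rle_trans; [apply HL; lra|]. mul_l. apply Rabs_le; lra.
     - apply is_CInt_minus.
      + apply (exC_sub F c d); first [exact HF | lra].
      + generalize (is_CInt_const (F (c + INR m * h)%R) (c + INR m * h) (c + INR (S m) * h)).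
       replace (c + INR (S m) * h - (c + INR m * h)) with h by lra. easy.
     - right; rewrite Hs; ring. }
    replace (CInt F c (c + INR m * h) + CInt F (c + INR m * h) (c + INR (S m) * h) -
     RtoC h * (csum (fun i => F (c + INR i * h)%R) (seq 0 m) + F (c + INR m * h)%R))%C with
    ((CInt F c (c + INR m * h) - RtoC h * csum (fun i => F (c + INR i * h)%R) (seq 0 m)) +
     (CInt F (c + INR m * h) (c + INR (S m) * h) - RtoC h * F (c + INR m * h)%R))%C by ring.
    via Cmod_triangle. rewrite S_INR in *. lra. }
  specialize (P n (le_n n)). replace (c + INR n * h) with d in P by lra.
  via P. right. replace (d - c) with (INR n * h) by easy. ring.
Qed.

(* Interchanging the two integrations costs nothing for an upper bound: the inner integrals are
  replaced by Riemann sums with uniformly small error. *)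
Lemma inner_average_bound {J} (l : list J) (w1 w2 : J -> R) (F : J -> R -> C) (f : J -> R -> R -> C)
  c d L B : c <= d -> 0 <= L -> 0 <= B ->
  (forall j, In j l -> w1 j <= w2 j /\ exC (F j) (w1 j) (w2 j) /\
   forall w, w1 j <= w <= w2 j -> is_CInt (f j w) c d (F j w) /\
    forall s t, c <= s <= d -> c <= t <= d -> Cmod (f j w s - f j w t)%C <= L * Rabs (s - t)) ->
  (forall s, c <= s <= d -> (forall j, In j l -> exC (fun w => f j w s) (w1 j) (w2 j)) /\
   Cmod (csum (fun j => CInt (fun w => f j w s) (w1 j) (w2 j)) l) <= B) ->
  Cmod (csum (fun j => CInt (F j) (w1 j) (w2 j)) l) <= (d - c) * B.
Proof.
  intros Hcd HL HB Hj Hs. set (K := rsum (fun j => L * (d - c) * (d - c) * (w2 j - w1 j)) l).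
  apply Rle_of_forall_div with (K := K). intros n Hn. assert (Hn0 : 0 < INR n) by pos. set (h := (d - c) / INR n).
  assert (Hh : 0 <= h) by (apply Rmult_le_pos; [lra|pos]). assert (Hnh : INR n * h = d - c) by (unfold h; field; lra).
  set (x := fun i : nat => c + INR i * h). assert (Hx : forall i, In i (seq 0 n) -> c <= x i <= d).
  { intros i Hi. apply in_seq in Hi. assert (Hi' : INR i <= INR n) by (apply le_INR; lia).
   unfold x. generalize (pos_INR i); nra. }
  set (G := fun j w => (RtoC h * csum (fun i => f j w (x i)) (seq 0 n))%C).
  set (IG := fun j => (RtoC h * csum (fun i => CInt (fun w => f j w (x i)) (w1 j) (w2 j)) (seq 0 n))%C).
  assert (HG : forall j, In j l -> is_CInt (G j) (w1 j) (w2 j) (IG j)).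
  { intros j Hin. unfold G, IG. apply is_CInt_scal.
   apply (is_CInt_csum (fun i w => f j w (x i)) (fun i => CInt (fun w => f j w (x i)) (w1 j) (w2 j))).
   intros i Hi. apply (Hs (x i) (Hx i Hi)). easy. }
  assert (E1 : forall j, In j l -> Cmod (CInt (F j) (w1 j) (w2 j) - IG j)%C <=
   / INR n * (L * (d - c) * (d - c) * (w2 j - w1 j))).
  { intros j Hin. destruct (Hj j Hin) as [Hw [HF Hf]].
   replace (/ INR n * (L * (d - c) * (d - c) * (w2 j - w1 j))) with (L * (d - c) * h * (w2 j - w1 j))
    by (unfold h; field; lra).
   apply (is_CInt_norm_const (fun w => F j w - G j w)%C (w1 j) (w2 j)); [easy| |].
   - intros w Hw'. destruct (Hf w Hw') as [H1 H2]. rewrite <- (is_CInt_unique _ _ _ _ H1). unfold G.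
    apply riemann_bound; try easy. eapply is_CInt_exC; exact H1.
   - apply is_CInt_minus; [exact HF|now apply HG]. }
  assert (E2 : Cmod (csum IG l) <= (d - c) * B).
  { replace (csum IG l) with (RtoC h * csum (fun i => csum (fun j =>
    CInt (fun w => f j w (x i)) (w1 j) (w2 j)) l) (seq 0 n))%C.
   - rewrite Cmod_mult, Cmod_R, (Rabs_pos_eq h) by easy. rewrite <- Hnh.
    replace (INR n * h * B) with (h * (B * INR (length (seq 0 n)))) by (rewrite length_seq; ring).
    mul_l. rewrite <- rsum_const. apply csum_norm. intros i Hi. now apply (Hs (x i) (Hx i Hi)).
   - unfold IG. rewrite csum_scal. f_equal. clear. induction (seq 0 n) as [|i m IH]; simpl.
    + induction l; simpl; [easy|rewrite <- IHl; ring].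
    + rewrite IH. now rewrite <- csum_plus. }
  replace (csum (fun j => CInt (F j) (w1 j) (w2 j)) l) with
   (csum (fun j => CInt (F j) (w1 j) (w2 j) - IG j)%C l + csum IG l)%C by (rewrite csum_minus; ring).
  via Cmod_triangle. rewrite Rplus_comm. apply Rplus_le_compat; [exact E2|].
  eapply Rle_trans; [apply csum_norm; exact E1|]. rewrite rsum_scal. unfold K. right; field; lra.
Qed.

(** * The Bessel function *)

Definition RI (f : R -> R) (a b : R) : R := RInt (V:=R_CompleteNormedModule) f a b.

Lemma RI_correct (f : R -> R) a b : (forall x, continuous f x) -> is_RInt (V:=R_NormedModule) f a b (RI f a b).
Proof.
  intros H. apply (RInt_correct (V:=R_CompleteNormedModule)).
  apply (ex_RInt_continuous (V:=R_CompleteNormedModule)). intros; apply H.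
Qed.

Lemma RI_Chasles (f : R -> R) a b c : (forall x, continuous f x) -> RI f a c = RI f a b + RI f b c.
Proof.
  intros H. symmetry. apply (RInt_Chasles (V:=R_CompleteNormedModule)); eexists; now apply RI_correct.
Qed.

Lemma exp_mono x y : x <= y -> exp x <= exp y.
Proof. intros [H|H]; [left; now apply exp_increasing|rewrite H; lra]. Qed.

(** x^D/D! is one term of the exponential series. *)
Lemma pow_exp_le x D : 0 < x -> exp (- x) <= INR (fact D) / x ^ D.
Proof.
  intros Hx. pose proof (pow_lt x D Hx) as HxD. pose proof (INR_fact_lt_0 D) as HF.
  rewrite exp_Ropp. apply Rmult_le_reg_r with (exp x * x ^ D).
  { pos. }
  replace (/ exp x * (exp x * x ^ D)) with (x ^ D) by (field; apply Rgt_not_eq, exp_pos).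
  replace (INR (fact D) / x ^ D * (exp x * x ^ D)) with (INR (fact D) * exp x) by (field; lra).
  assert (H : x ^ D / INR (fact D) <= exp x).
  { eapply Rle_trans; [|apply (exp_ge_taylor x D); lra]. destruct D as [|D]; [simpl; lra|]. rewrite tech5.
   assert (0 <= sum_f_R0 (fun k => x ^ k / INR (fact k)) D).
   { apply cond_pos_sum. intros n. apply Rlt_le, Rdiv_lt_0_compat; [pos|apply INR_fact_lt_0]. }
   lra. }
  apply (Rmult_le_compat_l (INR (fact D))) in H; [|lra].
  replace (INR (fact D) * (x ^ D / INR (fact D))) with (x ^ D) in H by (field; lra). exact H.
Qed.

Lemma cosh_ge_1 u : 1 <= cosh u.
Proof.
  unfold cosh. rewrite exp_Ropp. pose proof (exp_pos u) as H. assert (2 <= exp u + / exp u); [|lra].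
  replace (exp u + / exp u) with (2 + (exp u - 1) ^ 2 * / exp u) by (field; lra).
  assert (0 < / exp u) by now apply Rinv_0_lt_compat.
  generalize (Rmult_le_pos _ _ (pow2_ge_0 (exp u - 1)) (Rlt_le _ _ H0)); lra.
Qed.

Lemma inv_cosh_le u : / cosh u <= 2 * exp (- u).
Proof.
  rewrite exp_Ropp. pose proof (exp_pos u) as H.
  assert (E : exp u / 2 <= cosh u) by (unfold cosh; generalize (exp_pos (-u)); lra).
  replace (2 * / exp u) with (/ (exp u / 2)) by (field; lra). apply Rinv_le_contravar; lra.
Qed.

Lemma cosh_cont u : continuous cosh u.
Proof. apply (ex_derive_continuous cosh). exists (sinh u). apply is_derive_Reals, derivable_pt_lim_cosh. Qed.

Definition Kf (kappa v u : R) : R := exp (- v * cosh u) * cos (kappa * u).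

Lemma Kf_cont kappa v u : continuous (Kf kappa v) u.
Proof.
  unfold Kf. apply continuous_Rmult.
  - apply (continuous_comp (fun u => - v * cosh u) exp).
   + apply continuous_Rmult; [apply continuous_const|apply cosh_cont].
   + apply (ex_derive_continuous exp). eexists; apply is_derive_exp.
  - apply (continuous_comp (fun u => kappa * u) cos).
   + cont.
   + apply (ex_derive_continuous cos). eexists; apply is_derive_cos.
Qed.

Lemma is_RInt_exp_neg T T' : is_RInt (V:=R_NormedModule) (fun u => exp (- u)) T T' (exp (- T) - exp (- T')).
Proof.
  eapply is_RInt_eq; [apply (is_RInt_derive (V:=R_CompleteNormedModule) (fun u => - exp (- u)) (fun u => exp (- u)))| |].
  - intros x _. auto_derive; [easy|ring].
  - intros x _. apply (ex_derive_continuous (fun u => exp (- u))). auto_derive; easy.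
  - reflexivity.
  - unfold minus, plus, opp; simpl. ring.
Qed.

Lemma RInt_exp_bound f c T T' : T <= T' -> (forall u, continuous f u) ->
  (forall u, T <= u <= T' -> Rabs (f u) <= c * exp (- u)) ->
  Rabs (RI f T T') <= c * exp (- T).
Proof.
  intros HT Hf H. assert (Hc : 0 <= c).
  { generalize (H T ltac:(lra)) (Rabs_pos (f T)) (exp_pos (-T)). nra. }
  apply Rle_trans with (c * (exp (- T) - exp (- T'))).
  - apply (norm_RInt_le (V:=R_NormedModule) f (fun u => c * exp (- u)) T T' (RI f T T')); try easy.
   + now apply RI_correct.
   + apply (is_RInt_scal (V:=R_NormedModule)), is_RInt_exp_neg.
  - generalize (exp_pos (-T')); nra.
Qed.

(** Of the D factors cosh u produced by [pow_exp_le] one is kept, to make the bound integrable in u;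
    the others are at least 1. *)
Lemma Kf_bound kappa v u D : 0 < v -> (1 <= D)%nat ->
  Rabs (Kf kappa v u) <= 2 * INR (fact D) / v ^ D * exp (- u).
Proof.
  intros Hv HD. unfold Kf. rewrite Rabs_mult. pose proof (cosh_ge_1 u) as Hc. pose proof (pow_lt v D Hv).
  apply Rle_trans with (exp (- (v * cosh u)) * 1).
  { apply Rmult_le_compat; try apply Rabs_pos.
   - rewrite Rabs_pos_eq by pos. right; f_equal; ring.
   - apply Rabs_le, COS_bound. }
  rewrite Rmult_1_r. eapply Rle_trans; [apply (pow_exp_le _ D); nra|]. rewrite Rpow_mult_distr.
  assert (HcD : cosh u <= cosh u ^ D).
  { rewrite <- (pow_1 (cosh u)) at 1. now apply Rle_pow. }

  apply Rle_trans with (INR (fact D) / v ^ D * / cosh u).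
  - replace (INR (fact D) / (v ^ D * cosh u ^ D)) with (INR (fact D) / v ^ D * / cosh u ^ D) by (field; lra).
   mul_l. apply Rinv_le_contravar; lra.
  - replace (2 * INR (fact D) / v ^ D * exp (- u)) with (INR (fact D) / v ^ D * (2 * exp (- u))) by (field; lra).
   mul_l. apply inv_cosh_le.
Qed.

Definition KT (kappa v T : R) : R := RI (Kf kappa v) 0 T.

(** Until convergence is established, [K_imag] is only the value of a total operator. The Cauchy
    criterion follows from the exponential tail together with exp(-T) < 1/T. *)
Lemma KT_lim kappa v : 0 < v -> filterlim (KT kappa v) (Rbar_locally p_infty) (locally (K_imag kappa v)).
Proof.
  intros Hv. assert (HC : exists l, filterlim (KT kappa v) (Rbar_locally p_infty) (locally l)).
  { apply (filterlim_locally_cauchy (U:=R_CompleteSpace)). intros eps. set (N := Rmax 0 (2 * 1 / v / eps)).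
   exists (fun T => N < T). split; [exists N; easy|].
   assert (P : forall T T', N < T -> T <= T' -> Rabs (KT kappa v T' - KT kappa v T) < eps).
   { intros T T' HT HTT. pose proof (cond_pos eps) as He. assert (HT0 : 0 < T /\ 2 * 1 / v / eps < T).
    { split; eapply Rle_lt_trans; try exact HT; [apply Rmax_l|apply Rmax_r]. }
    unfold KT. rewrite (RI_Chasles (Kf kappa v) 0 T T') by apply Kf_cont.
    replace (_ + _ - _) with (RI (Kf kappa v) T T') by ring.
    eapply Rle_lt_trans; [apply (RInt_exp_bound (Kf kappa v) (2 * INR (fact 1) / v ^ 1)); try easy|].
    - apply Kf_cont.
    - intros; apply Kf_bound; [easy|lia].
    - replace (2 * INR (fact 1) / v ^ 1) with (2 * 1 / v) by (simpl; field; lra). assert (H : exp (- T) < / T).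
     { rewrite exp_Ropp. apply Rinv_lt_contravar; [apply Rmult_lt_0_compat; [lra|pos]|]. generalize (exp_ineq1 T); lra. }
     assert (Hc : 0 < 2 * 1 / v) by pos. apply Rlt_trans with (2 * 1 / v * / T); [now apply Rmult_lt_compat_l|].
     apply Rmult_lt_reg_r with T; [lra|]. rewrite Rmult_assoc, Rinv_l by lra.
     destruct HT0 as [_ HT0]. apply (Rmult_lt_compat_r eps) in HT0; [|easy].
     replace (2 * 1 / v / eps * eps) with (2 * 1 / v) in HT0 by (field; lra). lra. }
   intros T T' HT HT'. unfold ball; simpl; unfold AbsRing_ball, abs, minus, plus, opp; simpl. destruct (Rle_dec T T').
   - now apply P.
   - replace (KT kappa v T' + - KT kappa v T) with (-(KT kappa v T - KT kappa v T')) by ring.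
    rewrite Rabs_Ropp. apply P; lra. }
  destruct HC as [l Hl]. assert (Hgen : is_RInt_gen (V:=R_NormedModule)
   (fun u : R => exp (- v * cosh u) * cos (kappa * u)) (at_point 0) (Rbar_locally p_infty) l).
  { intros P HP. destruct (Hl P HP) as [N HN]. apply (Filter_prod _ _ _ (fun x => x = 0) (fun T => N < T)).
   - unfold at_point. reflexivity.
   - exists N; easy.
   - intros x y -> Hy. simpl. exists (KT kappa v y). split; [|now apply HN]. apply RI_correct, Kf_cont. }
  replace (K_imag kappa v) with l; [easy|]. symmetry. unfold K_imag.
  exact (is_RInt_gen_unique (V:=R_CompleteNormedModule) (Fa:=at_point 0) (Fb:=Rbar_locally p_infty)
   (fun u : R => exp (- v * cosh u) * cos (kappa * u)) l Hgen).
Qed.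

Lemma lim_Rabs_le (f : R -> R) (l B : R) : filterlim f (Rbar_locally p_infty) (locally l) ->
  (forall T, 0 < T -> Rabs (f T) <= B) -> Rabs l <= B.
Proof.
  intros Hf H. apply Rnot_lt_le. intros Hl. assert (He : 0 < Rabs l - B) by lra.
  destruct (Hf (fun y => Rabs (y - l) < Rabs l - B)) as [N HN].
  - exists (mkposreal _ He). intros y Hy. exact Hy.
  - set (T := Rmax N 0 + 1). assert (N < T /\ 0 < T) as [H1 H2].
   { unfold T; generalize (Rmax_l N 0) (Rmax_r N 0); lra. }
   specialize (HN T H1). specialize (H T H2). simpl in HN.
   generalize (Rabs_triang (f T) (l - f T)). replace (f T + (l - f T)) with l by ring. rewrite (Rabs_minus_sym l). lra.
Qed.

Lemma lim_minus (f g : R -> R) (l m : R) : filterlim f (Rbar_locally p_infty) (locally l) ->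
  filterlim g (Rbar_locally p_infty) (locally m) ->
  filterlim (fun T => f T - g T) (Rbar_locally p_infty) (locally (l - m)).
Proof.
  intros Hf Hg. unfold Rminus. eapply filterlim_comp_2; [exact Hf| |apply (filterlim_plus (V:=R_NormedModule))].
  eapply filterlim_comp; [exact Hg|apply (filterlim_opp (V:=R_NormedModule))].
Qed.

Lemma K_imag_bound kappa v D : 0 < v -> (1 <= D)%nat ->
  Rabs (K_imag kappa v) <= 2 * INR (fact D) / v ^ D.
Proof.
  intros Hv HD. apply (lim_Rabs_le _ _ _ (KT_lim kappa v Hv)). intros T HT.
  eapply Rle_trans; [apply (RInt_exp_bound (Kf kappa v) (2 * INR (fact D) / v ^ D)); [lra|apply Kf_cont|]|].
  - intros; now apply Kf_bound.
  - rewrite Ropp_0, exp_0; lra.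
Qed.

Lemma exp_diff_bound v w c : 0 <= c -> v <= w -> 0 <= exp (- v * c) - exp (- w * c) <= (w - v) * c * exp (- v * c).
Proof.
  intros Hc Hvw. replace (- w * c) with (- v * c + - ((w - v) * c)) by ring. rewrite exp_plus.
  pose proof (exp_pos (- v * c)) as H.
  assert (H1 : 1 - (w - v) * c <= exp (- ((w - v) * c))) by (generalize (exp_ineq1_le (- ((w - v) * c))); lra).
  assert (H2 : exp (- ((w - v) * c)) <= 1).
  { rewrite <- exp_0. apply exp_mono. nra. }
  split; nra.
Qed.

(** A change of the argument brings down a factor cosh u from the exponent; one more power of decay,
    the [S D] of the bound, pays for it. *)
Lemma K_imag_lip kappa v w D : 0 < v -> v <= w -> (1 <= D)%nat ->
  Rabs (K_imag kappa v - K_imag kappa w) <= 2 * INR (fact (S D)) / v ^ (S D) * (w - v).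
Proof.
  intros Hv Hvw HD. apply (lim_Rabs_le _ _ _ (lim_minus _ _ _ _ (KT_lim kappa v Hv) (KT_lim kappa w ltac:(lra)))).
  intros T HT. unfold KT.
  replace (RI (Kf kappa v) 0 T - RI (Kf kappa w) 0 T) with (RI (fun u => Kf kappa v u - Kf kappa w u) 0 T).
  2:{ apply is_RInt_unique. apply (is_RInt_minus (V:=R_NormedModule)); apply RI_correct, Kf_cont. }
  assert (HvD : 0 < v ^ S D) by now apply pow_lt.
  eapply Rle_trans; [apply (RInt_exp_bound _ (2 * INR (fact (S D)) / v ^ S D * (w - v))); [lra| |]|].
  - intros u. apply continuous_Rminus; apply Kf_cont.
  - intros u _. unfold Kf. replace (_ - _) with ((exp (- v * cosh u) - exp (- w * cosh u)) * cos (kappa * u)) by ring.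
   pose proof (cosh_ge_1 u) as Hc. destruct (exp_diff_bound v w (cosh u) ltac:(lra) Hvw) as [E1 E2].
   rewrite Rabs_mult, (Rabs_pos_eq _ E1). apply Rle_trans with ((w - v) * cosh u * exp (- v * cosh u) * 1).
   { apply Rmult_le_compat; auto using Rabs_pos. apply Rabs_le, COS_bound. }
   rewrite Rmult_1_r, !Rmult_assoc. assert (E3 : cosh u * exp (- v * cosh u) <= 2 * INR (fact (S D)) / v ^ S D * exp (- u)).
   { replace (- v * cosh u) with (- (v * cosh u)) by ring.
    apply Rle_trans with (cosh u * (INR (fact (S D)) / (v * cosh u) ^ S D)).
    { mul_l. apply pow_exp_le. nra. }

    assert (HcD1 : cosh u <= cosh u ^ D).
    { rewrite <- (pow_1 (cosh u)) at 1. now apply Rle_pow. }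
    replace (cosh u * (INR (fact (S D)) / (v * cosh u) ^ S D)) with (INR (fact (S D)) / v ^ S D * / cosh u ^ D).
    2:{ rewrite Rpow_mult_distr. replace (cosh u ^ S D) with (cosh u * cosh u ^ D) by (simpl; ring).
      field. repeat split; lra. }
    apply Rle_trans with (INR (fact (S D)) / v ^ S D * / cosh u).
    { mul_l. apply Rinv_le_contravar; lra. }
    replace (2 * INR (fact (S D)) / v ^ S D * exp (- u)) with (INR (fact (S D)) / v ^ S D * (2 * exp (- u))) by (field; lra).
    mul_l. apply inv_cosh_le. }
   apply (Rmult_le_compat_l (w - v)) in E3; [|lra]. lra.
  - rewrite Ropp_0, exp_0; lra.
Qed.

(** Integrate the derivative of -u exp(-v cosh u)/v and use u <= sinh u. The mass of exp(-v cosh u)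
    thus sits where u^2 is of order at most 1/v. *)
Lemma is_RInt_usinh v T : 0 < v -> 0 <= T ->
  RI (fun u => u * u * exp (- v * cosh u)) 0 T <=
  / v * RI (fun u => exp (- v * cosh u)) 0 T.
Proof.
  intros Hv HT. assert (Cc : forall u, continuous (fun u => exp (- v * cosh u)) u).
  { intros u. apply (continuous_comp (fun u => - v * cosh u) exp).
   + apply continuous_Rmult; [apply continuous_const|apply cosh_cont].
   + apply (ex_derive_continuous exp). eexists; apply is_derive_exp. }
  assert (Dc : forall u, is_derive cosh u (sinh u)) by (intros; apply is_derive_Reals, derivable_pt_lim_cosh).
  assert (Ds : forall u, is_derive sinh u (cosh u)) by (intros; apply is_derive_Reals, derivable_pt_lim_sinh).
  assert (H : is_RInt (V:=R_NormedModule) (fun u => u * sinh u * exp (- v * cosh u) - / v * exp (- v * cosh u)) 0 T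
   (- T * exp (- v * cosh T) / v)).
  { eapply is_RInt_eq; [apply (is_RInt_derive (V:=R_CompleteNormedModule) (fun u => - u * exp (- v * cosh u) / v)
    (fun u => u * sinh u * exp (- v * cosh u) - / v * exp (- v * cosh u)))| |].
   - intros u _. assert (D := Dc u). auto_derive; [eexists; exact D|].
    replace (Derive (fun y => cosh y) u) with (sinh u) by (symmetry; now apply is_derive_unique). field; lra.
   - intros u _. apply continuous_Rminus; apply continuous_Rmult; try apply Cc; try apply continuous_const.
    apply continuous_Rmult; [apply continuous_id|]. apply (ex_derive_continuous sinh). eexists; apply Ds.
   - reflexivity.
   - unfold minus, plus, opp; simpl. field; lra. }
  assert (E2 : is_RInt (V:=R_NormedModule) (fun u => exp (- v * cosh u)) 0 T (RI (fun u => exp (- v * cosh u)) 0 T)).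
  { apply RI_correct, Cc. }
  assert (E1 : is_RInt (V:=R_NormedModule) (fun u => u * u * exp (- v * cosh u)) 0 T
   (RI (fun u => u * u * exp (- v * cosh u)) 0 T)).
  { apply RI_correct. intros; apply continuous_Rmult; [|apply Cc]. apply continuous_Rmult; apply continuous_id. }
  pose proof (is_RInt_lin _ _ _ _ _ _ 1 (/ v) H E2) as H3. assert (Hsinh : forall u, 0 <= u -> u <= sinh u).
  { intros u Hu. destruct (Req_dec u 0) as [->|Hne]; [rewrite sinh_0; lra|].
   destruct (MVT_gen (fun x => sinh x - x) 0 u (fun x => cosh x - 1)) as [c [_ Hc]].
   - intros x _. assert (D := Ds x). auto_derive; [eexists; exact D|].
    replace (Derive (fun y => sinh y) x) with (cosh x) by (symmetry; now apply is_derive_unique). ring.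
   - intros x _. apply continuity_pt_filterlim. apply continuous_Rminus; [|apply continuous_id].
    apply (ex_derive_continuous sinh). eexists; apply Ds.
   - rewrite sinh_0 in Hc. generalize (cosh_ge_1 c); nra. }
  assert (E4 : RI (fun u => u * u * exp (- v * cosh u)) 0 T <=
   1 * (- T * exp (- v * cosh T) / v) + / v * RI (fun u => exp (- v * cosh u)) 0 T).
  { eapply (is_RInt_le _ _ 0 T _ _ HT E1 H3). intros u Hu. pose proof (exp_pos (- v * cosh u)).
   pose proof (Hsinh u ltac:(lra)). assert (u * u * exp (- v * cosh u) <= u * sinh u * exp (- v * cosh u)); [|lra].
   mul_r. apply Rmult_le_compat_l; lra. }
  assert (0 <= T * exp (- v * cosh T) / v).
  { pos. }
  lra.
Qed.

(* [cos x >= 1 - x^2/2] and an integration by parts show that for [v >= kappa^2] the oscillating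
  factor loses at most half of the mass. *)
Lemma K_imag_lower kappa v : 0 < v -> kappa ^ 2 <= v -> / 2 * exp (- v * cosh 1) <= K_imag kappa v.
Proof.
  intros Hv Hk. assert (Cc : forall u, continuous (fun u => exp (- v * cosh u)) u).
  { intros u. apply (continuous_comp (fun u => - v * cosh u) exp).
   + apply continuous_Rmult; [apply continuous_const|apply cosh_cont].
   + apply (ex_derive_continuous exp). eexists; apply is_derive_exp. }
  assert (H : forall T, 1 <= T -> / 2 * exp (- v * cosh 1) <= KT kappa v T).
  { intros T HT. set (A := RI (fun u => exp (- v * cosh u)) 0 T). set (B := RI (fun u => u * u * exp (- v * cosh u)) 0 T).
   assert (EA : forall a b, is_RInt (V:=R_NormedModule) (fun u => exp (- v * cosh u)) a b
    (RI (fun u => exp (- v * cosh u)) a b)).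
   { intros; apply RI_correct, Cc. }
   assert (EB : is_RInt (V:=R_NormedModule) (fun u => u * u * exp (- v * cosh u)) 0 T B).
   { apply RI_correct. intros; apply continuous_Rmult; [|apply Cc]. apply continuous_Rmult; apply continuous_id. }
   assert (HBA : B <= / v * A) by (apply is_RInt_usinh; lra). assert (HK : 1 * A + - (kappa ^ 2 / 2) * B <= KT kappa v T).
   { apply (is_RInt_le (fun u => 1 * exp (- v * cosh u) + - (kappa ^ 2 / 2) * (u * u * exp (- v * cosh u)))
     (Kf kappa v) 0 T); [lra| | |].
    - apply is_RInt_lin; [apply EA|apply EB].
    - apply RI_correct, Kf_cont.
    - intros u Hu. unfold Kf. pose proof (exp_pos (- v * cosh u)).
     assert (Hcos : 1 - (kappa * u) ^ 2 / 2 <= cos (kappa * u)).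
     { replace (kappa * u) with (2 * (kappa * u / 2)) at 2 by field. rewrite cos_2a_sin.
      assert (Hs : Rabs (sin (kappa * u / 2)) <= Rabs (kappa * u / 2)).
      { assert (Hsin : forall x, 0 <= x -> sin x <= x).
       { intros x [Hx|<-]; [left; now apply sin_lt_x|rewrite sin_0; lra]. }
       assert (Hsin' : forall x, 0 <= x -> - x <= sin x).
       { intros x Hx. destruct (Rle_dec x 1).
        - generalize PI2_1 PI_RGT_0; intros. generalize (sin_ge_0 x Hx ltac:(unfold PI2 in *; lra)). lra.
        - generalize (SIN_bound x); lra. }
       destruct (Rle_dec 0 (kappa * u / 2)).
       - rewrite (Rabs_pos_eq (kappa * u / 2)) by easy. apply Rabs_le. split; auto.
       - rewrite (Rabs_left (kappa * u / 2)) by lra. rewrite <- Rabs_Ropp, <- sin_neg.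
        apply Rabs_le. split; [|apply Hsin; lra]. generalize (Hsin' (- (kappa * u / 2)) ltac:(lra)); lra. }
      apply Rsqr_le_abs_1 in Hs. unfold Rsqr in Hs. nra. }
     nra. }
   assert (HA1 : exp (- v * cosh 1) <= A).
   { unfold A. rewrite (RI_Chasles _ 0 1 T) by apply Cc. assert (0 <= RI (fun u => exp (- v * cosh u)) 1 T).
    { apply RInt_ge_0; [easy|eexists; apply EA|intros; left; apply exp_pos]. }
    assert (exp (- v * cosh 1) <= RI (fun u => exp (- v * cosh u)) 0 1); [|lra].
    apply (is_RInt_le (fun _ => exp (- v * cosh 1)) (fun u => exp (- v * cosh u)) 0 1); [lra| |apply EA|].
    - eapply is_RInt_eq; [apply (is_RInt_const (V:=R_NormedModule))|reflexivity|].
     unfold scal; simpl; unfold mult; simpl. ring.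
    - intros u Hu. apply exp_mono. assert (cosh u <= cosh 1); [|nra]. destruct (MVT_gen cosh u 1 sinh) as [c [Hc1 Hc]].
     + intros; apply is_derive_Reals, derivable_pt_lim_cosh.
     + intros; apply continuity_pt_filterlim, cosh_cont.
     + rewrite Rmin_left, Rmax_right in Hc1 by lra. assert (0 <= sinh c); [|nra].
      unfold sinh. generalize (exp_increasing (-c) c ltac:(lra)); lra. }
   assert (0 <= A) by (generalize (exp_pos (- v * cosh 1)); lra). assert (kappa ^ 2 / 2 * B <= / 2 * A); [|lra].
   apply Rle_trans with (kappa ^ 2 / 2 * (/ v * A)).
   - apply Rmult_le_compat_l; [|easy]. generalize (pow2_ge_0 kappa); lra.
   - replace (kappa ^ 2 / 2 * (/ v * A)) with (kappa ^ 2 * / v * (/ 2 * A)) by (field; lra).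
    rewrite <- (Rmult_1_l (/ 2 * A)) at 2. mul_r.
    apply Rmult_le_reg_r with v; [easy|]. rewrite Rmult_assoc, Rinv_l by lra. lra. }
  apply Rnot_lt_le. intros Hlt. assert (He : 0 < / 2 * exp (- v * cosh 1) - K_imag kappa v) by lra.
  destruct (KT_lim kappa v Hv (fun y => Rabs (y - K_imag kappa v) < / 2 * exp (- v * cosh 1) - K_imag kappa v)) as [N HN].
  - exists (mkposreal _ He). intros y Hy. exact Hy.
  - set (T := Rmax N 1 + 1). assert (N < T /\ 1 <= T) as [H1 H2].
   { unfold T; generalize (Rmax_l N 1) (Rmax_r N 1); lra. }
   specialize (HN T H1). specialize (H T H2). simpl in HN. generalize (Rle_abs (KT kappa v T - K_imag kappa v)). lra.
Qed.

(** * Farey fractions *)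

Definition frac (v : Z * Z) : R := IZR (fst v) / IZR (snd v).

(** The Stern-Brocot tree cut at denominator Q: its leaves are the intervals between consecutive
    Farey fractions of order Q. The argument [n] is fuel for the recursion. *)
Fixpoint farey (n : nat) (Q : R) (u v : Z * Z) : list ((Z * Z) * (Z * Z)) :=
  match n with
  | O => [(u, v)]
  | S m => let w := (fst u + fst v, snd u + snd v)%Z in
    if Rle_dec (IZR (snd w)) Q then farey m Q u w ++ farey m Q w v else [(u, v)]
  end.

Definition neighbours (u v : Z * Z) : Prop :=
  (fst v * snd u - fst u * snd v = 1)%Z /\ (1 <= snd u)%Z /\ (1 <= snd v)%Z.

Lemma neighbours_lt u v : neighbours u v -> frac u < frac v.
Proof.
  intros [H [Hu Hv]]. unfold frac. apply IZR_le in Hu, Hv. apply (f_equal IZR) in H. rewrite minus_IZR, !mult_IZR in H.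
  apply Rmult_lt_reg_r with (IZR (snd u)); [lra|]. apply Rmult_lt_reg_r with (IZR (snd v)); [lra|].
  replace (IZR (fst u) / IZR (snd u) * IZR (snd u) * IZR (snd v)) with (IZR (fst u) * IZR (snd v)) by (field; lra).
  replace (IZR (fst v) / IZR (snd v) * IZR (snd u) * IZR (snd v)) with (IZR (fst v) * IZR (snd u)) by (field; lra). lra.
Qed.

Lemma neighbours_med u v (w := (fst u + fst v, snd u + snd v)%Z) : neighbours u v ->
  neighbours u w /\ neighbours w v.
Proof. unfold neighbours, w; simpl. intros [H [Hu Hv]]. repeat split; nia. Qed.

(** Passing to a mediant raises the sum of the two denominators by at least 1. With the assumed fuel
    a leaf is therefore reached because its mediant exceeds Q, and never by exhaustion below Q. *)
Lemma farey_leaf n Q u v : neighbours u v -> IZR (snd u) <= Q -> IZR (snd v) <= Q ->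
  Q < INR n + IZR (snd u) + IZR (snd v) ->
  forall p, In p (farey n Q u v) -> neighbours (fst p) (snd p) /\ IZR (snd (fst p)) <= Q /\
   IZR (snd (snd p)) <= Q /\ Q < IZR (snd (fst p)) + IZR (snd (snd p)) /\
   frac u <= frac (fst p) /\ frac (snd p) <= frac v.
Proof.
  revert u v. induction n as [|n IH]; intros u v H Hu Hv Hn p Hp.
  - simpl in Hp, Hn. destruct Hp as [<-|[]]. simpl. repeat split; try apply H; lra.
  - simpl in Hp. destruct (Rle_dec (IZR (snd u + snd v)) Q) as [Hw|Hw].
   + destruct (neighbours_med u v H) as [H1 H2]. pose proof (neighbours_lt _ _ H1). pose proof (neighbours_lt _ _ H2).
    assert (1 <= IZR (snd u) /\ 1 <= IZR (snd v)) as [Gu Gv] by (destruct H as [_ [A B]]; split; now apply IZR_le).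
    rewrite S_INR in Hn. apply in_app_or in Hp. destruct Hp as [Hp|Hp].
    * destruct (IH _ _ H1 Hu Hw ltac:(simpl; rewrite plus_IZR; lra) p Hp) as (A1&A2&A3&A4&A5&A6).
     repeat split; try apply A1; lra.
    * destruct (IH _ _ H2 Hw Hv ltac:(simpl; rewrite plus_IZR; lra) p Hp) as (A1&A2&A3&A4&A5&A6).
     repeat split; try apply A1; lra.
   + destruct Hp as [<-|[]]. simpl. rewrite plus_IZR in Hw. repeat split; try apply H; lra.
Qed.

(** Only additivity over adjacent intervals is asked of [F], so that the lemma also serves for
    integrals whose limits are clamped to a smaller interval. *)
Lemma farey_csum n Q u v (F : R -> R -> C) : neighbours u v ->
  (forall a b c, a <= b -> b <= c -> F a c = (F a b + F b c)%C) ->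
  csum (fun p => F (frac (fst p)) (frac (snd p))) (farey n Q u v) = F (frac u) (frac v).
Proof.
  intros H HF. revert u v H. induction n as [|n IH]; intros u v H; simpl; [ring|].
  destruct (Rle_dec (IZR (snd u + snd v)) Q) as [Hw|Hw]; [|simpl; ring]. destruct (neighbours_med u v H) as [H1 H2].
  pose proof (neighbours_lt _ _ H1). pose proof (neighbours_lt _ _ H2).
  rewrite csum_app, (IH _ _ H1), (IH _ _ H2). symmetry. apply HF; lra.
Qed.

Lemma farey_rsum n Q u v (F : R -> R -> R) : neighbours u v ->
  (forall a b c, a <= b -> b <= c -> F a c = F a b + F b c) ->
  rsum (fun p => F (frac (fst p)) (frac (snd p))) (farey n Q u v) = F (frac u) (frac v).
Proof.
  intros H HF. revert u v H. induction n as [|n IH]; intros u v H; simpl; [ring|].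
  destruct (Rle_dec (IZR (snd u + snd v)) Q) as [Hw|Hw]; [|simpl; ring]. destruct (neighbours_med u v H) as [H1 H2].
  pose proof (neighbours_lt _ _ H1). pose proof (neighbours_lt _ _ H2).
  rewrite rsum_app, (IH _ _ H1), (IH _ _ H2). symmetry. apply HF; lra.
Qed.

Lemma farey_range n Q u v p : neighbours u v -> In p (farey n Q u v) ->
  frac u <= frac (fst p) < frac v /\ frac u < frac (snd p) <= frac v.
Proof.
  revert u v. induction n as [|n IH]; intros u v H Hp; pose proof (neighbours_lt _ _ H).
  - destruct Hp as [<-|[]]. simpl; lra.
  - simpl in Hp. destruct (Rle_dec (IZR (snd u + snd v)) Q) as [Hw|Hw].
   + destruct (neighbours_med u v H) as [H1 H2]. pose proof (neighbours_lt _ _ H1). pose proof (neighbours_lt _ _ H2).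
    apply in_app_or in Hp. destruct Hp as [Hp|Hp]; [specialize (IH _ _ H1 Hp)|specialize (IH _ _ H2 Hp)]; lra.
   + destruct Hp as [<-|[]]. simpl; lra.
Qed.

Lemma farey_nodup n Q u v : neighbours u v ->
  NoDup (map fst (farey n Q u v)) /\ NoDup (map snd (farey n Q u v)).
Proof.
  revert u v. induction n as [|n IH]; intros u v H; simpl.
  - split; constructor; try constructor; easy.
  - destruct (Rle_dec (IZR (snd u + snd v)) Q) as [Hw|Hw].
   + destruct (neighbours_med u v H) as [H1 H2]. destruct (IH _ _ H1) as [A1 A2], (IH _ _ H2) as [B1 B2].
    rewrite !map_app. split; apply NoDup_app; try easy.
    * intros x Hx Hy. apply in_map_iff in Hx, Hy. destruct Hx as [p [<- Hp]], Hy as [p' [E Hp']].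
     pose proof (farey_range _ _ _ _ _ H1 Hp). pose proof (farey_range _ _ _ _ _ H2 Hp'). rewrite E in *; lra.
    * intros x Hx Hy. apply in_map_iff in Hx, Hy. destruct Hx as [p [<- Hp]], Hy as [p' [E Hp']].
     pose proof (farey_range _ _ _ _ _ H1 Hp). pose proof (farey_range _ _ _ _ _ H2 Hp'). rewrite E in *; lra.
   + simpl. split; constructor; try constructor; easy.
Qed.

Lemma mediant_minus u v : neighbours u v ->
  frac (fst u + fst v, snd u + snd v)%Z - frac u = / (IZR (snd u) * (IZR (snd u) + IZR (snd v))) /\
  frac v - frac (fst u + fst v, snd u + snd v)%Z = / (IZR (snd v) * (IZR (snd u) + IZR (snd v))).
Proof.
  intros [H [Hu Hv]]. unfold frac; simpl. apply IZR_le in Hu, Hv.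
  apply (f_equal IZR) in H. rewrite minus_IZR, !mult_IZR in H. rewrite !plus_IZR.
  assert (E : IZR (fst v) = (1 + IZR (fst u) * IZR (snd v)) / IZR (snd u)) by (apply Rmult_eq_reg_r with (IZR (snd u)); [field_simplify; lra|lra]).
  rewrite E. split; field; lra.
Qed.

Lemma farey_cover n Q u v x : neighbours u v -> frac u <= x <= frac v ->
  exists p, In p (farey n Q u v) /\ frac (fst p) <= x <= frac (snd p).
Proof.
  revert u v. induction n as [|n IH]; intros u v H Hx; simpl.
  - exists (u, v); simpl; tauto.
  - destruct (Rle_dec (IZR (snd u + snd v)) Q) as [Hw|Hw]; [|exists (u, v); simpl; tauto].
   destruct (neighbours_med u v H) as [H1 H2]. set (w := (fst u + fst v, snd u + snd v)%Z) in *.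
   destruct (Rle_dec x (frac w)).
   + destruct (IH _ _ H1 ltac:(lra)) as [p [Hp Hp']]. exists p; split; [apply in_or_app; now left|easy].
   + destruct (IH _ _ H2 ltac:(lra)) as [p [Hp Hp']]. exists p; split; [apply in_or_app; now right|easy].
Qed.

Lemma inv_prod_le Q k l : 1 <= k -> 0 < Q -> Q < k + l -> k * / (k * (k + l)) <= / Q.
Proof.
  intros Hk HR H. replace (k * / (k * (k + l))) with (/ (k + l)) by (field; lra). apply Rinv_le_contravar; lra.
Qed.

(** The point lies in a Farey interval, on one side of its mediant. The end on that side is the
    approximation, and the other end supplies the Bezout coefficients that are needed for a modular
    matrix. *)
Lemma dirichlet (Q x : R) : 1 <= Q -> exists h k a b : Z, (1 <= k)%Z /\ IZR k <= Q /\
  (a * h + b * k = -1)%Z /\ Rabs (IZR k * x - IZR h) <= / Q.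
Proof.
  intros HR. set (m := (up x - 1)%Z). destruct (archimed x) as [A1 A2].
  assert (Hm : IZR m <= x <= IZR m + 1) by (unfold m; rewrite minus_IZR; lra).
  set (u := (m, 1%Z)). set (v := ((m + 1)%Z, 1%Z)). assert (N : neighbours u v) by (unfold neighbours, u, v; simpl; lia).
  destruct (INR_unbounded Q) as [n Hn]. destruct (farey_cover n Q u v x N) as [p [Hp Hx]].
  { unfold frac, u, v; simpl. rewrite plus_IZR. lra. }
  destruct (farey_leaf n Q u v N HR HR ltac:(simpl; lra) p Hp) as (P1&P2&P3&P4&_).
  destruct p as [[h1 k1] [h2 k2]]; simpl in *. destruct (mediant_minus _ _ P1) as [D1 D2]; simpl in D1, D2.
  destruct P1 as [P0 [Pk1 Pk2]]; simpl in P0, Pk1, Pk2. assert (Q1 := IZR_le _ _ Pk1). assert (Q2 := IZR_le _ _ Pk2).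
  destruct (Rle_dec x (frac (h1 + h2, k1 + k2)%Z)) as [Hl|Hl].
  - exists h1, k1, k2, (- h2)%Z. repeat split; try easy; [lia|].
   assert (E : IZR k1 * x - IZR h1 = IZR k1 * (x - frac (h1, k1))) by (unfold frac; simpl; field; lra).
   rewrite E, Rabs_pos_eq by nra.
   apply Rle_trans with (IZR k1 * / (IZR k1 * (IZR k1 + IZR k2))); [apply Rmult_le_compat_l; lra|]. apply inv_prod_le; lra.
  - exists h2, k2, (- k1)%Z, h1. repeat split; try easy; [lia|].
   assert (E : IZR k2 * x - IZR h2 = - (IZR k2 * (frac (h2, k2) - x))) by (unfold frac; simpl; field; lra).
   rewrite E, Rabs_Ropp, Rabs_pos_eq by nra. rewrite (Rplus_comm (IZR k1)) in D2.
   apply Rle_trans with (IZR k2 * / (IZR k2 * (IZR k2 + IZR k1))); [apply Rmult_le_compat_l; lra|]. apply inv_prod_le; lra.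
Qed.

(** * Boundedness and Lipschitz continuity of the form *)

Lemma e_lip a b : Cmod (e a - e b)%C <= 2 * PI * Rabs (a - b).
Proof.
  pose proof PI_RGT_0 as HPI. replace (e a - e b)%C with (e b * (e (a - b) - RtoC 1))%C.
  2:{ replace a with (b + (a - b)) at 2 by ring. rewrite e_plus; ring. }
  rewrite Cmod_mult, Cmod_e, Rmult_1_l. set (x := a - b). apply Rsqr_incr_0_var; [|apply Rmult_le_pos; [lra|pos]].
  unfold Rsqr. replace (Cmod (e x - RtoC 1)%C * Cmod (e x - RtoC 1)%C) with (Cmod (e x - RtoC 1)%C ^ 2) by ring.
  rewrite Cmod2_alt. unfold e, Re, Im; simpl. replace (2 * PI * x) with (2 * (PI * x)) by ring. rewrite cos_2a_sin, sin_2a.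
  assert (Hs : Rabs (sin (PI * x)) <= PI * Rabs x).
  { replace (PI * Rabs x) with (Rabs (PI * x)) by (rewrite Rabs_mult, (Rabs_pos_eq PI); lra).
   assert (Hsin : forall x, 0 <= x -> Rabs (sin x) <= x).
   { intros z Hz. apply Rabs_le. split.
    - destruct (Rle_dec z 1).
     + generalize PI2_1 ; intros. generalize (sin_ge_0 z Hz ltac:(unfold PI2 in *; lra)). lra.
     + generalize (SIN_bound z); lra.
    - destruct Hz as [Hz|<-]; [left; now apply sin_lt_x|rewrite sin_0; lra]. }
   destruct (Rle_dec 0 (PI * x)).
   - rewrite (Rabs_pos_eq (PI * x)) by easy. now apply Hsin.
   - rewrite (Rabs_left (PI * x)) by lra. rewrite <- Rabs_Ropp, <- sin_neg. apply Hsin; lra. }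
  assert (H1 : Rsqr (sin (PI * x)) <= Rsqr (PI * Rabs x)).
  { apply Rsqr_le_abs_1. rewrite (Rabs_pos_eq (PI * Rabs x)); [easy|]. apply Rmult_le_pos; [lra|pos]. }
  unfold Rsqr in H1. pose proof (sin2_cos2 (PI * x)) as H2. unfold Rsqr in H2.
  set (s := sin (PI * x)) in *. set (c := cos (PI * x)) in *.
  replace ((1 - 2 * s * s + - (1)) * ((1 - 2 * s * s + - (1)) * 1) + (2 * s * c + - 0) * ((2 * s * c + - 0) * 1))
   with (4 * (s * s) * (s * s + c * c)) by ring.
  rewrite H2. lra.
Qed.

(** Partial sums symmetric in n: finite sums can be integrated term by term, and the error is
    controlled by [psiT_tail]. *)
Definition psiT (kappa : R) (t : Z -> C) (T : nat) (x y : R) : C :=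
  (RtoC (sqrt y) * csum (fun n => fourier_term kappa t x y (Z.of_nat n) +
   fourier_term kappa t x y (- Z.of_nat n)) (seq 1 T))%C.

(** A crude polynomial bound, which serves for convergence, for the regularity of the form and for
    truncations. The exponent theta itself enters in the estimates at a cusp and in the trivial
    bound of the short sum. *)
Definition coef_bd (t : Z -> C) (p : nat) (B : R) : Prop :=
  0 < B /\ forall n : nat, (1 <= n)%nat ->
   Cmod (t (Z.of_nat n)) <= B * INR n ^ p /\ Cmod (t (- Z.of_nat n)%Z) <= B * INR n ^ p.

Lemma parity_Cmod t (n : nat) : even_or_odd t -> (1 <= n)%nat ->
  Cmod (t (- Z.of_nat n)%Z) = Cmod (t (Z.of_nat n)).
Proof. intros [H|H] Hn; rewrite H by lia; [easy|apply Cmod_opp]. Qed.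

Lemma coef_bd_exists t theta : 0 <= theta -> even_or_odd t -> admissible_exponent t theta ->
  exists p B, coef_bd t p B.
Proof.
  intros H0 Hp Ha. destruct (Ha 1 ltac:(lra)) as [B HB]. destruct (INR_unbounded (theta + 1)) as [p Hpp].
  exists p, (Rabs B + 1). split; [generalize (Rabs_pos B); lra|]. intros n Hn. rewrite (parity_Cmod t n Hp Hn).
  assert (Hn1 : 1 <= INR n) by (apply (le_INR 1); lia).
  assert (E : Cmod (t (Z.of_nat n)) <= (Rabs B + 1) * INR n ^ p); [|split; exact E].
  eapply Rle_trans; [apply HB; lia|]. rewrite <- INR_IZR_INZ. assert (Hpow : Rpower (INR n) (theta + 1) <= INR n ^ p).
  { rewrite <- Rpower_pow by lra. apply Rle_Rpower; lra. }
  assert (0 < Rpower (INR n) (theta + 1)) by apply exp_pos. generalize (Rle_abs B) (Rabs_pos B). nra.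
Qed.

Lemma K_term_bound kappa n y D : (1 <= n)%nat -> 0 < y -> (1 <= D)%nat ->
  Rabs (K_imag kappa (2 * PI * INR n * y)) <= 2 * INR (fact D) / (INR n * y) ^ D.
Proof.
  intros Hn Hy HD. pose proof PI2_3_2 as HP. unfold PI2 in HP. assert (Hn1 : 1 <= INR n) by (apply (le_INR 1); lia).
  assert (0 < INR n * y) by nra. eapply Rle_trans; [apply (K_imag_bound kappa _ D); [nra|easy]|]. mul_l.
  apply Rinv_le_contravar; [pos|]. apply pow_incr. split; [lra|]. nra.
Qed.

Lemma sqrt_inv_pow y : 0 < y -> (sqrt y) * sqrt y = y.
Proof. intros; apply sqrt_sqrt; lra. Qed.

Lemma fourier_term_norm kappa t x y n : Cmod (fourier_term kappa t x y n) =
  Cmod (t n) * Rabs (K_imag kappa (2 * PI * Rabs (IZR n) * y)).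
Proof. unfold fourier_term. rewrite !Cmod_mult, Cmod_R, Cmod_e. ring. Qed.

Lemma abs_IZR_nat n : Rabs (IZR (Z.of_nat n)) = INR n /\ Rabs (IZR (- Z.of_nat n)) = INR n.
Proof.
  rewrite opp_IZR, Rabs_Ropp, <- INR_IZR_INZ. rewrite Rabs_pos_eq by apply pos_INR. easy.
Qed.

(** The decay of K is used to the power p + 2: p factors n absorb the coefficient and two make the
    series converge. *)
Lemma term_bound kappa t p B x y n : coef_bd t p B -> (1 <= n)%nat -> 0 < y ->
  Cmod (fourier_term kappa t x y (Z.of_nat n)) <= 2 * B * INR (fact (p + 2)) / y ^ (p + 2) / INR n ^ 2 /\
  Cmod (fourier_term kappa t x y (- Z.of_nat n)) <= 2 * B * INR (fact (p + 2)) / y ^ (p + 2) / INR n ^ 2.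
Proof.
  intros [HB Hc] Hn Hy. destruct (Hc n Hn) as [C1 C2]. destruct (abs_IZR_nat n) as [A1 A2].
  rewrite !fourier_term_norm, A1, A2. assert (Hn1 : 1 <= INR n) by (apply (le_INR 1); lia).
  pose proof (K_term_bound kappa n y (p + 2) Hn Hy ltac:(lia)) as HK. assert (P : forall c, 0 <= c -> c <= B * INR n ^ p ->
   c * Rabs (K_imag kappa (2 * PI * INR n * y)) <= 2 * B * INR (fact (p + 2)) / y ^ (p + 2) / INR n ^ 2).
  { intros c Hc0 Hc1. eapply Rle_trans; [apply Rmult_le_compat; [easy|pos|exact Hc1|exact HK]|].
   right. rewrite Rpow_mult_distr, (pow_add (INR n)).
   assert (0 < y ^ (p + 2)) by now apply pow_lt. assert (0 < INR n ^ p) by pos.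
 field. repeat split; lra. }
  split; apply P; auto using Cmod_ge_0.
Qed.

Lemma csum_seq_telescope (a : nat -> C) c T m : (1 <= T)%nat -> 0 <= c ->
  (forall n, (1 <= n)%nat -> Cmod (a n) <= c / INR n ^ 2) ->
  Cmod (csum a (seq (S T) m)) <= c * (/ INR T - / INR (T + m)).
Proof.
  intros HT Hc Ha. induction m as [|m IH].
  - simpl. rewrite Nat.add_0_r, Cmod_0. lra.
  - rewrite seq_S, csum_app. simpl. via Cmod_triangle. rewrite Cplus_0_r. specialize (Ha (S (T + m)) ltac:(lia)).
   replace (T + S m)%nat with (S (T + m)) by lia. assert (1 <= INR (T + m)) by (apply (le_INR 1); lia).
   assert (c / INR (S (T + m)) ^ 2 <= c * (/ INR (T + m) - / INR (S (T + m)))).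
   { mul_l. rewrite S_INR. set (z := INR (T + m)) in *. replace (/ z - / (z + 1)) with (/ (z * (z + 1))) by (field; lra).
    apply Rinv_le_contravar; nra. }
   lra.
Qed.

Lemma csum_seq_bound (a : nat -> C) c m : 0 <= c ->
  (forall n, (1 <= n)%nat -> Cmod (a n) <= c / INR n ^ 2) -> Cmod (csum a (seq 1 m)) <= 2 * c.
Proof.
  intros Hc Ha. destruct m as [|m]; [simpl; rewrite Cmod_0; lra|]. change (seq 1 (S m)) with (1%nat :: seq 2 m). simpl csum.
  via Cmod_triangle. pose proof (csum_seq_telescope a c 1 m (le_n 1) Hc Ha) as H.
  specialize (Ha 1%nat (le_n 1)). simpl in Ha. assert (0 < / INR (1 + m)) by pos.
  simpl (INR 1) in H. replace (c / (1 * (1 * 1))) with c in Ha by field. nra.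
Qed.

Lemma sum_n_csum (a : nat -> C) m : sum_n (G := C_AbelianMonoid) (fun k => a (S k)) m = csum a (seq 1 (S m)).
Proof.
  induction m as [|m IH].
  - rewrite sum_O. simpl. ring.
  - rewrite sum_Sn, IH, (seq_S (S m)), csum_app. simpl (csum a [_]). rewrite Cplus_0_r. reflexivity.
Qed.

Lemma series_tail (a : nat -> C) S c T : (1 <= T)%nat -> 0 <= c ->
  (forall n, (1 <= n)%nat -> Cmod (a n) <= c / INR n ^ 2) ->
  is_series (V := C_R_NormedModule) (fun k => a (Datatypes.S k)) S ->
  Cmod (S - csum a (seq 1 T))%C <= c / INR T.
Proof.
  intros HT Hc Ha HS.

  apply Rnot_lt_le. intros Hlt. set (d := Cmod (S - csum a (seq 1 T))%C - c / INR T). assert (Hd : 0 < d) by (unfold d; lra).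
  assert (Hd2 : 0 < d / 2) by lra. destruct (HS (fun z => ball (M:=C_UniformSpace) S (mkposreal _ Hd2) z)) as [N HN].
  { exists (mkposreal _ Hd2). intros z Hz. exact Hz. }
  set (m := (N + T)%nat). specialize (HN m ltac:(unfold m; lia)).
  assert (E : sum_n (G := C_AbelianMonoid) (fun k => a (Datatypes.S k)) m = csum a (seq 1 (Datatypes.S m))) by apply sum_n_csum.
  assert (HN' : ball (M:=C_UniformSpace) S (d / 2) (csum a (seq 1 (Datatypes.S m)))).
  { rewrite <- E. exact HN. }
  clear HN E. destruct HN' as [B1 B2].
  unfold ball in B1, B2; simpl in B1, B2. unfold AbsRing_ball, abs, minus, plus, opp in B1, B2; simpl in B1, B2.
  set (P := csum a (seq 1 (Datatypes.S m))) in *. assert (H1 : Cmod (P - S)%C < d).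
  { eapply Rle_lt_trans; [apply Cmod_2Rmax|]. simpl.
   assert (HM : Rmax (Rabs (fst P + - fst S)) (Rabs (snd P + - snd S)) < d / 2) by now apply Rmax_lub_lt.
   assert (HS2 : sqrt 2 <= 3/2). { apply Rsqr_incr_0_var; [|lra]. rewrite Rsqr_sqrt by lra. unfold Rsqr; lra. }
   assert (0 <= Rmax (Rabs (fst P + - fst S)) (Rabs (snd P + - snd S))).
   { eapply Rle_trans; [apply Rabs_pos|apply Rmax_l]. }
   apply Rle_lt_trans with (3 / 2 * Rmax (Rabs (fst P + - fst S)) (Rabs (snd P + - snd S))); [|lra].
   apply Rmult_le_compat_r; lra. }
  assert (H2 : Cmod (P - csum a (seq 1 T))%C <= c / INR T).
  { unfold P, m. replace (Datatypes.S (N + T)) with (T + Datatypes.S N)%nat by lia. rewrite seq_app, csum_app.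
   replace (csum a (seq 1 T) + csum a (seq (1 + T) (Datatypes.S N)) - csum a (seq 1 T))%C with
    (csum a (seq (1 + T) (Datatypes.S N))) by ring.
   pose proof (csum_seq_telescope a c T (Datatypes.S N) HT Hc Ha). assert (0 < / INR (T + Datatypes.S N)) by pos.
   unfold Rdiv. via H. apply Rmult_le_compat_l; lra. }
  assert (H3 : Cmod (S - csum a (seq 1 T))%C <= Cmod (S - P)%C + Cmod (P - csum a (seq 1 T))%C).
  { eapply Rle_trans; [|apply Cmod_triangle]. right; f_equal; ring. }
  rewrite <- (Cmod_opp (S - P)%C) in H3. replace (- (S - P))%C with (P - S)%C in H3 by ring. unfold d in *. lra.
Qed.

(** The loss of a power of 1/y is harmless: T either tends to infinity or is a high power of M,
    while the heights in question are at least 1/M. *)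
Lemma psiT_tail kappa psi t p B x y T : fourier_expansion kappa psi t -> coef_bd t p B ->
  0 < y -> (1 <= T)%nat ->
  Cmod (psi (x, y) - psiT kappa t T x y)%C <= sqrt y * (4 * B * INR (fact (p + 2)) / y ^ (p + 2)) / INR T.
Proof.
  intros Hf Hc Hy HT. destruct (Hf x y Hy) as [Sp [Sn [H1 [H2 H3]]]]. set (c := 2 * B * INR (fact (p + 2)) / y ^ (p + 2)).
  assert (Hc0 : 0 <= c).
  { destruct Hc as [HB _]. unfold c. apply Rmult_le_pos; [|pos]. generalize (INR_fact_lt_0 (p + 2)); nra. }
  assert (E1 := series_tail (fun n => fourier_term kappa t x y (Z.of_nat n)) Sp c T HT Hc0
   (fun n Hn => proj1 (term_bound kappa t p B x y n Hc Hn Hy)) H1).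
  assert (E2 := series_tail (fun n => fourier_term kappa t x y (- Z.of_nat n)) Sn c T HT Hc0
   (fun n Hn => proj2 (term_bound kappa t p B x y n Hc Hn Hy)) H2).
  unfold psiT. rewrite H3, csum_plus. match goal with |- Cmod (_ * (_ + _) - _ * (?A + ?D))%C <= _ =>
   replace (RtoC (sqrt y) * (Sp + Sn) - RtoC (sqrt y) * (A + D))%C with
   (RtoC (sqrt y) * ((Sp - A) + (Sn - D)))%C by ring end.
  rewrite Cmod_mult, Cmod_R, (Rabs_pos_eq (sqrt y)) by apply sqrt_pos. assert (HT0 : 0 < INR T) by pos.
  replace (sqrt y * (4 * B * INR (fact (p + 2)) / y ^ (p + 2)) / INR T) with (sqrt y * (c / INR T + c / INR T)).
  - mul_l. via Cmod_triangle. lra.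
  - unfold c. assert (0 < y ^ (p + 2)) by now apply pow_lt. field. lra.
Qed.

Lemma sqrt_le_2 y : / 4 <= y -> sqrt y <= 2 * y.
Proof.
  intros H. assert (H1 := sqrt_inv_pow y ltac:(lra)). assert (/ 2 <= sqrt y).
  { replace (/ 2) with (sqrt (/ 4)); [apply sqrt_le_1_alt; lra|].
   replace (/ 4) with (Rsqr (/ 2)) by (unfold Rsqr; field). apply sqrt_Rsqr; lra. }
  nra.
Qed.

Lemma sqrt_over_pow y D : / 4 <= y -> (1 <= D)%nat -> sqrt y / y ^ D <= 2 * 4 ^ (D - 1).
Proof.
  intros Hy HD. assert (0 < y ^ (D - 1)) by pos. replace D with (S (D - 1)) at 1 by lia. simpl.
  apply Rle_trans with (2 * y / (y * y ^ (D - 1))).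
  - mul_r. now apply sqrt_le_2.
  - replace (2 * y / (y * y ^ (D - 1))) with (2 * / y ^ (D - 1)) by (field; lra). mul_l. rewrite <- pow_inv.
   apply pow_incr. split; [pos|]. rewrite <- (Rinv_inv 4). apply Rinv_le_contravar; lra.
Qed.

Lemma psi_bounded_cusp kappa psi t p B : fourier_expansion kappa psi t -> coef_bd t p B ->
  exists C1, 0 < C1 /\ forall x y, / 4 <= y -> Cmod (psi (x, y)) <= C1.
Proof.
  intros Hf Hc. pose proof (proj1 Hc) as HB. pose proof (INR_fact_lt_0 (p + 2)) as HF.
  exists (8 * B * INR (fact (p + 2)) * (2 * 4 ^ (p + 2 - 1))). split.
  - pos.
  - intros x y Hy. assert (Hy0 : 0 < y) by lra. assert (HyD : 0 < y ^ (p + 2)) by now apply pow_lt.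
   pose proof (psiT_tail kappa psi t p B x y 1 Hf Hc Hy0 (le_n 1)) as H.
   assert (H1 : Cmod (psiT kappa t 1 x y) <= sqrt y * (4 * B * INR (fact (p + 2)) / y ^ (p + 2))).
   { unfold psiT. rewrite Cmod_mult, Cmod_R, (Rabs_pos_eq (sqrt y)) by apply sqrt_pos. mul_l. simpl csum. rewrite Cplus_0_r.
    destruct (term_bound kappa t p B x y 1 Hc (le_n 1) Hy0) as [T1 T2].
    via Cmod_triangle. simpl Z.of_nat in *. simpl INR in T1, T2. replace (4 * B * INR (fact (p + 2)) / y ^ (p + 2)) with
    (2 * B * INR (fact (p + 2)) / y ^ (p + 2) / 1 ^ 2 + 2 * B * INR (fact (p + 2)) / y ^ (p + 2) / 1 ^ 2) by (field; lra).
    apply Rplus_le_compat; [exact T1|exact T2]. }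
   simpl INR in H. rewrite Rdiv_1_r in H.
   replace (psi (x, y)) with ((psi (x, y) - psiT kappa t 1 x y) + psiT kappa t 1 x y)%C by ring. via Cmod_triangle.
   pose proof (sqrt_over_pow y (p + 2) Hy ltac:(lia)) as HS.
   replace (sqrt y * (4 * B * INR (fact (p + 2)) / y ^ (p + 2))) with
    (4 * B * INR (fact (p + 2)) * (sqrt y / y ^ (p + 2))) in * by (field; lra).
   assert (0 < 4 * B * INR (fact (p + 2))) by pos. apply (Rmult_le_compat_l (4 * B * INR (fact (p + 2)))) in HS; lra.
Qed.

(** The factors sqrt y, K and e are varied in turn. The variation of K and that of e each bring down
    a factor n, absorbed by using the decay of K with exponent [S D]. *)
Lemma Phi_diff kappa (n D : nat) s x1 y1 x2 y2 : (1 <= n)%nat -> (1 <= D)%nat -> Rabs s = 1 ->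
  / 2 <= y1 -> Rabs (y1 - y2) <= y1 / 2 ->
  Cmod (RtoC (sqrt y1) * (RtoC (K_imag kappa (2 * PI * INR n * y1)) * e (s * INR n * x1)) -
     RtoC (sqrt y2) * (RtoC (K_imag kappa (2 * PI * INR n * y2)) * e (s * INR n * x2)))%C
  <= 6 * 4 ^ D * (2 * INR (fact (S D))) / INR n ^ D * ((Rabs (x1 - x2) + Rabs (y1 - y2)) / y1).
Proof.
  intros Hn HD Hs Hy1 Hy. pose proof PI2_3_2 as HP. unfold PI2 in HP. assert (Hn1 : 1 <= INR n) by (apply (le_INR 1); lia).
  assert (Hy2 : y1 / 2 <= y2 <= 3 / 2 * y1) by (apply Rabs_le_between in Hy; lra).
  set (dx := Rabs (x1 - x2)). set (dy := Rabs (y1 - y2)) in *.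
  assert (Hdx : 0 <= dx) by apply Rabs_pos. assert (Hdy : 0 <= dy) by apply Rabs_pos.
  set (F := 2 * INR (fact (S D))). set (m := y1 / 2). assert (Hm : / 4 <= m) by (unfold m; lra).
  assert (HF : 0 < F) by (unfold F; generalize (INR_fact_lt_0 (S D)); lra).
  set (Q := F / (INR n * m) ^ D). assert (HnmD : 0 < (INR n * m) ^ D) by pos.
  assert (HQ : 0 < Q) by now apply Rdiv_lt_0_compat. assert (HnD : 0 < INR n ^ D) by pos.
  assert (Kb : forall y, m <= y -> Rabs (K_imag kappa (2 * PI * INR n * y)) <= Q).
  { intros y Hmy. eapply Rle_trans; [apply (K_term_bound kappa n y D); [easy|lra|easy]|].
   unfold Q. assert (HmyD : (INR n * m) ^ D <= (INR n * y) ^ D) by (apply pow_incr; nra).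
   assert (HFF : 2 * INR (fact D) <= F).
   { unfold F. mul_l. apply le_INR, fact_le. lia. }
   assert (0 < 2 * INR (fact D)) by (generalize (INR_fact_lt_0 D); lra).
   apply Rmult_le_compat; [lra|pos|easy|]. apply Rinv_le_contravar; lra. }
  assert (H2pn : 0 < 2 * PI * INR n) by pos. assert (Hnm : 0 < INR n * m) by pos.

  assert (Hw : INR n * m <= 2 * PI * INR n * m).
  { nra. }
  assert (Hc : (INR n * m) ^ D <= (2 * PI * INR n * m) ^ D) by (apply pow_incr; lra).

  assert (Hgen : forall d, 0 <= d -> F / (2 * PI * INR n * m) ^ S D * (2 * PI * INR n * d) <= Q * (d / m)).
  { intros d Hd.
   replace (F / (2 * PI * INR n * m) ^ S D * (2 * PI * INR n * d)) with (F / (2 * PI * INR n * m) ^ D * (d / m)).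
   2:{ simpl pow. field. repeat split; lra. }
   mul_r. mul_l. apply Rinv_le_contravar; lra. }
  assert (Hmon : forall u, m <= u -> / (2 * PI * INR n * u) ^ S D <= / (2 * PI * INR n * m) ^ S D).
  { intros u Hu. apply Rinv_le_contravar; [pos|]. apply pow_incr. split; [lra|]. apply Rmult_le_compat_l; lra. }
  assert (Kb' : Rabs (K_imag kappa (2 * PI * INR n * y2)) * (2 * PI * (INR n * dx)) <= Q * (dx / m)).
  { eapply Rle_trans; [|apply (Hgen dx Hdx)]. rewrite <- !Rmult_assoc. rewrite !Rmult_assoc.
   replace (2 * (PI * (INR n * dx))) with (2 * PI * INR n * dx) by ring. mul_r.
   eapply Rle_trans; [apply (K_imag_bound kappa _ (S D)); [|lia]|].
   - pos.
   - mul_l. generalize (Hmon y2 ltac:(unfold m; lra)). rewrite !Rmult_assoc. easy. }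
  assert (Kd : Rabs (K_imag kappa (2 * PI * INR n * y1) - K_imag kappa (2 * PI * INR n * y2)) <= Q * (dy / m)).
  { assert (G : forall u v, m <= u -> u <= v ->
    Rabs (K_imag kappa (2 * PI * INR n * u) - K_imag kappa (2 * PI * INR n * v)) <= Q * ((v - u) / m)).
   { intros u v Hu Huv. eapply Rle_trans; [apply (K_imag_lip kappa _ _ D); [pos| |easy]|].
    { apply Rmult_le_compat_l; lra. }
    fold F. eapply Rle_trans; [|apply (Hgen (v - u) ltac:(lra))].
    replace (2 * PI * INR n * v - 2 * PI * INR n * u) with (2 * PI * INR n * (v - u)) by ring. mul_r. mul_l.
    now apply Hmon. }
   unfold dy. destruct (Rle_dec y1 y2).
   - rewrite (Rabs_left1 (y1 - y2)) by lra. replace (- (y1 - y2)) with (y2 - y1) by ring. apply G; unfold m in *; lra.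
   - rewrite (Rabs_pos_eq (y1 - y2)) by lra. rewrite Rabs_minus_sym. apply G; unfold m in *; lra. }
  assert (Sq : Rabs (sqrt y1 - sqrt y2) <= sqrt y1 * (dy / y1)).
  { pose proof (sqrt_lt_R0 y1 ltac:(lra)) as P1. pose proof (sqrt_lt_R0 y2 ltac:(lra)) as P2.
   pose proof (sqrt_inv_pow y1 ltac:(lra)) as Q1. pose proof (sqrt_inv_pow y2 ltac:(lra)) as Q2.
   assert (E : Rabs (sqrt y1 - sqrt y2) * (sqrt y1 + sqrt y2) = dy).
   { unfold dy. rewrite <- (Rabs_pos_eq (sqrt y1 + sqrt y2)) by lra. rewrite <- Rabs_mult. f_equal. nra. }
   replace (sqrt y1 * (dy / y1)) with (dy / sqrt y1).
   2:{ assert (E' : forall r y, r * r = y -> 0 < r -> dy / r = r * (dy / y)) by (intros r y <- Hr; field; lra).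
     now apply E'. }
   apply Rmult_le_reg_r with (sqrt y1); [easy|]. unfold Rdiv. rewrite Rmult_assoc, Rinv_l by lra.
   generalize (Rabs_pos (sqrt y1 - sqrt y2)); nra. }
  assert (Sq2 : sqrt y2 <= 2 * sqrt y1).
  { replace (2 * sqrt y1) with (sqrt (4 * y1)).
   - apply sqrt_le_1_alt; lra.
   - rewrite sqrt_mult by lra. replace (sqrt 4) with 2; [easy|]. replace 4 with (Rsqr 2) by (unfold Rsqr; ring). now rewrite sqrt_Rsqr by lra. }
  set (k1 := K_imag kappa (2 * PI * INR n * y1)) in *. set (k2 := K_imag kappa (2 * PI * INR n * y2)) in *.
  set (e1 := e (s * INR n * x1)). set (e2 := e (s * INR n * x2)).
  replace (RtoC (sqrt y1) * (RtoC k1 * e1) - RtoC (sqrt y2) * (RtoC k2 * e2))%C with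
   (RtoC (sqrt y1 - sqrt y2) * (RtoC k1 * e1) + (RtoC (sqrt y2) * (RtoC (k1 - k2) * e1) +
    RtoC (sqrt y2) * (RtoC k2 * (e1 - e2))))%C by (rewrite !RtoC_minus; ring).
  assert (Cmod (e1 - e2)%C <= 2 * PI * (INR n * dx)).
  { via e_lip. right. f_equal. replace (s * INR n * x1 - s * INR n * x2) with (s * (INR n * (x1 - x2))) by ring.
   rewrite !Rabs_mult, Hs, (Rabs_pos_eq (INR n)) by lra. fold dx. ring. }
  pose proof (Kb y1 ltac:(unfold m; lra)) as Kb1. fold k1 in Kb1.
 pose proof (sqrt_pos y2) as Hs2.
  via Cmod_triangle. eapply Rle_trans; [apply Rplus_le_compat_l, Cmod_triangle|].
  rewrite !Cmod_mult, !Cmod_R. unfold e1 at 1 2. rewrite !Cmod_e, !Rmult_1_r, (Rabs_pos_eq (sqrt y2)) by easy.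
  assert (T1 : Rabs (sqrt y1 - sqrt y2) * Rabs k1 <= sqrt y1 * (dy / y1) * Q).
  { apply Rmult_le_compat; auto using Rabs_pos. }
  assert (T2 : sqrt y2 * Rabs (k1 - k2) <= 2 * sqrt y1 * (Q * (dy / m))).
  { apply Rmult_le_compat; auto using Rabs_pos. }
  assert (T3 : sqrt y2 * (Rabs k2 * Cmod (e1 - e2)%C) <= 2 * sqrt y1 * (Q * (dx / m))).
  { apply Rmult_le_compat; auto.
   - pos.
   - eapply Rle_trans; [|exact Kb']. apply Rmult_le_compat_l; auto using Rabs_pos. }
  apply Rle_trans with (sqrt y1 * Q * 5 * ((dx + dy) / y1)).
  { replace (dx / m) with (2 * dx / y1) in T3 by (unfold m; field; lra).
   replace (dy / m) with (2 * dy / y1) in T2 by (unfold m; field; lra). assert (0 <= sqrt y1 * Q * (dx / y1)).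
   { pos. }
   replace (sqrt y1 * Q * 5 * ((dx + dy) / y1)) with
    (sqrt y1 * (dy / y1) * Q + 2 * sqrt y1 * (Q * (2 * dy / y1)) + 2 * sqrt y1 * (Q * (2 * dx / y1)) + sqrt y1 * Q * (dx / y1)) by (field; lra).
   lra. }
  apply Rmult_le_compat_r.
  { pos. }
  unfold Q. rewrite Rpow_mult_distr. assert (HmD : 0 < m ^ D) by pos. assert (Hy1m : sqrt y1 <= 2 * sqrt m).
  { replace (2 * sqrt m) with (sqrt (4 * m)).
   - apply sqrt_le_1_alt; unfold m; lra.
   - rewrite sqrt_mult by lra. replace (sqrt 4) with 2; [easy|]. replace 4 with (Rsqr 2) by (unfold Rsqr; ring). now rewrite sqrt_Rsqr by lra. }
  pose proof (sqrt_over_pow m D Hm HD) as HSm. assert (HSm' : sqrt m / m ^ D <= / 2 * 4 ^ D).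
  { via HSm. replace D with (S (D - 1)) at 2 by lia. simpl. lra. }
  replace (sqrt y1 * (F / (INR n ^ D * m ^ D)) * 5) with (5 * F / INR n ^ D * (sqrt y1 / m ^ D)) by (field; lra).
  replace (6 * 4 ^ D * F / INR n ^ D) with (6 * F / INR n ^ D * 4 ^ D) by (field; lra). assert (sqrt y1 / m ^ D <= 4 ^ D).
  { apply Rle_trans with (2 * sqrt m / m ^ D); [mul_r; easy|]. unfold Rdiv in *; lra. }
  apply Rmult_le_compat; try lra.
  - pos.
  - pos.
  - mul_r; lra.
Qed.

Lemma psi_lip_cusp kappa psi t p B : fourier_expansion kappa psi t -> coef_bd t p B ->
  exists C1, 0 < C1 /\ forall x1 y1 x2 y2, / 2 <= y1 -> Rabs (y1 - y2) <= y1 / 2 ->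
   Cmod (psi (x1, y1) - psi (x2, y2))%C <= C1 * ((Rabs (x1 - x2) + Rabs (y1 - y2)) / y1).
Proof.
  intros Hf Hc. pose proof (proj1 Hc) as HB. set (D := (p + 2)%nat). set (G := 6 * 4 ^ D * (2 * INR (fact (S D)))).
  assert (HG : 0 < G). { unfold G. generalize (INR_fact_lt_0 (S D)) (pow_lt 4 D ltac:(lra)). intros. repeat apply Rmult_lt_0_compat; lra. }
  exists (2 * (2 * B * G)). split; [nra|]. intros x1 y1 x2 y2 Hy1 Hy. set (r := (Rabs (x1 - x2) + Rabs (y1 - y2)) / y1).
  assert (Hr : 0 <= r).
  { unfold r. apply Rmult_le_pos; [generalize (Rabs_pos (x1 - x2)) (Rabs_pos (y1 - y2)); lra|pos]. }
  assert (Hy2 : y1 / 2 <= y2 <= 3 / 2 * y1) by (apply Rabs_le_between in Hy; lra).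
  set (E := fun y => sqrt y * (4 * B * INR (fact (p + 2)) / y ^ (p + 2))).
  (* The bound for the partial sums is uniform in T and the two truncation errors are O(1/T), so it
     passes to psi. *)
  apply Rle_of_forall_div with (K := E y1 + E y2). intros T HT.
  pose proof (psiT_tail kappa psi t p B x1 y1 T Hf Hc ltac:(lra) HT) as E1.
  pose proof (psiT_tail kappa psi t p B x2 y2 T Hf Hc ltac:(lra) HT) as E2. fold (E y1) in E1. fold (E y2) in E2.
  assert (E3 : Cmod (psiT kappa t T x1 y1 - psiT kappa t T x2 y2)%C <= 2 * (2 * B * G * r)).
  { unfold psiT. rewrite <- !csum_scal, <- csum_minus. apply csum_seq_bound.
   { pos. }
   intros n Hn. assert (Hn1 : 1 <= INR n) by (apply (le_INR 1); lia).
   assert (P : forall z s, Rabs s = 1 -> IZR z = s * INR n -> Cmod (t z) <= B * INR n ^ p ->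
    Cmod (RtoC (sqrt y1) * fourier_term kappa t x1 y1 z - RtoC (sqrt y2) * fourier_term kappa t x2 y2 z)%C
     <= B * G * r / INR n ^ 2).
   { intros z s Hs Hz Ht. unfold fourier_term.
    assert (A : Rabs (IZR z) = INR n) by (rewrite Hz, Rabs_mult, Hs, Rabs_pos_eq; lra). rewrite A, Hz.
    match goal with |- Cmod (?a * (?tz * ?k1 * ?e1) - ?b * (?tz * ?k2 * ?e2))%C <= _ =>
     replace (a * (tz * k1 * e1) - b * (tz * k2 * e2))%C with (tz * (a * (k1 * e1) - b * (k2 * e2)))%C by ring end.
    rewrite Cmod_mult. pose proof (Phi_diff kappa n D s x1 y1 x2 y2 Hn ltac:(unfold D; lia) Hs Hy1 Hy) as HPhi.
    fold G in HPhi. fold r in HPhi. eapply Rle_trans; [apply Rmult_le_compat; [pos|pos|exact Ht|exact HPhi]|].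
    right. unfold D. rewrite (pow_add (INR n)). assert (0 < INR n ^ p) by pos. field. lra. }
   destruct (proj2 Hc n Hn) as [C1 C2].
   pose proof (P (Z.of_nat n) 1 ltac:(apply Rabs_R1) ltac:(rewrite <- INR_IZR_INZ; ring) C1) as P1.
   pose proof (P (- Z.of_nat n)%Z (-1) ltac:(rewrite Rabs_left; lra) ltac:(rewrite opp_IZR, <- INR_IZR_INZ; ring) C2) as P2.
   replace (2 * B * G * r / INR n ^ 2) with (B * G * r / INR n ^ 2 + B * G * r / INR n ^ 2) by (field; lra).
   eapply Rle_trans; [|apply Rplus_le_compat; [exact P1|exact P2]].
   eapply Rle_trans; [|apply Cmod_triangle]. right; f_equal; ring. }
  replace (psi (x1, y1) - psi (x2, y2))%C with ((psi (x1, y1) - psiT kappa t T x1 y1) +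
   ((psiT kappa t T x1 y1 - psiT kappa t T x2 y2) + - (psi (x2, y2) - psiT kappa t T x2 y2)))%C by ring.
  via Cmod_triangle. eapply Rle_trans; [apply Rplus_le_compat_l, Cmod_triangle|]. rewrite Cmod_opp. unfold Rdiv in *. lra.
Qed.

(* What the estimates use of the form: boundedness, a Lipschitz bound in the hyperbolic metric and
  invariance, the latter written at the cusp H/K with lower row (K, -H). *)
Record tame_form (psi : C -> C) (C0 : R) : Prop := {
  tame_pos : 0 < C0;
  tame_bound : forall x y, 0 < y -> Cmod (psi (x, y)) <= C0;
  tame_lip : forall x1 y1 x2 y2, 0 < y1 -> 0 < y2 ->
   Cmod (psi (x1, y1) - psi (x2, y2))%C <= C0 * ((Rabs (x1 - x2) + Rabs (y1 - y2)) / y1);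
  tame_periodic : forall (m : Z) x y, 0 < y -> psi (x + IZR m, y) = psi (x, y);
  tame_cusp : forall (K H a b : Z) u y, (a * H + b * K = -1)%Z -> K <> 0%Z -> 0 < y ->
   psi (IZR H / IZR K + u, y) =
   psi (IZR a / IZR K - u / (IZR K ^ 2 * (u ^ 2 + y ^ 2)), y / (IZR K ^ 2 * (u ^ 2 + y ^ 2)))
}.

(** * Moebius transformations and reduction to the cusp *)

Definition moebius (a b c d : R) (z : C) : C :=
  ((RtoC a * z + RtoC b) / (RtoC c * z + RtoC d))%C.

Lemma moebius_den c d (z : C) : 0 < snd z -> (c <> 0 \/ d <> 0) ->
  0 < (c * fst z + d) ^ 2 + (c * snd z) ^ 2.
Proof.
  intros Hz H. destruct (Req_dec c 0) as [->|Hc].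
  - destruct H as [H|H]; [easy|]. replace ((0 * fst z + d) ^ 2 + (0 * snd z) ^ 2) with (Rsqr d) by (unfold Rsqr; ring).
   now apply Rlt_0_sqr.
  - assert (0 < (c * snd z) ^ 2).
   { replace ((c * snd z) ^ 2) with (Rsqr (c * snd z)) by (unfold Rsqr; ring). apply Rlt_0_sqr.
    apply Rmult_integral_contrapositive. lra. }
   generalize (pow2_ge_0 (c * fst z + d)); lra.
Qed.

Lemma moebius_im a b c d (z : C) : a * d - b * c = 1 -> 0 < snd z ->
  snd (moebius a b c d z) = snd z / ((c * fst z + d) ^ 2 + (c * snd z) ^ 2).
Proof.
  intros Hdet Hz. assert (Hcd : c <> 0 \/ d <> 0).
  { destruct (Req_dec c 0) as [->|]; [right; intros ->; lra|now left]. }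
  pose proof (moebius_den c d z Hz Hcd) as HD. destruct z as [x y]; simpl fst in *; simpl snd in *.
  transitivity ((a * d - b * c) * y / ((c * x + d) ^ 2 + (c * y) ^ 2)); [|now rewrite Hdet, Rmult_1_l].
  unfold moebius. simpl. field. simpl in HD. nra.
Qed.

Lemma Cmod_sqr_den c d (z : C) : Cmod (RtoC c * z + RtoC d)%C ^ 2 = (c * fst z + d) ^ 2 + (c * snd z) ^ 2.
Proof. rewrite Cmod2_alt. unfold Re, Im. simpl. ring. Qed.

(** Together with [moebius_im] this is the invariance of the hyperbolic distance. *)
Lemma moebius_diff a b c d (z1 z2 : C) : a * d - b * c = 1 -> 0 < snd z1 -> 0 < snd z2 ->
  Cmod (moebius a b c d z1 - moebius a b c d z2)%C *
  (Cmod (RtoC c * z1 + RtoC d)%C * Cmod (RtoC c * z2 + RtoC d)%C) = Cmod (z1 - z2)%C.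
Proof.
  intros Hdet H1 H2. assert (Hcd : c <> 0 \/ d <> 0).
  { destruct (Req_dec c 0) as [->|]; [right; intros ->; lra|now left]. }
  assert (N : forall z : C, 0 < snd z -> (RtoC c * z + RtoC d)%C <> RtoC 0).
  { intros z Hz E. pose proof (moebius_den c d z Hz Hcd) as HD. rewrite <- Cmod_sqr_den, E, Cmod_0 in HD. lra. }
  rewrite <- !Cmod_mult. f_equal. unfold moebius.
  replace (z1 - z2)%C with (RtoC (a * d - b * c) * (z1 - z2))%C by (rewrite Hdet; ring).
  rewrite RtoC_minus, !RtoC_mult. field. split; now apply N.
Qed.

Lemma Cmod_le_abs (z : C) : Cmod z <= Rabs (fst z) + Rabs (snd z).
Proof.
  replace z with (RtoC (fst z) + Ci * RtoC (snd z))%C at 1 by (destruct z; unfold Ci, RtoC, Cplus, Cmult; simpl; f_equal; ring).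
  via Cmod_triangle. rewrite Cmod_mult, Cmod_Ci, !Cmod_R. lra.
Qed.

Lemma abs_le_2Cmod (z : C) : Rabs (fst z) + Rabs (snd z) <= 2 * Cmod z.
Proof. generalize (re_le_Cmod z) (im_le_Cmod z). unfold Re. lra. Qed.

(** For y < 1/2, [dirichlet] with Q = y^(-1/2) makes both squares in the denominator at most y. *)
Lemma reduce_height (x y : R) : 0 < y -> exists a b c d : Z, (a * d - b * c = 1)%Z /\
  / 2 <= y / ((IZR c * x + IZR d) ^ 2 + (IZR c * y) ^ 2).
Proof.
  intros Hy. destruct (Rle_dec (/ 2) y) as [H|H].
  - exists 1%Z, 0%Z, 0%Z, 1%Z. split; [lia|]. replace (y / ((0 * x + 1) ^ 2 + (0 * y) ^ 2)) with y by field. exact H.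
  - pose proof (sqrt_lt_R0 y Hy) as Hs. pose proof (sqrt_sqrt y ltac:(lra)) as Hss. assert (Hs1 : sqrt y <= 1) by nra.
   destruct (dirichlet (/ sqrt y) x) as (h & k & a & b & Hk & HkR & Hab & Hd).
   { rewrite <- Rinv_1. apply Rinv_le_contravar; lra. }
   exists a, b, k, (- h)%Z. split; [lia|]. rewrite Rinv_inv in Hd. rewrite opp_IZR. apply IZR_le in Hk.
   assert (H1 : (IZR k * x + - IZR h) ^ 2 <= y).
   { apply Rabs_le_between in Hd. rewrite <- Hss. nra. }
   assert (H2 : (IZR k * y) ^ 2 <= y).
   { apply (Rmult_le_compat_r (sqrt y)) in HkR; [|lra]. rewrite Rinv_l in HkR by lra. assert (0 < IZR k * sqrt y) by pos.
    assert (G : forall l s z, s * s = z -> (l * z) ^ 2 = (l * s) ^ 2 * z) by (intros l s z <-; ring).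
    rewrite (G (IZR k) (sqrt y) y Hss). assert ((IZR k * sqrt y) ^ 2 <= 1) by nra. nra. }
   assert (H3 : 0 < (IZR k * x + - IZR h) ^ 2 + (IZR k * y) ^ 2).
   { assert (0 < (IZR k * y) ^ 2) by pos. generalize (pow2_ge_0 (IZR k * x + - IZR h)); lra. }
   apply Rmult_le_reg_r with ((IZR k * x + - IZR h) ^ 2 + (IZR k * y) ^ 2); [easy|].
   unfold Rdiv. rewrite (Rmult_assoc y), Rinv_l by lra. lra.
Qed.

(** Both bounds hold high in the half-plane by the Fourier expansion and are carried to every point
    by invariance. For the Lipschitz bound the two points are moved by the same matrix; if their
    distance is at least a quarter of the height y1, boundedness is already enough. *)
Lemma maass_form_tame kappa psi t p B : maass_cusp_form kappa psi -> fourier_expansion kappa psi t ->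
  coef_bd t p B -> exists C0, tame_form psi C0.
Proof.
  intros Hpsi Hf Hc. destruct (psi_bounded_cusp kappa psi t p B Hf Hc) as [C1 [HC1 Hb]].
  destruct (psi_lip_cusp kappa psi t p B Hf Hc) as [C2 [HC2 Hl]]. pose proof (mcf_invariant _ _ Hpsi) as Hinv.
  assert (Hinv' : forall a b c d z, (a * d - b * c = 1)%Z -> 0 < snd z ->
   psi (moebius (IZR a) (IZR b) (IZR c) (IZR d) z) = psi z) by pos.
  assert (Hbd : forall x y, 0 < y -> Cmod (psi (x, y)) <= C1).
  { intros x y Hy. destruct (reduce_height x y Hy) as (a & b & c & d & Hdet & Hh). rewrite <- (Hinv' a b c d (x, y) Hdet Hy).
   assert (Hdet' : IZR a * IZR d - IZR b * IZR c = 1) by (rewrite <- !mult_IZR, <- minus_IZR; now f_equal).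
   pose proof (moebius_im _ _ _ _ (x, y) Hdet' Hy) as Him. set (w := moebius (IZR a) (IZR b) (IZR c) (IZR d) (x, y)) in *.
   rewrite (surjective_pairing w). apply Hb. rewrite Him. cbn [fst snd]. lra. }
  exists (8 * C1 + 8 * C2). split; [lra| | | |].
  - intros; eapply Rle_trans; [now apply Hbd|lra].
  - intros x1 y1 x2 y2 Hy1 Hy2. set (D := Rabs (x1 - x2) + Rabs (y1 - y2)).
   assert (HD0 : 0 <= D) by (unfold D; generalize (Rabs_pos (x1 - x2)) (Rabs_pos (y1 - y2)); lra).
   assert (Hr : 0 <= D / y1) by pos. destruct (Rle_dec (/ 4) (D / y1)) as [Hbig|Hsmall].
   { apply Rle_trans with (2 * C1); [|nra]. unfold Cminus. via Cmod_triangle. rewrite Cmod_opp.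
    generalize (Hbd x1 y1 Hy1) (Hbd x2 y2 Hy2). lra. }
   assert (HDy : D <= y1 / 4).
   { apply Rnot_le_lt in Hsmall. apply (Rmult_lt_compat_r y1) in Hsmall; [|easy].
    unfold Rdiv in Hsmall. rewrite Rmult_assoc, Rinv_l in Hsmall by lra. lra. }
   destruct (reduce_height x1 y1 Hy1) as (a & b & c & d & Hdet & Hh).
   assert (Hdet' : IZR a * IZR d - IZR b * IZR c = 1) by (rewrite <- !mult_IZR, <- minus_IZR; now f_equal).
   rewrite <- (Hinv' a b c d (x1, y1) Hdet Hy1), <- (Hinv' a b c d (x2, y2) Hdet Hy2).
   pose proof (moebius_im _ _ _ _ (x1, y1) Hdet' Hy1) as Him.
   pose proof (moebius_diff _ _ _ _ (x1, y1) (x2, y2) Hdet' Hy1 Hy2) as Hdiff.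
   rewrite <- Cmod_sqr_den in Him. change (snd (x1, y1)) with y1 in Him.
   pose proof (Cmod_sqr_den (IZR c) (IZR d) (x1, y1)) as Hsq. cbn [fst snd] in Hsq. rewrite <- Hsq in Hh.
   set (j1 := Cmod (RtoC (IZR c) * (x1, y1) + RtoC (IZR d))%C) in *.
   set (j2 := Cmod (RtoC (IZR c) * (x2, y2) + RtoC (IZR d))%C) in *. assert (Hj1 : 0 < j1).
   { destruct (Req_dec j1 0) as [E|E]; [rewrite E in Hh; unfold Rdiv in Hh; simpl in Hh; rewrite !Rmult_0_l, Rinv_0 in Hh; lra|].
    assert (0 <= j1) by apply Cmod_ge_0. lra. }
   assert (Hdist : Cmod ((x1, y1) - (x2, y2))%C <= D) by (apply (Cmod_le_abs ((x1, y1) - (x2, y2))%C)).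
   assert (Hcy : Rabs (IZR c) * y1 <= j1).
   { replace (Rabs (IZR c) * y1) with (Rabs (snd (RtoC (IZR c) * (x1, y1) + RtoC (IZR d))%C)); [apply im_le_Cmod|].
    simpl. replace (IZR c * y1 + 0 * x1 + 0) with (IZR c * y1) by ring. rewrite Rabs_mult, (Rabs_pos_eq y1); lra. }
   (* The modulus of c z + d dominates its imaginary part |c| y1, so a displacement of z by at most
      y1/4 changes it by at most a quarter. *)
   assert (Hj2 : 3 / 4 * j1 <= j2).
   { assert (E : j1 <= j2 + Rabs (IZR c) * Cmod ((x1, y1) - (x2, y2))%C).
    { unfold j1, j2. rewrite <- (Cmod_R (IZR c)), <- Cmod_mult. eapply Rle_trans; [|apply Cmod_triangle].
     right; f_equal. ring. }
    assert (Rabs (IZR c) * Cmod ((x1, y1) - (x2, y2))%C <= Rabs (IZR c) * (y1 / 4)).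
    { mul_l; lra. }
    lra. }
   set (w1 := moebius (IZR a) (IZR b) (IZR c) (IZR d) (x1, y1)) in *.
   set (w2 := moebius (IZR a) (IZR b) (IZR c) (IZR d) (x2, y2)) in *.
   (* The hyperbolic scale survives the transport: relative to the height of the first image, the
      distance grows by at most 4/3, and the estimate near the cusp becomes applicable. *)
   assert (Hw : Cmod (w1 - w2)%C <= 4 / 3 * (D / y1) * snd w1).
   { rewrite Him. apply Rmult_le_reg_r with (j1 * j2); [pos|]. rewrite Hdiff.
    replace (4 / 3 * (D / y1) * (y1 / j1 ^ 2) * (j1 * j2)) with (D * (4 / 3 * j2 / j1)) by (field; lra).
    via Hdist. rewrite <- (Rmult_1_r D) at 1. mul_l.
    apply Rmult_le_reg_r with j1; [easy|]. replace (4 / 3 * j2 / j1 * j1) with (4 / 3 * j2) by (field; lra). lra. }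
   rewrite <- Him in Hh. clearbody w1 w2 j1 j2. clear Hdiff Hsq. destruct w1 as [u1 v1], w2 as [u2 v2].
   pose proof (im_le_Cmod ((u1, v1) - (u2, v2))%C) as Hi. change (Rabs (v1 - v2) <= Cmod ((u1, v1) - (u2, v2))%C) in Hi.
   pose proof (abs_le_2Cmod ((u1, v1) - (u2, v2))%C) as Hab.
   change (Rabs (u1 - u2) + Rabs (v1 - v2) <= 2 * Cmod ((u1, v1) - (u2, v2))%C) in Hab. cbn [snd] in *.
   eapply Rle_trans; [apply Hl; [lra|]|].
   { via Hi. via Hw. nra. }
   assert (E : (Rabs (u1 - u2) + Rabs (v1 - v2)) / v1 <= 8 / 3 * (D / y1)).
   { apply Rcomplements.Rle_div_l; [lra|]. lra. }
   apply (Rmult_le_compat_l C2) in E; [|lra]. nra.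
  - intros m x y Hy. rewrite <- (Hinv' 1%Z m 0%Z 1%Z (x, y) ltac:(lia) Hy). f_equal.
   unfold moebius. apply injective_projections; simpl; field.
  - intros K H a b u y Hab HK Hy. assert (HK' : IZR K <> 0) by now apply not_0_IZR.
   rewrite <- (Hinv' a b K (- H)%Z (IZR H / IZR K + u, y) ltac:(lia) Hy). f_equal.
   apply (f_equal IZR) in Hab. rewrite plus_IZR, !mult_IZR in Hab.
   assert (Eb : IZR b = (-1 - IZR a * IZR H) / IZR K) by (apply Rmult_eq_reg_r with (IZR K); [field_simplify; lra|easy]).
   assert (Hn : u ^ 2 + y ^ 2 <> 0) by nra.
   unfold moebius. rewrite opp_IZR, Eb. apply injective_projections; simpl; field; repeat split; try easy.
   all: try (simpl in Hn; intros E; apply Hn; nra).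
   all: intros E; assert (E' : IZR K ^ 2 * (u ^ 2 + y ^ 2) = 0) by (rewrite <- E; ring);
    apply Rmult_integral in E'; destruct E' as [E'|E']; [now apply (pow_nonzero (IZR K) 2)|easy].
Qed.

(** * Cauchy-Schwarz for sums of integrals over overlapping intervals *)

Definition ind (lo hi : R) (f : R -> C) (x : R) : C :=
  if Rle_dec lo x then if Rle_dec x hi then f x else RtoC 0 else RtoC 0.

Lemma is_CInt_zero f a b : a <= b -> (forall x, a < x < b -> f x = RtoC 0) -> is_CInt f a b (RtoC 0).
Proof.
  intros Hab H. apply is_CInt_ext with (fun _ => RtoC 0); [easy|intros; now rewrite H|].
  generalize (is_CInt_const (RtoC 0) a b). now rewrite Cmult_0_r.
Qed.

Lemma is_CInt_ind f a lo hi b v : a <= lo -> lo <= hi -> hi <= b ->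
  is_CInt f lo hi v -> is_CInt (ind lo hi f) a b v.
Proof.
  intros H1 H2 H3 H. replace v with (RtoC 0 + (v + RtoC 0))%C by ring.
  apply is_CInt_Chasles with lo; [|apply is_CInt_Chasles with hi].
  - apply is_CInt_zero; [easy|]. intros x Hx. unfold ind. destruct (Rle_dec lo x); [lra|easy].
  - apply is_CInt_ext with f; [easy| |easy]. intros x Hx. unfold ind.
   destruct (Rle_dec lo x); [|lra]. destruct (Rle_dec x hi); [easy|lra].
  - apply is_CInt_zero; [easy|]. intros x Hx. unfold ind. destruct (Rle_dec lo x); [|easy].
   destruct (Rle_dec x hi); [lra|easy].
Qed.

Lemma csum_conj {A} (f : A -> C) l : Cconj (csum f l) = csum (fun x => Cconj (f x)) l.
Proof.
  induction l as [|x l IH]; simpl.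
  - unfold Cconj, RtoC; simpl. now rewrite Ropp_0.
  - rewrite <- IH. unfold Cconj, Cplus; simpl. f_equal. ring.
Qed.

Lemma csum_mult {A} (f g : A -> C) l :
  (csum f l * csum g l)%C = csum (fun p => csum (fun q => f p * g q)%C l) l.
Proof.
  assert (H : forall m, (csum f m * csum g l)%C = csum (fun p => csum (fun q => f p * g q)%C l) m).
  { induction m as [|x m IH]; simpl; [ring|]. rewrite <- IH, csum_scal. ring. }
  apply H.
Qed.

(** Cauchy-Schwarz in the form 2 |Phi| <= t |Phi|^2 + 1/t, which avoids square roots of integrals
    and leaves t to be optimised later. The square of the sum [Phi] of cut-off functions expands
    into integrals over the pairwise overlaps. *)
Lemma cs_pieces {A} (l : list A) (lo hi : A -> R) (G : A -> R -> C) (g : R -> C) (bd : A -> A -> R) a b C0 t :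
  a <= b -> 0 <= C0 -> 0 < t ->
  (forall x, a <= x <= b -> Cmod (g x) <= C0 /\ ccont g x) ->
  (forall p, In p l -> a <= lo p /\ lo p <= hi p /\ hi p <= b /\ (forall x, lo p <= x <= hi p -> ccont (G p) x)) ->
  (forall p q, In p l -> In q l -> 0 <= bd p q /\
   (Rmax (lo p) (lo q) <= Rmin (hi p) (hi q) ->
    Cmod (CInt (fun x => G p x * Cconj (G q x))%C (Rmax (lo p) (lo q)) (Rmin (hi p) (hi q))) <= bd p q)) ->
  Cmod (csum (fun p => CInt (fun x => g x * G p x)%C (lo p) (hi p)) l) <=
   C0 * (t * rsum (fun p => rsum (bd p) l) l + (b - a) / t) / 2.
Proof.
  intros Hab HC0 Ht Hg Hp Hbd. set (f := fun p => ind (lo p) (hi p) (G p)). set (Phi := fun x => csum (fun p => f p x) l).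
  set (v := fun p q => if Rle_dec (Rmax (lo p) (lo q)) (Rmin (hi p) (hi q)) then
   CInt (fun x => G p x * Cconj (G q x))%C (Rmax (lo p) (lo q)) (Rmin (hi p) (hi q)) else RtoC 0).
  assert (H1 : forall p q, In p l -> In q l -> is_CInt (fun x => f p x * Cconj (f q x))%C a b (v p q)).
  { intros p q Hip Hiq. destruct (Hp p Hip) as (A1&A2&A3&A4). destruct (Hp q Hiq) as (B1&B2&B3&B4).
   assert (E0 : Cconj (RtoC 0) = RtoC 0) by (unfold Cconj, RtoC; simpl; now rewrite Ropp_0).
   unfold v. destruct (Rle_dec _ _) as [Hle|Hle].
   - apply is_CInt_ext with (ind (Rmax (lo p) (lo q)) (Rmin (hi p) (hi q)) (fun x => G p x * Cconj (G q x))%C); [easy| |].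
    + intros x Hx. unfold f, ind. destruct (Rle_dec (lo p) x), (Rle_dec (lo q) x), (Rle_dec x (hi p)), (Rle_dec x (hi q)),
      (Rle_dec (Rmax (lo p) (lo q)) x), (Rle_dec x (Rmin (hi p) (hi q))); rewrite ?E0; try ring; exfalso;
     repeat match goal with H : ~ Rmax _ _ <= _ |- _ => apply H; apply Rmax_lub; assumption
      | H : ~ _ <= Rmin _ _ |- _ => apply H; apply Rmin_glb; assumption end;
     match goal with H : ~ ?u <= ?v |- _ => apply H end;
     generalize (Rmax_l (lo p) (lo q)) (Rmax_r (lo p) (lo q)) (Rmin_l (hi p) (hi q)) (Rmin_r (hi p) (hi q)); lra.
    + apply is_CInt_ind; try easy.
     * eapply Rle_trans; [exact A1|apply Rmax_l].
     * eapply Rle_trans; [apply Rmin_l|exact A3].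
     * apply exC_cont; [easy|]. intros x Hx.
      generalize (Rmax_l (lo p) (lo q)) (Rmax_r (lo p) (lo q)) (Rmin_l (hi p) (hi q)) (Rmin_r (hi p) (hi q)). intros.
      apply ccont_mult; [apply A4; lra|apply ccont_conj, B4; lra].
   - apply is_CInt_zero; [easy|]. intros x Hx. unfold f, ind.
    destruct (Rle_dec (lo p) x), (Rle_dec (lo q) x), (Rle_dec x (hi p)), (Rle_dec x (hi q)); rewrite ?E0; try ring.
    exfalso. apply Hle. apply Rle_trans with x; [now apply Rmax_lub|now apply Rmin_glb]. }
  assert (H2 : is_CInt (fun x => Phi x * Cconj (Phi x))%C a b (csum (fun p => csum (v p) l) l)).
  { apply is_CInt_ext with (fun x => csum (fun p => csum (fun q => f p x * Cconj (f q x))%C l) l); [easy| |].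
   - intros x _. unfold Phi. now rewrite csum_conj, csum_mult.
   - apply (is_CInt_csum (fun p x => csum (fun q => f p x * Cconj (f q x))%C l) (fun p => csum (v p) l)).
    intros p Hip. apply (is_CInt_csum (fun q x => f p x * Cconj (f q x))%C (v p)). intros q Hiq. now apply H1. }
  set (X := rsum (fun p => rsum (bd p) l) l). assert (H3 : Cmod (csum (fun p => csum (v p) l) l) <= X).
  { apply csum_norm. intros p Hip. apply csum_norm. intros q Hiq. destruct (Hbd p q Hip Hiq) as [D1 D2].
   unfold v. destruct (Rle_dec _ _) as [Hle|Hle]; [now apply D2|rewrite Cmod_0; easy]. }
  assert (H4 : is_CInt (fun x => g x * Phi x)%C a b (csum (fun p => CInt (fun x => g x * G p x)%C (lo p) (hi p)) l)).
  { apply is_CInt_ext with (fun x => csum (fun p => g x * f p x)%C l); [easy| |].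
   - intros x _. unfold Phi. now rewrite csum_scal.
   - apply (is_CInt_csum (fun p x => g x * f p x)%C (fun p => CInt (fun x => g x * G p x)%C (lo p) (hi p))).
    intros p Hip. destruct (Hp p Hip) as (A1&A2&A3&A4).
    apply is_CInt_ext with (ind (lo p) (hi p) (fun x => g x * G p x)%C); [easy| |].
    + intros x _. unfold f, ind. destruct (Rle_dec (lo p) x), (Rle_dec x (hi p)); ring.
    + apply is_CInt_ind; try easy. apply exC_cont; [easy|]. intros x Hx. apply ccont_mult; [apply Hg; lra|now apply A4]. }
  destruct H2 as [H2 _]. pose proof (is_RInt_const (V:=R_NormedModule) a b (1 : R)) as H5.
  pose proof (is_RInt_lin _ _ _ _ _ _ (C0 * t / 2) (C0 / t / 2) H2 H5) as H6.
  eapply Rle_trans; [apply (is_CInt_norm _ _ _ _ _ _ Hab) with (2 := H4) (3 := H6)|].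
  - intros x Hx. rewrite Cmod_mult.
   replace (fst (Phi x * Cconj (Phi x))%C) with (Cmod (Phi x) ^ 2) by (rewrite Cmod2_alt; unfold Re, Im; simpl; ring).
   set (r := Cmod (Phi x)). apply Rle_trans with (C0 * r).
   { apply Rmult_le_compat_r; [apply Cmod_ge_0|now apply Hg]. }
   replace (C0 * t / 2 * r ^ 2 + C0 / t / 2 * 1) with (C0 * (r + (t * r - 1) ^ 2 / (2 * t))) by (field; lra). mul_l.
   assert (0 <= (t * r - 1) ^ 2 / (2 * t)); [|lra]. apply Rmult_le_pos; [pos|pos].
  - unfold scal; simpl; unfold mult; simpl. pose proof (re_le_Cmod (csum (fun p => csum (v p) l) l)) as H7. unfold Re in H7.
   pose proof (Rle_abs (fst (csum (fun p => csum (v p) l) l))) as H8. set (Y := fst (csum (fun p => csum (v p) l) l)) in *.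
   replace (C0 * t / 2 * Y + C0 / t / 2 * ((b - a) * 1)) with (C0 * (t * Y + (b - a) / t) / 2) by (field; lra).
   unfold Rdiv at 1 3. mul_r. mul_l. apply Rplus_le_compat_r. mul_l. fold X. lra.
Qed.

(** * Oscillatory integrals with the difference of two phases *)

Lemma continuous_lin p k x : continuous (fun x : R => p + k * x) x.
Proof. apply continuous_Rplus; [apply continuous_const|cont]. Qed.

Lemma continuous_inv (f : R -> R) x : continuous f x -> f x <> 0 -> continuous (fun x => / f x) x.
Proof.
  intros Hf H. apply (continuous_comp f Rinv); [easy|]. apply (ex_derive_continuous Rinv). auto_derive; easy.
Qed.

(* The derivative of a difference of two phases -M/w is M (w - w')(w + w')/(w w')^2. *)
Lemma osc_separated (p k p' k' M W mu s : R) (A f : R -> R) a b : a <= b -> 0 < W -> 0 < M -> 0 < mu ->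
  (forall x, a <= x <= b -> W <= p + k * x /\ 0 < p' + k' * x) ->
  ((forall x, a <= x <= b -> mu <= (p - p') + (k - k') * x) \/
  (forall x, a <= x <= b -> mu <= (p' - p) + (k' - k) * x)) ->
  (forall x, a <= x <= b -> is_derive f x (M * (/ (p' + k' * x) ^ 2 - / (p + k * x) ^ 2))) ->
  bv A a b s -> (forall x, a <= x <= b -> continuous A x) ->
  Cmod (CInt (fun x => RtoC (A x * / ((p + k * x) ^ 2 * (p' + k' * x) ^ 2)) * e (f x))%C a b) <= 8 * s / (M * W * mu).
Proof.
  intros Hab HW HM Hmu Hw Hsep Hf HA HAc. set (V := fun x => / ((p - p') + (k - k') * x)). assert (HV : bv V a b (/ mu)).
  { destruct Hsep as [H|H].
   - now apply bv_inv_linear.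
   - apply (bv_ext (fun x => - / ((p' - p) + (k' - k) * x))).
    + intros x Hx. unfold V. rewrite <- Rinv_opp. f_equal. ring.
    + apply bv_opp, bv_inv_linear; easy. }
  assert (Hne : forall x, a <= x <= b -> p - p' + (k - k') * x <> 0).
  { intros x Hx. destruct Hsep as [H|H]; specialize (H x Hx); lra. }
  assert (HS : bv (fun x => / ((p + p') + (k + k') * x)) a b (/ W)).
  { apply bv_inv_linear; [easy|easy|]. intros x Hx. specialize (Hw x Hx). lra. }
  (* Dividing the amplitude by the derivative of the phase cancels the squares and leaves A/(M (w +
     w')(w - w')), a product of three functions of bounded variation. *)
  set (B := fun x => / M * (A x * / ((p + p') + (k + k') * x) * V x)). assert (HB : bv B a b (4 * s / (M * W * mu))).
  { replace (4 * s / (M * W * mu)) with (Rabs (/ M) * (2 * (2 * s * / W) * / mu)).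
   - apply bv_scal. apply (bv_mult (fun x => A x * / ((p + p') + (k + k') * x)) V); [easy| |easy]. now apply bv_mult.
   - rewrite Rabs_pos_eq by pos. field. lra. }
  set (f1 := fun x => M * (/ (p' + k' * x) ^ 2 - / (p + k * x) ^ 2)).
  assert (E : CInt (fun x => RtoC (A x * / ((p + k * x) ^ 2 * (p' + k' * x) ^ 2)) * e (f x))%C a b =
   CInt (fun x => RtoC (B x) * (RtoC (f1 x) * e (f x)))%C a b).
  { apply CInt_ext; [easy|]. intros x Hx. rewrite Cmult_assoc, <- RtoC_mult. f_equal. f_equal.
   specialize (Hw x ltac:(lra)). specialize (Hne x ltac:(lra)). unfold B, f1, V. field. repeat split; lra. }
  rewrite E. replace (8 * s / (M * W * mu)) with (2 * (4 * s / (M * W * mu))) by (field; lra).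
  apply (vdc f f1 B a b); try easy.
  - intros x Hx. specialize (Hw x Hx). unfold f1. apply continuous_Rmult; [apply continuous_const|].
   apply continuous_Rminus; apply continuous_inv.
   + apply (continuous_comp (fun x => p' + k' * x) (fun y => y ^ 2)); [apply continuous_lin|].
    apply (ex_derive_continuous (fun y => y ^ 2)). auto_derive; easy.
   + apply pow_nonzero; lra.
   + apply (continuous_comp (fun x => p + k * x) (fun y => y ^ 2)); [apply continuous_lin|].
    apply (ex_derive_continuous (fun y => y ^ 2)). auto_derive; easy.
   + apply pow_nonzero; lra.
  - intros x Hx. specialize (Hw x Hx). unfold B, V. apply continuous_Rmult; [apply continuous_const|].
   apply continuous_Rmult; [apply continuous_Rmult; [now apply HAc|]|].
   + apply continuous_inv; [apply continuous_lin|lra].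
   + apply continuous_inv; [apply continuous_lin|now apply Hne].
Qed.

Definition clamp (a b x : R) : R := Rmax a (Rmin b x).

Lemma clamp_spec a b x : a <= b -> a <= clamp a b x <= b /\
  (clamp a b x = x \/ (x < a /\ clamp a b x = a) \/ (b < x /\ clamp a b x = b)).
Proof.
  intros H. unfold clamp, Rmax, Rmin. destruct (Rle_dec b x); destruct (Rle_dec _ _); lra.
Qed.

(** The phase is stationary where the two linear functions w and w' meet. A neighbourhood of radius
    [rho] of that point is estimated trivially; outside it w and w' differ by at least |k - k'| rho.
    The point may lie outside [a, b], hence the clamping. *)
Lemma osc_saddle (p k p' k' M W s D0 rho : R) (A f : R -> R) a b :
  a <= b -> 0 < W -> 0 < M -> 0 < rho -> k <> k' ->
  (forall x, a <= x <= b -> W <= p + k * x /\ 0 < p' + k' * x) ->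
  (forall x, a <= x <= b -> is_derive f x (M * (/ (p' + k' * x) ^ 2 - / (p + k * x) ^ 2))) ->
  bv A a b s -> (forall x, a <= x <= b -> continuous A x) ->
  (forall x, a <= x <= b -> Rabs (A x * / ((p + k * x) ^ 2 * (p' + k' * x) ^ 2)) <= D0) ->
  Cmod (CInt (fun x => RtoC (A x * / ((p + k * x) ^ 2 * (p' + k' * x) ^ 2)) * e (f x))%C a b) <=
   16 * s / (M * W * (Rabs (k - k') * rho)) + 2 * rho * D0.
Proof.
  intros Hab HW HM Hrho Hk Hw Hf HA HAc HD. set (x0 := (p' - p) / (k - k')). assert (Hkk : k - k' <> 0) by lra.
  assert (Hlin : forall x, p - p' + (k - k') * x = (k - k') * (x - x0)) by (intros; unfold x0; field; lra).
  assert (Hka : 0 < Rabs (k - k')) by now apply Rabs_pos_lt.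
  set (F := fun x => (RtoC (A x * / ((p + k * x) ^ 2 * (p' + k' * x) ^ 2)) * e (f x))%C).
  set (c1 := clamp a b (x0 - rho)). set (c2 := clamp a b (x0 + rho)).
  destruct (clamp_spec a b (x0 - rho) Hab) as [R1 S1]. destruct (clamp_spec a b (x0 + rho) Hab) as [R2 S2].
  fold c1 in R1, S1. fold c2 in R2, S2. assert (H12 : c1 <= c2) by lra. assert (Fc : forall x, a <= x <= b -> ccont F x).
  { intros x Hx. specialize (Hw x Hx). apply ccont_amp.
   - apply continuous_Rmult; [now apply HAc|]. apply continuous_inv.
    + apply continuous_Rmult.
     * apply (continuous_comp (fun x => p + k * x) (fun y => y ^ 2)); [apply continuous_lin|].
      apply (ex_derive_continuous (fun y => y ^ 2)). auto_derive; easy.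
     * apply (continuous_comp (fun x => p' + k' * x) (fun y => y ^ 2)); [apply continuous_lin|].
      apply (ex_derive_continuous (fun y => y ^ 2)). auto_derive; easy.
    + apply Rmult_integral_contrapositive. split; apply pow_nonzero; lra.
   - apply ccont_e. apply (ex_derive_continuous f). eexists; now apply Hf. }
  assert (Fex : forall u v, a <= u -> u <= v -> v <= b -> exC F u v).
  { intros u v H1 H2 H3. apply exC_cont; [easy|]. intros; apply Fc; lra. }
  assert (Hside : forall u v, a <= u -> u <= v -> v <= b -> (u = v \/
    (forall x, u <= x <= v -> rho <= x - x0) \/ (forall x, u <= x <= v -> rho <= x0 - x)) ->
    Cmod (CInt F u v) <= 8 * s / (M * W * (Rabs (k - k') * rho))).
  { intros u v H1 H2 H3 H4. pose proof (bv_nonneg _ _ _ _ Hab HA) as Hs. destruct H4 as [->|H4].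
   - rewrite CInt_point, Cmod_0. apply Rmult_le_pos; [lra|]. left. apply Rinv_0_lt_compat.
    repeat apply Rmult_lt_0_compat; easy.
   - apply osc_separated; try easy.
    + pos.
    + intros; apply Hw; lra.
    + assert (Hlin' : forall x, p' - p + (k' - k) * x = (k - k') * (x0 - x)) by (intros; unfold x0; field; lra).
     destruct (Rle_dec 0 (k - k')) as [Hpos|Hneg].
     * rewrite (Rabs_pos_eq (k - k')) by easy. destruct H4 as [H4|H4]; [left|right]; intros x Hx;
      rewrite ?Hlin, ?Hlin'; apply Rmult_le_compat_l; auto.
     * rewrite (Rabs_left (k - k')) by lra. destruct H4 as [H4|H4]; [right|left]; intros x Hx;
      rewrite ?Hlin, ?Hlin'; specialize (H4 x Hx); nra.
    + intros; apply Hf; lra.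
    + now apply (bv_sub A a b).
    + intros; apply HAc; lra. }
  fold F. rewrite (CInt_Chasles F a c1 b) by (try easy; apply Fex; lra).
  rewrite (CInt_Chasles F c1 c2 b) by (try easy; apply Fex; lra).
  assert (I1 : Cmod (CInt F a c1) <= 8 * s / (M * W * (Rabs (k - k') * rho))).
  { apply Hside; try lra. destruct S1 as [S1|[S1|S1]].
   - right; right. intros; lra.
   - left; lra.
   - right; right. intros; lra. }
  assert (I3 : Cmod (CInt F c2 b) <= 8 * s / (M * W * (Rabs (k - k') * rho))).
  { apply Hside; try lra. destruct S2 as [S2|[S2|S2]].
   - right; left. intros; lra.
   - right; left. intros; lra.
   - left; lra. }
  assert (HD0 : 0 <= D0) by (eapply Rle_trans; [apply Rabs_pos|apply (HD a); lra]).
  assert (I2 : Cmod (CInt F c1 c2) <= D0 * (c2 - c1)).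
  { apply CInt_norm_const; [easy| |apply Fex; lra]. intros x Hx. unfold F.
   rewrite Cmod_mult, Cmod_R, Cmod_e, Rmult_1_r. apply HD; lra. }
  assert (D0 * (c2 - c1) <= D0 * (2 * rho)) by nra.
  via Cmod_triangle. eapply Rle_trans; [apply Rplus_le_compat_l, Cmod_triangle|].
  replace (16 * s / (M * W * (Rabs (k - k') * rho))) with
   (8 * s / (M * W * (Rabs (k - k') * rho)) + 8 * s / (M * W * (Rabs (k - k') * rho))) by (field; lra).
  lra.
Qed.

(** * Lattice points in boxes *)

Definition in_box (alpha E D : R) (v : Z * Z) : Prop :=
  (1 <= snd v)%Z /\ IZR (snd v) <= D /\ Rabs (IZR (fst v) - IZR (snd v) * alpha) <= E.

(** The product is k^2 max(|h/k - alpha|, 1/Delta). Fractions within 1/Delta of alpha are thus only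
    required to have a large denominator, the others to be far from alpha in terms of their
    denominator. *)
Definition badly_approx (alpha Delta tau E Q : R) : Prop :=
  forall v, in_box alpha E Q v ->
   tau <= IZR (snd v) * Rmax (Rabs (IZR (fst v) - IZR (snd v) * alpha)) (IZR (snd v) / Delta).

Lemma primitive_part (v : Z * Z) : (1 <= snd v)%Z -> exists h0 k0 g : Z,
  (1 <= g)%Z /\ (1 <= k0)%Z /\ fst v = (g * h0)%Z /\ snd v = (g * k0)%Z /\ rel_prime k0 h0.
Proof.
  intros Hk. destruct v as [h k]; simpl in *. assert (Hg : (0 < Z.gcd h k)%Z).
  { assert (Z.gcd h k <> 0)%Z by (intros E; apply Z.gcd_eq_0_r in E; lia). generalize (Z.gcd_nonneg h k); lia. }
  destruct (Z.gcd_divide_l h k) as [h0 Hh0]. destruct (Z.gcd_divide_r h k) as [k0 Hk0].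
  exists h0, k0, (Z.gcd h k). split; [lia|]. split; [nia|]. split; [nia|]. split; [nia|].
  apply rel_prime_sym. apply (proj1 (Zgcd_1_rel_prime h0 k0)). assert (E : (Z.gcd h k = Z.gcd h k * Z.gcd h0 k0)%Z).
  { rewrite <- (Z.abs_eq (Z.gcd h k)) at 2 by lia. rewrite <- Z.gcd_mul_mono_l.
   rewrite (Z.mul_comm _ h0), (Z.mul_comm _ k0), <- Hh0, <- Hk0. reflexivity. }
  nia.
Qed.

(** The determinant with a primitive vector (h0, k0) distributes the points over parallel lines, and
    two points of one line differ by a multiple of that vector. A point is coded by its line and by
    its position along it modulo an integer exceeding B0, which is injective because no multiple
    beyond B0 joins two points of the box. *)
Lemma box_count_aux alpha E D (L : list (Z * Z)) (h0 k0 : Z) B0 :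
  0 <= E -> 0 <= D -> NoDup L -> (forall v, In v L -> in_box alpha E D v) ->
  (1 <= k0)%Z -> rel_prime k0 h0 -> 0 <= B0 ->
  (forall t : Z, Rabs (IZR t) * IZR k0 <= D -> Rabs (IZR t) * Rabs (IZR h0 - IZR k0 * alpha) <= 2 * E ->
    Rabs (IZR t) <= B0) ->
  INR (length L) <= (2 * (IZR k0 * E + D * Rabs (IZR h0 - IZR k0 * alpha)) + 1) * (B0 + 1).
Proof.
  intros HE HD HL Hbox Hk0 Hprime HB0 HB. set (eps0 := IZR h0 - IZR k0 * alpha) in *.
  assert (Hk0R : 1 <= IZR k0) by now apply IZR_le. set (Mx := IZR k0 * E + D * Rabs eps0).
  assert (HMx : 0 <= Mx) by (unfold Mx; generalize (Rabs_pos eps0); nra).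
  set (a := up Mx). destruct (archimed Mx) as [Ha1 Ha2]. fold a in Ha1, Ha2.
  set (b := up B0). destruct (archimed B0) as [Hb1 Hb2]. fold b in Hb1, Hb2.
  assert (Ha : (1 <= a)%Z) by (assert (0 < a)%Z by (apply lt_IZR; lra); lia).
  assert (Hb : (1 <= b)%Z) by (assert (0 < b)%Z by (apply lt_IZR; lra); lia).
  set (mm := fun v : Z * Z => (k0 * fst v - snd v * h0)%Z). assert (Hm : forall v, In v L -> (- a < mm v < a)%Z).
  { intros v Hv. destruct (Hbox v Hv) as (V1 & V2 & V3). apply IZR_le in V1. assert (Habs : Rabs (IZR (mm v)) <= Mx).
   { unfold mm. rewrite minus_IZR, !mult_IZR. replace (IZR k0 * IZR (fst v) - IZR (snd v) * IZR h0) with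
     (IZR k0 * (IZR (fst v) - IZR (snd v) * alpha) + - (IZR (snd v) * eps0)) by (unfold eps0; ring).
    via Rabs_triang. rewrite Rabs_Ropp, !Rabs_mult. rewrite (Rabs_pos_eq (IZR k0)), (Rabs_pos_eq (IZR (snd v))) by lra.
    unfold Mx. apply Rplus_le_compat.
    - apply Rmult_le_compat_l; lra.
    - mul_r; lra. }
   apply Rabs_le_between in Habs. split; apply lt_IZR; rewrite ?opp_IZR; lra. }
  (* The determinant lies strictly between -a and a, so the shift by a - 1 maps it onto the 2 a - 1
     naturals from 0 on. *)
  set (f := fun v : Z * Z => (Z.to_nat (mm v + a - 1), Z.to_nat ((snd v / k0) mod b))).
  assert (Hinj : forall v w, In v L -> In w L -> f v = f w -> v = w).
  { intros v w Hv Hw Hf. pose proof (Hm v Hv). pose proof (Hm w Hw).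
   destruct (Hbox v Hv) as (V1 & V2 & V3). destruct (Hbox w Hw) as (W1 & W2 & W3). injection Hf as Hf1 Hf2.
   assert (Em : mm v = mm w) by lia.
   pose proof (Z.mod_pos_bound (snd v / k0) b ltac:(lia)). pose proof (Z.mod_pos_bound (snd w / k0) b ltac:(lia)).

   assert (Hdiv : (k0 | snd v - snd w)%Z).
   { apply Gauss with h0; [|easy]. exists (fst v - fst w)%Z. unfold mm in Em. nia. }
   destruct Hdiv as [t Ht]. assert (Eh : (fst v - fst w = t * h0)%Z) by (unfold mm in Em; nia).
   assert (Eq : (snd v / k0 = snd w / k0 + t)%Z).
   { replace (snd v) with (snd w + t * k0)%Z by lia. apply Z.div_add; lia. }
   assert (Hbt : (b | t)%Z).
   { exists (snd v / k0 / b - snd w / k0 / b)%Z.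
    pose proof (Z.div_mod (snd v / k0) b ltac:(lia)). pose proof (Z.div_mod (snd w / k0) b ltac:(lia)). nia. }
   assert (Ht0 : Rabs (IZR t) <= B0).
   { apply HB.
    - apply IZR_le in V1, W1. rewrite <- (Rabs_pos_eq (IZR k0)) by lra. rewrite <- Rabs_mult, <- mult_IZR, <- Ht, minus_IZR.
     apply Rabs_le. lra.
    - rewrite <- Rabs_mult.
     replace (IZR t * eps0) with ((IZR (fst v) - IZR (snd v) * alpha) - (IZR (fst w) - IZR (snd w) * alpha)).
     + apply Rabs_le_between in V3, W3. apply Rabs_le. lra.
     + assert (E1 := f_equal IZR Eh). assert (E2 := f_equal IZR Ht). rewrite minus_IZR, mult_IZR in E1, E2.
      unfold eps0. replace (IZR t * (IZR h0 - IZR k0 * alpha)) with (IZR t * IZR h0 - (IZR t * IZR k0) * alpha) by ring.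
      rewrite <- E1, <- E2. ring. }
   assert (t = 0)%Z.
   { destruct Hbt as [c Hc]. destruct (Z.eq_dec c 0) as [->|Hc0]; [lia|exfalso].
    rewrite Hc, mult_IZR, Rabs_mult, (Rabs_pos_eq (IZR b)) in Ht0 by lra. assert (1 <= Rabs (IZR c)).
    { rewrite <- abs_IZR. apply IZR_le. lia. }
    nra. }
   subst t. destruct v, w; simpl in *; f_equal; lia. }
  set (P := list_prod (seq 0 (Z.to_nat (2 * a - 1))) (seq 0 (Z.to_nat b))). assert (HND : NoDup (map f L)).
  { clear - HL Hinj. induction HL as [|v L Hv HL IH]; simpl; constructor.
   - rewrite in_map_iff. intros [w [Ew Hw]]. apply Hv. rewrite (Hinj v w); simpl; auto.
   - apply IH. intros; apply Hinj; simpl; auto. }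
  assert (Hincl : incl (map f L) P).
  { intros z Hz. apply in_map_iff in Hz. destruct Hz as [v [<- Hv]]. pose proof (Hm v Hv).
   pose proof (Z.mod_pos_bound (snd v / k0) b ltac:(lia)). unfold P, f. apply in_prod; apply in_seq; lia. }
  pose proof (NoDup_incl_length HND Hincl) as Hlen.
  rewrite length_map in Hlen. unfold P in Hlen. rewrite length_prod, !length_seq in Hlen.
  apply le_INR in Hlen. rewrite mult_INR in Hlen.
  rewrite !INR_IZR_INZ, !Z2Nat.id in Hlen by lia. rewrite minus_IZR, mult_IZR in Hlen. rewrite INR_IZR_INZ. via Hlen.
  apply IZR_le in Ha, Hb. fold Mx. apply Rmult_le_compat; lra.
Qed.

Lemma sqrt_ge_self_div D Q : 0 <= D -> D <= Q -> D <= sqrt D * sqrt Q.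
Proof.
  intros H1 H2. rewrite <- (sqrt_sqrt D) at 1 by easy. mul_l. now apply sqrt_le_1_alt.
Qed.

(* Either the points of the box span the plane, and there are about as many as the area, or they lie
  on few lines parallel to a short vector, whose length [badly_approx] bounds from below. *)
Lemma box_count alpha Delta tau E Q D (L : list (Z * Z)) :
  0 < Delta -> 0 < tau -> 0 < E -> 0 <= D -> D <= Q -> badly_approx alpha Delta tau E Q ->
  NoDup L -> (forall v, In v L -> in_box alpha E D v) ->
  INR (length L) <= sqrt D * (10 * E * sqrt Q + 4 * sqrt (E / tau) + 2 * (sqrt Q / sqrt (tau * Delta))).
Proof.
  intros HDe Htau HE HD HDQ Hbad HL Hbox.
  assert (HX : 0 <= sqrt D * (10 * E * sqrt Q + 4 * sqrt (E / tau) + 2 * (sqrt Q / sqrt (tau * Delta)))).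
  { assert (0 < sqrt (tau * Delta)) by pos. assert (0 <= sqrt Q / sqrt (tau * Delta)) by pos.
   generalize (sqrt_pos D) (sqrt_pos Q) (sqrt_pos (E / tau)). intros.
   apply Rmult_le_pos; [easy|]. assert (0 <= E * sqrt Q) by pos. lra. }
  destruct L as [|v0 L0]; [exact HX|]. set (L := v0 :: L0) in *. destruct (Hbox v0 (or_introl eq_refl)) as (V1 & V2 & V3).
  destruct (primitive_part v0 V1) as (h0 & k0 & g & Hg & Hk0 & Eh & Ek & Hp).
  assert (Hg' : 1 <= IZR g) by now apply IZR_le. assert (Hk0' : 1 <= IZR k0) by now apply IZR_le.
  rewrite Ek, mult_IZR in V2. rewrite Eh, Ek, !mult_IZR in V3. set (eps0 := IZR h0 - IZR k0 * alpha).
  replace (IZR g * IZR h0 - IZR g * IZR k0 * alpha) with (IZR g * eps0) in V3 by (unfold eps0; ring).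
  rewrite Rabs_mult, (Rabs_pos_eq (IZR g)) in V3 by lra.

  assert (HkD : IZR k0 <= D) by nra. assert (HeE : Rabs eps0 <= E) by nra.
  assert (Hb0 : in_box alpha E Q (h0, k0)) by (repeat split; simpl; [easy|lra|exact HeE]).
  apply Hbad in Hb0. simpl in Hb0. fold eps0 in Hb0.
  (* The largest multiple of (h0, k0) joining two points of the box: the condition on denominators
     allows D/k0, the other one 2 E/|eps0|, which is no restriction if eps0 = 0. *)
  set (B0 := if Req_dec_T eps0 0 then D / IZR k0 else Rmin (D / IZR k0) (2 * E / Rabs eps0)). assert (HDk : 1 <= D / IZR k0).
  { apply Rmult_le_reg_r with (IZR k0); [lra|]. unfold Rdiv. rewrite Rmult_assoc, Rinv_l by lra. lra. }
  assert (HB0 : 1 <= B0 /\ B0 <= D / IZR k0 /\ B0 * Rabs eps0 <= 2 * E).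
  { unfold B0. destruct (Req_dec_T eps0 0) as [E0|E0].
   - rewrite E0, Rabs_R0. lra.
   - assert (0 < Rabs eps0) by now apply Rabs_pos_lt. repeat split.
    + apply Rmin_glb; [easy|]. apply Rmult_le_reg_r with (Rabs eps0); [easy|].
     unfold Rdiv. rewrite Rmult_assoc, Rinv_l by lra. lra.
    + apply Rmin_l.
    + apply Rle_trans with (2 * E / Rabs eps0 * Rabs eps0).
     * mul_r; apply Rmin_r.
     * unfold Rdiv. rewrite Rmult_assoc, Rinv_l by lra. lra. }
  destruct HB0 as (HB1 & HB2 & HB3).
  assert (Hcount := box_count_aux alpha E D L h0 k0 B0 ltac:(lra) HD HL Hbox Hk0 Hp ltac:(lra)).
  fold eps0 in Hcount. lapply Hcount; clear Hcount.
  2:{ intros t T1 T2. unfold B0. destruct (Req_dec_T eps0 0) as [E0|E0].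
    - apply Rmult_le_reg_r with (IZR k0); [lra|]. unfold Rdiv. rewrite Rmult_assoc, Rinv_l by lra. lra.
    - assert (0 < Rabs eps0) by now apply Rabs_pos_lt. apply Rmin_glb.
     + apply Rmult_le_reg_r with (IZR k0); [lra|]. unfold Rdiv. rewrite Rmult_assoc, Rinv_l by lra. lra.
     + apply Rmult_le_reg_r with (Rabs eps0); [easy|]. unfold Rdiv. rewrite Rmult_assoc, Rinv_l by lra. lra. }
  intros Hcount. assert (HB2' : B0 * IZR k0 <= D).
  { apply (Rmult_le_compat_r (IZR k0)) in HB2; [|lra]. unfold Rdiv in HB2. rewrite Rmult_assoc, Rinv_l in HB2 by lra. lra. }
  (* By k0 <= D, B0 k0 <= D, |eps0| <= E and B0 |eps0| <= 2 E the area terms give 2 (1 + 1 + 1 + 2)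
     D E, and B0 + 1 <= 2 B0. *)
  assert (Hlen : INR (length L) <= 10 * D * E + 2 * B0).
  { nra. }
  via Hlen. assert (HDQ' := sqrt_ge_self_div D Q HD HDQ).
  pose proof (sqrt_pos D) as SD. pose proof (sqrt_pos Q) as SQ. pose proof (sqrt_pos (E / tau)) as SE.
  assert (STD : 0 < sqrt (tau * Delta)) by pos. assert (ST : 0 <= sqrt Q / sqrt (tau * Delta)) by pos.
  assert (T1 : 10 * D * E <= sqrt D * (10 * E * sqrt Q)).
  { nra. }
  (* According to which term of the maximum dominates, tau is a lower bound for k0 |eps0|, and B0^2
     is at most the product of its two bounds, or tau Delta is a lower bound's worth of k0^2, and B0
     <= D/k0. *)
  assert (T2 : B0 <= sqrt D * (2 * sqrt (E / tau)) \/ B0 <= sqrt D * (sqrt Q / sqrt (tau * Delta))).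
  { destruct (Rle_dec (IZR k0 / Delta) (Rabs eps0)) as [Hc|Hc].
   - left. rewrite Rmax_left in Hb0 by easy. assert (Hsq : B0 * B0 <= 4 * (D * (E / tau))).
    { apply Rmult_le_reg_r with tau; [easy|]. replace (4 * (D * (E / tau)) * tau) with (4 * D * E) by (field; lra).
     apply Rle_trans with (B0 * B0 * (IZR k0 * Rabs eps0)); [apply Rmult_le_compat_l; nra|].
     replace (B0 * B0 * (IZR k0 * Rabs eps0)) with ((B0 * IZR k0) * (B0 * Rabs eps0)) by ring.
     apply Rle_trans with (D * (2 * E)); [|nra]. apply Rmult_le_compat; nra. }
    apply Rsqr_incr_0_var; [|pos]. unfold Rsqr. via Hsq. right.
    rewrite <- (sqrt_sqrt D) at 1 by easy. rewrite <- (sqrt_sqrt (E / tau)) at 1 by pos. ring.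
   - right. rewrite Rmax_right in Hb0 by lra. assert (Hs : sqrt (tau * Delta) <= IZR k0).
    { rewrite <- (sqrt_Rsqr (IZR k0)) by lra. apply sqrt_le_1_alt. unfold Rsqr.
     apply (Rmult_le_compat_r Delta) in Hb0; [|lra].
     replace (IZR k0 * (IZR k0 / Delta) * Delta) with (IZR k0 * IZR k0) in Hb0 by (field; lra). exact Hb0. }
    apply Rmult_le_reg_r with (sqrt (tau * Delta)); [easy|].
    replace (sqrt D * (sqrt Q / sqrt (tau * Delta)) * sqrt (tau * Delta)) with (sqrt D * sqrt Q) by (field; lra).
    apply Rle_trans with D; [|easy]. apply Rle_trans with (B0 * IZR k0); [|easy]. apply Rmult_le_compat_l; lra. }

  destruct T2; nra.
Qed.

(** * Sums over lattice points weighted by the denominator *)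

Definition harm (n : nat) : R := rsum (fun i => / INR i) (seq 1 n).

Lemma harm_S n : harm (S n) = harm n + / INR (S n).
Proof.
  unfold harm. rewrite seq_S, rsum_app. change (1 + n)%nat with (S n).
  unfold rsum at 2. cbn [fold_right]. now rewrite Rplus_0_r.
Qed.

Lemma exists_max (L : list (Z * Z)) : L <> [] -> exists v, In v L /\ forall w, In w L -> (snd w <= snd v)%Z.
Proof.
  induction L as [|v L IH]; [easy|]. intros _. destruct L as [|w L'].
  - exists v. split; [now left|]. intros w [<-|[]]; lia.
  - destruct IH as [u [Hu Hmax]]; [easy|]. destruct (Z_le_dec (snd v) (snd u)).
   + exists u. split; [now right|]. intros z [<-|Hz]; auto.
   + exists v. split; [now left|]. intros z [<-|Hz]; [lia|]. specialize (Hmax z Hz). lia.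
Qed.

(** Remove a point of largest denominator: all n points lie in a box of that height, and [box_count]
    bounds the inverse root of the denominator by X/n. This replaces a partial summation and costs a
    harmonic sum. *)
Lemma box_sum alpha Delta tau E Q (L : list (Z * Z)) :
  0 < Delta -> 0 < tau -> 0 < E -> badly_approx alpha Delta tau E Q ->
  NoDup L -> (forall v, In v L -> in_box alpha E Q v) ->
  rsum (fun v => / sqrt (IZR (snd v))) L <=
   (10 * E * sqrt Q + 4 * sqrt (E / tau) + 2 * (sqrt Q / sqrt (tau * Delta))) * harm (length L).
Proof.
  intros HDe Htau HE Hbad. set (X := 10 * E * sqrt Q + 4 * sqrt (E / tau) + 2 * (sqrt Q / sqrt (tau * Delta))).
  remember (length L) as n eqn:Hn. revert L Hn. induction n as [|n IH]; intros L Hn HL Hbox.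
  - destruct L; [|easy]. unfold harm; simpl. lra.
  - destruct (exists_max L) as [v [Hv Hmax]]; [intros ->; easy|]. destruct (in_split v L Hv) as [l1 [l2 ->]].
   assert (HL' := NoDup_remove_1 _ _ _ HL).
   assert (Hn' : n = length (l1 ++ l2)) by (rewrite length_app in *; simpl in Hn; lia).
   assert (Hbox' : forall w, In w (l1 ++ l2) -> in_box alpha E Q w).
   { intros w Hw. apply Hbox. apply in_app_or in Hw. apply in_or_app. destruct Hw; [now left|right; now right]. }
   specialize (IH (l1 ++ l2) Hn' HL' Hbox'). rewrite rsum_app in *. simpl rsum. rewrite harm_S.
   destruct (Hbox v Hv) as (V1 & V2 & V3). assert (V1' := IZR_le _ _ V1). assert (Hc : INR (S n) <= sqrt (IZR (snd v)) * X).
   { rewrite Hn. apply (box_count alpha Delta tau E Q); try easy; [lra|].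
    intros w Hw. destruct (Hbox w Hw) as (W1 & W2 & W3). repeat split; try easy. apply IZR_le, Hmax, Hw. }
   assert (Hs : 0 < sqrt (IZR (snd v))) by pos. assert (Hn0 : 0 < INR (S n)) by pos.
   assert (/ sqrt (IZR (snd v)) <= X * / INR (S n)).
   { apply Rmult_le_reg_r with (sqrt (IZR (snd v)) * INR (S n)); [pos|].
    replace (/ sqrt (IZR (snd v)) * (sqrt (IZR (snd v)) * INR (S n))) with (INR (S n)) by (field; lra).
    replace (X * / INR (S n) * (sqrt (IZR (snd v)) * INR (S n))) with (sqrt (IZR (snd v)) * X) by (field; lra). exact Hc. }
   rewrite Rmult_plus_distr_l. lra.
Qed.

Lemma harm_ln n : (1 <= n)%nat -> harm n <= 1 + ln (INR n).
Proof.
  induction n as [|n IH]; [lia|]. intros _. destruct n as [|n].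
  - unfold harm; simpl. rewrite ln_1. lra.
  - rewrite harm_S. specialize (IH ltac:(lia)). set (z := INR (S n)) in *. assert (Hz : 1 <= z) by (apply (le_INR 1); lia).
   rewrite S_INR. fold z. assert (H : / (z + 1) <= ln (z + 1) - ln z).
   { assert (E : ln z - ln (z + 1) <= - / (z + 1)).
    { rewrite <- ln_div by lra. replace (z / (z + 1)) with (1 + - / (z + 1)) by (field; lra). set (u := - / (z + 1)).
     assert (Hu : 0 < 1 + u).
     { unfold u. assert (0 < z / (z + 1)) by pos. replace (1 + - / (z + 1)) with (z / (z + 1)) by (field; lra). easy. }
     rewrite <- (ln_exp u) at 2. apply ln_le; [easy|]. apply exp_ineq1_le. }
    lra. }
   lra.
Qed.

(** * Arcs and the modular transformation *)

(** A Lipschitz cut-off is enough, because only first order tests are applied to it, and its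
    integral is elementary. *)
Definition bump (v0 v : R) : R := Rmax 0 ((v - v0) * (v0 + 1 - v)).

Lemma bump_range v0 v : 0 <= bump v0 v <= 1.
Proof. unfold bump. split; [apply Rmax_l|]. apply Rmax_lub; [lra|]. generalize (pow2_ge_0 (v - v0 - 1 / 2)); nra. Qed.

Lemma bump_inside v0 v : v0 <= v <= v0 + 1 -> bump v0 v = (v - v0) * (v0 + 1 - v).
Proof. intros H. unfold bump. apply Rmax_right. nra. Qed.

Lemma bump_outside v0 v : v <= v0 \/ v0 + 1 <= v -> bump v0 v = 0.
Proof. intros H. unfold bump. apply Rmax_left. nra. Qed.

Lemma bump_lip v0 u v : Rabs (bump v0 u - bump v0 v) <= Rabs (u - v).
Proof.
  assert (W : forall u v, u <= v -> Rabs (bump v0 u - bump v0 v) <= v - u).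
  { clear u v. intros u v Huv. assert (H : forall z, (z <= v0 \/ v0 + 1 <= z) \/ v0 <= z <= v0 + 1) by (intros; lra).
   destruct (H u) as [Hu|Hu], (H v) as [Hv|Hv].
   - rewrite !bump_outside by easy. rewrite Rminus_0_r, Rabs_R0. lra.
   - rewrite (bump_outside v0 u), (bump_inside v0 v) by easy. rewrite Rabs_left1; nra.
   - rewrite (bump_outside v0 v), (bump_inside v0 u) by easy. rewrite Rabs_pos_eq; nra.
   - rewrite !bump_inside by easy. apply Rabs_le. nra. }
  destruct (Rle_dec u v).
  - rewrite (Rabs_left1 (u - v)) by lra. generalize (W u v r); lra.
  - rewrite (Rabs_pos_eq (u - v)) by lra. rewrite Rabs_minus_sym. apply W; lra.
Qed.

Lemma bump_cont v0 v : continuous (bump v0) v.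
Proof. apply (continuous_lip _ _ 1 1); [lra|]. intros y _. rewrite Rmult_1_l. apply bump_lip. Qed.

Lemma tame_cont_y psi C0 x y : tame_form psi C0 -> 0 < y -> ccont (fun y => psi (x, y)) y.
Proof.
  intros Hp Hy. apply (ccont_lip _ _ (C0 / y) y Hy). intros z Hz. apply Rabs_def2 in Hz. rewrite <- Cmod_opp.
  replace (- (psi (x, z) - psi (x, y)))%C with (psi (x, y) - psi (x, z))%C by ring.
  eapply Rle_trans; [apply (tame_lip _ _ Hp); lra|].
  rewrite Rminus_diag, Rabs_R0, Rplus_0_l, Rabs_minus_sym. right; field; lra.
Qed.

Lemma tame_cont_x psi C0 x y : tame_form psi C0 -> 0 < y -> ccont (fun x => psi (x, y)) x.
Proof.
  intros Hp Hy. apply (ccont_lip _ _ (C0 / y) 1 ltac:(lra)). intros z Hz. eapply Rle_trans; [apply (tame_lip _ _ Hp); lra|].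
  rewrite Rminus_diag, Rabs_R0, Rplus_0_r. right; field; lra.
Qed.

(** At the heights v/M the arguments 2 pi n v/M of K are of order 1 for n of order M. The parameter
    v0 will be kappa^2 + 1, which places them in the range of [K_imag_lower]. *)
Definition Psi (psi : C -> C) (v0 M x : R) : C :=
  CInt (fun v => RtoC (bump v0 v) * psi (x, v / M)%R)%C v0 (v0 + 1).

Lemma Psi_int psi C0 v0 M x : tame_form psi C0 -> 0 < v0 -> 0 < M ->
  exC (fun v => RtoC (bump v0 v) * psi (x, v / M)%R)%C v0 (v0 + 1).
Proof.
  intros Hp Hv HM. apply exC_cont; [lra|]. intros v Hvv. apply ccont_amp; [apply bump_cont|].
  apply (ccont_comp (fun y => psi (x, y)) (fun v => v / M)).
  - apply (tame_cont_y psi C0); [easy|]. apply Rdiv_lt_0_compat; lra.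
  - cont.
Qed.

Lemma Psi_bound psi C0 v0 M x : tame_form psi C0 -> 0 < v0 -> 0 < M -> Cmod (Psi psi v0 M x) <= C0.
Proof.
  intros Hp Hv HM. replace C0 with (C0 * (v0 + 1 - v0)) by ring.
  apply CInt_norm_const; [lra| |now apply (Psi_int psi C0)]. intros v Hvv.
  rewrite Cmod_mult, Cmod_R, Rabs_pos_eq by apply bump_range. rewrite <- (Rmult_1_l C0).
  apply Rmult_le_compat; try apply bump_range; [pos|]. apply (tame_bound _ _ Hp). apply Rdiv_lt_0_compat; lra.
Qed.

Lemma Psi_cont psi C0 v0 M x : tame_form psi C0 -> 0 < v0 -> 0 < M -> ccont (Psi psi v0 M) x.
Proof.
  intros Hp Hv HM. pose proof (tame_pos _ _ Hp). apply (ccont_lip _ _ (C0 * M / v0) 1 ltac:(lra)). intros z _.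
  replace (C0 * M / v0 * Rabs (z - x)) with (C0 * M / v0 * Rabs (z - x) * (v0 + 1 - v0)) by ring.
  apply (is_CInt_norm_const (fun v => RtoC (bump v0 v) * psi (z, v / M)%R - RtoC (bump v0 v) * psi (x, v / M)%R)%C v0 (v0 + 1)); [lra| |].
  - intros v Hvv. replace (RtoC (bump v0 v) * psi (z, v / M)%R - RtoC (bump v0 v) * psi (x, v / M)%R)%C with
    (RtoC (bump v0 v) * (psi (z, v / M)%R - psi (x, v / M)%R))%C by ring.
   assert (Hy : 0 < v / M) by pos.
   rewrite Cmod_mult, Cmod_R, Rabs_pos_eq by apply bump_range. rewrite <- (Rmult_1_l (C0 * M / v0 * _)).
   apply Rmult_le_compat; try apply bump_range; [pos|]. eapply Rle_trans; [apply (tame_lip _ _ Hp); easy|].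
   rewrite Rminus_diag, Rabs_R0, Rplus_0_r.
   replace (C0 * (Rabs (z - x) / (v / M))) with (C0 * M * Rabs (z - x) * / v) by (field; lra).
   replace (C0 * M / v0 * Rabs (z - x)) with (C0 * M * Rabs (z - x) * / v0) by (field; lra).
   apply Rmult_le_compat_l; [|apply Rinv_le_contravar; lra]. apply Rmult_le_pos; [nra|pos].
  - apply is_CInt_minus; now apply (Psi_int psi C0).
Qed.

(* Near the cusp H/K the point x + iy with x = H/K + 1/(Kw) is sent to (a - w)/K + i y w^2 up to
  a hyperbolic distance O(|K| w y). *)
Lemma cusp_approx psi C0 (H K a b : Z) w y : tame_form psi C0 -> (a * H + b * K = -1)%Z -> K <> 0%Z ->
  0 < w -> 0 < y ->
  Cmod (psi (IZR H / IZR K + / (IZR K * w), y)%R - psi ((IZR a - w) / IZR K, y * w ^ 2)%R)%C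
   <= 2 * C0 * (Rabs (IZR K) * w * y).
Proof.
  intros Hp Hab HK Hw Hy. rewrite (tame_cusp _ _ Hp K H a b _ y Hab HK Hy).
  assert (HK' : IZR K <> 0) by now apply not_0_IZR. set (k := IZR K) in *. set (A := IZR a).
  assert (Hka : 0 < Rabs k) by now apply Rabs_pos_lt.
  (* The exact image is (a - w/(1 + q^2))/K + i y w^2/(1 + q^2), so q measures the relative error of
     the approximation. *)
  set (q := Rabs k * w * y). assert (Hq : 0 < q) by (unfold q; repeat apply Rmult_lt_0_compat; easy).
  assert (Hk2 : k ^ 2 = Rabs k ^ 2) by (now rewrite pow2_abs).
  assert (Hq2 : q ^ 2 = k ^ 2 * w ^ 2 * y ^ 2) by (unfold q; rewrite Hk2; ring). assert (Hq1 : 0 < 1 + q ^ 2) by pos.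
  assert (Hyw : 0 < y * w ^ 2) by pos. set (u := / (k * w)).

  assert (Den : k ^ 2 * (u ^ 2 + y ^ 2) = (1 + q ^ 2) / w ^ 2).
  { unfold u. rewrite Hq2. field. lra. }
  rewrite Den. assert (E1 : A / k - u / ((1 + q ^ 2) / w ^ 2) = A / k - w / k / (1 + q ^ 2)) by (unfold u; field; lra).
  assert (E2 : y / ((1 + q ^ 2) / w ^ 2) = y * w ^ 2 / (1 + q ^ 2)) by (field; lra). rewrite E1, E2. rewrite <- Cmod_opp.
  match goal with |- Cmod (- (?X - ?Y)) <= _ => replace (- (X - Y))%C with (Y - X)%C by ring end.
  eapply Rle_trans; [apply (tame_lip _ _ Hp); [easy|]|].
  { pos. }
  pose proof (tame_pos _ _ Hp) as HC. rewrite (Rmult_comm 2 C0), Rmult_assoc. mul_l.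
  replace ((A - w) / k - (A / k - w / k / (1 + q ^ 2))) with (- (w / k * (q ^ 2 / (1 + q ^ 2)))) by (field; lra).
  replace (y * w ^ 2 - y * w ^ 2 / (1 + q ^ 2)) with (y * w ^ 2 * (q ^ 2 / (1 + q ^ 2))) by (field; lra).
  assert (Hr : 0 <= q ^ 2 / (1 + q ^ 2)) by pos.
  rewrite Rabs_Ropp, !Rabs_mult, (Rabs_pos_eq (q ^ 2 / (1 + q ^ 2))), Rabs_div, (Rabs_pos_eq w), (Rabs_pos_eq y), (Rabs_pos_eq (w ^ 2)) by
   (lra || easy || (apply pow2_ge_0)).
  replace ((w / Rabs k * (q ^ 2 / (1 + q ^ 2)) + y * w ^ 2 * (q ^ 2 / (1 + q ^ 2))) / (y * w ^ 2))
   with ((q ^ 2 / (1 + q ^ 2)) * (1 + / q)) by (unfold q; field; repeat split; try lra; try (now apply Rgt_not_eq); fold q; lra).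
  replace (q ^ 2 / (1 + q ^ 2) * (1 + / q)) with (q * ((q + 1) / (1 + q ^ 2))) by (field; lra).
  rewrite (Rmult_comm 2). mul_l. apply Rcomplements.Rle_div_l; [easy|]. nra.
Qed.

(* An arc ((H, K), a, (p1, p2)): the points H/K + sgn(K) p with p1 <= p <= p2, and the first entry a
  of a matrix of determinant 1 with lower row (K, -H). *)
Definition arc : Type := ((Z * Z) * Z * (R * R))%type.
Definition arc_v (A : arc) : Z * Z := fst (fst A).
Definition arc_H (A : arc) : Z := fst (arc_v A).
Definition arc_K (A : arc) : Z := snd (arc_v A).
Definition arc_a (A : arc) : Z := snd (fst A).
Definition arc_p1 (A : arc) : R := fst (snd A).
Definition arc_p2 (A : arc) : R := snd (snd A).
Definition arc_k (A : arc) : R := Rabs (IZR (arc_K A)).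
Definition arc_w1 (A : arc) : R := / (arc_k A * arc_p2 A).
(** Meaningful only for [0 < arc_p1 A]: for an arc that begins at its cusp the value is / 0 = 0.
    Such arcs are cut by [pieces] before w is used. *)
Definition arc_w2 (A : arc) : R := / (arc_k A * arc_p1 A).

Definition arc_ok (A : arc) : Prop :=
  arc_K A <> 0%Z /\ (exists b, arc_a A * arc_H A + b * arc_K A = -1)%Z /\ 0 <= arc_p1 A <= arc_p2 A.

Definition arc_pt (A : arc) (p : R) : R := IZR (arc_H A) / IZR (arc_K A) + IZR (Z.sgn (arc_K A)) * p.

Definition arc_int (f : R -> C) (A : arc) : C := CInt (fun p => f (arc_pt A p)) (arc_p1 A) (arc_p2 A).

Definition arc_clip (lo hi : R) (A : arc) : arc :=
  (fst A, (clamp (arc_p1 A) (arc_p2 A) (lo / arc_k A), clamp (arc_p1 A) (arc_p2 A) (hi / arc_k A))).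

Definition arc_nonempty (A : arc) : bool := if Rlt_dec (arc_p1 A) (arc_p2 A) then true else false.

(* The parts of the arcs on which w = 1/(|K| p) lies between 2^i Q and 2^(i+1) Q. *)
Definition pieces (Q : R) (l : list arc) (i : nat) : list arc :=
  filter arc_nonempty (map (arc_clip (/ (Q * 2 ^ S i)) (/ (Q * 2 ^ i))) l).

Lemma arc_k_pos A : arc_ok A -> 1 <= arc_k A.
Proof.
  intros [H _]. unfold arc_k. rewrite <- abs_IZR. apply IZR_le. lia.
Qed.

Lemma clamp_mono a b x y : x <= y -> clamp a b x <= clamp a b y.
Proof. intros H. unfold clamp. apply Rle_max_compat_l. apply Rle_min_compat_l. easy. Qed.

Lemma arc_pt_cont A p : continuous (arc_pt A) p.
Proof. apply continuous_lin. Qed.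

Lemma pieces_in Q l i A : 0 < Q -> (forall A, In A l -> arc_ok A) -> In A (pieces Q l i) ->
  exists A0, In A0 l /\ arc_v A = arc_v A0 /\ arc_a A = arc_a A0 /\ arc_ok A /\ 0 < arc_p1 A /\
   arc_p1 A0 <= arc_p1 A /\ arc_p2 A <= arc_p2 A0 /\
   Q * 2 ^ i <= arc_w1 A /\ arc_w1 A <= arc_w2 A /\ arc_w2 A <= 2 * (Q * 2 ^ i).
Proof.
  intros HQ Hok HA. unfold pieces in HA. apply filter_In in HA. destruct HA as [HA Hne].
  apply in_map_iff in HA. destruct HA as [A0 [<- HA0]]. exists A0.
  pose proof (Hok A0 HA0) as Hok0. pose proof (arc_k_pos A0 Hok0) as Hk. destruct Hok0 as (O1 & O2 & O3).
  unfold arc_nonempty in Hne. destruct (Rlt_dec _ _) as [Hlt|]; [|easy].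
  set (lo := / (Q * 2 ^ S i)) in *. set (hi := / (Q * 2 ^ i)) in *. assert (H2 : 0 < 2 ^ i) by pos.
  assert (HQ2 : 0 < Q * 2 ^ i) by now apply Rmult_lt_0_compat.
  assert (Elo : lo = hi / 2) by (unfold lo, hi; simpl; field; lra). assert (Hhi : 0 < hi) by (now apply Rinv_0_lt_compat).

  assert (Elk : lo / arc_k A0 = hi / arc_k A0 / 2) by (rewrite Elo; field; lra).
  change (arc_p1 (arc_clip lo hi A0)) with (clamp (arc_p1 A0) (arc_p2 A0) (lo / arc_k A0)) in *.
  change (arc_p2 (arc_clip lo hi A0)) with (clamp (arc_p1 A0) (arc_p2 A0) (hi / arc_k A0)) in *.
  destruct (clamp_spec (arc_p1 A0) (arc_p2 A0) (lo / arc_k A0) ltac:(lra)) as [R1 S1].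
  destruct (clamp_spec (arc_p1 A0) (arc_p2 A0) (hi / arc_k A0) ltac:(lra)) as [R2 S2].
  set (c1 := clamp (arc_p1 A0) (arc_p2 A0) (lo / arc_k A0)) in *.
  set (c2 := clamp (arc_p1 A0) (arc_p2 A0) (hi / arc_k A0)) in *.
 assert (C2 : c2 <= hi / arc_k A0) by lra.
  assert (EH : / hi = Q * 2 ^ i) by (unfold hi; now rewrite Rinv_inv). repeat split; try easy; try lra.
  - change (arc_p1 (arc_clip lo hi A0)) with c1. lra.
  - change (arc_p1 (arc_clip lo hi A0)) with c1. change (arc_p2 (arc_clip lo hi A0)) with c2. lra.
  - unfold arc_w1. change (arc_k (arc_clip lo hi A0)) with (arc_k A0). change (arc_p2 (arc_clip lo hi A0)) with c2.
   rewrite <- EH. apply Rinv_le_contravar; [pos|].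
   apply (Rmult_le_compat_l (arc_k A0)) in C2; [|lra]. replace (arc_k A0 * (hi / arc_k A0)) with hi in C2 by (field; lra). exact C2.
  - unfold arc_w1, arc_w2. change (arc_k (arc_clip lo hi A0)) with (arc_k A0).
   change (arc_p2 (arc_clip lo hi A0)) with c2. change (arc_p1 (arc_clip lo hi A0)) with c1.
   apply Rinv_le_contravar; [pos|]. apply Rmult_le_compat_l; lra.
  - unfold arc_w2. change (arc_k (arc_clip lo hi A0)) with (arc_k A0). change (arc_p1 (arc_clip lo hi A0)) with c1.
   rewrite <- EH. replace (2 * / hi) with (/ (arc_k A0 * (hi / arc_k A0 / 2))) by (field; lra).
   apply Rinv_le_contravar; [pos|]. apply Rmult_le_compat_l; lra.
Qed.

Lemma pieces_nodup Q l i : NoDup (map arc_v l) -> NoDup (map arc_v (pieces Q l i)).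
Proof.
  unfold pieces. intros H. induction l as [|A l IH]; simpl in *; [constructor|].
  inversion H as [|? ? H1 H2]; subst. specialize (IH H2).
  destruct (arc_nonempty _); [|exact IH]. simpl. constructor; [|exact IH].
  intros Hin. apply H1. change (arc_v (arc_clip (/ (Q * (2 * 2 ^ i))) (/ (Q * 2 ^ i)) A)) with (arc_v A) in Hin.
  apply in_map_iff in Hin. destruct Hin as [B [E HB]]. apply filter_In in HB. destruct HB as [HB _].
  apply in_map_iff in HB. destruct HB as [B0 [<- HB0]]. rewrite <- E.
  change (arc_v (arc_clip (/ (Q * (2 * 2 ^ i))) (/ (Q * 2 ^ i)) B0)) with (arc_v B0). now apply in_map.
Qed.

Lemma pieces_rsum_le Q l i (g : Z * Z -> R) : (forall A, In A l -> 0 <= g (arc_v A)) ->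
  rsum (fun A => g (arc_v A)) (pieces Q l i) <= rsum (fun A => g (arc_v A)) l.
Proof.
  unfold pieces. induction l as [|A l IH]; intros Hg; simpl; [lra|].
  assert (IH' := IH ltac:(intros; apply Hg; now right)). pose proof (Hg A (or_introl eq_refl)).
  destruct (arc_nonempty _); simpl.
  - change (arc_v (arc_clip (/ (Q * (2 * 2 ^ i))) (/ (Q * 2 ^ i)) A)) with (arc_v A). simpl in IH'. lra.
  - simpl in IH'. lra.
Qed.

(** What n dyadic classes leave of an arc lies within 1/(k Q 2^n) of its cusp and is estimated
    trivially. The hypothesis on [arc_p2] says that class 0 reaches the far end of every arc. *)
Lemma arc_int_split f l Q n B : 0 < Q -> 0 <= B -> (forall x, ccont f x) -> (forall x, Cmod (f x) <= B) ->
  (forall A, In A l -> arc_ok A /\ arc_p2 A <= / (arc_k A * Q)) ->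
  Cmod (csum (arc_int f) l) <= rsum (fun i => Cmod (csum (arc_int f) (pieces Q l i))) (seq 0 n) +
   rsum (fun A => B / (arc_k A * Q * 2 ^ n)) l.
Proof.
  intros HQ HB Hf HfB Hl.
  set (tail := fun n A => CInt (fun p => f (arc_pt A p)) (arc_p1 A) (clamp (arc_p1 A) (arc_p2 A) (/ (Q * 2 ^ n) / arc_k A))).
  assert (Fex : forall A u v, u <= v -> exC (fun p => f (arc_pt A p)) u v).
  { intros A u v Huv. apply exC_cont; [easy|]. intros p _. apply (ccont_comp f); [apply Hf|apply arc_pt_cont]. }
  (* Class i is the difference of the tails i and i + 1, so the sum telescopes; the pieces that were
     filtered out are points and have integral 0. *)
  assert (P : csum (arc_int f) l = (csum (fun i => csum (arc_int f) (pieces Q l i)) (seq 0 n) + csum (tail n) l)%C).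
  { induction n as [|n IH].
   - simpl. rewrite Cplus_0_l. apply csum_ext. intros A HA. unfold arc_int, tail. f_equal.
    destruct (Hl A HA) as [Hok Hp2]. pose proof (arc_k_pos A Hok). destruct Hok as (O1&O2&O3).
    unfold clamp. rewrite Rmult_1_r. replace (/ Q / arc_k A) with (/ (arc_k A * Q)) by (field; lra).
    rewrite Rmin_left, Rmax_right by lra. easy.
   - rewrite IH, csum_seq_S, <- Cplus_assoc. f_equal.
    assert (E : csum (arc_int f) (pieces Q l n) = csum (fun A => tail n A - tail (S n) A)%C l).
    { unfold pieces. clear IH. induction l as [|A l IH]; [easy|]. simpl csum at 2. rewrite <- IH by (intros; apply Hl; now right).
     destruct (Hl A (or_introl eq_refl)) as [Hok Hp2]. pose proof (arc_k_pos A Hok). destruct Hok as (O1&O2&O3).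
     set (B0 := arc_clip (/ (Q * 2 ^ S n)) (/ (Q * 2 ^ n)) A). assert (E0 : arc_int f B0 = (tail n A - tail (S n) A)%C).
     { unfold tail, arc_int. change (arc_pt B0) with (arc_pt A).
      change (arc_p1 B0) with (clamp (arc_p1 A) (arc_p2 A) (/ (Q * 2 ^ S n) / arc_k A)).
      change (arc_p2 B0) with (clamp (arc_p1 A) (arc_p2 A) (/ (Q * 2 ^ n) / arc_k A)).
      rewrite (CInt_Chasles _ (arc_p1 A) (clamp (arc_p1 A) (arc_p2 A) (/ (Q * 2 ^ S n) / arc_k A))
       (clamp (arc_p1 A) (arc_p2 A) (/ (Q * 2 ^ n) / arc_k A))); [ring| | |].
      - apply clamp_spec; lra.
      - apply clamp_mono. mul_r. assert (0 < 2 ^ n) by pos. apply Rinv_le_contravar; [pos|]. simpl. nra.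
      - apply Fex. apply clamp_spec; lra. }
     rewrite <- E0. simpl map. fold B0. simpl filter. unfold arc_nonempty at 1.
     destruct (Rlt_dec _ _) as [Hlt|Hge]; [easy|]. change (~ arc_p1 B0 < arc_p2 B0) in Hge.
     assert (E1 : arc_int f B0 = RtoC 0).
     { unfold arc_int. replace (arc_p2 B0) with (arc_p1 B0); [apply CInt_point|].
      apply Rle_antisym; [|lra]. apply clamp_mono. mul_r. assert (0 < 2 ^ n) by pos. apply Rinv_le_contravar; [pos|].
      simpl. nra. }
     rewrite E1. symmetry. apply Cplus_0_l. }
    rewrite E, csum_minus. ring. }
  rewrite P. via Cmod_triangle. apply Rplus_le_compat.
  - apply csum_norm. intros; lra.
  - apply csum_norm. intros A HA. destruct (Hl A HA) as [Hok Hp2]. pose proof (arc_k_pos A Hok). destruct Hok as (O1&O2&O3).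
   assert (H2 : 0 < 2 ^ n) by pos.
   destruct (clamp_spec (arc_p1 A) (arc_p2 A) (/ (Q * 2 ^ n) / arc_k A) ltac:(lra)) as [R1 S1].
   eapply Rle_trans; [apply (CInt_norm_const _ _ _ B); [easy|intros; apply HfB|now apply Fex]|]. unfold Rdiv at 2. mul_l.
   assert (0 < / (Q * 2 ^ n) / arc_k A).
   { pos. }
   replace (/ (arc_k A * Q * 2 ^ n)) with (/ (Q * 2 ^ n) / arc_k A) by (field; lra). lra.
Qed.

Definition arc_x (A : arc) (w : R) : R := IZR (arc_H A) / IZR (arc_K A) + / (IZR (arc_K A) * w).

Lemma arc_K_neq A : arc_ok A -> IZR (arc_K A) <> 0.
Proof. intros [H _]. now apply not_0_IZR. Qed.

Lemma arc_w_pos A : arc_ok A -> 0 < arc_p1 A -> 0 < arc_w1 A /\ arc_w1 A <= arc_w2 A.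
Proof.
  intros Hok Hp. pose proof (arc_k_pos A Hok). destruct Hok as (O1&O2&O3). unfold arc_w1, arc_w2. split.
  - pos.
  - apply Rinv_le_contravar; [pos|]. apply Rmult_le_compat_l; lra.
Qed.

Lemma sgn_over_abs (K : Z) (w : R) : K <> 0%Z -> w <> 0 ->
  IZR (Z.sgn K) * / (Rabs (IZR K) * w) = / (IZR K * w).
Proof.
  intros HK Hw. rewrite <- abs_IZR. assert (HK' : IZR K <> 0) by now apply not_0_IZR. destruct (Z.lt_ge_cases K 0).
  - rewrite Z.sgn_neg, Z.abs_neq, opp_IZR by lia. field. easy.
  - rewrite Z.sgn_pos, Z.abs_eq by lia. field. easy.
Qed.

(** The substitution p = 1/(|K| w); it reverses the orientation, whence the interchange of the
    limits. *)
Lemma arc_int_w f A : arc_ok A -> 0 < arc_p1 A -> (forall x, ccont f x) ->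
  arc_int f A = CInt (fun w => RtoC (/ (arc_k A * w ^ 2)) * f (arc_x A w))%C (arc_w1 A) (arc_w2 A).
Proof.
  intros Hok Hp Hf. pose proof (arc_k_pos A Hok) as Hk. destruct (arc_w_pos A Hok Hp) as [Hw1 Hw2].
 destruct Hok as (O1&O2&O3).
  set (k := arc_k A) in *. set (F := fun p => f (arc_pt A p)).
  assert (HF : forall p, ccont F p) by (intros p; apply (ccont_comp f); [apply Hf|apply arc_pt_cont]).
  pose proof (is_CInt_subst F (fun w => / (k * w)) (fun w => - / (k * w ^ 2)) (arc_w1 A) (arc_w2 A) Hw2) as H.
  lapply H; clear H; [|intros; apply HF]. intros H. lapply H; clear H.
  2:{ intros w Hw. split.
    - auto_derive; [apply Rmult_integral_contrapositive; lra|field; lra].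
    - apply (continuous_opp (V:=R_NormedModule)). apply continuous_inv.
     + apply continuous_Rmult; [apply continuous_const|].
      apply (ex_derive_continuous (fun w => w ^ 2)). auto_derive; easy.
     + apply Rmult_integral_contrapositive; split; [lra|apply pow_nonzero; lra]. }
  intros H. assert (E1 : / (k * arc_w1 A) = arc_p2 A) by (unfold arc_w1; fold k; field; lra).
  assert (E2 : / (k * arc_w2 A) = arc_p1 A) by (unfold arc_w2; fold k; field; lra). rewrite E1, E2 in H.
  assert (Hsw : CInt F (arc_p2 A) (arc_p1 A) = (- CInt F (arc_p1 A) (arc_p2 A))%C).
  { apply is_CInt_unique, is_CInt_swap. apply exC_cont; [lra|]. intros; apply HF. }
  rewrite Hsw in H. apply (is_CInt_scal (RtoC (-1))) in H.
  replace (RtoC (-1) * - CInt F (arc_p1 A) (arc_p2 A))%C with (arc_int f A) in H by (unfold arc_int; fold F; ring).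
  symmetry. apply is_CInt_unique. eapply is_CInt_ext; [easy| |exact H].
  intros w Hw. simpl. rewrite Cmult_assoc, <- RtoC_mult. f_equal.
  - f_equal. field. lra.
  - unfold F. f_equal. unfold arc_pt, arc_x. f_equal. apply sgn_over_abs; [easy|lra].
Qed.

(** * Transport of the integrand to a cusp *)

Definition wave (psi : C -> C) (v0 M x : R) : C := (e (- M * x) * Psi psi v0 M x)%C.

Lemma wave_cont psi C0 v0 M x : tame_form psi C0 -> 0 < v0 -> 0 < M -> ccont (wave psi v0 M) x.
Proof.
  intros Hp Hv HM. apply ccont_mult; [|now apply (Psi_cont psi C0)]. apply (ccont_e (fun x => - M * x)). cont.
Qed.

Lemma wave_bound psi C0 v0 M x : tame_form psi C0 -> 0 < v0 -> 0 < M -> Cmod (wave psi v0 M x) <= C0.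
Proof.
  intros Hp Hv HM. unfold wave. rewrite Cmod_mult, Cmod_e, Rmult_1_l. now apply (Psi_bound psi C0).
Qed.

(** The mean [Psi] with each point replaced by its approximate image from [cusp_approx]; the height
    is multiplied by w^2. *)
Definition PsiC (psi : C -> C) (v0 M : R) (A : arc) (w : R) : C :=
  CInt (fun v => RtoC (bump v0 v) * psi ((IZR (arc_a A) - w) / IZR (arc_K A), v / M * w ^ 2)%R)%C v0 (v0 + 1).

Definition cusp_int (psi : C -> C) (v0 M : R) (A : arc) : C :=
  CInt (fun w => RtoC (/ (arc_k A * w ^ 2)) * (e (- M * arc_x A w) * PsiC psi v0 M A w))%C (arc_w1 A) (arc_w2 A).

Lemma PsiC_int psi C0 v0 M A w : tame_form psi C0 -> 0 < v0 -> 0 < M -> 0 < w ->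
  exC (fun v => RtoC (bump v0 v) * psi ((IZR (arc_a A) - w) / IZR (arc_K A), v / M * w ^ 2)%R)%C v0 (v0 + 1).
Proof.
  intros Hp Hv HM Hw. apply exC_cont; [lra|]. intros v Hvv. apply ccont_amp; [apply bump_cont|].
  apply (ccont_comp (fun y => psi ((IZR (arc_a A) - w) / IZR (arc_K A), y)) (fun v => v / M * w ^ 2)).
  - apply (tame_cont_y psi C0); [easy|]. apply Rmult_lt_0_compat; [|pos]. apply Rdiv_lt_0_compat; lra.
  - cont.
Qed.

Lemma arc_curve_lip psi C0 A y w z : tame_form psi C0 -> arc_ok A -> 0 < y -> 0 < w -> Rabs (z - w) < w ->
  Cmod (psi ((IZR (arc_a A) - z) / IZR (arc_K A), y * z ^ 2)%R - psi ((IZR (arc_a A) - w) / IZR (arc_K A), y * w ^ 2)%R)%C <=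
   C0 * (/ (y * w ^ 2) + 3 / w) * Rabs (z - w).
Proof.
  intros Hp Hok Hy Hw Hz. pose proof (tame_pos _ _ Hp) as HC. pose proof (arc_K_neq A Hok) as HK.
  pose proof (arc_k_pos A Hok) as Hk. apply Rabs_def2 in Hz. assert (Hw2 : 0 < w ^ 2) by pos.
  rewrite <- Cmod_opp. match goal with |- Cmod (- (?X - ?Y)) <= _ => replace (- (X - Y))%C with (Y - X)%C by ring end.
  assert (Hz2 : 0 < y * z ^ 2) by pos. via (tame_lip _ _ Hp); [pos|easy|]. rewrite Rmult_assoc. mul_l.
  replace ((IZR (arc_a A) - w) / IZR (arc_K A) - (IZR (arc_a A) - z) / IZR (arc_K A)) with ((z - w) / IZR (arc_K A)) by (field; easy).
  replace (y * w ^ 2 - y * z ^ 2) with (y * ((w + z) * (w - z))) by ring.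
  rewrite Rabs_div, !Rabs_mult, (Rabs_pos_eq y), (Rabs_pos_eq (w + z)), (Rabs_minus_sym w z) by lra.
  fold (arc_k A). set (d := Rabs (z - w)). assert (Hd : 0 <= d) by apply Rabs_pos.
  apply Rle_trans with ((d + y * (3 * w * d)) / (y * w ^ 2)); [|right; field; lra]. mul_r. apply Rplus_le_compat.
  - unfold Rdiv. rewrite <- (Rmult_1_r d) at 2. mul_l. rewrite <- Rinv_1. apply Rinv_le_contravar; lra.
  - mul_l. apply Rmult_le_compat_r; lra.
Qed.

Lemma PsiC_cont psi C0 v0 M A w : tame_form psi C0 -> 0 < v0 -> 0 < M -> arc_ok A -> 0 < w ->
  ccont (PsiC psi v0 M A) w.
Proof.
  intros Hp Hv HM Hok Hw. pose proof (tame_pos _ _ Hp) as HC. assert (Hw2 : 0 < w ^ 2) by pos.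
  set (L := C0 * (/ (v0 / M * w ^ 2) + 3 / w)).
  apply (ccont_lip _ _ L w Hw). intros z Hz. pose proof Hz as Hz'. apply Rabs_def2 in Hz'.
  replace (L * Rabs (z - w)) with (L * Rabs (z - w) * (v0 + 1 - v0)) by ring.
  set (x := fun w => (IZR (arc_a A) - w) / IZR (arc_K A)).
  apply (is_CInt_norm_const (fun v => RtoC (bump v0 v) * psi (x z, v / M * z ^ 2)%R - RtoC (bump v0 v) * psi (x w, v / M * w ^ 2)%R)%C v0 (v0 + 1)); [lra| |].
  - intros v Hvv. rewrite Cmult_minus. assert (Hy : 0 < v / M) by pos.
   rewrite Cmod_mult, Cmod_R, Rabs_pos_eq by apply bump_range. rewrite <- (Rmult_1_l (L * _)).
   apply Rmult_le_compat; try apply bump_range; [pos|]. via (arc_curve_lip psi C0 A (v / M) w z); try easy.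
   mul_r. unfold L. mul_l. apply Rplus_le_compat_r, Rinv_le_contravar; [pos|]. mul_r. apply Rmult_le_compat_r; [pos|lra].
  - apply is_CInt_minus; apply (PsiC_int psi C0); easy || lra.
Qed.

Lemma arc_x_cont A w : arc_ok A -> 0 < w -> continuous (arc_x A) w.
Proof.
  intros Hok Hw. pose proof (arc_K_neq A Hok). unfold arc_x. apply continuous_Rplus; [apply continuous_const|].
  apply continuous_inv.
  - cont.
  - apply Rmult_integral_contrapositive; lra.
Qed.

Lemma inv_kw2_cont k w : 0 < k -> 0 < w -> continuous (fun w => / (k * w ^ 2)) w.
Proof.
  intros Hk Hw. apply continuous_inv.
  - apply continuous_Rmult; [apply continuous_const|]. apply (ex_derive_continuous (fun w => w ^ 2)). auto_derive; easy.
  - apply Rmult_integral_contrapositive; split; [lra|apply pow_nonzero; lra].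
Qed.

(** The error |K| w y of [cusp_approx] meets the density 1/(|K| w^2), so that a dyadic range of w
    contributes O(1/M) whatever the denominator. *)
Lemma arc_int_approx psi C0 v0 M A W0 : tame_form psi C0 -> 0 < v0 -> 0 < M -> arc_ok A -> 0 < arc_p1 A ->
  0 < W0 -> W0 <= arc_w1 A -> arc_w2 A <= 2 * W0 ->
  Cmod (arc_int (wave psi v0 M) A - cusp_int psi v0 M A)%C <= 2 * C0 * (v0 + 1) / M.
Proof.
  intros Hp Hv HM Hok Hp1 HW H1 H2. pose proof (arc_k_pos A Hok) as Hk. destruct (arc_w_pos A Hok Hp1) as [Hw1 Hw2].
  pose proof (tame_pos _ _ Hp) as HC.
  rewrite (arc_int_w (wave psi v0 M) A Hok Hp1) by (intros; now apply (wave_cont psi C0)).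
  set (D := 2 * C0 * (v0 + 1) / M). assert (HD : 0 < D) by (unfold D; apply Rdiv_lt_0_compat; nra).
  apply Rle_trans with (D / W0 * (arc_w2 A - arc_w1 A)).
  2:{ apply Rle_trans with (D / W0 * W0); [|right; field; lra]. mul_l; lra. }
  apply (is_CInt_norm_const (fun w => RtoC (/ (arc_k A * w ^ 2)) * wave psi v0 M (arc_x A w) -
   RtoC (/ (arc_k A * w ^ 2)) * (e (- M * arc_x A w) * PsiC psi v0 M A w))%C (arc_w1 A) (arc_w2 A)); [easy| |].
  - intros w Hw. assert (Hw0 : 0 < w) by lra. unfold wave. rewrite !Cmult_minus.

   rewrite !Cmod_mult, Cmod_e, Rmult_1_l, Cmod_R, Rabs_pos_eq by pos.
   assert (HP : Cmod (Psi psi v0 M (arc_x A w) - PsiC psi v0 M A w)%C <= D * (arc_k A * w)).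
   { replace (D * (arc_k A * w)) with (D * (arc_k A * w) * (v0 + 1 - v0)) by ring.
    apply (is_CInt_norm_const (fun v => RtoC (bump v0 v) * psi (arc_x A w, v / M)%R -
     RtoC (bump v0 v) * psi ((IZR (arc_a A) - w) / IZR (arc_K A), v / M * w ^ 2)%R)%C v0 (v0 + 1)); [lra| |].
    - intros v Hvv. rewrite Cmult_minus. assert (Hy : 0 < v / M) by pos.
     rewrite Cmod_mult, Cmod_R, Rabs_pos_eq by apply bump_range. rewrite <- (Rmult_1_l (D * _)).
     apply Rmult_le_compat; try apply bump_range; [pos|]. destruct Hok as (O1 & [b O2] & O3).
     via (cusp_approx psi C0 _ _ _ b w (v / M) Hp O2 O1 Hw0 Hy). fold (arc_k A). unfold D.
     replace (2 * C0 * (v0 + 1) / M * (arc_k A * w)) with (2 * C0 * (arc_k A * w * ((v0 + 1) / M))) by (field; lra).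
     mul_l. mul_l. mul_r; lra.
    - apply is_CInt_minus; [now apply (Psi_int psi C0)|now apply (PsiC_int psi C0)]. }
   apply Rle_trans with (/ (arc_k A * w ^ 2) * (D * (arc_k A * w))).
   { mul_l; easy. }
   replace (/ (arc_k A * w ^ 2) * (D * (arc_k A * w))) with (D / w) by (field; lra). mul_l. apply Rinv_le_contravar; lra.
  - apply is_CInt_minus.
   + apply exC_cont; [easy|]. intros w Hw. apply ccont_amp; [apply inv_kw2_cont; lra|].
    apply (ccont_comp (wave psi v0 M)); [now apply (wave_cont psi C0)|apply arc_x_cont; [easy|lra]].
   + apply exC_cont; [easy|]. intros w Hw. apply ccont_amp; [apply inv_kw2_cont; lra|]. apply ccont_mult.
    * apply (ccont_e (fun w => - M * arc_x A w)). apply continuous_Rmult; [apply continuous_const|apply arc_x_cont; [easy|lra]].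
    * apply (PsiC_cont psi C0); easy || lra.
Qed.

(** * Double sums and counting *)

Lemma rsum_list_prod {A B} (f : A * B -> R) (l : list A) (m : list B) :
  rsum f (list_prod l m) = rsum (fun a => rsum (fun b => f (a, b)) m) l.
Proof.
  induction l as [|a l IH]; simpl; [easy|]. rewrite rsum_app, IH. f_equal.
  clear. induction m as [|b m IH]; simpl; [easy|]. now rewrite IH.
Qed.

Lemma csum_list_prod {A B} (f : A * B -> C) (l : list A) (m : list B) :
  csum f (list_prod l m) = csum (fun a => csum (fun b => f (a, b)) m) l.
Proof.
  induction l as [|a l IH]; simpl; [easy|]. rewrite csum_app, IH. f_equal.
  clear. induction m as [|b m IH]; simpl; [easy|]. now rewrite IH.
Qed.

Lemma rsum_swap {A B} (f : A -> B -> R) (l : list A) (m : list B) :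
  rsum (fun a => rsum (f a) m) l = rsum (fun b => rsum (fun a => f a b) l) m.
Proof.
  induction l as [|a l IH]; simpl.
  - induction m; simpl; [easy|]. rewrite <- IHm. lra.
  - rewrite IH, <- rsum_plus. easy.
Qed.

Lemma count_interval (H : nat) z c ell (g : nat -> R) : 0 <= c -> 0 <= ell ->
  (forall d, 0 <= g d <= c) -> (forall d, g d <> 0 -> z <= INR d <= z + ell) ->
  rsum g (seq 0 H) <= c * (ell + 1).
Proof.
  (* For the induction on H the bound counts only the part of the interval below H; one unit beyond
     its right end accounts for the last integer. *)
  intros Hc Hl Hg Hz. assert (P : rsum g (seq 0 H) <= c * Rmax 0 (Rmin (INR H) (z + ell + 1) - z)).
  { induction H as [|H IH].
   - simpl. apply Rmult_le_pos; [easy|apply Rmax_l].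
   - rewrite rsum_seq_S. destruct (Req_dec (g H) 0) as [E|E].
    + rewrite E, Rplus_0_r. via IH. mul_l.
     apply Rle_max_compat_l. apply Rplus_le_compat_r. apply Rle_min_compat_r. apply le_INR; lia.
    + specialize (Hz H E). specialize (Hg H). rewrite (Rmin_left (INR H)) in IH by lra. rewrite Rmax_right in IH by lra.
     rewrite S_INR, Rmin_left, Rmax_right by lra. apply Rle_trans with (c * (INR H - z) + c); [lra|]. right; ring. }
  via P. mul_l. apply Rmax_lub; [lra|]. generalize (Rmin_r (INR H) (z + ell + 1)); lra.
Qed.

Lemma harm_mono m n : (m <= n)%nat -> harm m <= harm n.
Proof.
  intros H. induction H; [lra|]. rewrite harm_S. assert (0 < / INR (S m0)) by pos. lra.
Qed.

Lemma harm_nonneg n : 0 <= harm n.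
Proof. replace 0 with (harm 0) by reflexivity. apply harm_mono; lia. Qed.

Lemma rsum_map {A B} (f : B -> R) (g : A -> B) l : rsum f (map g l) = rsum (fun x => f (g x)) l.
Proof. induction l as [|x l IH]; simpl; [easy|]. now rewrite IH. Qed.

Lemma sum_inv_dist (H d : nat) : (d < H)%nat ->
  rsum (fun i => if Nat.eq_dec i d then 0 else / Rabs (INR d - INR i)) (seq 0 H) <= 2 * harm H.
Proof.
  intros Hd. set (g := fun i => if Nat.eq_dec i d then 0 else / Rabs (INR d - INR i)).
  replace H with (d + (1 + (H - S d)))%nat by lia. rewrite !seq_app, !rsum_app. simpl (0 + d)%nat.
  assert (E1 : rsum g (seq 0 d) = harm d).
  { transitivity (rsum (fun i => / (INR d - INR i)) (seq 0 d)).
   - apply rsum_ext. intros i Hi. apply in_seq in Hi. unfold g. destruct (Nat.eq_dec i d); [lia|].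
    assert (INR i < INR d) by (apply lt_INR; lia). rewrite Rabs_pos_eq; lra.
   - clear. induction d as [|d IH]; [easy|]. change (seq 0 (S d)) with (0%nat :: seq 1 d). rewrite <- seq_shift.
    change (rsum (fun i => / (INR (S d) - INR i)) (0%nat :: map S (seq 0 d))) with
     (/ (INR (S d) - INR 0) + rsum (fun i => / (INR (S d) - INR i)) (map S (seq 0 d))).
    rewrite rsum_map, harm_S. simpl (INR 0). rewrite Rminus_0_r, Rplus_comm. f_equal.
    rewrite <- IH. apply rsum_ext. intros i _. f_equal. rewrite !S_INR. ring. }
  assert (E2 : rsum g (seq (d + 1) (H - S d)) = harm (H - S d)).
  { generalize (H - S d)%nat as m. induction m as [|m IH]; [easy|].
   rewrite seq_S, rsum_app, IH, harm_S. f_equal. simpl. unfold g. destruct (Nat.eq_dec _ _); [lia|].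
   rewrite Rplus_0_r. f_equal. rewrite !plus_INR. simpl (INR 1).
   replace (INR d - (INR d + 1 + INR m)) with (- (INR m + 1)) by ring. rewrite Rabs_Ropp, Rabs_pos_eq.
   - destruct m; simpl; ring.
   - generalize (pos_INR m); lra. }
  assert (E3 : rsum g (seq d 1) = 0).
  { simpl. unfold g. destruct (Nat.eq_dec d d); [ring|easy]. }
  rewrite E1, E2, E3.
  pose proof (harm_mono d (d + (1 + (H - S d))) ltac:(lia)). pose proof (harm_mono (H - S d) (d + (1 + (H - S d))) ltac:(lia)). lra.
Qed.

(** [M / w ^ 2] is the Jacobian of v = M s / w^2. *)
Definition amp_phi (v0 M s w : R) : R := M / w ^ 2 * bump v0 (M * s / w ^ 2).

Lemma inv_sq_diff W w z : 0 < W -> W <= w -> W <= z -> Rabs (/ w ^ 2 - / z ^ 2) <= 2 * Rabs (w - z) / W ^ 3.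
Proof.
  intros HW Hw Hz. replace (/ w ^ 2 - / z ^ 2) with ((z - w) * ((z + w) / (w ^ 2 * z ^ 2))) by (field; lra).
  rewrite Rabs_mult, Rabs_minus_sym.

  assert (H2 : 0 < W ^ 3) by now apply pow_lt. assert (H3 : 0 < (z + w) / (w ^ 2 * z ^ 2)) by pos.
  rewrite (Rabs_pos_eq ((z + w) / _)) by lra.
  replace (2 * Rabs (w - z) / W ^ 3) with (Rabs (w - z) * (2 / W ^ 3)) by (field; lra). mul_l.
  replace ((z + w) / (w ^ 2 * z ^ 2)) with (/ (w * (w * z)) + / (z * (w * z)) - (/ (w * (w * z)) + / (z * (w * z)) - (z + w) / (w ^ 2 * z ^ 2))) by ring.
  replace ((z + w) / (w ^ 2 * z ^ 2)) with (/ (w * (w * z)) + / (z * (w * z))) by (field; lra).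
  assert (Hp : forall x, W <= x -> / (x * (w * z)) <= / W ^ 3).
  { intros x Hx. apply Rinv_le_contravar; [easy|]. simpl. rewrite Rmult_1_r. apply Rmult_le_compat; try nra. }
  pose proof (Hp w Hw). pose proof (Hp z Hz). unfold Rdiv. lra.
Qed.

Lemma amp_phi_bound v0 M s W w : 0 < M -> 0 < W -> W <= w -> 0 <= amp_phi v0 M s w <= M / W ^ 2.
Proof.
  intros HM HW Hw. unfold amp_phi. assert (H1 : 0 < W ^ 2) by now apply pow_lt. assert (H2 : W ^ 2 <= w ^ 2) by nra.
  assert (0 < M / w ^ 2) by pos. destruct (bump_range v0 (M * s / w ^ 2)). split; [pos|].
  rewrite <- (Rmult_1_r (M / W ^ 2)). apply Rmult_le_compat; try lra. mul_l. apply Rinv_le_contravar; lra.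
Qed.

(** The hypothesis on M s confines s to the heights that occur for w in [W, 2 W], and thereby the
    rate at which the argument of the bump varies with w. *)
Lemma amp_phi_lip v0 M s W w z : 0 < M -> 0 < W -> W <= w -> W <= z -> 0 <= s ->
  M * s <= 4 * (v0 + 1) * W ^ 2 -> 1 <= v0 ->
  Rabs (amp_phi v0 M s w - amp_phi v0 M s z) <= 10 * (v0 + 1) * M / W ^ 3 * Rabs (w - z).
Proof.
  intros HM HW Hw Hz Hs Hs1 Hv. unfold amp_phi. assert (H2 : 0 < W ^ 2) by now apply pow_lt.
  pose proof (inv_sq_diff W w z HW Hw Hz) as Hd. set (D := Rabs (w - z)) in *. assert (HD : 0 <= D) by apply Rabs_pos.
  set (bw := bump v0 (M * s / w ^ 2)). set (bz := bump v0 (M * s / z ^ 2)).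
  assert (Hb : Rabs (bw - bz) <= 8 * (v0 + 1) / W * D).
  { via bump_lip. replace (M * s / w ^ 2 - M * s / z ^ 2) with (M * s * (/ w ^ 2 - / z ^ 2)) by (unfold Rdiv; ring).
   rewrite Rabs_mult, (Rabs_pos_eq (M * s)) by pos. apply Rle_trans with (4 * (v0 + 1) * W ^ 2 * (2 * D / W ^ 3)).
   - apply Rmult_le_compat; [pos|pos|easy|easy].
   - right. field. lra. }
  replace (M / w ^ 2 * bw - M / z ^ 2 * bz) with (M * ((/ w ^ 2 - / z ^ 2) * bw) + M / z ^ 2 * (bw - bz)) by (unfold Rdiv; ring).
  via Rabs_triang. rewrite !Rabs_mult, (Rabs_pos_eq M) by lra. assert (Hz2 : 0 < M / z ^ 2 <= M / W ^ 2).
  { assert (W ^ 2 <= z ^ 2) by nra. split; [pos|]. mul_l. apply Rinv_le_contravar; lra. }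
  rewrite (Rabs_pos_eq (M / z ^ 2)) by lra. assert (Hbw : Rabs bw <= 1) by (rewrite Rabs_pos_eq; apply bump_range).
  assert (T1 : M * (Rabs (/ w ^ 2 - / z ^ 2) * Rabs bw) <= M * (2 * D / W ^ 3 * 1)).
  { mul_l. apply Rmult_le_compat; auto using Rabs_pos. }
  assert (T2 : M / z ^ 2 * Rabs (bw - bz) <= M / W ^ 2 * (8 * (v0 + 1) / W * D)).
  { apply Rmult_le_compat; auto using Rabs_pos; lra. }
  replace (M / W ^ 2 * (8 * (v0 + 1) / W * D)) with (M * D / W ^ 3 * (8 * (v0 + 1))) in T2 by (field; lra).
  replace (M * (2 * D / W ^ 3 * 1)) with (M * D / W ^ 3 * 2) in T1 by (field; lra).
  replace (10 * (v0 + 1) * M / W ^ 3 * D) with (M * D / W ^ 3 * (10 * (v0 + 1))) by (field; lra).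
  assert (0 <= M * D / W ^ 3) by pos. nra.
Qed.

(** Along the segment w changes by at most W, which turns the Lipschitz constant of order M/W^3 into
    a variation of order M/W^2. *)
Lemma amp_phi_bv v0 M s W p k a b : a <= b -> 0 < M -> 0 < W -> 1 <= v0 -> 0 <= s ->
  M * s <= 4 * (v0 + 1) * W ^ 2 -> (forall x, a <= x <= b -> W <= p + k * x <= 2 * W) ->
  bv (fun x => amp_phi v0 M s (p + k * x)) a b (10 * (v0 + 1) * M / W ^ 2).
Proof.
  intros Hab HM HW Hv Hs0 Hs Hw.

  apply (bv_lip _ _ _ _ (10 * (v0 + 1) * M / W ^ 3 * Rabs k)).
  - intros x Hx. destruct (amp_phi_bound v0 M s W (p + k * x) HM HW ltac:(apply Hw; lra)).
   rewrite Rabs_pos_eq by easy. unfold Rdiv in *. nra.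
  - intros x y Hx Hxy Hy. eapply Rle_trans; [apply (amp_phi_lip v0 M s W); try easy; apply Hw; lra|].
   replace (p + k * y - (p + k * x)) with (k * (y - x)) by ring. rewrite Rabs_mult, (Rabs_pos_eq (y - x)) by lra. right; ring.
  - assert (Hk : Rabs k * (b - a) <= W).
   { rewrite <- (Rabs_pos_eq (b - a)) by lra. rewrite <- Rabs_mult.
    pose proof (Hw a ltac:(lra)). pose proof (Hw b ltac:(lra)). apply Rabs_le. lra. }
   replace (10 * (v0 + 1) * M / W ^ 3 * Rabs k * (b - a)) with (10 * (v0 + 1) * M / W ^ 3 * (Rabs k * (b - a))) by ring.
   replace (10 * (v0 + 1) * M / W ^ 2) with (10 * (v0 + 1) * M / W ^ 3 * W) by (field; lra).
   apply Rmult_le_compat_l; [|easy]. apply Rmult_le_pos; [nra|pos].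
Qed.

Lemma amp_phi_cont v0 M s (f : R -> R) x : continuous f x -> 0 < f x -> continuous (fun x => amp_phi v0 M s (f x)) x.
Proof.
  intros Hf H. apply (continuous_comp f (amp_phi v0 M s)); [easy|]. unfold amp_phi.
  assert (C1 : continuous (fun w => / w ^ 2) (f x)).
  { apply continuous_inv; [|apply pow_nonzero; lra]. apply (ex_derive_continuous (fun w => w ^ 2)). auto_derive; easy. }
  apply continuous_Rmult; [apply continuous_Rmult; [apply continuous_const|exact C1]|].
  apply (continuous_comp (fun w => M * s / w ^ 2) (bump v0)); [|apply bump_cont].
  apply continuous_Rmult; [apply continuous_const|exact C1].
Qed.

Lemma phase_derive M (c K p : R) x : K <> 0 -> p + - K * x <> 0 ->
  is_derive (fun x => - M * (c + / (K * (p + - K * x)))) x (- (M * / (p + - K * x) ^ 2)).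
Proof.
  intros HK Hw. auto_derive.
  - apply Rmult_integral_contrapositive. easy.
  - field. easy.
Qed.

(** * Pairs of arcs on a horizontal line *)

(** With w = p - K x the factor 1/|K| of the density 1/(|K| w^2) is cancelled by dw = |K| dx. As a
    function of x the phase has derivative -M/w^2, in which K occurs only through w. *)
Definition line_fun (v0 M s c K p x : R) : C :=
  (RtoC (amp_phi v0 M s (p + - K * x) / (p + - K * x) ^ 2) * e (- M * (c + / (K * (p + - K * x)))))%C.

Lemma line_fun_cont v0 M s c K p x : K <> 0 -> 0 < p + - K * x -> ccont (line_fun v0 M s c K p) x.
Proof.
  intros HK Hw. assert (Cw : continuous (fun x => p + - K * x) x) by apply continuous_lin. apply ccont_amp.
  - apply continuous_Rmult; [now apply (amp_phi_cont v0 M s (fun x => p + - K * x))|].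
   apply continuous_inv; [|apply pow_nonzero; lra].
   apply (continuous_comp (fun x => p + - K * x) (fun w => w ^ 2)); [easy|].
   apply (ex_derive_continuous (fun w => w ^ 2)). auto_derive; easy.
  - apply (ccont_e (fun x => - M * (c + / (K * (p + - K * x))))).
   apply (ex_derive_continuous (fun x => - M * (c + / (K * (p + - K * x))))). eexists. apply phase_derive; [easy|lra].
Qed.

Lemma line_fun_norm v0 M s c K p x W : 0 < M -> 0 < W -> W <= p + - K * x ->
  Cmod (line_fun v0 M s c K p x) <= M / W ^ 4.
Proof.
  intros HM HW Hw. unfold line_fun. rewrite Cmod_mult, Cmod_e, Cmod_R, Rmult_1_r.
  destruct (amp_phi_bound v0 M s W _ HM HW Hw) as [B1 B2]. set (w := p + - K * x) in *.
  assert (H2 : 0 < W ^ 2) by now apply pow_lt. assert (W ^ 2 <= w ^ 2) by nra. assert (0 < / w ^ 2) by pos.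
  rewrite Rabs_pos_eq by pos. replace (M / W ^ 4) with (M / W ^ 2 * / W ^ 2) by (field; lra).
  apply Rmult_le_compat; try lra. apply Rinv_le_contravar; lra.
Qed.

Section Pair.

Variables (v0 M s W c K p c' K' p' a b : R).
Hypotheses (Hab : a <= b) (HM : 0 < M) (HW : 0 < W) (Hv : 1 <= v0) (Hs0 : 0 <= s)
  (Hs : M * s <= 4 * (v0 + 1) * W ^ 2) (HK : K <> 0) (HK' : K' <> 0)
  (Hw : forall x, a <= x <= b -> W <= p + - K * x <= 2 * W)
  (Hw' : forall x, a <= x <= b -> W <= p' + - K' * x <= 2 * W).

Let I := CInt (fun x => line_fun v0 M s c K p x * Cconj (line_fun v0 M s c' K' p' x))%C a b.
Let A x := amp_phi v0 M s (p + - K * x) * amp_phi v0 M s (p' + - K' * x).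
Let f x := - M * (c + / (K * (p + - K * x))) - - M * (c' + / (K' * (p' + - K' * x))).

Lemma pair_eq : I = CInt (fun x => RtoC (A x * / ((p + - K * x) ^ 2 * (p' + - K' * x) ^ 2)) * e (f x))%C a b.
Proof.
  apply CInt_ext; [easy|]. intros x Hx. unfold line_fun, f. rewrite <- e_conj_mult.
  set (w := p + - K * x). set (w' := p' + - K' * x).
  assert (Hww : 0 < w /\ 0 < w') by (unfold w, w'; specialize (Hw x); specialize (Hw' x); lra).
  replace (A x * / (w ^ 2 * w' ^ 2)) with ((amp_phi v0 M s w / w ^ 2) * (amp_phi v0 M s w' / w' ^ 2)) by
   (unfold A; fold w w'; field; lra).
  rewrite RtoC_mult. set (E1 := e _). set (E2 := e _). set (r1 := _ / w ^ 2). set (r2 := _ / w' ^ 2).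
  replace (Cconj (RtoC r2 * E2)) with (RtoC r2 * Cconj E2)%C; [ring|]. unfold Cconj, Cmult, RtoC; simpl. f_equal; ring.
Qed.

Lemma pair_trivial : Cmod I <= (M / W ^ 4) ^ 2 * (b - a).
Proof.
  apply CInt_norm_const; [easy| |].
  - intros x Hx. specialize (Hw x Hx). specialize (Hw' x Hx). rewrite Cmod_mult, Cmod_conj.
   replace ((M / W ^ 4) ^ 2) with (M / W ^ 4 * (M / W ^ 4)) by ring.
   apply Rmult_le_compat; try apply Cmod_ge_0; apply line_fun_norm; lra.
  - apply exC_cont; [easy|]. intros x Hx. specialize (Hw x Hx). specialize (Hw' x Hx).
   apply ccont_mult; [|apply ccont_conj]; apply line_fun_cont; easy || lra.
Qed.

Lemma pair_amp_bv : bv A a b (200 * (v0 + 1) ^ 2 * M ^ 2 / W ^ 4).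
Proof.
  replace (200 * (v0 + 1) ^ 2 * M ^ 2 / W ^ 4) with (2 * (10 * (v0 + 1) * M / W ^ 2) * (10 * (v0 + 1) * M / W ^ 2)) by (field; lra).
  apply bv_mult; [easy| |]; now apply amp_phi_bv.
Qed.

Lemma pair_amp_cont x : a <= x <= b -> continuous A x.
Proof.
  intros Hx. specialize (Hw x Hx). specialize (Hw' x Hx).
  apply continuous_Rmult; (apply amp_phi_cont; [apply continuous_lin|lra]).
Qed.

Lemma pair_phase x : a <= x <= b -> is_derive f x (M * (/ (p' + - K' * x) ^ 2 - / (p + - K * x) ^ 2)).
Proof.
  intros Hx. specialize (Hw x Hx). specialize (Hw' x Hx). replace (M * (/ (p' + - K' * x) ^ 2 - / (p + - K * x) ^ 2)) with
   (minus (- (M * / (p + - K * x) ^ 2)) (- (M * / (p' + - K' * x) ^ 2))) by (unfold minus, plus, opp; simpl; ring).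
  apply (is_derive_minus (V := R_NormedModule)); apply phase_derive; easy || lra.
Qed.

(** The case of an arc and its own translate: w and w' differ by the constant p - p', so the phases
    are separated throughout. *)
Lemma pair_parallel : K = K' -> p <> p' -> Cmod I <= 1600 * (v0 + 1) ^ 2 * M / (W ^ 5 * Rabs (p - p')).
Proof.
  intros EK Hp. assert (Hpp : 0 < Rabs (p - p')) by (apply Rabs_pos_lt; lra). rewrite pair_eq.
  eapply Rle_trans; [apply (osc_separated p (- K) p' (- K') M W (Rabs (p - p')) (200 * (v0 + 1) ^ 2 * M ^ 2 / W ^ 4) A f a b); try easy|].
  - intros x Hx. specialize (Hw x Hx). specialize (Hw' x Hx). lra.
  - rewrite EK. destruct (Rle_dec 0 (p - p')).
   + left. intros x _. rewrite Rabs_pos_eq by easy. lra.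
   + right. intros x _. rewrite Rabs_left by lra. lra.
  - apply pair_phase.
  - apply pair_amp_bv.
  - apply pair_amp_cont.
  - right. field. lra.
Qed.

(** The radius sqrt(W^3/(M |K - K'|)) balances the two terms of [osc_saddle]. The constant is 16 *
    200 + 2, where 200 stems from [pair_amp_bv]. *)
Lemma pair_transversal : K <> K' ->
  Cmod I <= 3202 * (v0 + 1) ^ 2 * (M ^ 2 / W ^ 8) * sqrt (W ^ 3 / M) / sqrt (Rabs (K - K')).
Proof.
  intros HKK. assert (Hka : 0 < Rabs (K - K')) by (apply Rabs_pos_lt; lra). set (k := Rabs (K - K')) in *.
  assert (HW3 : 0 < W ^ 3 / M) by pos. set (r := sqrt (W ^ 3 / M)). assert (Hr : 0 < r) by now apply sqrt_lt_R0.
  assert (Hk : 0 < sqrt k) by now apply sqrt_lt_R0. assert (Hr2 : r * r = W ^ 3 / M) by (apply sqrt_sqrt; lra).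
  assert (Hk2 : sqrt k * sqrt k = k) by (apply sqrt_sqrt; lra). rewrite pair_eq.
  eapply Rle_trans; [apply (osc_saddle p (- K) p' (- K') M W (200 * (v0 + 1) ^ 2 * M ^ 2 / W ^ 4) ((M / W ^ 4) ^ 2) (r / sqrt k) A f a b); try easy|].
  - pos.
  - lra.
  - intros x Hx. specialize (Hw x Hx). specialize (Hw' x Hx). lra.
  - apply pair_phase.
  - apply pair_amp_bv.
  - apply pair_amp_cont.
  - intros x Hx. pose proof (Hw x Hx). pose proof (Hw' x Hx). unfold A.
   destruct (amp_phi_bound v0 M s W (p + - K * x) HM HW ltac:(lra)) as [B1 B2].
   destruct (amp_phi_bound v0 M s W (p' + - K' * x) HM HW ltac:(lra)) as [B3 B4].
   set (w := p + - K * x) in *. set (w' := p' + - K' * x) in *. assert (H2 : 0 < W ^ 2) by now apply pow_lt.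
   assert (W ^ 2 <= w ^ 2) by nra. assert (W ^ 2 <= w' ^ 2) by nra. assert (Hinv : 0 < / (w ^ 2 * w' ^ 2)) by pos.
   rewrite Rabs_pos_eq by pos. replace ((M / W ^ 4) ^ 2) with (M / W ^ 2 * (M / W ^ 2) * / (W ^ 2 * W ^ 2)) by (field; lra).
   apply Rmult_le_compat; [pos|lra|apply Rmult_le_compat; lra|].
   apply Rinv_le_contravar; [pos|]. apply Rmult_le_compat; lra.
  - replace (- K - - K') with (- (K - K')) by ring. rewrite Rabs_Ropp. fold k.
   set (V := (v0 + 1) ^ 2). assert (HV : 1 <= V) by (unfold V; nra).
   assert (Ek : forall l t u, t * t = l -> 0 < t -> l * (u / t) = t * u) by (intros l t u <- Ht; field; lra).
   rewrite (Ek k (sqrt k) r Hk2 Hk).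
   assert (E1 : 16 * (200 * V * M ^ 2 / W ^ 4) / (M * W * (sqrt k * r)) = 3200 * V * (M ^ 2 / W ^ 8) * r / sqrt k).
   { assert (Ei : / r = r * (M / W ^ 3)).
    { apply Rmult_eq_reg_l with r; [|lra]. rewrite Rinv_r by lra. rewrite <- Rmult_assoc, Hr2. field. lra. }
    replace (16 * (200 * V * M ^ 2 / W ^ 4) / (M * W * (sqrt k * r))) with
     (16 * (200 * V * M ^ 2 / W ^ 4) / (M * W * sqrt k) * / r) by (field; lra).
    rewrite Ei. field. lra. }
   rewrite E1. assert (E2 : 2 * (r / sqrt k) * (M / W ^ 4) ^ 2 = 2 * (M ^ 2 / W ^ 8) * r / sqrt k) by (field; lra).
   rewrite E2. assert (Hpos : 0 <= (M ^ 2 / W ^ 8) * r / sqrt k).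
   { pos. }
   replace (3200 * V * (M ^ 2 / W ^ 8) * r / sqrt k) with (3200 * V * ((M ^ 2 / W ^ 8) * r / sqrt k)) by (unfold Rdiv; ring).
   replace (2 * (M ^ 2 / W ^ 8) * r / sqrt k) with (2 * ((M ^ 2 / W ^ 8) * r / sqrt k)) by (unfold Rdiv; ring).
   replace (3202 * V * (M ^ 2 / W ^ 8) * r / sqrt k) with (3202 * V * ((M ^ 2 / W ^ 8) * r / sqrt k)) by (unfold Rdiv; ring).
   nra.
Qed.

End Pair.

(** * Positions of the arcs on the horizontal line *)

Definition arc_lo (A : arc) : R :=
  Rmin ((IZR (arc_a A) - arc_w1 A) / IZR (arc_K A)) ((IZR (arc_a A) - arc_w2 A) / IZR (arc_K A)).
Definition arc_hi (A : arc) : R :=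
  Rmax ((IZR (arc_a A) - arc_w1 A) / IZR (arc_K A)) ((IZR (arc_a A) - arc_w2 A) / IZR (arc_K A)).

Lemma arc_lo_hi A : arc_ok A -> 0 < arc_p1 A ->
  (0 < IZR (arc_K A) /\ arc_lo A = (IZR (arc_a A) - arc_w2 A) / IZR (arc_K A) /\
   arc_hi A = (IZR (arc_a A) - arc_w1 A) / IZR (arc_K A) /\ arc_k A = IZR (arc_K A)) \/
  (IZR (arc_K A) < 0 /\ arc_lo A = (IZR (arc_a A) - arc_w1 A) / IZR (arc_K A) /\
   arc_hi A = (IZR (arc_a A) - arc_w2 A) / IZR (arc_K A) /\ arc_k A = - IZR (arc_K A)).
Proof.
  intros Hok Hp. pose proof (arc_K_neq A Hok) as HK. destruct (arc_w_pos A Hok Hp) as [H1 H2].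
  unfold arc_lo, arc_hi, arc_k. set (K := IZR (arc_K A)) in *. set (a := IZR (arc_a A)).
  destruct (Rlt_dec 0 K) as [Hpos|Hneg].
  - left. assert (Hi : 0 < / K) by now apply Rinv_0_lt_compat. assert ((a - arc_w2 A) / K <= (a - arc_w1 A) / K) by nra.
   rewrite Rmin_right, Rmax_left, Rabs_pos_eq by lra. easy.
  - right. assert (HK' : K < 0) by lra. assert (Hi : / K < 0) by now apply Rinv_lt_0_compat.
   assert ((a - arc_w1 A) / K <= (a - arc_w2 A) / K) by (unfold Rdiv; nra).
   rewrite Rmin_left, Rmax_right, Rabs_left by lra. easy.
Qed.

Lemma arc_lo_hi_len A : arc_ok A -> 0 < arc_p1 A ->
  arc_lo A <= arc_hi A /\ arc_hi A - arc_lo A = (arc_w2 A - arc_w1 A) / arc_k A.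
Proof.
  intros Hok Hp. destruct (arc_w_pos A Hok Hp) as [H1 H2]. pose proof (arc_k_pos A Hok) as Hk.
  assert (E : arc_hi A - arc_lo A = (arc_w2 A - arc_w1 A) / arc_k A).
  { destruct (arc_lo_hi A Hok Hp) as [(G1 & -> & -> & ->)|(G1 & -> & -> & ->)]; field; lra. }
  split; [|easy]. assert (0 <= (arc_w2 A - arc_w1 A) / arc_k A); [|lra]. apply Rmult_le_pos; [lra|pos].
Qed.

Lemma arc_w_of_x A x : arc_ok A -> 0 < arc_p1 A -> arc_lo A <= x <= arc_hi A ->
  arc_w1 A <= IZR (arc_a A) + - IZR (arc_K A) * x <= arc_w2 A.
Proof.
  intros Hok Hp Hx. destruct (arc_lo_hi A Hok Hp) as [(G1 & G2 & G3 & G4)|(G1 & G2 & G3 & G4)];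
  rewrite G2, G3 in Hx; set (K := IZR (arc_K A)) in *; set (a := IZR (arc_a A)) in *.
  - assert (E1 : (a - arc_w2 A) / K * K = a - arc_w2 A) by (field; lra).
   assert (E2 : (a - arc_w1 A) / K * K = a - arc_w1 A) by (field; lra). nra.
  - assert (E1 : (a - arc_w2 A) / K * K = a - arc_w2 A) by (field; lra).
   assert (E2 : (a - arc_w1 A) / K * K = a - arc_w1 A) by (field; lra). nra.
Qed.

Lemma arc_lo_hi_bound A W : arc_ok A -> 0 < arc_p1 A -> arc_w2 A <= 2 * W -> Rabs (IZR (arc_a A)) <= W ->
  - (3 * W) <= arc_lo A /\ arc_hi A <= 3 * W.
Proof.
  intros Hok Hp Hw Ha. destruct (arc_w_pos A Hok Hp) as [H1 H2]. pose proof (arc_k_pos A Hok) as Hk.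
  destruct (arc_lo_hi_len A Hok Hp) as [H3 _]. apply Rabs_le_between in Ha.
  assert (P : forall x, arc_lo A <= x <= arc_hi A -> - (3 * W) <= x <= 3 * W).
  { intros x Hx. pose proof (arc_w_of_x A x Hok Hp Hx) as Hwx.
   destruct (arc_lo_hi A Hok Hp) as [(G1 & G2 & G3 & G4)|(G1 & G2 & G3 & G4)]; rewrite G4 in Hk; nra. }
  split; apply P; lra.
Qed.

(* The substitution is s = v w^2 / M. *)
Definition cusp_fun (psi : C -> C) (v0 M : R) (A : arc) (w s : R) : C :=
  (RtoC (/ (arc_k A * w ^ 2)) * (e (- M * arc_x A w) *
   (RtoC (amp_phi v0 M s w) * psi ((IZR (arc_a A) - w) / IZR (arc_K A), s)%R)))%C.

Definition arc_line (v0 M s : R) (A : arc) (d : nat) (x : R) : C :=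
  line_fun v0 M s (IZR (arc_H A) / IZR (arc_K A)) (IZR (arc_K A)) (IZR (arc_a A) - IZR (arc_K A) * INR d) x.

(** The substitution w = a - K x, followed by a translation by d that psi does not notice; only the
    constant term of w is changed, by K d. *)
Lemma cusp_fun_line psi C0 v0 M A s d : tame_form psi C0 -> 0 < M -> arc_ok A -> 0 < arc_p1 A -> 0 < s ->
  CInt (fun w => cusp_fun psi v0 M A w s) (arc_w1 A) (arc_w2 A) =
  CInt (fun x => psi (x, s) * arc_line v0 M s A d x)%C (arc_lo A - INR d) (arc_hi A - INR d).
Proof.
  intros Hp HM Hok Hp1 Hs. pose proof (arc_K_neq A Hok) as HK. pose proof (arc_k_pos A Hok) as Hk.
  destruct (arc_w_pos A Hok Hp1) as [H1 H2]. destruct (arc_lo_hi_len A Hok Hp1) as [H3 H4].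
  set (K := IZR (arc_K A)) in *. set (a := IZR (arc_a A)) in *. set (c := IZR (arc_H A) / K).
  set (F := fun x => (psi (x, s) * line_fun v0 M s c K a x)%C).
  assert (HF : is_CInt F (arc_lo A) (arc_hi A) (CInt F (arc_lo A) (arc_hi A))).
  { apply exC_cont; [easy|]. intros x Hx. pose proof (arc_w_of_x A x Hok Hp1 Hx) as Hwx. fold a K in Hwx.
   apply ccont_mult; [now apply (tame_cont_x psi C0)|apply line_fun_cont; easy || lra]. }
  transitivity (CInt F (arc_lo A) (arc_hi A)).
  - set (W := fun w => cusp_fun psi v0 M A w s). symmetry.
   assert (Wx : forall x, arc_lo A < x < arc_hi A -> (RtoC (arc_k A) * W (- K * x + a)%R)%C = F x).
   { intros x Hx. pose proof (arc_w_of_x A x Hok Hp1 ltac:(lra)) as Hwx. fold a K in Hwx.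
    unfold W, cusp_fun, F, line_fun, arc_x. fold K a c. replace (- K * x + a) with (a + - K * x) by ring.
    set (w := a + - K * x) in *. replace ((a - w) / K) with x by (unfold w; field; easy).
    replace (amp_phi v0 M s w / w ^ 2) with (arc_k A * (/ (arc_k A * w ^ 2) * amp_phi v0 M s w)) by (field; lra).
    rewrite !RtoC_mult. ring. }
   assert (Cw : forall w, arc_w1 A <= w <= arc_w2 A -> ccont W w).
   { intros w Hw. unfold W, cusp_fun. apply ccont_amp; [apply inv_kw2_cont; lra|]. apply ccont_mult.
    - apply (ccont_e (fun w => - M * arc_x A w)). apply continuous_Rmult; [apply continuous_const|apply arc_x_cont; [easy|lra]].
    - apply ccont_amp; [apply (amp_phi_cont v0 M s (fun w => w)); [apply continuous_id|lra]|].
     apply (ccont_comp (fun x => psi (x, s)) (fun w => (IZR (arc_a A) - w) / IZR (arc_K A))).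
     + now apply (tame_cont_x psi C0).
     + apply continuous_Rmult; [|apply continuous_const].
      apply continuous_Rminus; [apply continuous_const|apply continuous_id]. }
   assert (EW : exC W (arc_w1 A) (arc_w2 A)) by now apply exC_cont.
   destruct (arc_lo_hi A Hok Hp1) as [(G1 & G2 & G3 & G4)|(G1 & G2 & G3 & G4)]; fold K a in G1, G2, G3, G4.
   + assert (E1 : - K * arc_lo A + a = arc_w2 A) by (rewrite G2; field; easy).
    assert (E2 : - K * arc_hi A + a = arc_w1 A) by (rewrite G3; field; easy).
    pose proof (is_CInt_comp_lin W (- K) a (arc_lo A) (arc_hi A) (- CInt W (arc_w1 A) (arc_w2 A))%C) as Hc.
    rewrite E1, E2 in Hc. specialize (Hc (is_CInt_swap _ _ _ _ EW)). apply (is_CInt_scal (RtoC (-1))) in Hc.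
    apply is_CInt_unique. replace (CInt W (arc_w1 A) (arc_w2 A)) with (RtoC (-1) * - CInt W (arc_w1 A) (arc_w2 A))%C by ring.
    eapply is_CInt_ext; [easy| |exact Hc]. intros x Hx. cbv beta. rewrite <- Wx by easy. rewrite Cmult_assoc, <- RtoC_mult.
    rewrite G4. f_equal. f_equal. ring.
   + assert (E1 : - K * arc_lo A + a = arc_w1 A) by (rewrite G2; field; easy).
    assert (E2 : - K * arc_hi A + a = arc_w2 A) by (rewrite G3; field; easy).
    pose proof (is_CInt_comp_lin W (- K) a (arc_lo A) (arc_hi A) (CInt W (arc_w1 A) (arc_w2 A))) as Hc.
    rewrite E1, E2 in Hc. specialize (Hc EW).
    apply is_CInt_unique. eapply is_CInt_ext; [easy| |exact Hc]. intros x Hx. cbv beta. rewrite <- Wx by easy.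
    now rewrite G4.
  - symmetry. pose proof (is_CInt_comp_lin F 1 (INR d) (arc_lo A - INR d) (arc_hi A - INR d) (CInt F (arc_lo A) (arc_hi A))) as Hc.
   replace (1 * (arc_lo A - INR d) + INR d) with (arc_lo A) in Hc by ring.
   replace (1 * (arc_hi A - INR d) + INR d) with (arc_hi A) in Hc by ring.
   specialize (Hc HF). apply is_CInt_unique. eapply is_CInt_ext; [lra| |exact Hc].
   intros x Hx. cbv beta. rewrite Cmult_1_l, Rmult_1_l. unfold F, arc_line. fold K a c.
   rewrite (INR_IZR_INZ d), (tame_periodic _ _ Hp) by easy. f_equal.
   unfold line_fun. replace (a + - K * (x + IZR (Z.of_nat d))) with (a - K * IZR (Z.of_nat d) + - K * x) by ring. easy.
Qed.

Definition off_diag (v0 M W : R) : R := 3202 * (v0 + 1) ^ 2 * (M ^ 2 / W ^ 8) * sqrt (W ^ 3 / M).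

Definition overlap (P Q : arc * nat) : Prop :=
  Rmax (arc_lo (fst P) - INR (snd P)) (arc_lo (fst Q) - INR (snd Q)) <=
  Rmin (arc_hi (fst P) - INR (snd P)) (arc_hi (fst Q) - INR (snd Q)).

(** In the families considered K determines the arc, so that comparing K separates an arc and its
    translates from the other pairs. For the latter it matters that pairs without overlap contribute
    nothing. *)
Definition pair_bd (v0 M W : R) (P Q : arc * nat) : R :=
  if Z.eq_dec (arc_K (fst P)) (arc_K (fst Q)) then
   if Nat.eq_dec (snd Q) (snd P) then (M / W ^ 4) ^ 2 * (W / arc_k (fst P))
   else 1600 * (v0 + 1) ^ 2 * M / W ^ 5 * / arc_k (fst P) * / Rabs (INR (snd P) - INR (snd Q))
  else if Rle_dec (Rmax (arc_lo (fst P) - INR (snd P)) (arc_lo (fst Q) - INR (snd Q)))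
       (Rmin (arc_hi (fst P) - INR (snd P)) (arc_hi (fst Q) - INR (snd Q)))
   then off_diag v0 M W / sqrt (Rabs (IZR (arc_K (fst P)) - IZR (arc_K (fst Q)))) else 0.

(** Cost per translate, with S1 for the sum of 1/|K| and S2 for the sums of |K - K'|^(-1/2). The
    three terms stand for the diagonal, for an arc against its other translates, and for pairs of
    different arcs. *)
Definition line_sum (v0 M W S1 S2 : R) (H : nat) : R :=
  S1 * ((M / W ^ 4) ^ 2 * W + 3200 * (v0 + 1) ^ 2 * M / W ^ 5 * harm H + 8 * W * off_diag v0 M W * S2).

(** * The double sum over arcs and translates *)

Section Line.

Variables (psi : C -> C) (C0 v0 M W s S1 S2 : R) (l : list arc) (H : nat).
Hypotheses (Hp : tame_form psi C0) (HM : 0 < M) (HW : 1 <= W) (Hv : 1 <= v0) (Hs : 0 < s)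
  (HMs : M * s <= 4 * (v0 + 1) * W ^ 2)
  (Hl : forall A, In A l -> arc_ok A /\ 0 < arc_p1 A /\ W <= arc_w1 A /\ arc_w2 A <= 2 * W /\
   arc_k A <= W /\ Rabs (IZR (arc_a A)) <= W)
  (HND : NoDup l) (HKinj : forall A B, In A l -> In B l -> arc_K A = arc_K B -> A = B)
  (HS1 : rsum (fun A => / arc_k A) l <= S1)
  (HS2 : forall A, In A l -> rsum (fun B => if Z.eq_dec (arc_K A) (arc_K B) then 0
    else / sqrt (Rabs (IZR (arc_K A) - IZR (arc_K B)))) l <= S2)
  (HS20 : 0 <= S2) (HH : 3 * W <= INR H).

Lemma off_diag_nonneg : 0 <= off_diag v0 M W.
Proof.
  unfold off_diag. assert (0 < M ^ 2 / W ^ 8) by pos. generalize (sqrt_pos (W ^ 3 / M)) (pow2_ge_0 (v0 + 1)). intros.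
  apply Rmult_le_pos; [|easy]. apply Rmult_le_pos; lra.
Qed.

Lemma pair_bd_spec P Q : In P (list_prod l (seq 0 H)) -> In Q (list_prod l (seq 0 H)) ->
  0 <= pair_bd v0 M W P Q /\
  (overlap P Q -> Cmod (CInt (fun x => arc_line v0 M s (fst P) (snd P) x * Cconj (arc_line v0 M s (fst Q) (snd Q) x))%C
   (Rmax (arc_lo (fst P) - INR (snd P)) (arc_lo (fst Q) - INR (snd Q)))
   (Rmin (arc_hi (fst P) - INR (snd P)) (arc_hi (fst Q) - INR (snd Q)))) <= pair_bd v0 M W P Q).
Proof.
  destruct P as [A d], Q as [B d']. intros HP HQ. apply in_prod_iff in HP, HQ. destruct HP as [HA _], HQ as [HB _].
  destruct (Hl A HA) as (A1 & A2 & A3 & A4 & A5 & A6). destruct (Hl B HB) as (B1 & B2 & B3 & B4 & B5 & B6).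
  pose proof (arc_k_pos A A1) as kA. pose proof (arc_K_neq A A1) as KA. pose proof (arc_K_neq B B1) as KB.
  unfold overlap, pair_bd. simpl fst; simpl snd.
  set (lo := Rmax (arc_lo A - INR d) (arc_lo B - INR d')). set (hi := Rmin (arc_hi A - INR d) (arc_hi B - INR d')).
  assert (RA : forall x, lo <= x <= hi -> arc_lo A <= x + INR d <= arc_hi A).
  { intros x Hx. generalize (Rmax_l (arc_lo A - INR d) (arc_lo B - INR d')) (Rmin_l (arc_hi A - INR d) (arc_hi B - INR d')).
   fold lo hi. lra. }
  assert (RB : forall x, lo <= x <= hi -> arc_lo B <= x + INR d' <= arc_hi B).
  { intros x Hx. generalize (Rmax_r (arc_lo A - INR d) (arc_lo B - INR d')) (Rmin_r (arc_hi A - INR d) (arc_hi B - INR d')).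
   fold lo hi. lra. }
  assert (WA : forall x, lo <= x <= hi -> W <= IZR (arc_a A) - IZR (arc_K A) * INR d + - IZR (arc_K A) * x <= 2 * W).
  { intros x Hx. pose proof (arc_w_of_x A (x + INR d) A1 A2 (RA x Hx)). lra. }
  assert (WB : forall x, lo <= x <= hi -> W <= IZR (arc_a B) - IZR (arc_K B) * INR d' + - IZR (arc_K B) * x <= 2 * W).
  { intros x Hx. pose proof (arc_w_of_x B (x + INR d') B1 B2 (RB x Hx)). lra. }
  assert (HW0 : 0 < W) by lra. assert (Hs' : 0 <= s) by lra. pose proof off_diag_nonneg as Hod.

  destruct (Z.eq_dec (arc_K A) (arc_K B)) as [EK|EK].
  - pose proof (HKinj A B HA HB EK) as EAB. subst B. destruct (Nat.eq_dec d' d) as [Ed|Ed].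
   + split.
    * pos.
    * intros Hov. unfold arc_line. eapply Rle_trans; [apply (pair_trivial v0 M s W _ _ _ _ _ _ lo hi); easy|]. mul_l.
     destruct (arc_lo_hi_len A A1 A2) as [L1 L2]. pose proof (RA lo ltac:(lra)). pose proof (RA hi ltac:(lra)).
     apply Rle_trans with (arc_hi A - arc_lo A); [lra|]. rewrite L2. mul_r. lra.
   + assert (Hdd : INR d - INR d' <> 0) by (intros E; apply Ed, INR_eq; lra).
    assert (Hda : 0 < Rabs (INR d - INR d')) by now apply Rabs_pos_lt. assert (Hcst : 0 < 1600 * (v0 + 1) ^ 2 * M / W ^ 5).
    { pos. }
    split.
    * pos.
    * intros Hov. unfold arc_line. eapply Rle_trans; [apply (pair_parallel v0 M s W _ _ _ _ _ _ lo hi); try easy|].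
     -- intros E. apply Hdd. apply Rmult_eq_reg_l with (IZR (arc_K A)); lra.
     -- right. replace (IZR (arc_a A) - IZR (arc_K A) * INR d - (IZR (arc_a A) - IZR (arc_K A) * INR d')) with
       (- (IZR (arc_K A) * (INR d - INR d'))) by ring.
      rewrite Rabs_Ropp, Rabs_mult. fold (arc_k A). field.
 repeat split; lra.
  - assert (HKK : IZR (arc_K A) <> IZR (arc_K B)) by (intros E; now apply EK, eq_IZR).
   assert (Hka : 0 < sqrt (Rabs (IZR (arc_K A) - IZR (arc_K B)))) by (apply sqrt_lt_R0, Rabs_pos_lt; lra).
   destruct (Rle_dec lo hi) as [Hle|Hle].
   + split; [apply Rmult_le_pos; [easy|pos]|]. intros _. unfold arc_line.
    apply (pair_transversal v0 M s W _ _ _ _ _ _ lo hi); easy.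
   + split; [lra|]. intros Hov. easy.
Qed.

Lemma row_same A d : In A l -> (d < H)%nat ->
  rsum (fun d' => pair_bd v0 M W (A, d) (A, d')) (seq 0 H) <=
   / arc_k A * ((M / W ^ 4) ^ 2 * W + 3200 * (v0 + 1) ^ 2 * M / W ^ 5 * harm H).
Proof.
  intros HA Hd. destruct (Hl A HA) as (A1 & _). pose proof (arc_k_pos A A1) as kA. assert (Hik : 0 < / arc_k A) by pos.
  set (c1 := 1600 * (v0 + 1) ^ 2 * M / W ^ 5). set (D := (M / W ^ 4) ^ 2 * W * / arc_k A). assert (Hc1 : 0 < c1).
  { unfold c1. apply Rdiv_lt_0_compat; [|pos]. repeat apply Rmult_lt_0_compat; try lra. }
  assert (E : rsum (fun d' => pair_bd v0 M W (A, d) (A, d')) (seq 0 H) =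
   rsum (fun d' => if Nat.eq_dec d' d then D else 0) (seq 0 H) +
   c1 * / arc_k A * rsum (fun i => if Nat.eq_dec i d then 0 else / Rabs (INR d - INR i)) (seq 0 H)).
  { rewrite <- rsum_scal, <- rsum_plus. apply rsum_ext. intros i _. unfold pair_bd. simpl fst; simpl snd.
   destruct (Z.eq_dec (arc_K A) (arc_K A)); [|easy]. destruct (Nat.eq_dec i d).
   - unfold D, Rdiv. ring.
   - unfold c1, Rdiv. ring. }
  rewrite E. pose proof (sum_inv_dist H d Hd) as HS. assert (HD : 0 <= D).
  { unfold D. apply Rmult_le_pos; [|lra]. apply Rmult_le_pos; [pos|lra]. }
  assert (H1 : rsum (fun d' => if Nat.eq_dec d' d then D else 0) (seq 0 H) <= D * (0 + 1)).
  { apply (count_interval H (INR d) D 0); [easy|lra| |].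
   - intros i. destruct (Nat.eq_dec i d); lra.
   - intros i Hi. destruct (Nat.eq_dec i d) as [->|]; [lra|easy]. }
  assert (H2 : c1 * / arc_k A * rsum (fun i => if Nat.eq_dec i d then 0 else / Rabs (INR d - INR i)) (seq 0 H) <=
   c1 * / arc_k A * (2 * harm H)) by (mul_l; easy).
  replace (/ arc_k A * ((M / W ^ 4) ^ 2 * W + 3200 * (v0 + 1) ^ 2 * M / W ^ 5 * harm H)) with (D * (0 + 1) + c1 * / arc_k A * (2 * harm H)).
  - lra.
  - unfold D, c1, Rdiv. ring.
Qed.

(** Translates of B that meet a given translate of A correspond to integers in an interval whose
    length is the sum of the two lengths. The additional 1 in the count is absorbed because the
    denominators are at most W. *)
Lemma row_other A B d : In A l -> In B l -> arc_K A <> arc_K B ->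
  rsum (fun d' => pair_bd v0 M W (A, d) (B, d')) (seq 0 H) <=
   off_diag v0 M W / sqrt (Rabs (IZR (arc_K A) - IZR (arc_K B))) * (2 * W * (/ arc_k A + / arc_k B)).
Proof.
  intros HA HB EK. destruct (Hl A HA) as (A1 & A2 & A3 & A4 & A5 & A6). destruct (Hl B HB) as (B1 & B2 & B3 & B4 & B5 & B6).
  pose proof (arc_k_pos A A1) as kA. pose proof (arc_k_pos B B1) as kB. pose proof off_diag_nonneg as Hod.
  assert (HKK : IZR (arc_K A) <> IZR (arc_K B)) by (intros E; now apply EK, eq_IZR).
  assert (Hka : 0 < sqrt (Rabs (IZR (arc_K A) - IZR (arc_K B)))) by (apply sqrt_lt_R0, Rabs_pos_lt; lra).
  set (c := off_diag v0 M W / sqrt (Rabs (IZR (arc_K A) - IZR (arc_K B)))).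
  assert (Hc : 0 <= c) by (apply Rmult_le_pos; [easy|pos]).
  destruct (arc_lo_hi_len A A1 A2) as [LA1 LA2]. destruct (arc_lo_hi_len B B1 B2) as [LB1 LB2].
  set (ell := (arc_hi A - arc_lo A) + (arc_hi B - arc_lo B)). via (count_interval H (arc_lo B - arc_hi A + INR d) c ell).
  - easy.
  - unfold ell; lra.
  - intros i. unfold pair_bd. simpl fst; simpl snd. destruct (Z.eq_dec _ _); [easy|]. destruct (Rle_dec _ _); fold c; lra.
  - intros i. unfold pair_bd. simpl fst; simpl snd. destruct (Z.eq_dec _ _); [easy|].
   destruct (Rle_dec _ _) as [Hle|Hle]; [|lra]. intros _.
   generalize (Rmax_l (arc_lo A - INR d) (arc_lo B - INR i)) (Rmax_r (arc_lo A - INR d) (arc_lo B - INR i))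
    (Rmin_l (arc_hi A - INR d) (arc_hi B - INR i)) (Rmin_r (arc_hi A - INR d) (arc_hi B - INR i)). unfold ell. lra.
  - mul_l. unfold ell. rewrite LA2, LB2.
   assert (P : forall A, arc_w2 A - arc_w1 A <= W -> 1 <= arc_k A -> (arc_w2 A - arc_w1 A) / arc_k A <= W * / arc_k A).
   { intros D H1 H2. mul_r; easy. }
   pose proof (P A ltac:(lra) kA). pose proof (P B ltac:(lra) kB). assert (1 <= W * / arc_k A).
   { apply Rmult_le_reg_r with (arc_k A); [lra|]. rewrite Rmult_assoc, Rinv_l by lra. lra. }

   lra.
Qed.

Lemma rsum_single {T} (m : list T) (x : T) (g : T -> R) c : 0 <= c -> NoDup m ->
  (forall y, In y m -> y <> x -> g y = 0) -> (forall y, g y <= c) -> rsum g m <= c.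
Proof.
  intros Hc Hm Hg Hgc. induction m as [|y m IH]; simpl; [easy|]. inversion Hm as [|? ? N1 N2]; subst.
  destruct (Classical_Prop.classic (y = x)) as [->|Hne].
  - assert (E : rsum g m = 0).
   { rewrite (rsum_ext g (fun _ => 0) m); [rewrite rsum_const; ring|]. intros z Hz. apply Hg; [now right|]. intros ->; easy. }
   rewrite E. specialize (Hgc x). lra.
  - rewrite (Hg y) by (easy || now left). rewrite Rplus_0_l. apply IH; [easy|]. intros; apply Hg; [now right|easy].
Qed.

(** By symmetry the sum over A and B of (1/k_A + 1/k_B) |K_A - K_B|^(-1/2) is twice the sum with
    1/k_A alone, whose inner sum is bounded by S2 and whose outer sum by S1. *)
Lemma total_bound : rsum (fun P => rsum (pair_bd v0 M W P) (list_prod l (seq 0 H))) (list_prod l (seq 0 H)) <=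
  INR H * line_sum v0 M W S1 S2 H.
Proof.
  pose proof off_diag_nonneg as Hod. pose proof (harm_nonneg H) as Hh.
  set (Dg := (M / W ^ 4) ^ 2 * W + 3200 * (v0 + 1) ^ 2 * M / W ^ 5 * harm H). assert (HDg : 0 <= Dg).
  { unfold Dg. apply Rplus_le_le_0_compat.
   - pos.
   - apply Rmult_le_pos; [|easy]. apply Rmult_le_pos; [|pos]. repeat apply Rmult_le_pos; try lra. }
  set (g := fun A B => if Z.eq_dec (arc_K A) (arc_K B) then 0 else / sqrt (Rabs (IZR (arc_K A) - IZR (arc_K B)))).
  assert (Hg0 : forall A B, 0 <= g A B).
  { intros A B. unfold g. destruct (Z.eq_dec _ _) as [E|E]; [lra|]. left. apply Rinv_0_lt_compat, sqrt_lt_R0, Rabs_pos_lt.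
   intros E'. apply E, eq_IZR. lra. }
  assert (Hgs : forall A B, g A B = g B A).
  { intros A B. unfold g. destruct (Z.eq_dec (arc_K A) (arc_K B)), (Z.eq_dec (arc_K B) (arc_K A)); try congruence.
   now rewrite Rabs_minus_sym. }
  set (o := 2 * W * off_diag v0 M W). assert (Ho : 0 <= o) by (unfold o; nra).
  assert (Hrow : forall A d, In A l -> (d < H)%nat -> rsum (pair_bd v0 M W (A, d)) (list_prod l (seq 0 H)) <=
   / arc_k A * Dg + o * rsum (fun B => (/ arc_k A + / arc_k B) * g A B) l).
  { intros A d HA Hd. rewrite rsum_list_prod. destruct (Hl A HA) as (A1 & _). pose proof (arc_k_pos A A1) as kA.
   assert (HikA : 0 < / arc_k A) by pos.
   via (rsum_le _ (fun B => (if Z.eq_dec (arc_K A) (arc_K B) then / arc_k A * Dg else 0) +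
    o * ((/ arc_k A + / arc_k B) * g A B))).
   - intros B HB. unfold g. destruct (Z.eq_dec (arc_K A) (arc_K B)) as [E|E].
    + rewrite Rmult_0_r, Rmult_0_r, Rplus_0_r. rewrite <- (HKinj A B HA HB E). now apply row_same.
    + rewrite Rplus_0_l. eapply Rle_trans; [now apply row_other|]. unfold o, Rdiv. right; ring.
   - rewrite rsum_plus, rsum_scal. apply Rplus_le_compat_r. apply (rsum_single l A); [pos|easy| |].
    + intros B HB Hne. destruct (Z.eq_dec _ _) as [E|E]; [|easy]. exfalso; apply Hne. symmetry. now apply HKinj.
    + intros B. destruct (Z.eq_dec _ _); [lra|]. apply Rmult_le_pos; lra. }
  rewrite rsum_list_prod.
  via (rsum_le _ (fun A => (/ arc_k A * Dg + o * rsum (fun B => (/ arc_k A + / arc_k B) * g A B) l) * INR H)).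
  { intros A HA. replace (INR H) with (INR (length (seq 0 H))) by now rewrite length_seq. rewrite <- rsum_const.
   apply rsum_le. intros d Hd. apply in_seq in Hd. apply Hrow; [easy|lia]. }
  assert (E : forall c (f : arc -> R), rsum (fun A => f A * c) l = c * rsum f l).
  { intros c f. rewrite <- rsum_scal. apply rsum_ext. intros; ring. }
  rewrite E. mul_l. rewrite rsum_plus, rsum_scal, (E Dg). assert (Hik : forall A, In A l -> 0 <= / arc_k A).
  { intros A HA. destruct (Hl A HA) as (A1 & _). pose proof (arc_k_pos A A1). left; apply Rinv_0_lt_compat; lra. }
  assert (T : rsum (fun A => rsum (fun B => (/ arc_k A + / arc_k B) * g A B) l) l <= 2 * S1 * S2).
  { assert (P : rsum (fun A => rsum (fun B => / arc_k A * g A B) l) l <= S1 * S2).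
   { apply Rle_trans with (rsum (fun A => S2 * / arc_k A) l).
    - apply rsum_le. intros A HA. rewrite rsum_scal, Rmult_comm. apply Rmult_le_compat_r; [now apply Hik|]. now apply HS2.
    - rewrite rsum_scal, Rmult_comm. apply Rmult_le_compat_r; easy. }
   replace (rsum (fun A => rsum (fun B => (/ arc_k A + / arc_k B) * g A B) l) l) with
    (rsum (fun A => rsum (fun B => / arc_k A * g A B) l) l + rsum (fun A => rsum (fun B => / arc_k B * g A B) l) l).
   - rewrite (rsum_swap (fun A B => / arc_k B * g A B)).
    assert (E2 : rsum (fun b => rsum (fun a => / arc_k b * g a b) l) l = rsum (fun A => rsum (fun B => / arc_k A * g A B) l) l).
    { apply rsum_ext. intros A _. apply rsum_ext. intros B _. now rewrite Hgs. }
    rewrite E2. lra.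
   - rewrite <- rsum_plus. apply rsum_ext. intros A _. rewrite <- rsum_plus. apply rsum_ext. intros B _. ring. }
  unfold line_sum. fold Dg. apply Rle_trans with (Dg * S1 + o * (2 * S1 * S2)).
  - apply Rplus_le_compat; apply Rmult_le_compat_l; easy.
  - assert (0 <= S1).
   { eapply Rle_trans; [|exact HS1]. apply rsum_nonneg. exact Hik. }
   assert (0 <= S1 * (W * off_diag v0 M W * S2)) by pos. unfold o. lra.
Qed.

End Line.

(** * Estimate for one dyadic class of arcs *)

Definition good_pieces (W S1 S2 : R) (l : list arc) : Prop :=
  (forall A, In A l -> arc_ok A /\ 0 < arc_p1 A /\ W <= arc_w1 A /\ arc_w2 A <= 2 * W /\
   arc_k A <= W /\ Rabs (IZR (arc_a A)) <= W) /\
  NoDup l /\ (forall A B, In A l -> In B l -> arc_K A = arc_K B -> A = B) /\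
  rsum (fun A => / arc_k A) l <= S1 /\ 0 <= S2 /\
  (forall A, In A l -> rsum (fun B => if Z.eq_dec (arc_K A) (arc_K B) then 0
    else / sqrt (Rabs (IZR (arc_K A) - IZR (arc_K B)))) l <= S2).

(* Translating the line by 0, 1, ..., H - 1 turns the sum over l into an average of sums over pairs,
  to which the Cauchy-Schwarz inequality applies; only differences of shifts matter. *)
Lemma line_bound psi C0 v0 M W s S1 S2 l (H : nat) t : tame_form psi C0 -> 0 < M -> 1 <= W -> 1 <= v0 ->
  0 < s -> M * s <= 4 * (v0 + 1) * W ^ 2 -> good_pieces W S1 S2 l -> 3 * W <= INR H -> 0 < t ->
  Cmod (csum (fun A => CInt (fun w => cusp_fun psi v0 M A w s) (arc_w1 A) (arc_w2 A)) l) <=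
   C0 * (t * line_sum v0 M W S1 S2 H + 3 / t) / 2.
Proof.
  intros Hp HM HW Hv Hs HMs (Hl & HND & HKinj & HS1 & HS20 & HS2) HH Ht.
  assert (HN : 0 < INR H) by lra. pose proof (tame_pos _ _ Hp) as HC. set (P := list_prod l (seq 0 H)).
  set (lo := fun Q : arc * nat => arc_lo (fst Q) - INR (snd Q)).
  set (hi := fun Q : arc * nat => arc_hi (fst Q) - INR (snd Q)).
  set (G := fun Q : arc * nat => arc_line v0 M s (fst Q) (snd Q)).
  assert (HPin : forall Q, In Q P -> In (fst Q) l /\ (snd Q < H)%nat).
  { intros [A d] HQ. apply in_prod_iff in HQ. destruct HQ as [H1 H2]. apply in_seq in H2. simpl. split; [easy|lia]. }
  (* All translates lie in an interval of length 6 W + H <= 3 H; this is the origin of the term 3 /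
     t. *)
  pose proof (cs_pieces P lo hi G (fun x => psi (x, s)) (pair_bd v0 M W) (- (3 * W) - INR H) (3 * W) C0 t) as HCS.
  lapply HCS; clear HCS; [intros HCS|lra]. lapply HCS; clear HCS; [intros HCS|lra]. specialize (HCS Ht).
  lapply HCS; clear HCS; [intros HCS|].
  2:{ intros x Hx. split; [now apply (tame_bound _ _ Hp)|now apply (tame_cont_x psi C0)]. }
  lapply HCS; clear HCS; [intros HCS|].
  2:{ intros Q HQ. destruct (HPin Q HQ) as [HA Hd]. destruct Q as [A d]; simpl in HA, Hd.
    destruct (Hl A HA) as (A1 & A2 & A3 & A4 & A5 & A6).
    destruct (arc_lo_hi_bound A W A1 A2 A4 A6) as [B1 B2]. destruct (arc_lo_hi_len A A1 A2) as [L1 L2].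
    assert (Hd' : 0 <= INR d <= INR H) by (split; [pos|apply le_INR; lia]).
    unfold lo, hi, G; simpl. split; [lra|]. split; [lra|]. split; [lra|].
    intros x Hx. apply line_fun_cont; [now apply arc_K_neq|].
    pose proof (arc_w_of_x A (x + INR d) A1 A2 ltac:(lra)). lra. }
  lapply HCS; clear HCS; [intros HCS|].
  2:{ intros Q Q' HQ HQ'. apply (pair_bd_spec v0 M W s l H HM HW Hv Hs HMs Hl HKinj Q Q' HQ HQ'). }
  assert (E : csum (fun Q => CInt (fun x => psi (x, s) * G Q x)%C (lo Q) (hi Q)) P =
   (RtoC (INR H) * csum (fun A => CInt (fun w => cusp_fun psi v0 M A w s) (arc_w1 A) (arc_w2 A)) l)%C).
  { unfold P. rewrite csum_list_prod, <- csum_scal. apply csum_ext. intros A HA. destruct (Hl A HA) as (A1 & A2 & _).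
   transitivity (csum (fun _ : nat => CInt (fun w => cusp_fun psi v0 M A w s) (arc_w1 A) (arc_w2 A)) (seq 0 H)).
   - apply csum_ext. intros d _. unfold lo, hi, G; simpl. symmetry. now apply (cusp_fun_line psi C0).
   - generalize (CInt (fun w => cusp_fun psi v0 M A w s) (arc_w1 A) (arc_w2 A)). clear. intros c.
    induction H as [|H IH]; [simpl; ring|]. rewrite csum_seq_S, IH, S_INR, RtoC_plus. ring. }
  rewrite E, Cmod_mult, Cmod_R, (Rabs_pos_eq (INR H)) in HCS by lra.
  pose proof (total_bound v0 M W S1 S2 l H HM HW Hv Hl HND HKinj HS1 HS2 HS20) as HT.
  fold P in HT. apply Rmult_le_reg_l with (INR H); [easy|]. via HCS.
  replace (INR H * (C0 * (t * line_sum v0 M W S1 S2 H + 3 / t) / 2)) with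
   (C0 * (t * (INR H * line_sum v0 M W S1 S2 H) + 3 * INR H / t) / 2) by (field; lra).
  unfold Rdiv at 1 3. mul_r. mul_l. apply Rplus_le_compat.
  - apply Rmult_le_compat_l; lra.
  - mul_r. lra.
Qed.

(** The interval of heights does not depend on w: it contains the support of the amplitude for every
    w in [W, 2 W], so that the two integrations can be interchanged. *)
Lemma cusp_fun_average psi C0 v0 M A w W : tame_form psi C0 -> 0 < M -> 0 < W -> 1 <= v0 ->
  W <= w <= 2 * W ->
  is_CInt (cusp_fun psi v0 M A w) (v0 * W ^ 2 / M) (4 * (v0 + 1) * W ^ 2 / M)
   (RtoC (/ (arc_k A * w ^ 2)) * (e (- M * arc_x A w) * PsiC psi v0 M A w))%C.
Proof.
  intros Hp HM HW Hv Hw. assert (Hw0 : 0 < w) by lra. assert (HWw : W ^ 2 <= w ^ 2 <= 4 * W ^ 2).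
  { nra. }
  unfold cusp_fun. apply is_CInt_scal, is_CInt_scal. set (x := (IZR (arc_a A) - w) / IZR (arc_K A)).
  set (sa := v0 * w ^ 2 / M). set (sb := (v0 + 1) * w ^ 2 / M). assert (HiM : 0 < / M) by now apply Rinv_0_lt_compat.
  assert (O1 : v0 * W ^ 2 / M <= sa) by (mul_r; nra). assert (O2 : sa <= sb) by (mul_r; nra).
  assert (O3 : sb <= 4 * (v0 + 1) * W ^ 2 / M) by (mul_r; nra).
  replace (PsiC psi v0 M A w) with (RtoC 0 + (PsiC psi v0 M A w + RtoC 0))%C by ring.
  assert (Z : forall s, s <= sa \/ sb <= s -> amp_phi v0 M s w = 0).
  { intros s Hs. unfold amp_phi. rewrite bump_outside; [ring|].
   assert (Ea : M * sa / w ^ 2 = v0) by (unfold sa; field; lra). assert (Eb : M * sb / w ^ 2 = v0 + 1) by (unfold sb; field; lra).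
   assert (Hm : forall u v, u <= v -> M * u / w ^ 2 <= M * v / w ^ 2).
   { intros u v Huv. mul_r. apply Rmult_le_compat_l; lra. }
   destruct Hs as [Hs|Hs]; [left; rewrite <- Ea|right; rewrite <- Eb]; now apply Hm. }
  apply is_CInt_Chasles with sa; [|apply is_CInt_Chasles with sb].
  - apply is_CInt_zero; [easy|]. intros s Hs. rewrite Z by lra. ring.
  - pose proof (PsiC_int psi C0 v0 M A w Hp ltac:(lra) HM Hw0) as HI. unfold exC in HI. fold x in HI.
   fold (PsiC psi v0 M A w) in HI.
   match type of HI with is_CInt ?F _ _ _ => assert (HI' : is_CInt F (M / w ^ 2 * sa + 0) (M / w ^ 2 * sb + 0) (PsiC psi v0 M A w)) end.
   { replace (M / w ^ 2 * sa + 0) with v0 by (unfold sa; field; lra).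
    replace (M / w ^ 2 * sb + 0) with (v0 + 1) by (unfold sb; field; lra). exact HI. }
   clear HI. rename HI' into HI. apply is_CInt_comp_lin in HI.
   eapply is_CInt_ext; [easy| |exact HI]. intros s Hs. cbv beta. rewrite Cmult_assoc, <- RtoC_mult. f_equal.
   + f_equal. unfold amp_phi. f_equal. f_equal. field; lra.
   + f_equal. f_equal. field. lra.
  - apply is_CInt_zero; [easy|]. intros s Hs. rewrite Z by lra. ring.
Qed.

Lemma cusp_fun_lip psi C0 v0 M A w W s t : tame_form psi C0 -> 0 < M -> 0 < W -> 1 <= v0 -> arc_ok A ->
  W <= w -> v0 * W ^ 2 / M <= s -> v0 * W ^ 2 / M <= t ->
  Cmod (cusp_fun psi v0 M A w s - cusp_fun psi v0 M A w t)%C <=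
   M / W ^ 4 * (C0 * (2 * M / W ^ 2)) * Rabs (s - t).
Proof.
  intros Hp HM HW Hv Hok Hw Hs Ht. pose proof (tame_pos _ _ Hp) as HC. pose proof (arc_k_pos A Hok) as Hk.
  assert (H2 : 0 < W ^ 2) by now apply pow_lt. assert (HWw : W ^ 2 <= w ^ 2) by nra.
  assert (Hs0 : 0 < v0 * W ^ 2 / M) by pos. unfold cusp_fun. set (x := (IZR (arc_a A) - w) / IZR (arc_K A)).
  rewrite !Cmult_minus.

  rewrite !Cmod_mult, Cmod_e, Rmult_1_l, Cmod_R, Rabs_pos_eq by pos.
  set (d := Rabs (s - t)). assert (Hd : 0 <= d) by apply Rabs_pos.
  assert (H1 : Cmod (RtoC (amp_phi v0 M s w) * psi (x, s) - RtoC (amp_phi v0 M t w) * psi (x, t))%C <=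
   M / W ^ 2 * (C0 * (2 * M / W ^ 2)) * d).
  { replace (RtoC (amp_phi v0 M s w) * psi (x, s) - RtoC (amp_phi v0 M t w) * psi (x, t))%C with
    (RtoC (amp_phi v0 M s w) * (psi (x, s) - psi (x, t)) + RtoC (amp_phi v0 M s w - amp_phi v0 M t w) * psi (x, t))%C
    by (rewrite RtoC_minus; ring).
   via Cmod_triangle. rewrite !Cmod_mult, !Cmod_R.
   destruct (amp_phi_bound v0 M s W w HM HW Hw) as [B1 B2]. rewrite (Rabs_pos_eq (amp_phi v0 M s w)) by easy.
   assert (T1 : Cmod (psi (x, s) - psi (x, t))%C <= C0 * (d * (M / W ^ 2))).
   { eapply Rle_trans; [apply (tame_lip _ _ Hp); lra|]. mul_l. rewrite Rminus_diag, Rabs_R0, Rplus_0_l. fold d. mul_l.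
    replace (M / W ^ 2) with (/ (W ^ 2 / M)) by (field; lra). apply Rinv_le_contravar.
    - pos.
    - eapply Rle_trans; [|exact Hs]. mul_r. nra. }
   assert (T2 : Rabs (amp_phi v0 M s w - amp_phi v0 M t w) <= M / W ^ 2 * (M / W ^ 2 * d)).
   { unfold amp_phi. rewrite <- Rmult_minus_distr_l, Rabs_mult. assert (HMw : 0 < M / w ^ 2 <= M / W ^ 2).
    { split; [pos|]. mul_l. apply Rinv_le_contravar; lra. }
    rewrite (Rabs_pos_eq (M / w ^ 2)) by lra. apply Rmult_le_compat; try lra; [pos|]. via bump_lip.
    replace (M * s / w ^ 2 - M * t / w ^ 2) with (M / w ^ 2 * (s - t)) by (field; lra).
    rewrite Rabs_mult, (Rabs_pos_eq (M / w ^ 2)) by lra. fold d. apply Rmult_le_compat_r; lra. }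
   assert (T3 := tame_bound _ _ Hp x t ltac:(lra)).
   assert (T4 : amp_phi v0 M s w * Cmod (psi (x, s) - psi (x, t))%C <= M / W ^ 2 * (C0 * (d * (M / W ^ 2)))).
   { apply Rmult_le_compat; auto using Cmod_ge_0. }
   assert (T5 : Rabs (amp_phi v0 M s w - amp_phi v0 M t w) * Cmod (psi (x, t)) <= M / W ^ 2 * (M / W ^ 2 * d) * C0).
   { apply Rmult_le_compat; auto using Cmod_ge_0, Rabs_pos. }
   replace (M / W ^ 2 * (C0 * (2 * M / W ^ 2)) * d) with
    (M / W ^ 2 * (C0 * (d * (M / W ^ 2))) + M / W ^ 2 * (M / W ^ 2 * d) * C0) by (field; lra).
   lra. }
  replace (M / W ^ 4 * (C0 * (2 * M / W ^ 2)) * d) with (/ W ^ 2 * (M / W ^ 2 * (C0 * (2 * M / W ^ 2)) * d)) by (field; lra).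
  apply Rmult_le_compat; auto using Cmod_ge_0.
  - pos.
  - apply Rinv_le_contravar; [easy|]. nra.
Qed.

(** [line_bound] is applied at every height and integrated over an interval of heights of length at
    most 4 (v0 + 1) W^2 / M. *)
Lemma pieces_bound psi C0 v0 M W S1 S2 l (H : nat) t : tame_form psi C0 -> 0 < M -> 1 <= W -> 1 <= v0 ->
  good_pieces W S1 S2 l -> 3 * W <= INR H -> 0 < t -> 0 <= line_sum v0 M W S1 S2 H ->
  Cmod (csum (cusp_int psi v0 M) l) <=
   4 * (v0 + 1) * W ^ 2 / M * (C0 * (t * line_sum v0 M W S1 S2 H + 3 / t) / 2).
Proof.
  intros Hp HM HW Hv Hg HH Ht HY. pose proof (tame_pos _ _ Hp) as HC. pose proof Hg as (Hl & _).

  assert (HiM : 0 < / M) by now apply Rinv_0_lt_compat. set (s0 := v0 * W ^ 2 / M). set (s1 := 4 * (v0 + 1) * W ^ 2 / M).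
  assert (Hs0 : 0 < s0) by (unfold s0; apply Rdiv_lt_0_compat; nra). assert (Hs01 : s0 <= s1) by (unfold s0, s1; mul_r; nra).
  set (Bd := C0 * (t * line_sum v0 M W S1 S2 H + 3 / t) / 2). assert (HBd : 0 <= Bd).
  { unfold Bd. assert (0 < 3 / t) by pos.
   apply Rmult_le_pos; [|lra]. apply Rmult_le_pos; [lra|]. assert (0 <= t * line_sum v0 M W S1 S2 H) by pos. lra. }
  apply Rle_trans with ((s1 - s0) * Bd); [|mul_r; lra]. unfold cusp_int. apply (inner_average_bound l arc_w1 arc_w2
   (fun A w => RtoC (/ (arc_k A * w ^ 2)) * (e (- M * arc_x A w) * PsiC psi v0 M A w))%C
   (fun A w s => cusp_fun psi v0 M A w s) s0 s1 (M / W ^ 4 * (C0 * (2 * M / W ^ 2))) Bd); try easy.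
  - pos.
  - intros A HA. destruct (Hl A HA) as (A1 & A2 & A3 & A4 & A5 & A6). destruct (arc_w_pos A A1 A2) as [w1 w2].
   split; [easy|]. pose proof (arc_k_pos A A1) as kA. split.
   + apply exC_cont; [easy|]. intros w Hw. apply ccont_amp; [apply inv_kw2_cont; lra|]. apply ccont_mult.
    * apply (ccont_e (fun w => - M * arc_x A w)). apply continuous_Rmult; [apply continuous_const|apply arc_x_cont; [easy|lra]].
    * apply (PsiC_cont psi C0); easy || lra.
   + intros w Hw. split.
    * apply (cusp_fun_average psi C0); try easy; lra.
    * intros u v Hu Hv'. apply cusp_fun_lip; try easy; unfold s0 in *; lra.
  - intros s Hs. split.
   + intros A HA. destruct (Hl A HA) as (A1 & A2 & A3 & A4 & A5 & A6). destruct (arc_w_pos A A1 A2) as [w1 w2].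
    pose proof (arc_k_pos A A1) as kA.
    apply exC_cont; [easy|]. intros w Hw. unfold cusp_fun. apply ccont_amp; [apply inv_kw2_cont; lra|]. apply ccont_mult.
    * apply (ccont_e (fun w => - M * arc_x A w)). apply continuous_Rmult; [apply continuous_const|apply arc_x_cont; [easy|lra]].
    * apply ccont_amp; [apply (amp_phi_cont v0 M s (fun w => w)); [apply continuous_id|lra]|].
     apply (ccont_comp (fun x => psi (x, s)) (fun w => (IZR (arc_a A) - w) / IZR (arc_K A))).
     -- apply (tame_cont_x psi C0); [easy|lra].
     -- apply continuous_Rmult; [|apply continuous_const].
      apply continuous_Rminus; [apply continuous_const|apply continuous_id].
   + apply (line_bound psi C0); try easy; [lra|]. apply Rmult_le_reg_r with (/ M); [easy|]. unfold s1, Rdiv in Hs.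
    replace (M * s * / M) with s by (field; lra). lra.
Qed.

(** * Intervals without good approximations *)

Definition mediant (p : (Z * Z) * (Z * Z)) : Z * Z := (fst (fst p) + fst (snd p), snd (fst p) + snd (snd p))%Z.

(** The part of a Farey interval from its left end to the mediant. Since the ends are neighbours,
    the denominator of the right end is a possible entry [a]. *)
Definition right_arc (x1 x2 : R) (p : (Z * Z) * (Z * Z)) : arc :=
  (fst p, snd (snd p), (clamp x1 x2 (frac (fst p)) - frac (fst p), clamp x1 x2 (frac (mediant p)) - frac (fst p))).

(** Both entries of the fraction are negated: w = 1/(|K| p) then stays positive on the left of a
    cusp, and the sign of K tells the two sides apart. *)
Definition left_arc (x1 x2 : R) (p : (Z * Z) * (Z * Z)) : arc :=
  ((- fst (snd p), - snd (snd p))%Z, snd (fst p),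
  (frac (snd p) - clamp x1 x2 (frac (snd p)), frac (snd p) - clamp x1 x2 (frac (mediant p)))).

Definition farey_arcs (x1 x2 : R) (L : list ((Z * Z) * (Z * Z))) : list arc :=
  filter arc_nonempty (flat_map (fun p => [right_arc x1 x2 p; left_arc x1 x2 p]) L).

Lemma csum_filter_nonempty f l : (forall A, In A l -> arc_p1 A <= arc_p2 A) ->
  csum (arc_int f) (filter arc_nonempty l) = csum (arc_int f) l.
Proof.
  induction l as [|A l IH]; intros H; simpl; [easy|].
  rewrite <- IH by (intros; apply H; now right). unfold arc_nonempty at 1. destruct (Rlt_dec _ _) as [h|h]; simpl; [easy|].
  replace (arc_int f A) with (RtoC 0); [now rewrite Cplus_0_l|].
  unfold arc_int. pose proof (H A (or_introl eq_refl)). replace (arc_p2 A) with (arc_p1 A) by lra.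
  symmetry. apply CInt_point.
Qed.

Lemma CInt_shift f c a b : a <= b -> (forall x, ccont f x) ->
  CInt (fun p => f (c + p)) (a - c) (b - c) = CInt f a b.
Proof.
  intros Hab Hf. apply is_CInt_unique. assert (H : is_CInt f (1 * (a - c) + c) (1 * (b - c) + c) (CInt f a b)).
  { replace (1 * (a - c) + c) with a by ring. replace (1 * (b - c) + c) with b by ring. apply exC_cont; auto. }
  apply is_CInt_comp_lin in H. eapply is_CInt_ext; [lra| |exact H]. intros x _. cbv beta.
  rewrite Cmult_1_l. replace (c + x) with (1 * x + c) by ring. easy.
Qed.

Lemma CInt_reflect f c a b : a <= b -> (forall x, ccont f x) ->
  CInt (fun p => f (c - p)) (c - b) (c - a) = CInt f a b.
Proof.
  intros Hab Hf. apply is_CInt_unique. assert (H : is_CInt f (-1 * (c - a) + c) (-1 * (c - b) + c) (CInt f a b)).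
  { replace (-1 * (c - a) + c) with a by ring. replace (-1 * (c - b) + c) with b by ring. apply exC_cont; auto. }
  apply is_CInt_comp_lin, is_CInt_swap, (is_CInt_scal (RtoC (-1))) in H.
  replace (RtoC (-1) * - CInt f a b)%C with (CInt f a b) in H by (generalize (CInt f a b); intros c'; apply injective_projections; simpl; ring).
  eapply is_CInt_ext; [lra| |exact H]. intros x _. cbv beta.
  replace (c - x) with (-1 * x + c) by ring. generalize (f (-1 * x + c)); intros y. rewrite Cmult_assoc, <- RtoC_mult.
  replace (-1 * -1) with 1 by ring. apply Cmult_1_l.
Qed.

Lemma right_arc_int f x1 x2 p : neighbours (fst p) (snd p) -> (forall x, ccont f x) ->
  arc_int f (right_arc x1 x2 p) = CInt f (clamp x1 x2 (frac (fst p))) (clamp x1 x2 (frac (mediant p))).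
Proof.
  intros Hp Hf. pose proof Hp as (_ & Hu & _). destruct (neighbours_med _ _ Hp) as [N1 N2]. apply neighbours_lt in N1.
  rewrite <- (CInt_shift f (frac (fst p))) by (easy || (apply clamp_mono; unfold mediant; lra)).
  unfold arc_int. apply CInt_ext.
  { cbn [arc_p1 arc_p2 right_arc fst snd]. unfold arc_p1, arc_p2; simpl. apply Rplus_le_compat_r, clamp_mono. unfold mediant; lra. }
  intros y _. f_equal. unfold arc_pt, arc_H, arc_K, arc_v, right_arc. cbn [fst snd].
  rewrite Z.sgn_pos by lia. unfold frac. ring.
Qed.

Lemma left_arc_int f x1 x2 p : neighbours (fst p) (snd p) -> (forall x, ccont f x) ->
  arc_int f (left_arc x1 x2 p) = CInt f (clamp x1 x2 (frac (mediant p))) (clamp x1 x2 (frac (snd p))).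
Proof.
  intros Hp Hf. pose proof Hp as (_ & _ & Hu). destruct (neighbours_med _ _ Hp) as [N1 N2]. apply neighbours_lt in N2.
  assert (Hle : clamp x1 x2 (frac (mediant p)) <= clamp x1 x2 (frac (snd p))) by (apply clamp_mono; unfold mediant; lra).
  rewrite <- (CInt_reflect f (frac (snd p))) by easy. unfold arc_int. apply CInt_ext.
  { unfold arc_p1, arc_p2; simpl. lra. }
  intros y _. f_equal. unfold arc_pt, arc_H, arc_K, arc_v, left_arc. cbn [fst snd].
  rewrite Z.sgn_neg by lia. unfold frac. rewrite !opp_IZR. apply IZR_le in Hu. field. lra.
Qed.

Lemma farey_arcs_int f n Q u v x1 x2 : neighbours u v -> IZR (snd u) <= Q -> IZR (snd v) <= Q ->
  Q < INR n + IZR (snd u) + IZR (snd v) -> (forall x, ccont f x) ->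
  csum (arc_int f) (farey_arcs x1 x2 (farey n Q u v)) = CInt f (clamp x1 x2 (frac u)) (clamp x1 x2 (frac v)).
Proof.
  intros N Hu Hv Hn Hf. pose proof (farey_csum n Q u v (fun a b => CInt f (clamp x1 x2 a) (clamp x1 x2 b)) N) as HS.
  cbv beta in HS. rewrite <- HS.
  2:{ intros a b c Hab Hbc. apply CInt_Chasles; try now apply clamp_mono.
    apply exC_cont; [apply clamp_mono; lra|]. intros; apply Hf. }
  pose proof (farey_leaf n Q u v N Hu Hv Hn) as HL. clear HS. set (L := farey n Q u v) in *. clearbody L.
  unfold farey_arcs. rewrite csum_filter_nonempty.
  - induction L as [|p L IH]; [easy|]. cbn [flat_map]. rewrite csum_app, IH by (intros; apply HL; now right).
   destruct (HL p (or_introl eq_refl)) as [Hp _]. cbn [csum fold_right].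
   unfold csum at 1. cbn [fold_right]. rewrite right_arc_int, left_arc_int by easy.
   change (csum (fun p0 => CInt f (clamp x1 x2 (frac (fst p0))) (clamp x1 x2 (frac (snd p0)))) (p :: L)) with
    (CInt f (clamp x1 x2 (frac (fst p))) (clamp x1 x2 (frac (snd p))) +
    csum (fun p0 => CInt f (clamp x1 x2 (frac (fst p0))) (clamp x1 x2 (frac (snd p0)))) L)%C.
   destruct (neighbours_med _ _ Hp) as [N1 N2]. apply neighbours_lt in N1, N2.
   rewrite (CInt_Chasles f (clamp x1 x2 (frac (fst p))) (clamp x1 x2 (frac (mediant p))) (clamp x1 x2 (frac (snd p)))); [ring|..];
    try (apply clamp_mono; unfold mediant; lra).
   apply exC_cont; [apply clamp_mono; lra|]. intros; apply Hf.
  - intros A HA. apply in_flat_map in HA. destruct HA as [p [Hp [<-|[<-|[]]]]]; destruct (HL p Hp) as [N' _];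
    destruct (neighbours_med _ _ N') as [N1 N2]; apply neighbours_lt in N1, N2.
   + unfold arc_p1, arc_p2; simpl. apply Rplus_le_compat_r, clamp_mono. unfold mediant; lra.
   + unfold arc_p1, arc_p2; simpl.
    assert (clamp x1 x2 (frac (mediant p)) <= clamp x1 x2 (frac (snd p))) by (apply clamp_mono; unfold mediant; lra). lra.
Qed.

Lemma nonempty_lt A : arc_nonempty A = true -> arc_p1 A < arc_p2 A.
Proof. unfold arc_nonempty. now destruct (Rlt_dec _ _). Qed.

(** The mediant is at distance 1/(k (k + k')) with Q < k + k' <= 2 Q. The first inequality bounds
    the extent of the arc, the second recovers 1/k from the distance. *)
Lemma right_arc_spec Q x1 x2 p (A := right_arc x1 x2 p) : x1 <= x2 -> 0 < Q -> neighbours (fst p) (snd p) ->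
  IZR (snd (fst p)) <= Q -> IZR (snd (snd p)) <= Q -> Q < IZR (snd (fst p)) + IZR (snd (snd p)) -> arc_p1 A < arc_p2 A ->
  arc_ok A /\ arc_p2 A <= / (arc_k A * Q) /\ arc_k A <= Q /\ Rabs (IZR (arc_a A)) <= Q /\
  Rabs (IZR (arc_H A) - IZR (arc_K A) * x1) <= / Q + arc_k A * (x2 - x1) /\
  frac (fst p) < x2 /\ x1 < frac (mediant p) /\ frac (mediant p) - frac (fst p) <= / (arc_k A * Q) /\
  / arc_k A <= 2 * Q * (frac (mediant p) - frac (fst p)).
Proof.
  intros Hx HQ Hp Hk1 Hk2 Hsum Hlt. pose proof Hp as (Hd & Hu & Hv). apply IZR_le in Hu, Hv.
  destruct (neighbours_med _ _ Hp) as [N1 N2]. apply neighbours_lt in N1, N2.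
  destruct (mediant_minus _ _ Hp) as [E1 E2]. change ((fst (fst p) + fst (snd p))%Z, (snd (fst p) + snd (snd p))%Z) with (mediant p) in *.
  set (l := frac (fst p)) in *. set (m := frac (mediant p)) in *.
  set (k := IZR (snd (fst p))) in *. set (k' := IZR (snd (snd p))) in *.
  assert (Ek : arc_k A = k) by (apply Rabs_pos_eq; change (0 <= k); lra).
  unfold A, arc_p1, arc_p2, right_arc in Hlt. cbn [fst snd] in Hlt. fold l m in Hlt.
  destruct (clamp_spec x1 x2 l Hx) as [R1 S1]. destruct (clamp_spec x1 x2 m Hx) as [R2 S2].
  assert (Hl : l < x2) by lra. assert (Hm : x1 < m) by lra. change (arc_p2 A) with (clamp x1 x2 m - l).
  assert (Hml : m - l <= / (k * Q)).
  { rewrite E1. apply Rinv_le_contravar; [pos|]. apply Rmult_le_compat_l; lra. }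
  rewrite Ek. split; [split; [|split]|].
  - change (snd (fst p) <> 0)%Z. intros E. unfold k in Hu. rewrite E in Hu. lra.
  - exists (- fst (snd p))%Z. unfold A, right_arc, arc_a, arc_H, arc_K, arc_v. cbn [fst snd]. lia.
  - change (0 <= clamp x1 x2 l - l <= clamp x1 x2 m - l). lra.
  - split; [lra|]. split; [easy|]. split.
   { change (Rabs k' <= Q). rewrite Rabs_pos_eq; lra. }
   split; [|split; [easy|split; [easy|split; [easy|]]]].
   + change (Rabs (IZR (fst (fst p)) - k * x1) <= / Q + k * (x2 - x1)).
    replace (IZR (fst (fst p)) - k * x1) with (k * (l - x1)) by (unfold l, frac; fold k; field; lra).
    rewrite Rabs_mult, Rabs_pos_eq by lra.
    replace (/ Q + k * (x2 - x1)) with (k * (/ (k * Q) + (x2 - x1))) by (field; lra). mul_l. apply Rabs_le; lra.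
   + rewrite E1. replace (2 * Q * / (k * (k + k'))) with (/ k * (2 * Q * / (k + k'))) by (field; lra).
    rewrite <- (Rmult_1_r (/ k)) at 1. mul_l.
    apply Rmult_le_reg_r with (k + k'); [lra|]. rewrite Rmult_assoc, Rinv_l by lra. lra.
Qed.

Lemma left_arc_spec Q x1 x2 p (A := left_arc x1 x2 p) : x1 <= x2 -> 0 < Q -> neighbours (fst p) (snd p) ->
  IZR (snd (fst p)) <= Q -> IZR (snd (snd p)) <= Q -> Q < IZR (snd (fst p)) + IZR (snd (snd p)) -> arc_p1 A < arc_p2 A ->
  arc_ok A /\ arc_p2 A <= / (arc_k A * Q) /\ arc_k A <= Q /\ Rabs (IZR (arc_a A)) <= Q /\
  Rabs (IZR (arc_H A) - IZR (arc_K A) * x1) <= / Q + arc_k A * (x2 - x1) /\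
  frac (mediant p) < x2 /\ x1 < frac (snd p) /\ frac (snd p) - frac (mediant p) <= / (arc_k A * Q) /\
  / arc_k A <= 2 * Q * (frac (snd p) - frac (mediant p)).
Proof.
  intros Hx HQ Hp Hk1 Hk2 Hsum Hlt. pose proof Hp as (Hd & Hu & Hv). apply IZR_le in Hu, Hv.
  destruct (neighbours_med _ _ Hp) as [N1 N2]. apply neighbours_lt in N1, N2.
  destruct (mediant_minus _ _ Hp) as [E1 E2]. change ((fst (fst p) + fst (snd p))%Z, (snd (fst p) + snd (snd p))%Z) with (mediant p) in *.
  set (r := frac (snd p)) in *. set (m := frac (mediant p)) in *.
  set (k := IZR (snd (snd p))) in *. set (k' := IZR (snd (fst p))) in *. assert (Ek : arc_k A = k).
  { change (Rabs (IZR (- snd (snd p))) = k). rewrite opp_IZR, Rabs_Ropp. apply Rabs_pos_eq. change (0 <= k); lra. }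
  unfold A, arc_p1, arc_p2, left_arc in Hlt. cbn [fst snd] in Hlt. fold r m in Hlt.
  destruct (clamp_spec x1 x2 r Hx) as [R1 S1]. destruct (clamp_spec x1 x2 m Hx) as [R2 S2].
  assert (Hr : x1 < r) by lra. assert (Hm : m < x2) by lra. change (arc_p2 A) with (r - clamp x1 x2 m).
  assert (Hml : r - m <= / (k * Q)).
  { rewrite E2. apply Rinv_le_contravar; [pos|]. apply Rmult_le_compat_l; lra. }
  rewrite Ek. split; [split; [|split]|].
  - change (- snd (snd p) <> 0)%Z. intros E. assert (E' : snd (snd p) = 0%Z) by lia. unfold k in Hv. rewrite E' in Hv. lra.
  - exists (- fst (fst p))%Z. unfold A, left_arc, arc_a, arc_H, arc_K, arc_v. cbn [fst snd]. lia.
  - change (0 <= r - clamp x1 x2 r <= r - clamp x1 x2 m). lra.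
  - split; [lra|]. split; [easy|]. split.
   { change (Rabs k' <= Q). rewrite Rabs_pos_eq; lra. }
   split; [|split; [easy|split; [easy|split; [easy|]]]].
   + change (Rabs (IZR (- fst (snd p)) - IZR (- snd (snd p)) * x1) <= / Q + k * (x2 - x1)). rewrite !opp_IZR. fold k.
    replace (- IZR (fst (snd p)) - - k * x1) with (- (k * (r - x1))) by (unfold r, frac; fold k; field; lra).
    rewrite Rabs_Ropp, Rabs_mult, Rabs_pos_eq by lra.
    replace (/ Q + k * (x2 - x1)) with (k * (/ (k * Q) + (x2 - x1))) by (field; lra). mul_l. apply Rabs_le; lra.
   + rewrite E2. replace (2 * Q * / (k * (k' + k))) with (/ k * (2 * Q * / (k' + k))) by (field; lra).
    rewrite <- (Rmult_1_r (/ k)) at 1. mul_l.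
    apply Rmult_le_reg_r with (k' + k); [lra|]. rewrite Rmult_assoc, Rinv_l by lra. lra.
Qed.

(** A fraction is the left end of at most one leaf and the right end of at most one, and the signs
    of the denominators keep the two kinds apart. *)
Lemma farey_arcs_nodup n Q u v x1 x2 : neighbours u v -> IZR (snd u) <= Q -> IZR (snd v) <= Q ->
  Q < INR n + IZR (snd u) + IZR (snd v) -> NoDup (map arc_v (farey_arcs x1 x2 (farey n Q u v))).
Proof.
  intros N Hu Hv Hn. pose proof (farey_leaf n Q u v N Hu Hv Hn) as HL. destruct (farey_nodup n Q u v N) as [D1 D2].
  set (L := farey n Q u v) in *. clearbody L. unfold farey_arcs.
  assert (HF : forall l : list arc, NoDup (map arc_v l) -> NoDup (map arc_v (filter arc_nonempty l))).
  { induction l as [|A l IH]; intros H; simpl; [easy|]. inversion H as [|? ? H1 H2]; subst.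
   destruct (arc_nonempty A); [|auto]. simpl. constructor; [|auto]. intros Hin. apply H1.
   apply in_map_iff in Hin. destruct Hin as [B [E HB]]. apply filter_In in HB. apply in_map_iff. exists B; tauto. }
  apply HF. clear HF. induction L as [|p L IH]; [constructor|]. simpl in D1, D2.
  inversion D1 as [|? ? A1 A2]; inversion D2 as [|? ? B1 B2]; subst.
  specialize (IH ltac:(intros; apply HL; now right) A2 B2). cbn [flat_map app map].
  destruct (HL p (or_introl eq_refl)) as [(_ & P1 & P2) _].
  assert (HIn : forall w, In w (map arc_v (flat_map (fun p => [right_arc x1 x2 p; left_arc x1 x2 p]) L)) ->
   exists p', In p' L /\ (w = fst p' \/ w = (- fst (snd p'), - snd (snd p'))%Z)).
  { intros w Hw. apply in_map_iff in Hw. destruct Hw as [A [<- HA]]. apply in_flat_map in HA.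
   destruct HA as [p' [Hp' [<-|[<-|[]]]]]; exists p'; split; auto. }
  constructor; [|constructor; [|easy]].
  - intros [E|HA].
   + change ((- fst (snd p), - snd (snd p))%Z = fst p) in E. apply (f_equal snd) in E. cbn [snd] in E. lia.
   + change (In (fst p) (map arc_v (flat_map (fun p => [right_arc x1 x2 p; left_arc x1 x2 p]) L))) in HA.
    destruct (HIn _ HA) as [p' [Hp' [E|E]]].
    * apply A1. rewrite E. now apply in_map.
    * destruct (HL p' (or_intror Hp')) as [(_ & P1' & P2') _]. rewrite E in P1. cbn [snd] in P1. lia.
  - intros HA. change (In (- fst (snd p), - snd (snd p))%Z (map arc_v (flat_map (fun p => [right_arc x1 x2 p; left_arc x1 x2 p]) L))) in HA.
   destruct (HIn _ HA) as [p' [Hp' [E|E]]].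
   + destruct (HL p' (or_intror Hp')) as [(_ & P1' & P2') _]. rewrite <- E in P1'. cbn [snd] in P1'. lia.
   + apply B1. replace (snd p) with (snd p'); [now apply in_map|]. injection E as E1 E2. apply injective_projections; lia.
Qed.

Lemma farey_arcs_in n Q u v x1 x2 A : x1 <= x2 -> 0 < Q -> neighbours u v -> IZR (snd u) <= Q -> IZR (snd v) <= Q ->
  Q < INR n + IZR (snd u) + IZR (snd v) -> In A (farey_arcs x1 x2 (farey n Q u v)) ->
  arc_ok A /\ arc_p2 A <= / (arc_k A * Q) /\ arc_k A <= Q /\ Rabs (IZR (arc_a A)) <= Q /\
  Rabs (IZR (arc_H A) - IZR (arc_K A) * x1) <= / Q + arc_k A * (x2 - x1).
Proof.
  intros Hx HQ N Hu Hv Hn HA. apply filter_In in HA. destruct HA as [HA Hne]. apply nonempty_lt in Hne.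
  apply in_flat_map in HA. destruct HA as [p [Hp HA]].
  destruct (farey_leaf n Q u v N Hu Hv Hn p Hp) as (P1 & P2 & P3 & P4 & _). destruct HA as [<-|[<-|[]]].
  - pose proof (right_arc_spec Q x1 x2 p Hx HQ P1 P2 P3 P4 Hne). tauto.
  - pose proof (left_arc_spec Q x1 x2 p Hx HQ P1 P2 P3 P4 Hne). tauto.
Qed.

(* 1/k1 + 1/k2 = (k1 + k2)/(k1 k2), where k1 + k2 > Q and 1/(k1 k2) is the distance of the neighbours. *)
Lemma farey_arcs_rsum n Q u v x1 x2 delta : x1 <= x2 -> 0 < Q -> neighbours u v -> IZR (snd u) <= Q -> IZR (snd v) <= Q ->
  Q < INR n + IZR (snd u) + IZR (snd v) -> 0 <= delta ->
  (forall A, In A (farey_arcs x1 x2 (farey n Q u v)) -> / (arc_k A * Q) <= delta) ->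
  rsum (fun A => / arc_k A) (farey_arcs x1 x2 (farey n Q u v)) <= 2 * Q * (x2 - x1 + 2 * delta).
Proof.
  (* Enlarged by [delta] the interval contains in full every half leaf that carries an arc, so
     clamping to it changes none of their lengths and the sum telescopes. *)
  intros Hx HQ N Hu Hv Hn Hdelta Hd. set (cl := clamp (x1 - delta) (x2 + delta)).
  pose proof (farey_rsum n Q u v (fun a b => 2 * Q * (cl b - cl a)) N ltac:(intros; cbv beta; ring)) as HS. cbv beta in HS.
  apply Rle_trans with (2 * Q * (cl (frac v) - cl (frac u))).
  2:{ mul_l. unfold cl. pose proof (clamp_spec (x1 - delta) (x2 + delta) (frac v) ltac:(lra)).
    pose proof (clamp_spec (x1 - delta) (x2 + delta) (frac u) ltac:(lra)). lra. }
  rewrite <- HS. clear HS. pose proof (farey_leaf n Q u v N Hu Hv Hn) as HL.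
  unfold farey_arcs in *. set (L := farey n Q u v) in *. clearbody L.
  assert (Hcl : forall a b, a <= b -> b - a <= delta -> x1 < b -> a < x2 -> cl b - cl a = b - a).
  { intros a b h1 h2 h3 h4. unfold cl, clamp. rewrite !Rmin_right, !Rmax_right by lra. ring. }
  assert (Hcl' : forall a b, a <= b -> 0 <= cl b - cl a).
  { intros a b h. assert (cl a <= cl b) by now apply clamp_mono. lra. }
  induction L as [|p L IH]; [simpl; lra|]. cbn [flat_map app] in *.
  assert (IHd : forall A, In A (filter arc_nonempty (flat_map (fun p => [right_arc x1 x2 p; left_arc x1 x2 p]) L)) ->
   / (arc_k A * Q) <= delta).
  { intros A HA. apply Hd. apply filter_In in HA. apply filter_In. split; [|easy]. right; right; easy. }
  specialize (IH IHd ltac:(intros; apply HL; now right)). destruct (HL p (or_introl eq_refl)) as (P1 & P2 & P3 & P4 & _).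
  destruct (neighbours_med _ _ P1) as [N1 N2]. apply neighbours_lt in N1, N2.
  change (frac (fst p) < frac (mediant p)) in N1. change (frac (mediant p) < frac (snd p)) in N2.
  set (B := rsum (fun A => / arc_k A) (filter arc_nonempty (flat_map (fun p => [right_arc x1 x2 p; left_arc x1 x2 p]) L))) in *.
  set (l := frac (fst p)) in *. set (m := frac (mediant p)) in *. set (r := frac (snd p)) in *.
  assert (HR : (if arc_nonempty (right_arc x1 x2 p) then / arc_k (right_arc x1 x2 p) else 0) <= 2 * Q * (cl m - cl l)).
  { destruct (arc_nonempty (right_arc x1 x2 p)) eqn:Hne.
   - pose proof (right_arc_spec Q x1 x2 p Hx HQ P1 P2 P3 P4 (nonempty_lt _ Hne)) as (_&_&_&_&_&h1&h2&h3&h4).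
    fold l m in h1, h2, h3, h4. assert (In (right_arc x1 x2 p) (filter arc_nonempty (right_arc x1 x2 p :: left_arc x1 x2 p :: flat_map (fun p => [right_arc x1 x2 p; left_arc x1 x2 p]) L))) by (apply filter_In; split; [now left|easy]).
    specialize (Hd _ H). rewrite Hcl by lra. exact h4.
   - apply Rmult_le_pos; [lra|]. apply Hcl'; lra. }
  assert (HLf : (if arc_nonempty (left_arc x1 x2 p) then / arc_k (left_arc x1 x2 p) else 0) <= 2 * Q * (cl r - cl m)).
  { destruct (arc_nonempty (left_arc x1 x2 p)) eqn:Hne.
   - pose proof (left_arc_spec Q x1 x2 p Hx HQ P1 P2 P3 P4 (nonempty_lt _ Hne)) as (_&_&_&_&_&h1&h2&h3&h4).
    fold r m in h1, h2, h3, h4. assert (In (left_arc x1 x2 p) (filter arc_nonempty (right_arc x1 x2 p :: left_arc x1 x2 p :: flat_map (fun p => [right_arc x1 x2 p; left_arc x1 x2 p]) L))) by (apply filter_In; split; [right; now left|easy]).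
    specialize (Hd _ H). rewrite Hcl by lra. exact h4.
   - apply Rmult_le_pos; [lra|]. apply Hcl'; lra. }
  apply Rle_trans with ((if arc_nonempty (right_arc x1 x2 p) then / arc_k (right_arc x1 x2 p) else 0) +
   ((if arc_nonempty (left_arc x1 x2 p) then / arc_k (left_arc x1 x2 p) else 0) + B)).
  - right. cbn [filter]. destruct (arc_nonempty (right_arc x1 x2 p)), (arc_nonempty (left_arc x1 x2 p));
    unfold rsum; cbn [fold_right]; fold (rsum (fun A => / arc_k A)); unfold B, rsum; ring.
  - change (rsum (fun p0 => 2 * Q * (cl (frac (snd p0)) - cl (frac (fst p0)))) (p :: L)) with
    (2 * Q * (cl r - cl l) + rsum (fun p0 => 2 * Q * (cl (frac (snd p0)) - cl (frac (fst p0)))) L). lra.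
Qed.

(** * Logarithms and lists without duplicates *)

Lemma ln_nonneg M : 1 <= M -> 0 <= ln M.
Proof. intros HM. rewrite <- ln_1. apply Rcomplements.ln_le; lra. Qed.

Lemma ln_2_le : ln 2 <= 1.
Proof. rewrite <- (ln_exp 1). apply Rcomplements.ln_le; [lra|]. generalize (exp_ineq1 1); lra. Qed.

Lemma pow2_bracket M : 1 <= M -> exists n, M <= 2 ^ n <= 2 * M /\ INR n <= 2 * (1 + ln M).
Proof.
  intros HM. destruct (Pow_x_infinity 2 ltac:(rewrite Rabs_pos_eq; lra) M) as [N HN].
  specialize (HN N (Nat.le_refl N)). rewrite Rabs_pos_eq in HN by pos. apply Rge_le in HN.
  assert (P : exists n, M <= 2 ^ n <= 2 * M).
  { induction N as [|N IH].
   - exists 0%nat. simpl in *. lra.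
   - destruct (Rle_dec M (2 ^ N)) as [h|h]; [auto|]. exists (S N). simpl in *. lra. }
  destruct P as [n Hn]. exists n. split; [easy|].
  assert (INR n * ln 2 <= ln 2 + ln M) by (rewrite <- ln_pow, <- ln_mult by lra; apply Rcomplements.ln_le; [pos|easy]).
  pose proof ln_2_le. pose proof ln_lt_2. pose proof (pos_INR n). pose proof (ln_nonneg M HM). nra.
Qed.

Lemma NoDup_map_inj {A B} (f : A -> B) l x y : NoDup (map f l) -> In x l -> In y l -> f x = f y -> x = y.
Proof.
  induction l as [|a l IH]; simpl; [easy|]. intros H. inversion H as [|? ? H1 H2]; subst.
  intros [<-|Hx] [<-|Hy] E; try easy; try (now apply IH).
  - exfalso. apply H1. rewrite E. now apply in_map.
  - exfalso. apply H1. rewrite <- E. now apply in_map.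
Qed.

Lemma NoDup_map_filter {A B} (f : A -> B) p l : NoDup (map f l) -> NoDup (map f (filter p l)).
Proof.
  induction l as [|a l IH]; intros H; simpl; [easy|]. inversion H as [|? ? H1 H2]; subst.
  destruct (p a); [|auto]. simpl. constructor; [|auto]. intros Hin. apply H1.
  apply in_map_iff in Hin. destruct Hin as [b [E Hb]]. apply filter_In in Hb. apply in_map_iff. exists b; tauto.
Qed.

Lemma length_filter_le {A} (p : A -> bool) l : (length (filter p l) <= length l)%nat.
Proof. induction l as [|a l IH]; simpl; [lia|]. destruct (p a); simpl; lia. Qed.

(** The vectors (H_B - H_A, K_B - K_A), or their negatives, are distinct lattice points of a box
    twice as large as the one containing the arcs, hence the factors 2 in the hypotheses. The factor
    2 in the conclusion is for the two signs of K_B - K_A. *)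
Lemma difference_sum alpha Delta tau E Q l A :
  0 < Delta -> 0 < tau -> 0 < E -> badly_approx alpha Delta tau E Q -> NoDup (map arc_v l) -> In A l ->
  (forall B, In B l -> 2 * arc_k B <= Q /\ 2 * Rabs (IZR (arc_H B) - IZR (arc_K B) * alpha) <= E) ->
  rsum (fun B => if Z.eq_dec (arc_K A) (arc_K B) then 0 else / sqrt (Rabs (IZR (arc_K A) - IZR (arc_K B)))) l <=
   2 * (10 * E * sqrt Q + 4 * sqrt (E / tau) + 2 * (sqrt Q / sqrt (tau * Delta))) * harm (length l).
Proof.
  intros HDe Htau HE Hbad HND HA Hl. set (X := 10 * E * sqrt Q + 4 * sqrt (E / tau) + 2 * (sqrt Q / sqrt (tau * Delta))).
  assert (HX : 0 <= X).
  { unfold X.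
 pose proof (sqrt_pos (E / tau)).
   assert (0 <= sqrt Q / sqrt (tau * Delta)) by pos. assert (0 <= E * sqrt Q) by pos. lra. }
  set (Lp := map (fun B => (arc_H B - arc_H A, arc_K B - arc_K A)%Z) (filter (fun B => (arc_K A <? arc_K B)%Z) l)).
  set (Lm := map (fun B => (arc_H A - arc_H B, arc_K A - arc_K B)%Z) (filter (fun B => (arc_K B <? arc_K A)%Z) l)).
  destruct (Hl A HA) as [A1 A2]. unfold arc_k in A1.
  assert (Bp : rsum (fun v => / sqrt (IZR (snd v))) Lp <= X * harm (length l)).
  { eapply Rle_trans; [apply (box_sum alpha Delta tau E Q); try easy|].
   - unfold Lp. apply (NoDup_map_inv (fun w => (fst w + arc_H A, snd w + arc_K A)%Z)). rewrite map_map.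
    rewrite (map_ext _ arc_v); [now apply NoDup_map_filter|]. intros B. unfold arc_H, arc_K.
    apply injective_projections; cbn [fst snd]; ring.
   - intros v Hv. apply in_map_iff in Hv. destruct Hv as [B [<- HB]]. apply filter_In in HB. destruct HB as [HB HK].
    apply Z.ltb_lt in HK. destruct (Hl B HB) as [B1 B2]. unfold arc_k in B1.
    unfold in_box; cbn [fst snd]. split; [lia|]. rewrite !minus_IZR.
    split; [pose proof (Rle_abs (IZR (arc_K B))); pose proof (Rcomplements.Rabs_maj2 (IZR (arc_K A))); lra|].
    replace (IZR (arc_H B) - IZR (arc_H A) - (IZR (arc_K B) - IZR (arc_K A)) * alpha) with
     ((IZR (arc_H B) - IZR (arc_K B) * alpha) - (IZR (arc_H A) - IZR (arc_K A) * alpha)) by ring.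
    via Rabs_triang. rewrite Rabs_Ropp. lra.
   - mul_l. apply harm_mono. unfold Lp. rewrite length_map. apply length_filter_le. }
  assert (Bm : rsum (fun v => / sqrt (IZR (snd v))) Lm <= X * harm (length l)).
  { eapply Rle_trans; [apply (box_sum alpha Delta tau E Q); try easy|].
   - unfold Lm. apply (NoDup_map_inv (fun w => (arc_H A - fst w, arc_K A - snd w)%Z)). rewrite map_map.
    rewrite (map_ext _ arc_v); [now apply NoDup_map_filter|]. intros B. unfold arc_H, arc_K.
    apply injective_projections; cbn [fst snd]; ring.
   - intros v Hv. apply in_map_iff in Hv. destruct Hv as [B [<- HB]]. apply filter_In in HB. destruct HB as [HB HK].
    apply Z.ltb_lt in HK. destruct (Hl B HB) as [B1 B2]. unfold arc_k in B1.
    unfold in_box; cbn [fst snd]. split; [lia|]. rewrite !minus_IZR.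
    split; [pose proof (Rle_abs (IZR (arc_K A))); pose proof (Rcomplements.Rabs_maj2 (IZR (arc_K B))); lra|].
    replace (IZR (arc_H A) - IZR (arc_H B) - (IZR (arc_K A) - IZR (arc_K B)) * alpha) with
     ((IZR (arc_H A) - IZR (arc_K A) * alpha) - (IZR (arc_H B) - IZR (arc_K B) * alpha)) by ring.
    via Rabs_triang. rewrite Rabs_Ropp. lra.
   - mul_l. apply harm_mono. unfold Lm. rewrite length_map. apply length_filter_le. }
  apply Rle_trans with (rsum (fun v => / sqrt (IZR (snd v))) Lp + rsum (fun v => / sqrt (IZR (snd v))) Lm); [|lra].
  unfold Lp, Lm. rewrite !rsum_map. cbn [snd]. right. clear. induction l as [|B l IH]; simpl; [ring|]. rewrite IH.
  destruct (Z.eq_dec (arc_K A) (arc_K B)) as [E|E], (Z.ltb_spec (arc_K A) (arc_K B)) as [h1|h1],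
   (Z.ltb_spec (arc_K B) (arc_K A)) as [h2|h2]; try lia; simpl; try ring.
  - rewrite minus_IZR, Rabs_minus_sym, Rabs_pos_eq; [ring|]. apply IZR_lt in h1; lra.
  - rewrite minus_IZR, Rabs_pos_eq; [ring|]. apply IZR_lt in h2; lra.
Qed.

Lemma harm_le_ln M n : 1 <= M -> INR n <= 4 * M ^ 2 -> harm n <= 3 * (1 + ln M).
Proof.
  intros HM Hn. assert (HlM : 0 <= ln M) by (apply ln_nonneg; lra). destruct n as [|n]; [unfold harm; simpl; lra|].
  eapply Rle_trans; [apply harm_ln; lia|]. assert (0 < INR (S n)) by pos. assert (H4 : ln 4 <= 2).
  { replace 4 with (2 ^ 2) by ring. rewrite ln_pow by lra. simpl. pose proof ln_2_le. lra. }
  assert (ln (INR (S n)) <= ln 4 + 2 * ln M); [|lra].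
  replace (2 * ln M) with (ln (M ^ 2)) by (rewrite ln_pow by lra; simpl; lra).
  rewrite <- ln_mult by pos. apply Rcomplements.ln_le; easy.
Qed.

(** * The estimate when no small denominator comes close *)

Section Bad.

Variables (psi : C -> C) (C0 v0 q s z x1 x2 ell : R).
Hypotheses (Hp : tame_form psi C0) (Hv : 1 <= v0) (Hq : 64 <= q) (Hs : 1 <= s) (Hqs : 4 * q ^ 3 <= s ^ 2)
  (Hz : 1 <= z) (Hzq : z <= q) (H0 : 0 <= x1) (H01 : x1 <= x2) (H1 : x2 <= 1) (Hlen : x2 - x1 <= / s ^ 2)
  (Hell : ell = 1 + ln (s ^ 2 * q ^ 6)).

Let Delta := s ^ 2.
Let M := s ^ 2 * q ^ 6.
(** The Farey order is (Delta sqrt M)^(1/3): with it the diagonal terms and the pairs of different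
    arcs have the same order, up to powers of z and logarithms. *)
Let Rr := q * s.
Let tau := / (q ^ 2 * z ^ 2).
(** An arc that meets the interval has |H - K x1| <= 1/[Rr] + k/[Delta] <= 2 q/s, and differences of
    two arcs double this. *)
Let E := 4 * q / s.

Hypothesis (Hbad : badly_approx x1 Delta tau E (2 * Rr)).

Let fuel := Z.to_nat (up Rr).
Let arcs := farey_arcs x1 x2 (farey fuel Rr (0, 1)%Z (1, 1)%Z).

Lemma bad_basic : 64 <= Rr /\ 1 <= M /\ q <= M /\ Rr <= M /\ 1 <= ell /\ 0 < tau /\ 0 < E /\ E < 1 /\ 0 < Delta.
Proof.
  assert (h1 : 64 <= Rr) by (unfold Rr; nra).
  assert (hq2 : 1 <= q ^ 2) by nra. assert (hq4 : 1 <= q ^ 4) by (replace (q ^ 4) with (q ^ 2 * q ^ 2) by ring; nra).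
  assert (hq6 : q <= q ^ 6) by (replace (q ^ 6) with (q * (q * q ^ 4)) by ring; nra). assert (hs2 : s <= s ^ 2) by nra.
  assert (h2 : q * s <= M) by (unfold M; rewrite (Rmult_comm q); apply Rmult_le_compat; lra).
  assert (h3 : q <= q * s) by nra. assert (h4 : 1 <= ell).
  { rewrite Hell. fold M. pose proof (ln_nonneg M ltac:(lra)). lra. }
  assert (h5 : 0 < q ^ 2 * z ^ 2) by pos.
  split; [easy|]. split; [unfold Rr in h1; lra|]. split; [lra|]. split; [easy|]. split; [easy|].
  split; [now apply Rinv_0_lt_compat|]. split; [unfold E; apply Rdiv_lt_0_compat; lra|]. split; [|unfold Delta; nra].
  unfold E. apply Rmult_lt_reg_r with s; [lra|]. unfold Rdiv. rewrite Rmult_assoc, Rinv_l by lra.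
 nra.
Qed.

(** The lower bound for the denominators comes from [Hbad]: an arc meeting the interval satisfies |H
    - K x1| <= 1/[Rr] + k/[Delta], and k (1/[Rr] + k/[Delta]) stays below tau as long as k < s/(2 q
    z^2). *)
Lemma bad_arcs A : In A arcs -> arc_ok A /\ arc_p2 A <= / (arc_k A * Rr) /\ arc_k A <= Rr /\ Rabs (IZR (arc_a A)) <= Rr /\
  2 * Rabs (IZR (arc_H A) - IZR (arc_K A) * x1) <= E /\ s / (2 * q * z ^ 2) <= arc_k A.
Proof.
  intros HA. destruct bad_basic as (b1 & b2 & b3 & b3' & b4 & b5 & b6 & b7 & b8). assert (HN : Rr < INR fuel + 1 + 1).
  { pose proof (nat_ceil Rr ltac:(lra)). unfold fuel. lra. }
  pose proof (farey_arcs_in fuel Rr (0, 1)%Z (1, 1)%Z x1 x2 A H01 ltac:(lra) ltac:(unfold neighbours; simpl; lia)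
   ltac:(simpl; lra) ltac:(simpl; lra) HN HA) as (P1 & P2 & P3 & P4 & P5).
  pose proof (arc_k_pos A P1) as Hk. assert (P6 : Rabs (IZR (arc_H A) - IZR (arc_K A) * x1) <= / Rr + arc_k A * / s ^ 2).
  { nra. }
  assert (HsR : / Rr <= q / s).
  { unfold Rr. rewrite Rinv_mult. unfold Rdiv. mul_r. rewrite <- (Rinv_inv q) at 2. apply Rinv_le_contravar; [pos|].
   apply Rle_trans with 1; [rewrite <- Rinv_1; apply Rinv_le_contravar; lra|lra]. }
  assert (HkR : arc_k A * / s ^ 2 <= q / s).
  { apply Rle_trans with (Rr * / s ^ 2); [mul_r; easy|]. right. unfold Rr. field. lra. }
  assert (P7 : 2 * Rabs (IZR (arc_H A) - IZR (arc_K A) * x1) <= E).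
  { unfold E. replace (4 * q / s) with (2 * (q / s + q / s)) by (field; lra). lra. }
  split; [easy|]. split; [easy|]. split; [easy|]. split; [easy|]. split; [easy|].
  destruct (Rle_dec (s / (2 * q * z ^ 2)) (arc_k A)) as [h|h]; [easy|]. exfalso. apply Rnot_le_lt in h.
  set (k := arc_k A) in *. set (d := Rabs (IZR (arc_H A) - IZR (arc_K A) * x1)) in *.
  assert (Hb : tau <= k * Rmax d (k / Delta)).
  { destruct P1 as [HK _]. destruct (Z.lt_ge_cases (arc_K A) 0) as [Hn|Hn].
   - assert (Ek : IZR (- arc_K A) = k) by (unfold k, arc_k; rewrite opp_IZR, Rabs_left1; [easy|]; apply IZR_lt in Hn; lra).
    assert (Ed : Rabs (IZR (- arc_H A) - IZR (- arc_K A) * x1) = d).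
    { unfold d. rewrite !opp_IZR, <- Rabs_Ropp. f_equal. ring. }
    pose proof (Hbad (- arc_H A, - arc_K A)%Z) as HB. unfold in_box in HB. cbn [fst snd] in HB. rewrite Ed, Ek in HB. apply HB.
    split; [lia|]. split; [lra|]. lra.
   - assert (Ek : IZR (arc_K A) = k) by (unfold k, arc_k; rewrite Rabs_pos_eq; [easy|]; apply IZR_le in Hn; lra).
    pose proof (Hbad (arc_H A, arc_K A)) as HB. unfold in_box in HB. cbn [fst snd] in HB. fold d in HB. rewrite Ek in HB. apply HB.
    split; [lia|]. split; [lra|]. lra. }
  assert (Hm : Rmax d (k / Delta) <= / Rr + k * / s ^ 2).
  { apply Rmax_lub; [easy|]. unfold Delta, Rdiv. assert (0 < / Rr) by pos. lra. }
  assert (Hb2 : tau <= k * (/ Rr + k * / s ^ 2)) by nra. set (m := s / (2 * q * z ^ 2)) in *.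
  assert (Hz2 : 1 <= z ^ 2) by nra.

  assert (Hc : k * (/ Rr + k * / s ^ 2) < m * (/ Rr + m * / s ^ 2)).
  { assert (0 < / s ^ 2) by pos. assert (0 < / Rr) by pos.
   apply Rmult_gt_0_lt_compat; try lra; [|apply Rplus_lt_compat_l, Rmult_lt_compat_r; lra].
   assert (0 < k * / s ^ 2) by pos. lra. }
  assert (Hc2 : m * (/ Rr + m * / s ^ 2) <= tau).
  { unfold m, Rr, tau. replace (s / (2 * q * z ^ 2) * (/ (q * s) + s / (2 * q * z ^ 2) * / s ^ 2)) with
    (/ (q ^ 2 * z ^ 2) * ((2 + / z ^ 2) / 4)) by (field; lra).
   rewrite <- (Rmult_1_r (/ (q ^ 2 * z ^ 2))) at 2. mul_l.
   assert (/ z ^ 2 <= 1) by (rewrite <- Rinv_1; apply Rinv_le_contravar; lra). lra. }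
  lra.
Qed.

Lemma bad_nodup : NoDup (map arc_v arcs).
Proof.
  destruct bad_basic as (b1 & b2 & b3 & b3' & b4 & b5 & b6 & b7 & b8).
  apply farey_arcs_nodup; [unfold neighbours; simpl; lia|simpl; lra|simpl; lra|].
  pose proof (nat_ceil Rr ltac:(lra)). unfold fuel. simpl. lra.
Qed.

(** Since the denominators are not small, no arc extends further than 2 z^2/s^2 from its cusp, and
    the interval has to be enlarged only by a multiple of z^2/[Delta]. *)
Lemma bad_S1 : rsum (fun A => / arc_k A) arcs <= 10 * q * z ^ 2 / s.
Proof.
  destruct bad_basic as (b1 & b2 & b3 & b3' & b4 & b5 & b6 & b7 & b8).
 assert (Hz2 : 1 <= z ^ 2) by nra.
  eapply Rle_trans; [apply (farey_arcs_rsum fuel Rr (0, 1)%Z (1, 1)%Z x1 x2 (2 * z ^ 2 / s ^ 2)); try (simpl; lra)|].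
  - unfold neighbours; simpl; lia.
  - pose proof (nat_ceil Rr ltac:(lra)). unfold fuel. simpl. lra.
  - pos.
  - intros A HA. destruct (bad_arcs A HA) as (P1 & _ & _ & _ & _ & P6).
   replace (2 * z ^ 2 / s ^ 2) with (/ (s / (2 * q * z ^ 2) * Rr)) by (unfold Rr; field; lra).
   apply Rinv_le_contravar; [|apply Rmult_le_compat_r; lra].
   apply Rmult_lt_0_compat; [|lra]. apply Rdiv_lt_0_compat; [lra|nra].
  - replace (10 * q * z ^ 2 / s) with (2 * Rr * (z ^ 2 / s ^ 2 + 2 * (2 * z ^ 2 / s ^ 2))) by (unfold Rr; field; lra).
   mul_l. apply Rplus_le_compat_r. via Hlen. rewrite <- (Rmult_1_l (/ s ^ 2)). mul_r; lra.
Qed.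

Lemma bad_length l : (forall A, In A l -> arc_ok A /\ arc_k A <= Rr) -> rsum (fun A => / arc_k A) l <= 10 * q * z ^ 2 / s ->
  INR (length l) <= 10 * q ^ 2 * z ^ 2.
Proof.
  intros Hl HS. destruct bad_basic as (b1 & _).
  replace (10 * q ^ 2 * z ^ 2) with (Rr * (10 * q * z ^ 2 / s)) by (unfold Rr; field; lra).
  apply Rle_trans with (Rr * rsum (fun A => / arc_k A) l); [|apply Rmult_le_compat_l; lra].
  clear HS. induction l as [|A l IH]; [simpl; lra|].
  specialize (IH ltac:(intros; apply Hl; now right)). destruct (Hl A (or_introl eq_refl)) as [O1 O2].
  pose proof (arc_k_pos A O1). cbn [length rsum fold_right]. rewrite S_INR.
  change (fold_right (fun x acc => / arc_k x + acc) 0 l) with (rsum (fun A => / arc_k A) l). assert (1 <= Rr * / arc_k A).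
  { rewrite <- (Rinv_r (arc_k A)) by lra. mul_r; lra. }
  lra.
Qed.

(** With these values of E, tau and Delta the three terms of [box_count] agree up to a factor z; 71
    = 60 + 8 + 3. *)
Lemma bad_X : 10 * E * sqrt (2 * Rr) + 4 * sqrt (E / tau) + 2 * (sqrt (2 * Rr) / sqrt (tau * Delta)) <= 71 * q ^ 2 * z / sqrt Rr.
Proof.
  destruct bad_basic as (b1 & b2 & b3 & b3' & b4 & b5 & b6 & b7 & b8).
  set (r := sqrt Rr). assert (Hr : 0 < r) by (apply sqrt_lt_R0; lra). assert (Hrr : r * r = Rr) by (apply sqrt_sqrt; lra).
  assert (E1 : sqrt (2 * Rr) <= 3 / 2 * r).
  { rewrite sqrt_mult by lra. mul_r. replace (3 / 2) with (sqrt ((3 / 2) * (3 / 2))) by (apply sqrt_square; lra).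
   apply sqrt_le_1_alt. lra. }
  assert (E2 : sqrt (E / tau) = 2 * q ^ 2 * z / r).
  { replace (E / tau) with ((2 * q ^ 2 * z / r) * (2 * q ^ 2 * z / r)).
   - apply sqrt_square. left. apply Rdiv_lt_0_compat; [|easy]. nra.
   - replace (2 * q ^ 2 * z / r * (2 * q ^ 2 * z / r)) with (4 * q ^ 4 * z ^ 2 / (r * r)) by (field; lra).
    rewrite Hrr. unfold E, tau, Rr. field. lra. }
  assert (E3 : sqrt (tau * Delta) = s / (q * z)).
  { replace (tau * Delta) with ((s / (q * z)) * (s / (q * z))) by (unfold tau, Delta; field; lra).
   apply sqrt_square. left. apply Rdiv_lt_0_compat; nra. }
  rewrite E2, E3. assert (T1 : 10 * E * sqrt (2 * Rr) <= 60 * q ^ 2 * z / r).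
  { apply Rle_trans with (10 * E * (3 / 2 * r)); [apply Rmult_le_compat_l; lra|].
   replace (10 * E * (3 / 2 * r)) with (15 * E * (r * r) / r) by (field; lra). rewrite Hrr. mul_r. unfold E, Rr.
   replace (15 * (4 * q / s) * (q * s)) with (60 * q ^ 2 * 1) by (field; lra). apply Rmult_le_compat_l; nra. }
  assert (T3 : sqrt (2 * Rr) / (s / (q * z)) <= 3 / 2 * q ^ 2 * z / r).
  { replace (3 / 2 * q ^ 2 * z / r) with (3 / 2 * r / (s / (q * z))).
   - apply Rmult_le_compat_r; [|easy]. left. apply Rinv_0_lt_compat, Rdiv_lt_0_compat; nra.
   - replace (3 / 2 * r / (s / (q * z))) with (3 / 2 * (r * r) / (s / (q * z)) / r) by (field; lra). rewrite Hrr.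
    unfold Rr. field. lra. }
  replace (71 * q ^ 2 * z / r) with (60 * q ^ 2 * z / r + 4 * (2 * q ^ 2 * z / r) + 2 * (3 / 2 * q ^ 2 * z / r)) by (field; lra).
  lra.
Qed.

Let S2 := 2 * (71 * q ^ 2 * z / sqrt Rr) * (3 * ell).

(** Clipping changes neither the fraction nor the entry a, so whatever depends only on them is
    inherited from the full arcs. *)
Lemma bad_good i : good_pieces (Rr * 2 ^ i) (10 * q * z ^ 2 / s) S2 (pieces Rr arcs i) /\
  INR (length (pieces Rr arcs i)) <= 10 * q ^ 2 * z ^ 2.
Proof.
  destruct bad_basic as (b1 & b2 & b3 & b3' & b4 & b5 & b6 & b7 & b8). assert (Hi : 1 <= 2 ^ i) by (apply pow_R1_Rle; lra).
  assert (HP : forall A, In A (pieces Rr arcs i) -> exists A0, In A0 arcs /\ arc_v A = arc_v A0 /\ arc_a A = arc_a A0 /\ arc_ok A /\ 0 < arc_p1 A /\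
   arc_p1 A0 <= arc_p1 A /\ arc_p2 A <= arc_p2 A0 /\
   Rr * 2 ^ i <= arc_w1 A /\ arc_w1 A <= arc_w2 A /\ arc_w2 A <= 2 * (Rr * 2 ^ i)).
  { intros A HA. apply pieces_in; [lra| |easy]. intros B HB. now apply bad_arcs. }
  assert (HB : forall A, In A (pieces Rr arcs i) -> arc_ok A /\ 0 < arc_p1 A /\ Rr * 2 ^ i <= arc_w1 A /\ arc_w2 A <= 2 * (Rr * 2 ^ i) /\
   arc_k A <= Rr /\ Rabs (IZR (arc_a A)) <= Rr /\ 2 * Rabs (IZR (arc_H A) - IZR (arc_K A) * x1) <= E).
  { intros A HA. destruct (HP A HA) as [A0 (I1 & I2 & I3 & I4 & I5 & I6 & I7 & I8 & I9 & I10)].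
   destruct (bad_arcs A0 I1) as (P1 & P2 & P3 & P4 & P5 & P6). unfold arc_k, arc_K, arc_H in *. rewrite I2, I3. tauto. }
  assert (HS1 : rsum (fun A => / arc_k A) (pieces Rr arcs i) <= 10 * q * z ^ 2 / s).
  { eapply Rle_trans; [|exact bad_S1]. apply (pieces_rsum_le Rr arcs i (fun v => / Rabs (IZR (snd v)))).
   intros A HA. left. apply Rinv_0_lt_compat. pose proof (arc_k_pos A (proj1 (bad_arcs A HA))). unfold arc_k, arc_K in *. lra. }
  assert (HLen : INR (length (pieces Rr arcs i)) <= 10 * q ^ 2 * z ^ 2).
  { apply bad_length; [|easy]. intros A HA. destruct (HB A HA); tauto. }
  assert (HND : NoDup (map arc_v (pieces Rr arcs i))) by (apply pieces_nodup, bad_nodup).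
  assert (HX : 0 <= 71 * q ^ 2 * z / sqrt Rr).
  { pos. }
  assert (HRi : Rr <= Rr * 2 ^ i) by nra. split; [|easy]. split; [|split; [|split; [|split; [|split]]]].
  - intros A HA. destruct (HB A HA) as (B1 & B2 & B3 & B4 & B5 & B6 & B7). repeat split; try easy; try lra; apply B1.
  - now apply NoDup_map_inv in HND.
  (* K determines H because |H_A - H_B| <= E < 1, where E < 1 comes from 4 q^3 <= s^2. *)
  - intros A B HA HB' EK. apply (NoDup_map_inj arc_v (pieces Rr arcs i)); try easy.
   apply injective_projections; [|exact EK]. change (arc_H A = arc_H B).
   destruct (HB A HA) as (_ & _ & _ & _ & _ & _ & A7). destruct (HB B HB') as (_ & _ & _ & _ & _ & _ & B7).
   rewrite EK in A7. assert (Hd : Rabs (IZR (arc_H A) - IZR (arc_H B)) < 1).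
   { replace (IZR (arc_H A) - IZR (arc_H B)) with ((IZR (arc_H A) - IZR (arc_K B) * x1) - (IZR (arc_H B) - IZR (arc_K B) * x1)) by ring.
    eapply Rle_lt_trans; [apply Rabs_triang|]. rewrite Rabs_Ropp. lra. }
   rewrite <- minus_IZR, <- abs_IZR in Hd. apply lt_IZR in Hd. lia.
  - exact HS1.
  - unfold S2. apply Rmult_le_pos; lra.
  - intros A HA. eapply Rle_trans; [apply (difference_sum x1 Delta tau E (2 * Rr)); try easy|].
   + intros B HB'. destruct (HB B HB') as (B1 & B2 & B3 & B4 & B5 & B6 & B7). split; [lra|easy].
   + unfold S2. apply Rmult_le_compat.
    * pos.
    * apply harm_nonneg.
    * mul_l. apply bad_X.
    * rewrite Hell; apply harm_le_ln; [easy|]. fold M. via HLen.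
     assert (Hq4 : q ^ 2 * z ^ 2 <= q ^ 4) by (replace (q ^ 4) with (q ^ 2 * q ^ 2) by ring; mul_l; (apply pow_incr; lra)).
     assert (Hq6 : 10 * q ^ 4 <= q ^ 6) by (replace (q ^ 6) with (q ^ 2 * q ^ 4) by ring; mul_r; nra).
     assert (q ^ 6 <= M) by (unfold M; rewrite <- (Rmult_1_l (q ^ 6)) at 1; mul_r; nra). nra.
Qed.

Lemma bad_class i : 2 ^ i <= M ->
  Delta * Cmod (csum (arc_int (wave psi v0 M)) (pieces Rr arcs i)) <= 6 * 10 ^ 8 * (v0 + 1) ^ 3 * C0 * ell * (z ^ 2 / q).
Proof.
  intros HiM. destruct bad_basic as (b1 & b2 & b3 & b3' & b4 & b5 & b6 & b7 & b8). pose proof (tame_pos _ _ Hp) as HC.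
  destruct (bad_good i) as [HG HLen]. set (W := Rr * 2 ^ i) in *. set (l := pieces Rr arcs i) in *.
  assert (Hi : 1 <= 2 ^ i) by (apply pow_R1_Rle; lra).
  assert (HRW : Rr <= W) by (unfold W; rewrite <- (Rmult_1_r Rr) at 1; apply Rmult_le_compat_l; lra).
  (* The number of translates is of order W <= M^2, so that [harm H] is still a logarithm of M. *)
  set (H := Z.to_nat (up (3 * W))). assert (HH : 3 * W <= INR H <= 4 * W).
  { pose proof (nat_ceil (3 * W) ltac:(lra)). unfold H. lra. }
  assert (HWM : W <= M ^ 2).
  { unfold W. replace (M ^ 2) with (M * M) by ring. apply Rmult_le_compat; lra. }
  assert (Hh : harm H <= 3 * ell) by (rewrite Hell; apply harm_le_ln; [easy|fold M; lra]).
  set (v1 := v0 + 1) in *. assert (Hv1 : 2 <= v1) by (unfold v1; lra). set (S1 := 10 * q * z ^ 2 / s) in *.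
  assert (Hz2 : 1 <= z ^ 2) by nra. assert (HS1 : 0 < S1) by (apply Rdiv_lt_0_compat; nra).
  set (g := W ^ 2 / M). assert (Hg : 0 < g) by (apply Rdiv_lt_0_compat; [nra|lra]). set (LS := line_sum v0 M W S1 S2 H).
  set (r := sqrt Rr). assert (Hr : 0 < r) by (apply sqrt_lt_R0; lra). assert (Hrr : r * r = Rr) by (apply sqrt_sqrt; lra).
  assert (HS2 : 0 <= S2).
  { apply HG. }
  assert (Hv2 : 0 < v1 ^ 2) by nra. assert (HW4 : 0 < W ^ 4) by pos. assert (HW5 : 0 < W ^ 5) by pos.
  assert (HW8 : 0 < W ^ 8) by pos. assert (HLS : 0 <= LS).
  { unfold LS, line_sum, off_diag. fold v1. apply Rmult_le_pos; [lra|]. assert (0 <= (M / W ^ 4) ^ 2 * W) by pos.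
   assert (0 <= 3200 * v1 ^ 2 * M / W ^ 5 * harm H).
   { apply Rmult_le_pos; [|apply harm_nonneg]. left. apply Rdiv_lt_0_compat; [pos|easy]. }
   assert (0 <= 8 * W * (3202 * v1 ^ 2 * (M ^ 2 / W ^ 8) * sqrt (W ^ 3 / M)) * S2).
   { pos. }
   lra. }
  (* [sqrt M = s q^3] and [sqrt W >= r] *)
  assert (Hsq : sqrt (W ^ 3 / M) / W ^ 3 <= / (r ^ 3 * (s * q ^ 3))).
  { set (w := sqrt W). assert (Hww : w * w = W) by (apply sqrt_sqrt; lra).
   assert (Hrw : r <= w) by (apply sqrt_le_1_alt; lra). assert (Hsq3 : 0 < s * q ^ 3) by pos.
   replace (W ^ 3 / M) with ((w ^ 3 / (s * q ^ 3)) * (w ^ 3 / (s * q ^ 3))).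
   2:{ rewrite <- Hww. unfold M. field. lra. }

   rewrite sqrt_square by pos.
   replace (w ^ 3 / (s * q ^ 3) / W ^ 3) with (/ (w ^ 3 * (s * q ^ 3))) by (rewrite <- Hww; field; lra).

   apply Rinv_le_contravar; [pos|]. mul_r. apply pow_incr; lra. }
  set (u := z ^ 4 / q ^ 2). assert (Hu : 0 < u) by (unfold u; apply Rdiv_lt_0_compat; apply pow_lt; lra).
  assert (HK : Delta ^ 2 * (g ^ 2 * LS) <= 2 * 10 ^ 8 * v1 ^ 2 * ell * u).
  (* Only negative powers of W remain, so every class is covered by the worst case W = [Rr]; 25616 =
     8 * 3202. *)
  { assert (E0 : g ^ 2 * LS = S1 * (/ W ^ 3 + 3200 * v1 ^ 2 * harm H / (M * W) + 25616 * v1 ^ 2 * (sqrt (W ^ 3 / M) / W ^ 3) * S2)).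
   { unfold g, LS, line_sum, off_diag. fold v1. field. lra. }
   rewrite E0. assert (T1 : / W ^ 3 <= / (q ^ 3 * s ^ 3)).
   { replace (q ^ 3 * s ^ 3) with (Rr ^ 3) by (unfold Rr; ring). apply Rinv_le_contravar; [pos|apply pow_incr; lra]. }
   assert (T2 : 3200 * v1 ^ 2 * harm H / (M * W) <= 3200 * v1 ^ 2 * (3 * ell) / (s ^ 3 * q ^ 7)).
   { apply Rmult_le_compat.
    - apply Rmult_le_pos; [lra|apply harm_nonneg].
    - pos.
    - apply Rmult_le_compat_l; lra.
    - apply Rinv_le_contravar; [pos|].
     replace (s ^ 3 * q ^ 7) with (M * Rr) by (unfold M, Rr; ring). apply Rmult_le_compat_l; lra. }
   assert (T3 : sqrt (W ^ 3 / M) / W ^ 3 * S2 <= 426 * ell * z / (q ^ 3 * s ^ 3)).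
   { eapply Rle_trans; [mul_r; exact Hsq|]. unfold S2. fold r. right.
    replace (/ (r ^ 3 * (s * q ^ 3)) * (2 * (71 * q ^ 2 * z / r) * (3 * ell))) with
     (426 * q ^ 2 * z * ell / ((r * r) * (r * r) * (s * q ^ 3))) by (field; lra).
    rewrite Hrr. unfold Rr. field. lra. }
   apply Rle_trans with (Delta ^ 2 * (S1 * (/ (q ^ 3 * s ^ 3) + 3200 * v1 ^ 2 * (3 * ell) / (s ^ 3 * q ^ 7) +
     25616 * v1 ^ 2 * (426 * ell * z / (q ^ 3 * s ^ 3))))).
   { mul_l. mul_l.
    assert (25616 * v1 ^ 2 * (sqrt (W ^ 3 / M) / W ^ 3) * S2 <= 25616 * v1 ^ 2 * (426 * ell * z / (q ^ 3 * s ^ 3))).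
    { rewrite Rmult_assoc. apply Rmult_le_compat_l; lra. }
    lra. }
   replace (Delta ^ 2 * (S1 * (/ (q ^ 3 * s ^ 3) + 3200 * v1 ^ 2 * (3 * ell) / (s ^ 3 * q ^ 7) +
     25616 * v1 ^ 2 * (426 * ell * z / (q ^ 3 * s ^ 3))))) with
    (z ^ 2 / q ^ 2 * (10 + 96000 * (v1 ^ 2 * ell) * / q ^ 4 + 109124160 * (v1 ^ 2 * ell) * z))
    by (unfold Delta, S1; field; lra).
   unfold u. replace (2 * 10 ^ 8 * v1 ^ 2 * ell * (z ^ 4 / q ^ 2)) with (z ^ 2 / q ^ 2 * (2 * 10 ^ 8 * (v1 ^ 2 * ell) * z ^ 2)) by (field; lra).
   mul_l. assert (Hve : 1 <= v1 ^ 2 * ell) by nra. set (y := v1 ^ 2 * ell) in *.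
   assert (Hq4 : / q ^ 4 <= 1) by (rewrite <- Rinv_1; apply Rinv_le_contravar; [lra|]; apply pow_R1_Rle; lra).
   assert (96000 * y * / q ^ 4 <= 96000 * y) by nra. assert (y * z <= y * z ^ 2) by (apply Rmult_le_compat_l; nra).
   assert (y * 1 <= y * z ^ 2) by (apply Rmult_le_compat_l; nra). lra. }
  (* This t equalises the two terms of [pieces_bound]: multiplied by Delta, both are of order z^2/q,
     up to the logarithm in the first. *)
  set (sg := q / z ^ 2). assert (Hsg : 0 < sg) by (apply Rdiv_lt_0_compat; lra). set (t := g * Delta * sg).
  assert (Ht : 0 < t) by (unfold t; apply Rmult_lt_0_compat; [pos|]; easy).
  pose proof (pieces_bound psi C0 v0 M W S1 S2 l H t Hp ltac:(lra) ltac:(lra) Hv HG (proj1 HH) Ht HLS) as HPB.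
  fold LS v1 in HPB.
  assert (Happ : Cmod (csum (arc_int (wave psi v0 M)) l - csum (cusp_int psi v0 M) l)%C <= INR (length l) * (2 * C0 * v1 / M)).
  { rewrite <- csum_minus, (Rmult_comm (INR _)), <- rsum_const. eapply Rle_trans; [apply csum_norm; intros; apply Rle_refl|].
   apply rsum_le. intros A HA. destruct HG as (HG & _). destruct (HG A HA) as (G1 & G2 & G3 & G4 & _).
   apply (arc_int_approx psi C0 v0 M A W); try easy; lra. }
  set (X := csum (arc_int (wave psi v0 M)) l) in *. set (Y := csum (cusp_int psi v0 M) l) in *.
  assert (HXY : Cmod X <= Cmod (X - Y)%C + Cmod Y).
  { replace X with ((X - Y) + Y)%C at 1 by ring. apply Cmod_triangle. }
  assert (A1 : Delta * (INR (length l) * (2 * C0 * v1 / M)) <= 20 * C0 * v1 * (z ^ 2 / q)).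
  { apply Rle_trans with (Delta * (10 * q ^ 2 * z ^ 2 * (2 * C0 * v1 / M))).
   - mul_l. apply Rmult_le_compat_r; [|easy]. left. apply Rdiv_lt_0_compat; nra.
   - replace (Delta * (10 * q ^ 2 * z ^ 2 * (2 * C0 * v1 / M))) with (20 * C0 * v1 * (z ^ 2 * / q ^ 4)) by (unfold Delta, M; field; lra).
    mul_l. mul_l. apply Rinv_le_contravar; [lra|]. replace q with (q ^ 1) at 1 by ring. apply Rle_pow; [lra|lia]. }
  assert (A2 : Delta * Cmod Y <= 2 * v1 * C0 * (2 * 10 ^ 8 * v1 ^ 2 * ell + 3) * (z ^ 2 / q)).
  { eapply Rle_trans; [mul_l; exact HPB|]. replace (Delta * (4 * v1 * W ^ 2 / M * (C0 * (t * LS + 3 / t) / 2))) with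
    (2 * v1 * C0 * (sg * (Delta ^ 2 * (g ^ 2 * LS)) + 3 / sg)).
   2:{ unfold t, g. field. repeat split; lra. }
   replace (2 * v1 * C0 * (2 * 10 ^ 8 * v1 ^ 2 * ell + 3) * (z ^ 2 / q)) with
    (2 * v1 * C0 * (sg * (2 * 10 ^ 8 * v1 ^ 2 * ell * u) + 3 / sg)) by (unfold sg, u; field; lra).
   mul_l. apply Rplus_le_compat_r, Rmult_le_compat_l; lra. }
  apply Rle_trans with ((20 * C0 * v1 + 2 * v1 * C0 * (2 * 10 ^ 8 * v1 ^ 2 * ell + 3)) * (z ^ 2 / q)).
  { rewrite Rmult_plus_distr_r. eapply Rle_trans; [mul_l; exact HXY|]. rewrite Rmult_plus_distr_l.
   apply Rplus_le_compat; [|exact A2]. eapply Rle_trans; [mul_l; exact Happ|exact A1]. }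
  mul_r. set (y := C0 * v1). assert (Hy : 0 < y) by (unfold y; nra). assert (Hve : 1 <= v1 ^ 2 * ell) by nra.
  replace (20 * C0 * v1 + 2 * v1 * C0 * (2 * 10 ^ 8 * v1 ^ 2 * ell + 3)) with (y * (26 + 4 * 10 ^ 8 * (v1 ^ 2 * ell))) by (unfold y; ring).
  replace (6 * 10 ^ 8 * v1 ^ 3 * C0 * ell) with (y * (6 * 10 ^ 8 * (v1 ^ 2 * ell))) by (unfold y; ring).
  apply Rmult_le_compat_l; lra.
Qed.

Lemma bad_total : Delta * Cmod (CInt (wave psi v0 M) x1 x2) <= 2 * 10 ^ 9 * (v0 + 1) ^ 3 * C0 * ell ^ 2 * (z ^ 2 / q).
Proof.
  destruct bad_basic as (b1 & b2 & b3 & b3' & b4 & b5 & b6 & b7 & b8). pose proof (tame_pos _ _ Hp) as HC.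
  assert (Hf : forall x, ccont (wave psi v0 M) x) by (intros; apply (wave_cont psi C0); easy || lra).
  assert (HI : CInt (wave psi v0 M) x1 x2 = csum (arc_int (wave psi v0 M)) arcs).
  { unfold arcs. rewrite farey_arcs_int; try easy; try (simpl; lra).
   - unfold frac; simpl. replace (0 / 1) with 0 by field. replace (1 / 1) with 1 by field.
    unfold clamp. rewrite (Rmin_right x2 0), (Rmin_left x2 1), (Rmax_left x1 0), (Rmax_right x1 x2) by lra. easy.
   - pose proof (nat_ceil Rr ltac:(lra)). unfold fuel. simpl. lra. }
  rewrite HI. destruct (pow2_bracket M b2) as [n [[Hn1 Hn2] HnL]]. assert (HLen : INR (length arcs) <= 10 * q ^ 2 * z ^ 2).
  { apply bad_length; [|exact bad_S1]. intros A HA. destruct (bad_arcs A HA); tauto. }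
  pose proof (arc_int_split (wave psi v0 M) arcs Rr n C0 ltac:(lra) ltac:(lra) Hf
   ltac:(intros; apply wave_bound; easy || lra) ltac:(intros A HA; destruct (bad_arcs A HA); tauto)) as HSp.
  set (c := 6 * 10 ^ 8 * (v0 + 1) ^ 3 * C0 * ell * (z ^ 2 / q)). assert (Hzq2 : 0 < z ^ 2 / q) by pos.
  assert (Hv1 : 8 <= (v0 + 1) ^ 3) by (replace 8 with (2 ^ 3) by ring; apply pow_incr; lra).
  assert (Hcl : Delta * rsum (fun i => Cmod (csum (arc_int (wave psi v0 M)) (pieces Rr arcs i))) (seq 0 n) <= INR n * c).
  { rewrite <- rsum_scal. replace (INR n) with (INR (length (seq 0 n))) by now rewrite length_seq. rewrite (Rmult_comm (INR _)), <- rsum_const.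
   apply rsum_le. intros i Hi. apply in_seq in Hi. apply bad_class.
   apply Rmult_le_reg_l with 2; [lra|]. eapply Rle_trans; [|exact Hn2]. change (2 * 2 ^ i) with (2 ^ S i). apply Rle_pow; [lra|lia]. }
  assert (Htl : Delta * rsum (fun A => C0 / (arc_k A * Rr * 2 ^ n)) arcs <= 10 * C0 * (z ^ 2 / q)).
  { apply Rle_trans with (Delta * (C0 / (Rr * 2 ^ n) * (10 * q * z ^ 2 / s))).
   - mul_l. eapply Rle_trans; [|apply Rmult_le_compat_l; [|exact bad_S1]].
    + rewrite <- rsum_scal. right. apply rsum_ext. intros A HA. pose proof (arc_k_pos A (proj1 (bad_arcs A HA))). field. lra.
    + pos.
   - replace (Delta * (C0 / (Rr * 2 ^ n) * (10 * q * z ^ 2 / s))) with (10 * C0 * (z ^ 2 * / 2 ^ n)) by (unfold Delta, Rr; field; lra).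
    mul_l. mul_l. apply Rinv_le_contravar; lra. }
  fold M in Hell. rewrite <- Hell in HnL. apply (Rmult_le_compat_l Delta) in HSp; [|lra]. rewrite Rmult_plus_distr_l in HSp.
  apply Rle_trans with (2 * ell * c + 10 * C0 * (z ^ 2 / q)).
  { assert (Hc : 0 <= c) by (unfold c; apply Rmult_le_pos; [|lra]; apply Rmult_le_pos; [|lra]; apply Rmult_le_pos; lra).
   assert (INR n * c <= 2 * ell * c) by nra. lra. }
  unfold c. replace (2 * ell * (6 * 10 ^ 8 * (v0 + 1) ^ 3 * C0 * ell * (z ^ 2 / q)) + 10 * C0 * (z ^ 2 / q)) with
   (C0 * (z ^ 2 / q) * (12 * 10 ^ 8 * ((v0 + 1) ^ 3 * ell ^ 2) + 10)) by ring.
  replace (2 * 10 ^ 9 * (v0 + 1) ^ 3 * C0 * ell ^ 2 * (z ^ 2 / q)) with (C0 * (z ^ 2 / q) * (2 * 10 ^ 9 * ((v0 + 1) ^ 3 * ell ^ 2))) by ring.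
  mul_l.
 assert (8 <= (v0 + 1) ^ 3 * ell ^ 2) by nra. lra.
Qed.

End Bad.

(** * Neighbourhoods of a rational *)

Lemma bv_inv_phase M m a b mu : 0 < a -> a <= b -> 0 < M -> 0 < mu ->
  (forall x, a <= x <= b -> mu <= M / x ^ 2 - m) \/ (forall x, a <= x <= b -> mu <= m - M / x ^ 2) ->
  bv (fun x => / (M / x ^ 2 - m)) a b (/ mu).
Proof.
  intros Ha Hab HM Hmu H. assert (Hd : forall x y, a <= x -> x <= y -> M / y ^ 2 <= M / x ^ 2).
  { intros x y H1 H2. mul_l. apply Rinv_le_contravar; [pos|apply pow_incr; lra]. }
  destruct H as [H|H].
  - apply bv_incr; [easy| |].
   + intros x y H1 H2 H3. pose proof (H y ltac:(lra)). specialize (Hd x y H1 H2). split.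
    * pos.
    * apply Rinv_le_contravar; lra.
   + apply Rinv_le_contravar; [easy|apply H; lra].
  - apply (bv_ext (fun x => - / (m - M / x ^ 2))).
   + intros x Hx. specialize (H x Hx). rewrite <- Rinv_opp. f_equal. ring.
   + apply bv_opp, bv_decr; [easy| |].
    * intros x y H1 H2 H3. pose proof (H x ltac:(lra)). specialize (Hd x y H1 H2). split.
     -- pos.
     -- apply Rinv_le_contravar; lra.
    * apply Rinv_le_contravar; [easy|apply H; lra].
Qed.

Lemma continuous_quot_sq M x : 0 < x -> continuous (fun x => M / x ^ 2) x.
Proof.
  intros Hx. apply continuous_Rmult; [apply continuous_const|]. apply (continuous_inv (fun x => x ^ 2)).
  - apply (ex_derive_continuous (fun x => x ^ 2)). auto_derive; easy.
  - apply pow_nonzero; lra.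
Qed.

Lemma osc_far M m K (A f : R -> R) a b s mu : 0 < a -> a <= b -> 0 < M -> 0 < mu -> K <> 0 ->
  (forall x, a <= x <= b -> mu <= M / x ^ 2 - m) \/ (forall x, a <= x <= b -> mu <= m - M / x ^ 2) ->
  (forall x, a <= x <= b -> is_derive f x ((M / x ^ 2 - m) / K)) ->
  bv A a b s -> (forall x, a <= x <= b -> continuous A x) ->
  Cmod (CInt (fun x => RtoC (A x) * e (f x))%C a b) <= 4 * s * Rabs K / mu.
Proof.
  intros Ha Hab HM Hmu HK Hsep Hf HA HAc. pose proof (bv_inv_phase M m a b mu Ha Hab HM Hmu Hsep) as HV.
  assert (Hne : forall x, a <= x <= b -> M / x ^ 2 - m <> 0).
  { intros x Hx. destruct Hsep as [H|H]; specialize (H x Hx); lra. }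
  pose proof (bv_mult _ _ _ _ _ _ Hab HA (bv_scal _ _ _ _ K HV)) as HB. cbv beta in HB.
  rewrite (CInt_ext _ (fun x => RtoC (A x * (K * / (M / x ^ 2 - m))) * (RtoC ((M / x ^ 2 - m) / K) * e (f x)))%C).
  - replace (4 * s * Rabs K / mu) with (2 * (2 * s * (Rabs K * / mu))) by (field; lra).
   apply (vdc f (fun x => (M / x ^ 2 - m) / K)); try easy.
   + intros x Hx. apply continuous_Rmult; [|apply continuous_const]. apply continuous_Rminus; [|apply continuous_const].
    apply continuous_quot_sq; lra.
   + intros x Hx. apply continuous_Rmult; [now apply HAc|]. apply continuous_Rmult; [apply continuous_const|].
    apply continuous_inv; [|now apply Hne]. apply continuous_Rminus; [|apply continuous_const]. apply continuous_quot_sq; lra.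
  - easy.
  - intros x Hx. specialize (Hne x ltac:(lra)). rewrite Cmult_assoc, <- RtoC_mult. f_equal. f_equal.
   set (u := M / x ^ 2 - m) in *. field. easy.
Qed.

(** A second derivative test at the stationary point sqrt(M/m). The radius balances the trivial
    bound s rho inside with the first derivative bound of order s |K| W/(m rho) outside. *)
Lemma osc_stationary M m K (A f : R -> R) W a b s : 0 < W -> W <= a -> a <= b -> b <= 2 * W -> 0 < M -> 0 < m -> K <> 0 ->
  (forall x, a <= x <= b -> is_derive f x ((M / x ^ 2 - m) / K)) ->
  bv A a b s -> (forall x, a <= x <= b -> continuous A x) ->
  Cmod (CInt (fun x => RtoC (A x) * e (f x))%C a b) <= 18 * s * sqrt (Rabs K * W / m).
Proof.
  intros HW HWa Hab HbW HM Hm HK Hf HA HAc. pose proof (bv_nonneg _ _ _ _ Hab HA) as Hs.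
  assert (HKa : 0 < Rabs K) by now apply Rabs_pos_lt. assert (Hr0 : 0 < Rabs K * W / m) by pos.
  set (rho := sqrt (Rabs K * W / m)). assert (Hrho : 0 < rho) by now apply sqrt_lt_R0.
  assert (Hrr : rho * rho = Rabs K * W / m) by (apply sqrt_sqrt; lra).
  set (c := sqrt (M / m)). assert (Hc : 0 < c) by (apply sqrt_lt_R0, Rdiv_lt_0_compat; lra).
  assert (Hcc : M = m * (c * c)) by (unfold c; rewrite sqrt_sqrt; [field; lra|pos]).
  set (F := fun x => (RtoC (A x) * e (f x))%C). set (c1 := clamp a b (c - rho)). set (c2 := clamp a b (c + rho)).
  destruct (clamp_spec a b (c - rho) Hab) as [R1 S1]. destruct (clamp_spec a b (c + rho) Hab) as [R2 S2].
  fold c1 in R1, S1. fold c2 in R2, S2. assert (H12 : c1 <= c2) by lra.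
  assert (Fex : forall u v, a <= u -> u <= v -> v <= b -> exC F u v).
  { intros u v H1 H2 H3. apply exC_cont; [easy|]. intros x Hx. apply ccont_amp; [apply HAc; lra|].
   apply ccont_e. apply (ex_derive_continuous f). eexists; apply Hf; lra. }
  set (mu := m * rho / (2 * W)). assert (Hmu : 0 < mu) by (unfold mu; apply Rdiv_lt_0_compat; [pos|]; lra).
  (* |M/x^2 - m| = m |x - c| (x + c) / x^2 *)
  assert (Hlow : forall d x, rho <= d -> W <= x <= 2 * W -> mu <= m * d * (x + c) / x ^ 2).
  { intros d x Hd Hx. apply Rle_trans with (m * rho / x).
   - unfold mu. mul_l. apply Rinv_le_contravar; lra.
   - replace (m * d * (x + c) / x ^ 2) with (m * (d * (x + c) / x) / x) by (field; lra). mul_r. mul_l.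
    apply Rmult_le_reg_r with x; [lra|]. unfold Rdiv. rewrite Rmult_assoc, Rinv_l by lra. nra. }
  assert (Hside : forall u v, a <= u -> u <= v -> v <= b -> (u = v \/
    (forall x, u <= x <= v -> rho <= x - c) \/ (forall x, u <= x <= v -> rho <= c - x)) ->
    Cmod (CInt F u v) <= 8 * s * rho).
  { intros u v H1 H2 H3 H4. destruct H4 as [->|H4].
   - rewrite CInt_point, Cmod_0. apply Rmult_le_pos; lra.
   - replace (8 * s * rho) with (4 * s * Rabs K / mu).
    2:{ unfold mu. apply Rmult_eq_reg_r with (rho * m); [|apply Rmult_integral_contrapositive; lra].
      transitivity (8 * s * (Rabs K * W)); [field; lra|]. transitivity (8 * s * (rho * rho) * m); [rewrite Hrr; field; lra|ring]. }
    apply (osc_far M m K A f); try easy; try lra.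
    + destruct H4 as [H4|H4]; [right|left]; intros x Hx; specialize (H4 x Hx).
     * replace (m - M / x ^ 2) with (m * (x - c) * (x + c) / x ^ 2) by (rewrite Hcc; field; lra). apply Hlow; lra.
     * replace (M / x ^ 2 - m) with (m * (c - x) * (x + c) / x ^ 2) by (rewrite Hcc; field; lra). apply Hlow; lra.
    + intros; apply Hf; lra.
    + now apply (bv_sub A a b).
    + intros; apply HAc; lra. }
  fold F. rewrite (CInt_Chasles F a c1 b) by (try easy; apply Fex; lra).
  rewrite (CInt_Chasles F c1 c2 b) by (try easy; apply Fex; lra). assert (I1 : Cmod (CInt F a c1) <= 8 * s * rho).
  { apply Hside; try lra. destruct S1 as [S1|[S1|S1]].
   - right; right. intros; lra.
   - left; lra.
   - right; right. intros; lra. }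
  assert (I3 : Cmod (CInt F c2 b) <= 8 * s * rho).
  { apply Hside; try lra. destruct S2 as [S2|[S2|S2]].
   - right; left. intros; lra.
   - right; left. intros; lra.
   - left; lra. }
  assert (I2 : Cmod (CInt F c1 c2) <= s * (c2 - c1)).
  { apply CInt_norm_const; [easy| |apply Fex; lra]. intros x Hx. unfold F.
   rewrite Cmod_mult, Cmod_R, Cmod_e, Rmult_1_r. apply HA; lra. }
  assert (s * (c2 - c1) <= s * (2 * rho)) by nra.
  via Cmod_triangle. eapply Rle_trans; [apply Rplus_le_compat_l, Cmod_triangle|]. lra.
Qed.

(** * Weights of the Fourier coefficients at a cusp *)

Lemma K_imag_cont kappa v : 0 < v -> continuous (K_imag kappa) v.
Proof.
  intros Hv. set (L := 2 * INR (fact 2) / (v / 2) ^ 2). assert (HL : 0 <= L).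
  { unfold L. apply Rmult_le_pos; [simpl; lra|]. left. apply Rinv_0_lt_compat, pow_lt. lra. }
  apply (continuous_lip _ _ L (v / 2)); [lra|]. intros y Hy. apply Rabs_def2 in Hy.
  assert (P : forall a b, v / 2 <= a -> a <= b -> Rabs (K_imag kappa a - K_imag kappa b) <= L * (b - a)).
  { intros a b Ha Hab. eapply Rle_trans; [apply (K_imag_lip kappa a b 1); lra || lia|]. mul_r. unfold L. mul_l.
   apply Rinv_le_contravar; [pos|apply pow_incr; lra]. }
  destruct (Rle_dec y v) as [h|h].
  - rewrite (Rabs_left1 (y - v)) by lra. eapply Rle_trans; [apply P; lra|]. right; ring.
  - rewrite (Rabs_pos_eq (y - v)) by lra. rewrite Rabs_minus_sym. eapply Rle_trans; [apply P; lra|]. right; ring.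
Qed.

(** Differentiation in w produces a factor n y w; one more power of the decay of K turns it into
    1/W, so that the variation over a dyadic interval is of the order of the bound for the size. *)
Lemma kernel_bv kappa n y W a b D : (1 <= n)%nat -> 0 < y -> 0 < W -> W <= a -> a <= b -> b <= 2 * W -> (1 <= D)%nat ->
  bv (fun w => K_imag kappa (2 * PI * INR n * (y * w ^ 2))) a b (8 * INR (fact (S D)) / (INR n * (y * W ^ 2)) ^ D).
Proof.
  intros Hn Hy HW HWa Hab HbW HD. pose proof PI2_3_2 as HP. unfold PI2 in HP.
  assert (Hn1 : 1 <= INR n) by (apply (le_INR 1); lia). assert (HW2 : 0 < W ^ 2) by now apply pow_lt.
  assert (Hy2 : 0 < y * W ^ 2) by now apply Rmult_lt_0_compat.
  set (q := INR n * (y * W ^ 2)). assert (Hq : 0 < q) by (unfold q; apply Rmult_lt_0_compat; lra).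
  assert (HqD : 0 < q ^ D) by now apply pow_lt.
  pose proof (INR_fact_lt_0 D) as F1. assert (F2 : INR (fact D) <= INR (fact (S D))) by (apply le_INR; simpl; lia).
  assert (Hmon : forall x, a <= x -> q <= INR n * (y * x ^ 2)).
  { intros x Hx. unfold q. mul_l. mul_l. apply pow_incr; lra. }
  apply (bv_lip _ _ _ _ (2 * INR (fact (S D)) * 4 / (q ^ D * W))).
  - intros x Hx. specialize (Hmon x ltac:(lra)). assert (Hx2 : 0 < y * x ^ 2) by pos.
   via (K_term_bound kappa n (y * x ^ 2) D Hn Hx2 HD). apply Rle_trans with (2 * INR (fact D) / q ^ D).
   + mul_l. apply Rinv_le_contravar; [easy|]. apply pow_incr; lra.
   + mul_r; lra.
  - intros x z Hx Hxz Hz. pose proof (Hmon x Hx) as Hmx.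
   set (X := 2 * PI * INR n * (y * x ^ 2)). set (Z := 2 * PI * INR n * (y * z ^ 2)).
   assert (HX : 2 * PI * q <= X) by (unfold X; nra).
   assert (HXZ : Z - X = 2 * PI * INR n * y * (z + x) * (z - x)) by (unfold X, Z; ring).
   assert (Hny : 0 < 2 * PI * INR n * y) by pos. assert (Hle : Z - X <= 2 * PI * INR n * y * (4 * W) * (z - x)).
   { rewrite HXZ. mul_r. apply Rmult_le_compat_l; lra. }
   assert (H0 : 0 <= Z - X) by (rewrite HXZ; apply Rmult_le_pos; [|lra]; apply Rmult_le_pos; lra).
   assert (Hq2 : q <= 2 * PI * q) by nra.
   rewrite Rabs_minus_sym. eapply Rle_trans; [apply (K_imag_lip kappa X Z D); lra || easy|].
   apply Rle_trans with (2 * INR (fact (S D)) / (q ^ D * (2 * PI * q)) * (2 * PI * INR n * y * (4 * W) * (z - x))).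
   + apply Rmult_le_compat; try easy.
    * pos.
    * mul_l. apply Rinv_le_contravar; [nra|].
     change (X ^ S D) with (X * X ^ D). rewrite Rmult_comm. apply Rmult_le_compat; [nra|lra|lra|apply pow_incr; lra].
   + right. unfold q at 2. field. repeat split; lra.
  - replace (8 * INR (fact (S D)) / q ^ D) with (2 * INR (fact (S D)) * 4 / (q ^ D * W) * W) by (field; lra).
   apply Rmult_le_compat_l; [|lra]. left. apply Rdiv_lt_0_compat; [lra|pos].
Qed.

(* The kernel K decays like any power at infinity, but only the exponent D = 1 is affordable near 0. *)
Lemma weight_bound th B N (n : nat) : 0 <= B -> 0 <= th <= 1 -> 0 < N -> (1 <= n)%nat ->
  exists D, (1 <= D)%nat /\
   let P := B * Rpower (INR n) th * (8 * INR (fact (S D)) / (INR n / N) ^ D) in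
   let G := 192 * B * Rpower (Rmax 1 N) th * Rmin 1 N in
   P <= G * (Rmax 1 N / INR n) /\ P <= G * (Rmax 1 N / INR n) ^ 2.
Proof.
  intros HB Hth HN Hn. assert (Hn1 : 1 <= INR n) by (apply (le_INR 1); lia). set (Np := Rmax 1 N). set (Nm := Rmin 1 N).
  assert (HNp : 1 <= Np) by apply Rmax_l. assert (HNm : 0 < Nm <= 1) by (split; [apply Rmin_pos; lra|apply Rmin_l]).
  assert (HNN : N = Np * Nm).
  { unfold Np, Nm, Rmax, Rmin. destruct (Rle_dec 1 N); lra. }
  assert (Hmu : 0 < Np / INR n) by pos. assert (HRp : 0 < Rpower Np th) by apply exp_pos.
  destruct (Rle_dec (INR n) Np) as [h|h].
  - exists 1%nat. split; [lia|]. cbv zeta. fold Np Nm. assert (H1 : 1 <= Np / INR n).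
   { rewrite <- (Rinv_r (INR n)) by lra. mul_r; easy. }
   assert (E : B * Rpower (INR n) th * (8 * INR (fact 2) / (INR n / N) ^ 1) <= 192 * B * Rpower Np th * Nm * (Np / INR n)).
   { replace (8 * INR (fact 2) / (INR n / N) ^ 1) with (16 * (Nm * (Np / INR n))).
    2:{ rewrite HNN. simpl. field. lra. }
    apply Rle_trans with (B * Rpower Np th * (192 * (Nm * (Np / INR n)))); [|right; ring].
    assert (0 < Nm * (Np / INR n)) by pos. apply Rmult_le_compat; try lra.
    - pos.
    - mul_l. apply Rle_Rpower_l; lra. }
   split; [exact E|]. via E. apply Rmult_le_compat_l; [|nra]. apply Rmult_le_pos; [|lra]. apply Rmult_le_pos; lra.
  (* Beyond [Np] one of the three powers of decay pays for the growth of the coefficients, as th <=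
     1, and two remain for convergence. *)
  - apply Rnot_le_lt in h. exists 3%nat. split; [lia|]. cbv zeta. fold Np Nm.
   set (r := Np / INR n) in *. assert (H1 : r < 1).
   { unfold r. rewrite <- (Rinv_r (INR n)) by lra. apply Rmult_lt_compat_r; [pos|easy]. }
   assert (HR : Rpower (INR n) th <= Rpower Np th * / r).
   { replace (INR n) with (Np * / r) by (unfold r; field; lra).
    assert (Hr1 : 1 < / r) by (rewrite <- Rinv_1; apply Rinv_lt_contravar; lra).
    rewrite <- Rpower_mult_distr by lra. mul_l. rewrite <- (Rpower_1 (/ r)) at 2 by lra. apply Rle_Rpower; lra. }
   assert (E : B * Rpower (INR n) th * (8 * INR (fact 4) / (INR n / N) ^ 3) <= 192 * B * Rpower Np th * Nm * r ^ 2).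
   { replace (8 * INR (fact 4) / (INR n / N) ^ 3) with (192 * (Nm ^ 3 * r ^ 3)).
    2:{ unfold r. rewrite HNN. simpl. field. lra. }
    apply Rle_trans with (B * (Rpower Np th * / r) * (192 * (Nm * r ^ 3))); [|right; field; lra].
    assert (0 < r ^ 3) by pos. apply Rmult_le_compat; try lra.
    - pos.
    - pos.
    - apply Rmult_le_compat_l; lra.
    - mul_l. mul_r. replace (Nm ^ 3) with (Nm * (Nm * Nm)) by ring. nra. }
   split; [|exact E]. via E. apply Rmult_le_compat_l; [|nra]. apply Rmult_le_pos; [|lra]. apply Rmult_le_pos; lra.
Qed.

Definition inv_dist (j n : nat) : R := if Nat.eq_dec n j then 0 else / Rabs (INR j - INR n).

Lemma inv_dist_nonneg j n : 0 <= inv_dist j n.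
Proof.
  unfold inv_dist. destruct (Nat.eq_dec n j); [lra|]. left. apply Rinv_0_lt_compat, Rabs_pos_lt.
  intros E. apply Rminus_diag_uniq, INR_eq in E. lia.
Qed.

Lemma rsum_truncate (a : nat -> R) m T : (forall n, (1 <= n)%nat -> 0 <= a n) ->
  rsum (fun n => if le_dec n m then a n else 0) (seq 1 T) <= rsum a (seq 1 m).
Proof.
  intros Ha. induction m as [|m IH].
  - simpl. clear Ha. right. assert (H : forall s T, (1 <= s)%nat -> rsum (fun n => if le_dec n 0 then a n else 0) (seq s T) = 0).
   { intros s T'. revert s. induction T' as [|T' IH]; intros s Hs; simpl; [easy|]. rewrite IH by lia. destruct (le_dec s 0); [lia|ring]. }
   apply H; lia.
  - rewrite seq_S, rsum_app. cbn [rsum fold_right]. change (1 + m)%nat with (S m).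
   apply Rle_trans with (rsum (fun n => (if le_dec n m then a n else 0) + (if Nat.eq_dec n (S m) then a n else 0)) (seq 1 T)).
   + apply rsum_le. intros n Hn. apply in_seq in Hn.
    destruct (le_dec n (S m)), (le_dec n m), (Nat.eq_dec n (S m)); try lia; lra.
   + rewrite rsum_plus. apply Rplus_le_compat; [easy|]. clear IH. pose proof (Ha (S m) ltac:(lia)) as H0.
    assert (H : forall s, rsum (fun n => if Nat.eq_dec n (S m) then a n else 0) (seq s T) <= a (S m) + 0 /\
     ((S m < s)%nat -> rsum (fun n => if Nat.eq_dec n (S m) then a n else 0) (seq s T) <= 0)).
    { induction T as [|T IH]; intros s; simpl; [split; intros; lra|]. destruct (IH (S s)) as [I1 I2].
     destruct (Nat.eq_dec s (S m)) as [->|Hne].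
     - specialize (I2 ltac:(lia)). split; [lra|lia].
     - split; [lra|]. intros. specialize (I2 ltac:(lia)). lra. }
    apply H.
Qed.

Lemma rsum_tail_squares m T : (1 <= m)%nat -> rsum (fun n => if le_dec n m then 0 else / INR n ^ 2) (seq 1 T) <= / INR m.
Proof.
  intros Hm. assert (Hm1 : 1 <= INR m) by (apply (le_INR 1); lia).
  assert (H : rsum (fun n => if le_dec n m then 0 else / INR n ^ 2) (seq 1 T) <= if le_dec T m then 0 else / INR m - / INR T).
  { induction T as [|T IH]; [simpl; lra|]. rewrite seq_S, rsum_app. cbn [rsum fold_right]. change (1 + T)%nat with (S T).
   destruct (le_dec (S T) m), (le_dec T m); try lia; try lra.
   - assert (T = m) by lia. subst T. rewrite S_INR.
    assert (/ (INR m + 1) ^ 2 <= / INR m - / (INR m + 1)); [|unfold rsum in *; lra].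
    replace (/ INR m - / (INR m + 1)) with (/ (INR m * (INR m + 1))) by (field; lra). apply Rinv_le_contravar; nra.
   - assert (HT : 1 <= INR T) by (apply (le_INR 1); lia). rewrite S_INR.
    assert (/ (INR T + 1) ^ 2 <= / INR T - / (INR T + 1)); [|unfold rsum in *; lra].
    replace (/ INR T - / (INR T + 1)) with (/ (INR T * (INR T + 1))) by (field; lra). apply Rinv_le_contravar; nra. }
  assert (0 < / INR m) by pos. destruct (le_dec T m); [lra|]. assert (0 < / INR T) by pos. lra.
Qed.

(** * Derivative tests for the single frequencies at a cusp *)

Section Direct.

Variables (kappa B th M W w1 w2 v K c a h : R).
Hypotheses (HB : 0 <= B) (Hth : 0 <= th <= 1) (HM : 0 < M) (HW : 0 < W) (Hw1 : W <= w1) (Hw12 : w1 <= w2)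
  (Hw2 : w2 <= 2 * W) (Hv : 1 <= v) (HK : K <> 0).

Let k := Rabs K.
Let N := M / W ^ 2.
Let Np := Rmax 1 N.
Let N1 := M / w2 ^ 2.
Let N2 := M / w1 ^ 2.
Let y := v / M.
Let G := 192 * B * Rpower Np th * Rmin 1 N.

Hypothesis (Hh : forall m, INR m <= 2 * Np + 1 -> harm m <= h).

Variables j1 j2 m0 : nat.
Hypotheses (Hj1 : INR j1 <= N1 < INR j1 + 1) (Hj2 : INR j2 <= N2 < INR j2 + 1) (Hm0 : INR m0 <= 2 * Np < INR m0 + 1).

(** The stationary frequencies fill [N1, N2], and one outside at distance d contributes its weight
    divided by d. Up to 2 Np the distance is measured from the integer parts j1 and j2; beyond, it
    is of order n. *)
Let far (n : nat) : R :=
  if le_dec n m0 then 4 * (2 * (inv_dist j1 n + inv_dist j2 n) + 2 / INR n) else Np / INR n ^ 2.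
Let near (n : nat) : R := if Rlt_dec (N1 - 1) (INR n) then if Rlt_dec (INR n) (N2 + 1) then 1 else 0 else 0.

(** Its stationary point is w = sqrt(M/m), which lies in [w1, w2] exactly for N1 <= m <= N2; for
    negative m there is none. *)
Definition cusp_phase (m w : R) : R := - M * (c + / (K * w)) + m * ((a - w) / K).
Definition cusp_term (n : nat) (m w : R) : C :=
  (RtoC (K_imag kappa (2 * PI * INR n * (y * w ^ 2)) / w) * e (cusp_phase m w))%C.

Lemma N_basic : 0 < N /\ N / 4 <= N1 /\ N1 <= N2 /\ N2 <= N /\ 1 <= Np /\ N <= Np /\ 0 <= G /\ 0 < y.
Proof.
  assert (H1 : forall x z, 0 < x -> x <= z -> M / z ^ 2 <= M / x ^ 2).
  { intros x z h1 h2. mul_l. apply Rinv_le_contravar; [pos|apply pow_incr; lra]. }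
  assert (H4 : N / 4 = M / (2 * W) ^ 2) by (unfold N; field; lra). split; [unfold N; apply Rdiv_lt_0_compat; [easy|pos]|].
  split; [rewrite H4; apply H1; lra|]. split; [apply H1; lra|]. split; [apply H1; lra|]. split; [apply Rmax_l|]. split; [apply Rmax_r|].
  split; [|unfold y; apply Rdiv_lt_0_compat; lra]. assert (HN : 0 < N) by (unfold N; apply Rdiv_lt_0_compat; [easy|pos]).
  unfold G. assert (0 < Rpower Np th) by apply exp_pos. assert (0 < Rmin 1 N) by (apply Rmin_pos; lra).
  apply Rmult_le_pos; [|lra]. apply Rmult_le_pos; lra.
Qed.

Lemma cusp_phase_derive m w : 0 < w -> is_derive (cusp_phase m) w ((M / w ^ 2 - m) / K).
Proof. intros Hw. unfold cusp_phase. auto_derive; [apply Rmult_integral_contrapositive; lra|field; lra]. Qed.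

Lemma cusp_amp_cont n w : (1 <= n)%nat -> 0 < w -> continuous (fun w => K_imag kappa (2 * PI * INR n * (y * w ^ 2)) / w) w.
Proof.
  intros Hn Hw. destruct N_basic as (_&_&_&_&_&_&_&Hy). assert (Hn1 : 0 < INR n) by pos. pose proof PI_RGT_0.
  apply continuous_Rmult.
  - apply (continuous_comp (fun w => 2 * PI * INR n * (y * w ^ 2)) (K_imag kappa)).
   + apply (ex_derive_continuous (fun w => 2 * PI * INR n * (y * w ^ 2))). auto_derive; easy.
   + apply K_imag_cont. apply Rmult_lt_0_compat; [nra|]. apply Rmult_lt_0_compat; [easy|pos].
  - apply (continuous_inv (fun w => w)); [apply continuous_id|lra].
Qed.

Lemma cusp_term_exC n m : (1 <= n)%nat -> exC (cusp_term n m) w1 w2.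
Proof.
  intros Hn. apply exC_cont; [easy|]. intros w Hw. apply ccont_amp; [apply cusp_amp_cont; [easy|lra]|].
  apply ccont_e. apply (ex_derive_continuous (cusp_phase m)). eexists; apply cusp_phase_derive; lra.
Qed.

Lemma far_nonneg n : (1 <= n)%nat -> 0 <= far n.
Proof.
  intros Hn. destruct N_basic as (_&_&_&_&HNp&_).
  unfold far. pose proof (inv_dist_nonneg j1 n). pose proof (inv_dist_nonneg j2 n). destruct (le_dec n m0).
  - assert (0 < 2 / INR n) by pos. lra.
  - pos.
Qed.

Lemma near_nonneg n : 0 <= near n.
Proof. unfold near. destruct (Rlt_dec _ _); [destruct (Rlt_dec _ _)|]; lra. Qed.

(** For n <= 2 Np the bound Np <= 4 (n + d) gives Np/(n d) <= 4 (1/d + 1/n), which separates the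
    weight from the distance. For larger n the quadratic decay of the weight and d >= n/2
    suffice. *)
Lemma far_claim (n : nat) d P : (1 <= n)%nat -> 0 < d -> Np <= 4 * (INR n + d) -> (2 * Np < INR n -> INR n / 2 <= d) ->
  / d <= 2 * (inv_dist j1 n + inv_dist j2 n) + / INR n ->
  P <= G * (Np / INR n) -> P <= G * (Np / INR n) ^ 2 -> P / d <= G * far n.
Proof.
  intros Hn Hd H1 H2 H3 HP1 HP2. destruct N_basic as (_&_&_&_&HNp&_&HG&_).
  assert (Hn1 : 1 <= INR n) by (apply (le_INR 1); lia). assert (Hid : 0 < / d) by now apply Rinv_0_lt_compat.
  unfold far. destruct (le_dec n m0) as [h0|h0].
  - apply Rle_trans with (G * (Np / INR n) / d); [apply Rmult_le_compat_r; lra|]. unfold Rdiv. rewrite !Rmult_assoc. mul_l.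
   apply Rle_trans with (4 * (INR n + d) * (/ INR n * / d)).
   + apply Rmult_le_compat_r; [|easy]. apply Rmult_le_pos; [pos|]; lra.
   + replace (4 * (INR n + d) * (/ INR n * / d)) with (4 * (/ d + / INR n)) by (field; lra). lra.
  - assert (h1 : INR m0 + 1 <= INR n) by (rewrite <- S_INR; apply le_INR; lia). specialize (H2 ltac:(lra)).
   apply Rle_trans with (G * (Np / INR n) ^ 2 / d); [apply Rmult_le_compat_r; lra|].
   unfold Rdiv. rewrite Rmult_assoc. mul_l. replace (Np * / INR n ^ 2) with (Np ^ 2 * / INR n ^ 2 * / Np) by (field; lra).
   replace ((Np * / INR n) ^ 2) with (Np ^ 2 * / INR n ^ 2) by (field; lra).
   apply Rmult_le_compat_l; [|apply Rinv_le_contravar; lra].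
   apply Rmult_le_pos; [pos|]. left. apply Rinv_0_lt_compat, pow_lt; lra.
Qed.

Lemma direct_term (n : nat) m : (1 <= n)%nat -> m = INR n \/ m = - INR n ->
  B * Rpower (INR n) th * Cmod (CInt (cusp_term n m) w1 w2) <=
   2 * G / W * (4 * k * far n + 432 * sqrt (k * W / Np) * near n).
Proof.
  intros Hn Hm. destruct N_basic as (HN & HN1 & HN12 & HN2 & HNp & HNNp & HG & Hy).
  assert (Hn1 : 1 <= INR n) by (apply (le_INR 1); lia). assert (Hk : 0 < k) by now apply Rabs_pos_lt.
  destruct (weight_bound th B N n HB Hth HN Hn) as [D [HD [HP1 HP2]]].
  fold Np in HP1, HP2. fold G in HP1, HP2. set (b := B * Rpower (INR n) th) in *.
  assert (Hb : 0 <= b) by (apply Rmult_le_pos; [easy|pos]).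
  set (kap := 8 * INR (fact (S D)) / (INR n / N) ^ D) in *. set (P := b * kap) in *. assert (HnN : 0 < INR n / N) by pos.
  assert (Hkap : 0 <= kap).
  { unfold kap. pose proof (INR_fact_lt_0 (S D)). left. apply Rdiv_lt_0_compat; [lra|pos]. }
  assert (HP0 : 0 <= P) by now apply Rmult_le_pos.
  assert (HA : bv (fun w => K_imag kappa (2 * PI * INR n * (y * w ^ 2)) / w) w1 w2 (2 * kap * / W)).
  { apply bv_mult; [easy| |].
   - eapply bv_le; [|apply (kernel_bv kappa n y W w1 w2 D); easy]. unfold kap. mul_l. apply Rinv_le_contravar; [pos|].
    apply pow_incr. split; [lra|]. unfold Rdiv. mul_l. unfold y, N.
    replace (v / M * W ^ 2) with (v * / (M / W ^ 2)) by (field; lra). rewrite <- (Rmult_1_l (/ (M / W ^ 2))) at 1.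
    apply Rmult_le_compat_r; [|easy]. left. apply Rinv_0_lt_compat; exact HN.
   - apply (bv_ext (fun w => / (0 + 1 * w))); [intros; f_equal; ring|]. apply bv_inv_linear; [easy|easy|]. intros; lra. }
  assert (HAc : forall w, w1 <= w <= w2 -> continuous (fun w => K_imag kappa (2 * PI * INR n * (y * w ^ 2)) / w) w).
  { intros w Hw. apply cusp_amp_cont; [easy|lra]. }
  assert (Hf : forall w, w1 <= w <= w2 -> is_derive (cusp_phase m) w ((M / w ^ 2 - m) / K)).
  { intros w Hw. apply cusp_phase_derive; lra. }
  pose proof (far_nonneg n Hn) as Hfar. pose proof (near_nonneg n) as Hnear. assert (HGW : 0 <= 2 * G / W) by pos.

  assert (HFar : forall d, 0 < d -> Np <= 4 * (INR n + d) -> (2 * Np < INR n -> INR n / 2 <= d) ->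
   / d <= 2 * (inv_dist j1 n + inv_dist j2 n) + / INR n ->
   (forall x, w1 <= x <= w2 -> d <= M / x ^ 2 - m) \/ (forall x, w1 <= x <= w2 -> d <= m - M / x ^ 2) ->
   b * Cmod (CInt (cusp_term n m) w1 w2) <= 2 * G / W * (4 * k * far n + 432 * sqrt (k * W / Np) * near n)).
  { intros d Hd D1 D2 D3 D4. apply Rle_trans with (2 * G / W * (4 * k * far n)).
   2:{ mul_l. assert (0 <= 432 * sqrt (k * W / Np) * near n) by pos. lra. }
   pose proof (osc_far M m K _ (cusp_phase m) w1 w2 _ d ltac:(lra) Hw12 HM Hd HK D4 Hf HA HAc) as HO.
   apply Rle_trans with (b * (4 * (2 * kap * / W) * Rabs K / d)); [now apply Rmult_le_compat_l|].
   fold k. replace (b * (4 * (2 * kap * / W) * k / d)) with (8 * k / W * (P / d)) by (unfold P; field; lra).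
   replace (2 * G / W * (4 * k * far n)) with (8 * k / W * (G * far n)) by (field; lra). mul_l. now apply far_claim. }
  assert (Hmon : forall x, w1 <= x <= w2 -> N1 <= M / x ^ 2 <= N2).
  { intros x Hx. split; (mul_l; apply Rinv_le_contravar; [pos|apply pow_incr; lra]). }
  assert (Hin : 0 < / INR n) by pos. pose proof (inv_dist_nonneg j1 n) as I1. pose proof (inv_dist_nonneg j2 n) as I2.
  assert (HNp4 : Np <= Rmax 1 (4 * N1)) by (unfold Np; apply Rle_max_compat_l; lra). destruct Hm as [-> | ->].
  - destruct (Rlt_dec (N1 - 1) (INR n)) as [h1|h1]; [destruct (Rlt_dec (INR n) (N2 + 1)) as [h2|h2]|].
   + assert (Enear : near n = 1) by (unfold near; destruct (Rlt_dec _ _); [destruct (Rlt_dec _ _)|]; easy).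
    apply Rle_trans with (2 * G / W * (432 * sqrt (k * W / Np) * near n)).
    2:{ mul_l. assert (0 <= 4 * k * far n) by pos. lra. }
    rewrite Enear, Rmult_1_r.
    pose proof (osc_stationary M (INR n) K _ (cusp_phase (INR n)) W w1 w2 _ HW Hw1 Hw12 Hw2 HM ltac:(lra) HK Hf HA HAc) as HO.
    apply Rle_trans with (b * (18 * (2 * kap * / W) * sqrt (Rabs K * W / INR n))); [now apply Rmult_le_compat_l|].
    fold k. replace (b * (18 * (2 * kap * / W) * sqrt (k * W / INR n))) with (36 / W * (P * sqrt (k * W / INR n))) by (unfold P; field; lra).
    replace (2 * G / W * (432 * sqrt (k * W / Np))) with (36 / W * (G * 8 * (3 * sqrt (k * W / Np)))) by (field; lra).
    (* A near frequency is comparable with Np, because n > N1 - 1, n >= 1 and N1 >= N/4. *)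
    mul_l. assert (H8 : Np <= 8 * INR n).
    { via HNp4. apply Rmax_lub; [lra|]. destruct (Rle_dec N1 2); lra. }
    assert (HkW : 0 < k * W) by now apply Rmult_lt_0_compat. apply Rmult_le_compat; [easy|pos| |].
    * via HP1. mul_l. apply Rcomplements.Rle_div_l; [lra|]. lra.
    * replace 3 with (sqrt (3 * 3)) at 1 by (apply sqrt_square; lra). rewrite <- sqrt_mult by pos. apply sqrt_le_1_alt.
     replace (k * W / INR n) with (k * W * / INR n) by easy. replace (3 * 3 * (k * W / Np)) with (k * W * (9 / Np)) by (field; lra).
     mul_l. apply Rmult_le_reg_r with (INR n * Np); [pos|].
     replace (/ INR n * (INR n * Np)) with Np by (field; lra). replace (9 / Np * (INR n * Np)) with (9 * INR n) by (field; lra). lra.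
   + apply Rnot_lt_le in h2. apply (HFar (INR n - N2)); try lra.
    * unfold Np in *. via HNp4. apply Rmax_lub; lra.
    (* As n - N2 >= 1, replacing N2 by its integer part at most doubles the distance. *)
    * assert (Hj : INR j2 < INR n) by lra. assert (HD2 : inv_dist j2 n = / (INR n - INR j2)).
     { unfold inv_dist. destruct (Nat.eq_dec n j2) as [->|]; [lra|]. rewrite Rabs_left1 by lra. f_equal; ring. }
     assert (/ (INR n - N2) <= 2 * / (INR n - INR j2)); [|lra].
     replace (2 * / (INR n - INR j2)) with (/ ((INR n - INR j2) / 2)) by (field; lra). apply Rinv_le_contravar; lra.
    * right. intros x Hx. specialize (Hmon x Hx). lra.
   + apply Rnot_lt_le in h1. apply (HFar (N1 - INR n)); try lra.
    * via HNp4. apply Rmax_lub; lra.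
    * assert (Hj : INR n < INR j1) by lra. assert (HD1 : inv_dist j1 n = / (INR j1 - INR n)).
     { unfold inv_dist. destruct (Nat.eq_dec n j1) as [->|]; [lra|]. rewrite Rabs_pos_eq by lra. easy. }
     assert (/ (N1 - INR n) <= / (INR j1 - INR n)); [|assert (0 < / (INR j1 - INR n)) by pos; lra].
     apply Rinv_le_contravar; lra.
    * left. intros x Hx. specialize (Hmon x Hx). lra.
  (* For a negative frequency both terms of the derivative have the same sign, so the distance is at
     least N1 + n. *)
  - apply (HFar (N1 + INR n)); try lra.
   + via HNp4. apply Rmax_lub; lra.
   + assert (/ (N1 + INR n) <= / INR n) by (apply Rinv_le_contravar; lra). lra.
   + left. intros x Hx. specialize (Hmon x Hx). lra.
Qed.

Lemma h_ge_1 : 1 <= h.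
Proof.
  destruct N_basic as (_&_&_&_&HNp&_). apply Rle_trans with (harm 1); [unfold harm; simpl; lra|]. apply Hh. simpl. lra.
Qed.

Lemma inv_dist_sum j : INR j <= 2 * Np -> rsum (inv_dist j) (seq 1 m0) <= 2 * h.
Proof.
  intros Hj. assert (Hjm : (j < S m0)%nat) by (apply INR_lt; rewrite S_INR; lra).
  apply Rle_trans with (rsum (inv_dist j) (seq 0 (S m0))).
  - change (seq 0 (S m0)) with (0%nat :: seq 1 m0). cbn [rsum fold_right]. pose proof (inv_dist_nonneg j 0).
   unfold rsum. lra.
  - via (sum_inv_dist (S m0) j Hjm). mul_l. apply Hh. rewrite S_INR. lra.
Qed.

(** Harmonic sums up to 2 Np account for 40 h, and the tail of Np/n^2 for at most 1. *)
Lemma far_sum T : rsum far (seq 1 T) <= 41 * h.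
Proof.
  destruct N_basic as (HN & HN1 & HN12 & HN2 & HNp & HNNp & HG & Hy). pose proof h_ge_1 as Hh1.
  assert (Hm1 : (1 <= m0)%nat) by (apply INR_le; simpl; lra).
  set (A := fun n => 4 * (2 * (inv_dist j1 n + inv_dist j2 n) + 2 / INR n)).
  apply Rle_trans with (rsum (fun n => if le_dec n m0 then A n else 0) (seq 1 T) + Np * rsum (fun n => if le_dec n m0 then 0 else / INR n ^ 2) (seq 1 T)).
  { rewrite <- rsum_scal, <- rsum_plus. apply rsum_le. intros n Hn. unfold far, A. destruct (le_dec n m0); unfold Rdiv; lra. }
  assert (T1 : rsum (fun n => if le_dec n m0 then A n else 0) (seq 1 T) <= 40 * h).
  { via rsum_truncate.
   - intros n Hn. assert (0 < 2 / INR n) by pos.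
    pose proof (inv_dist_nonneg j1 n). pose proof (inv_dist_nonneg j2 n). unfold A. lra.
   - apply Rle_trans with (8 * (rsum (inv_dist j1) (seq 1 m0) + rsum (inv_dist j2) (seq 1 m0)) + 8 * harm m0).
    + right. unfold harm. rewrite <- rsum_plus, <- !rsum_scal, <- rsum_plus. apply rsum_ext. intros n _. unfold A, Rdiv. ring.
    + pose proof (inv_dist_sum j1 ltac:(lra)). pose proof (inv_dist_sum j2 ltac:(lra)). pose proof (Hh m0 ltac:(lra)). lra. }
  assert (T2 : Np * rsum (fun n => if le_dec n m0 then 0 else / INR n ^ 2) (seq 1 T) <= 1).
  { assert (Hm : Np <= INR m0) by lra. apply Rle_trans with (Np * / INR m0); [mul_l; now apply rsum_tail_squares|].
   rewrite <- (Rinv_r (INR m0)) by lra. mul_r; easy. }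
  lra.
Qed.

(** The near frequencies lie in an interval of length N2 - N1 + 2, and counting its integers costs
    one more. *)
Lemma near_sum T : rsum near (seq 1 T) <= N2 - N1 + 3.
Proof.
  destruct N_basic as (HN & HN1 & HN12 & HN2 & HNp & HNNp & HG & Hy). apply Rle_trans with (rsum near (seq 0 (S T))).
  - change (seq 0 (S T)) with (0%nat :: seq 1 T). cbn [rsum fold_right]. pose proof (near_nonneg 0). unfold rsum. lra.
  - replace (N2 - N1 + 3) with (1 * (N2 - N1 + 2 + 1)) by ring. apply (count_interval (S T) (N1 - 1)); try lra.
   + intros d. unfold near. destruct (Rlt_dec _ _); [destruct (Rlt_dec _ _)|]; lra.
   + intros d. unfold near. destruct (Rlt_dec _ _); [destruct (Rlt_dec _ _)|]; lra.
Qed.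

Lemma direct_sum T :
  rsum (fun n => B * Rpower (INR n) th * (Cmod (CInt (cusp_term n (INR n)) w1 w2) + Cmod (CInt (cusp_term n (- INR n)) w1 w2))) (seq 1 T) <=
   4 * G / W * (164 * k * h + 432 * sqrt (k * W / Np) * (N2 - N1 + 3)).
Proof.
  destruct N_basic as (HN & HN1 & HN12 & HN2 & HNp & HNNp & HG & Hy). assert (Hk : 0 < k) by now apply Rabs_pos_lt.
  apply Rle_trans with (4 * G / W * (4 * k * rsum far (seq 1 T) + 432 * sqrt (k * W / Np) * rsum near (seq 1 T))).
  - rewrite <- !rsum_scal, <- rsum_plus, <- rsum_scal. apply rsum_le. intros n Hn. apply in_seq in Hn.
   rewrite Rmult_plus_distr_l.
   pose proof (direct_term n (INR n) ltac:(lia) (or_introl eq_refl)). pose proof (direct_term n (- INR n) ltac:(lia) (or_intror eq_refl)).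
   replace (4 * G / W) with (2 * G / W + 2 * G / W) by (field; lra). lra.
  - mul_l. pose proof (sqrt_pos (k * W / Np)).
   assert (4 * k * rsum far (seq 1 T) <= 4 * k * (41 * h)) by (mul_l; apply far_sum).
   assert (432 * sqrt (k * W / Np) * rsum near (seq 1 T) <= 432 * sqrt (k * W / Np) * (N2 - N1 + 3)) by (mul_l; apply near_sum).
   lra.
Qed.

End Direct.

(** * One arc estimated by the Fourier expansion at its cusp *)

Definition cusp_line (psi : C -> C) (v0 M : R) (A : arc) (w v : R) : C :=
  (RtoC (/ (arc_k A * w ^ 2)) * (e (- M * arc_x A w) *
   (RtoC (bump v0 v) * psi ((IZR (arc_a A) - w) / IZR (arc_K A), v / M * w ^ 2)%R)))%C.

(** The factor sqrt(v/M) w of the expansion at height v w^2/M meets the density 1/(|K| w^2), which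
    leaves the amplitude K/w of [cusp_term]. *)
Lemma cusp_line_psiT kappa t v0 M A T w v : arc_ok A -> 0 < M -> 0 < w -> 0 < v ->
  (RtoC (/ (arc_k A * w ^ 2)) * (e (- M * arc_x A w) *
   (RtoC (bump v0 v) * psiT kappa t T ((IZR (arc_a A) - w) / IZR (arc_K A)) (v / M * w ^ 2))))%C =
  (RtoC (bump v0 v * sqrt (v / M) / arc_k A) * csum (fun n =>
   t (Z.of_nat n) * cusp_term kappa M v (IZR (arc_K A)) (IZR (arc_H A) / IZR (arc_K A)) (IZR (arc_a A)) n (INR n) w +
   t (- Z.of_nat n)%Z * cusp_term kappa M v (IZR (arc_K A)) (IZR (arc_H A) / IZR (arc_K A)) (IZR (arc_a A)) n (- INR n) w)%C (seq 1 T))%C.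
Proof.
  intros Hok HM Hw Hv. pose proof (arc_k_pos A Hok) as Hk.

  assert (Es : sqrt (v / M * w ^ 2) = sqrt (v / M) * w).
  { rewrite sqrt_mult by pos. f_equal. replace (w ^ 2) with (w * w) by ring. apply sqrt_square; lra. }
  unfold psiT. rewrite Es. set (x := (IZR (arc_a A) - w) / IZR (arc_K A)). set (k := arc_k A) in *. set (y := v / M) in *.
  assert (Hterm : forall (n : nat) (m : Z), Rabs (IZR m) = INR n ->
   (RtoC (/ (k * w ^ 2)) * (e (- M * arc_x A w) * (RtoC (bump v0 v) * (RtoC (sqrt y * w) * fourier_term kappa t x (y * w ^ 2) m))))%C =
   (RtoC (bump v0 v * sqrt y / k) * (t m * cusp_term kappa M v (IZR (arc_K A)) (IZR (arc_H A) / IZR (arc_K A)) (IZR (arc_a A)) n (IZR m) w))%C).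
  { intros n m Hm. unfold fourier_term, cusp_term, cusp_phase. rewrite Hm, e_plus. fold y x. fold (arc_x A w).
   change (IZR (arc_H A) / IZR (arc_K A) + / (IZR (arc_K A) * w)) with (arc_x A w).
   set (Kn := K_imag kappa (2 * PI * INR n * (y * w ^ 2))). generalize (e (- M * arc_x A w)) (e (IZR m * x)) (t m). intros e1 e2 tm.
   replace (RtoC (/ (k * w ^ 2)) * (e1 * (RtoC (bump v0 v) * (RtoC (sqrt y * w) * (tm * RtoC Kn * e2)))))%C with
    (RtoC (/ (k * w ^ 2)) * RtoC (bump v0 v) * RtoC (sqrt y * w) * RtoC Kn * (tm * e1 * e2))%C by ring.
   replace (RtoC (bump v0 v * sqrt y / k) * (tm * (RtoC (Kn / w) * (e1 * e2))))%C with
    (RtoC (bump v0 v * sqrt y / k) * RtoC (Kn / w) * (tm * e1 * e2))%C by ring.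
   rewrite <- !RtoC_mult. f_equal. f_equal. field. lra. }
  transitivity (csum (fun n => RtoC (/ (k * w ^ 2)) * (e (- M * arc_x A w) * (RtoC (bump v0 v) * (RtoC (sqrt y * w) *
   (fourier_term kappa t x (y * w ^ 2) (Z.of_nat n) + fourier_term kappa t x (y * w ^ 2) (- Z.of_nat n))))))%C (seq 1 T)).
  { now rewrite !csum_scal. }
  rewrite <- csum_scal. apply csum_ext. intros n _. destruct (abs_IZR_nat n) as [E1 E2].
  pose proof (Hterm n (Z.of_nat n) E1) as T1. pose proof (Hterm n (- Z.of_nat n)%Z E2) as T2.
  rewrite opp_IZR, <- INR_IZR_INZ in T2. rewrite <- INR_IZR_INZ in T1. rewrite !Cmult_plus_distr_l. now f_equal.
Qed.

Section CuspBound.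

Variables (psi : C -> C) (C0 kappa : R) (t : Z -> C) (p : nat) (B' B th v0 M W ell h : R) (A : arc).
Hypotheses (Hp : tame_form psi C0) (Hf : fourier_expansion kappa psi t) (Hc : coef_bd t p B')
  (HB : 0 <= B) (Hth : 0 <= th <= 1)
  (Ht : forall n, (1 <= n)%nat -> Cmod (t (Z.of_nat n)) <= B * Rpower (INR n) th /\ Cmod (t (- Z.of_nat n)%Z) <= B * Rpower (INR n) th)
  (Hv0 : 1 <= v0) (HM : 0 < M) (HW : 0 < W) (Hok : arc_ok A) (Hp1 : 0 < arc_p1 A)
  (Hw1 : W <= arc_w1 A) (Hw2 : arc_w2 A <= 2 * W) (Hlen : arc_p2 A - arc_p1 A <= ell)
  (Hh : forall m, INR m <= 2 * Rmax 1 (M / W ^ 2) + 1 -> harm m <= h).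

Let k := arc_k A.
Let Np := Rmax 1 (M / W ^ 2).
Let G := 192 * B * Rpower Np th * Rmin 1 (M / W ^ 2).

(** The last bracket bounds the number of near frequencies: the change of M/w^2 along the arc,
    estimated through its length in [frequencies_count], plus 3. *)
Definition direct_bound : R :=
  sqrt (v0 + 1) / (sqrt M * k) * (4 * G / W * (164 * k * h + 432 * sqrt (k * W / Np) * (2 * M * k * ell / W + 3))).

(** In terms of the distance p to the cusp M/w^2 is M (k p)^2, and k p <= 1/W along the arc. *)
Lemma frequencies_count : M / arc_w1 A ^ 2 - M / arc_w2 A ^ 2 <= 2 * M * k * ell / W.
Proof.
  pose proof (arc_k_pos A Hok) as Hk. fold k in Hk. destruct (arc_w_pos A Hok Hp1) as [w1 w12].
  assert (E1 : arc_p2 A = / (k * arc_w1 A)).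
  { unfold arc_w1. fold k. destruct Hok as (_&_&h1&h2). field. split; lra. }
  assert (E2 : arc_p1 A = / (k * arc_w2 A)) by (unfold arc_w2; fold k; field; lra).
  rewrite E1, E2 in Hlen. set (u1 := arc_w1 A) in *. set (u2 := arc_w2 A) in *.
  replace (M / u1 ^ 2 - M / u2 ^ 2) with (M * k * (/ (k * u1) - / (k * u2)) * (/ u1 + / u2)) by (field; lra).
  replace (2 * M * k * ell / W) with (M * k * ell * (2 / W)) by (field; lra). assert (H0 : 0 <= / (k * u1) - / (k * u2)).
  { assert (/ (k * u2) <= / (k * u1)); [|lra]. apply Rinv_le_contravar; [pos|]. apply Rmult_le_compat_l; lra. }
  assert (HMk : 0 < M * k) by pos.
  assert (i1 : / u1 <= / W) by (apply Rinv_le_contravar; lra). assert (i2 : / u2 <= / W) by (apply Rinv_le_contravar; lra).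
  assert (i3 : 0 < / u1) by pos. assert (i4 : 0 < / u2) by pos. apply Rmult_le_compat; try lra.
  - pos.
  - apply Rmult_le_compat_l; lra.
Qed.

Lemma G_nonneg : 0 <= G.
Proof.
  assert (HN : 0 < M / W ^ 2) by pos.
  unfold G. assert (0 < Rpower Np th) by apply exp_pos. assert (0 < Rmin 1 (M / W ^ 2)) by (apply Rmin_pos; lra).
  apply Rmult_le_pos; [|lra]. apply Rmult_le_pos; lra.
Qed.

Lemma cusp_line_exC v : 0 < v -> exC (fun w => cusp_line psi v0 M A w v) (arc_w1 A) (arc_w2 A).
Proof.
  intros Hv. pose proof (arc_k_pos A Hok) as Hk. destruct (arc_w_pos A Hok Hp1) as [w1 w12]. pose proof (tame_pos _ _ Hp) as HC.
  pose proof (arc_K_neq A Hok) as HK.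
  apply exC_cont; [easy|]. intros w Hw. unfold cusp_line. apply ccont_amp; [apply inv_kw2_cont; lra|]. apply ccont_mult.
  - apply (ccont_e (fun w => - M * arc_x A w)). apply continuous_Rmult; [apply continuous_const|apply arc_x_cont; [easy|lra]].
  - apply ccont_mult; [apply ccont_const|].
   apply (ccont_lip _ _ (C0 * (/ (v / M * w ^ 2) + 3 / w)) w ltac:(lra)). intros z Hz. apply arc_curve_lip; easy || pos.
Qed.

(** For a fixed height the expansion is truncated at T; the bound for the truncated sum is uniform
    in T and the error is O(1/T). *)
Lemma cusp_line_bound v : v0 <= v <= v0 + 1 -> Cmod (CInt (fun w => cusp_line psi v0 M A w v) (arc_w1 A) (arc_w2 A)) <= direct_bound.
Proof.
  intros Hv. pose proof (arc_k_pos A Hok) as Hk. fold k in Hk. destruct (arc_w_pos A Hok Hp1) as [w1 w12].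
  pose proof (arc_K_neq A Hok) as HK. pose proof G_nonneg as HG. assert (Hy : 0 < v / M) by pos.
  set (u1 := arc_w1 A) in *. set (u2 := arc_w2 A) in *.
  set (ct := fun n m => cusp_term kappa M v (IZR (arc_K A)) (IZR (arc_H A) / IZR (arc_K A)) (IZR (arc_a A)) n m).
  set (g := fun T w => (RtoC (/ (arc_k A * w ^ 2)) * (e (- M * arc_x A w) *
   (RtoC (bump v0 v) * psiT kappa t T ((IZR (arc_a A) - w) / IZR (arc_K A)) (v / M * w ^ 2))))%C).
  set (c := bump v0 v * sqrt (v / M) / k).
  set (I := fun T => (RtoC c * csum (fun n => t (Z.of_nat n) * CInt (ct n (INR n)) u1 u2 + t (- Z.of_nat n)%Z * CInt (ct n (- INR n)%R) u1 u2)%C (seq 1 T))%C).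
  assert (HI : forall T, is_CInt (g T) u1 u2 (I T)).
  { intros T. eapply is_CInt_ext; [easy| |].
   - intros w Hw. symmetry. apply cusp_line_psiT; try easy; lra.
   - apply is_CInt_scal. apply (is_CInt_csum (fun n w => t (Z.of_nat n) * ct n (INR n) w + t (- Z.of_nat n)%Z * ct n (- INR n)%R w)%C).
    intros n Hn. apply in_seq in Hn. apply is_CInt_plus; apply is_CInt_scal; apply (cusp_term_exC kappa B th M W u1 u2 v); try easy; try lra; lia. }
  assert (Hc0 : 0 <= c <= sqrt (v0 + 1) / (sqrt M * k)).
  { unfold c. rewrite sqrt_div_alt by easy. assert (0 < sqrt M) by now apply sqrt_lt_R0. pose proof (bump_range v0 v).
   assert (sqrt v <= sqrt (v0 + 1)) by (apply sqrt_le_1_alt; lra). pose proof (sqrt_pos v).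
   replace (bump v0 v * (sqrt v / sqrt M) / k) with (bump v0 v * sqrt v * / (sqrt M * k)) by (field; lra).
   assert (0 < / (sqrt M * k)) by pos. split; [apply Rmult_le_pos; [pos|]; lra|]. mul_r. nra. }
  assert (HIB : forall T, Cmod (I T) <= direct_bound).
  { intros T. unfold I. rewrite Cmod_mult, Cmod_R, Rabs_pos_eq by apply Hc0. unfold direct_bound.
   apply Rmult_le_compat; [apply Hc0|pos|apply Hc0|]. assert (N1p : 0 <= M / u2 ^ 2) by pos.
   assert (N2p : 0 <= M / u1 ^ 2) by pos.
   assert (N3p : 0 <= 2 * Rmax 1 (M / W ^ 2)) by (pose proof (Rmax_l 1 (M / W ^ 2)); lra).
   destruct (nfloor_ex _ N1p) as [j1 Hj1]. destruct (nfloor_ex _ N2p) as [j2 Hj2]. destruct (nfloor_ex _ N3p) as [m0 Hm0].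
   pose proof (direct_sum kappa B th M W u1 u2 v (IZR (arc_K A)) (IZR (arc_H A) / IZR (arc_K A)) (IZR (arc_a A)) h
    HB Hth HM HW Hw1 w12 Hw2 ltac:(lra) HK Hh j1 j2 m0 Hj1 Hj2 Hm0 T) as HS.
   fold (arc_k A) in HS. fold k Np in HS. fold G in HS. eapply Rle_trans; [apply csum_norm|via HS].
   - intros n Hn. apply in_seq in Hn. destruct (Ht n ltac:(lia)) as [T1 T2].
    via Cmod_triangle. rewrite !Cmod_mult, Rmult_plus_distr_l.
    apply Rplus_le_compat; apply Rmult_le_compat_r; auto using Cmod_ge_0.
   - mul_l. apply Rplus_le_compat_l. mul_l. pose proof frequencies_count. fold u1 u2 in H. lra. }
  set (err := / (k * u1 ^ 2) * (sqrt (v / M * u2 ^ 2) * (4 * B' * INR (fact (p + 2)) / (v / M * u1 ^ 2) ^ (p + 2)))).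
  apply (Rle_of_forall_div _ _ (err * (u2 - u1))). intros T HT. assert (HT1 : 0 < INR T) by pos.
  set (X := CInt (fun w => cusp_line psi v0 M A w v) u1 u2).
  assert (HX : exC (fun w => cusp_line psi v0 M A w v) u1 u2) by (apply cusp_line_exC; lra).
  assert (HD : Cmod (X - I T)%C <= err / INR T * (u2 - u1)).
  { apply (is_CInt_norm_const (fun w => cusp_line psi v0 M A w v - g T w)%C u1 u2); [easy| |now apply is_CInt_minus].
   intros w Hw. unfold cusp_line, g. rewrite !Cmult_minus.
   assert (Hkw : 0 < arc_k A * w ^ 2) by (apply Rmult_lt_0_compat; [fold k; lra|pos]).
   rewrite !Cmod_mult, Cmod_e, Rmult_1_l, !Cmod_R, Rabs_pos_eq by pos.
   rewrite (Rabs_pos_eq (bump v0 v)) by apply bump_range. assert (Hyw : 0 < v / M * u1 ^ 2 <= v / M * w ^ 2).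
   { split; [apply Rmult_lt_0_compat; [easy|pos]|]. mul_l; (apply pow_incr; lra). }
   pose proof (psiT_tail kappa psi t p B' ((IZR (arc_a A) - w) / IZR (arc_K A)) (v / M * w ^ 2) T Hf Hc ltac:(lra) HT) as HPT.
   unfold err. match goal with |- _ <= ?a * ?b / ?c => replace (a * b / c) with (a * (b / c)) by (unfold Rdiv; ring) end.
   apply Rmult_le_compat.
   - pos.
   - apply Rmult_le_pos; [apply bump_range|pos].
   - fold k. apply Rinv_le_contravar; [apply Rmult_lt_0_compat; [lra|pos]|]. mul_l; (apply pow_incr; lra).
   - pose proof (bump_range v0 v) as Hb. match goal with |- _ * ?m <= _ => apply Rle_trans with (1 * m); [mul_r; lra|] end.
    rewrite Rmult_1_l. via HPT. mul_r. destruct Hc as [HB0 _]. pose proof (INR_fact_lt_0 (p + 2)).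
    assert (0 < 4 * B' * INR (fact (p + 2))) by pos. apply Rmult_le_compat; [pos| | |].
    + pos.
    + apply sqrt_le_1_alt. mul_l; (apply pow_incr; lra).
    + mul_l. apply Rinv_le_contravar; [pos|apply pow_incr; lra]. }
  replace X with ((X - I T) + I T)%C by ring. via Cmod_triangle.
  specialize (HIB T). replace (err * (u2 - u1) / INR T) with (err / INR T * (u2 - u1)) by (field; lra). lra.
Qed.

Lemma cusp_int_direct : Cmod (cusp_int psi v0 M A) <= direct_bound.
Proof.
  pose proof (arc_k_pos A Hok) as Hk. destruct (arc_w_pos A Hok Hp1) as [w1 w12]. pose proof (tame_pos _ _ Hp) as HC.
  assert (HD : 0 <= direct_bound).
  { via Cmod_ge_0. apply (cusp_line_bound v0); lra. }
  replace direct_bound with ((v0 + 1 - v0) * direct_bound) by ring.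
  replace (cusp_int psi v0 M A) with (csum (fun A => CInt (fun w => RtoC (/ (arc_k A * w ^ 2)) * (e (- M * arc_x A w) * PsiC psi v0 M A w))%C (arc_w1 A) (arc_w2 A)) [A])
   by (unfold cusp_int; cbn [csum fold_right]; apply Cplus_0_r).
  apply (inner_average_bound [A] arc_w1 arc_w2 _ (fun A w v => cusp_line psi v0 M A w v) v0 (v0 + 1) (/ W ^ 2 * (2 * C0)) direct_bound); try lra.
  - pos.
  - intros A' [<-|[]]. split; [easy|]. split.
   + apply exC_cont; [easy|]. intros w Hw. apply ccont_amp; [apply inv_kw2_cont; lra|]. apply ccont_mult.
    * apply (ccont_e (fun w => - M * arc_x A w)). apply continuous_Rmult; [apply continuous_const|apply arc_x_cont; [easy|lra]].
    * apply (PsiC_cont psi C0); easy || lra.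
   + intros w Hw. split.
    * unfold cusp_line. apply is_CInt_scal, is_CInt_scal. apply (PsiC_int psi C0); try easy; lra.
    * intros u v Hu Hv. unfold cusp_line. set (x := (IZR (arc_a A) - w) / IZR (arc_K A)). rewrite !Cmult_minus.

     rewrite !Cmod_mult, Cmod_e, Rmult_1_l, Cmod_R, Rabs_pos_eq by pos.
     rewrite Rmult_assoc. apply Rmult_le_compat; [pos|pos| |].
     -- apply Rinv_le_contravar; [pos|]. nra.
     -- assert (Huy : 0 < u / M * w ^ 2) by pos. assert (Hvy : 0 < v / M * w ^ 2) by pos.
      replace (RtoC (bump v0 u) * psi (x, u / M * w ^ 2)%R - RtoC (bump v0 v) * psi (x, v / M * w ^ 2)%R)%C with
       (RtoC (bump v0 u) * (psi (x, u / M * w ^ 2)%R - psi (x, v / M * w ^ 2)%R) + RtoC (bump v0 u - bump v0 v) * psi (x, v / M * w ^ 2)%R)%C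
       by (rewrite RtoC_minus; ring).
      via Cmod_triangle. rewrite !Cmod_mult, !Cmod_R, (Rabs_pos_eq (bump v0 u)) by apply bump_range.
      pose proof (bump_range v0 u) as Hb. pose proof (bump_lip v0 u v) as HL. pose proof (tame_bound _ _ Hp x _ Hvy) as HT.
      assert (T1 : Cmod (psi (x, u / M * w ^ 2)%R - psi (x, v / M * w ^ 2)%R)%C <= C0 * Rabs (u - v)).
      { eapply Rle_trans; [apply (tame_lip _ _ Hp); easy|]. mul_l. rewrite Rminus_diag, Rabs_R0, Rplus_0_l.
       replace (u / M * w ^ 2 - v / M * w ^ 2) with ((u - v) * (w ^ 2 / M)) by (field; lra).
       assert (Hwm : 0 < w ^ 2 / M) by pos. rewrite Rabs_mult, (Rabs_pos_eq (w ^ 2 / M)) by lra.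
       replace (Rabs (u - v) * (w ^ 2 / M) / (u / M * w ^ 2)) with (Rabs (u - v) * / u) by (field; lra).
       rewrite <- (Rmult_1_r (Rabs (u - v))) at 2. mul_l. rewrite <- Rinv_1. apply Rinv_le_contravar; lra. }
      assert (T2 : bump v0 u * Cmod (psi (x, u / M * w ^ 2)%R - psi (x, v / M * w ^ 2)%R)%C <= 1 * (C0 * Rabs (u - v))).
      { apply Rmult_le_compat; try lra. apply Cmod_ge_0. }
      assert (T3 : Rabs (bump v0 u - bump v0 v) * Cmod (psi (x, v / M * w ^ 2)%R) <= Rabs (u - v) * C0).
      { apply Rmult_le_compat; try easy; [pos|pos]. }
      lra.
  - intros v Hv. split.
   + intros A' [<-|[]]. apply cusp_line_exC; lra.
   + cbn [csum fold_right]. rewrite Cplus_0_r. now apply cusp_line_bound.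
Qed.

End CuspBound.

(** [T1] belongs to the far frequencies, [T2] to the near frequencies counted by the length of the
    arc, and [T3] to the 3 further ones. The condition Delta << M^(2/3) enters in [T3], in the form
    s <= Aq^2 q^6. *)
Lemma direct_bound_le B th v0 W h q s z Aq Lam (A : arc) :
  0 <= B -> 1 <= v0 -> 0 < W -> 1 <= h -> 1 <= q -> 0 < s -> 1 <= z -> z ^ 2 <= q -> 1 <= Aq -> s <= Aq ^ 2 * q ^ 6 ->
  1 <= arc_k A -> / W <= 6 * q / s -> arc_k A / W <= 2 / (q ^ 2 * z ^ 2) ->
  Rpower (Rmax 1 (s ^ 2 * q ^ 6 / W ^ 2)) th <= Lam ->
  s ^ 2 * direct_bound B th v0 (s ^ 2 * q ^ 6) W (/ s ^ 2) h A <= 3 * 10 ^ 6 * B * (v0 + 1) * Lam * h * Aq / (q * z).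
Proof.
  intros HB Hv HW Hh Hq Hs Hz Hzq HAq HsA Hk HW1 HkW HLam. unfold direct_bound.
  set (k := arc_k A) in *. set (M := s ^ 2 * q ^ 6) in *.
  set (Nm := Rmin 1 (M / W ^ 2)) in *. set (Np := Rmax 1 (M / W ^ 2)) in *.
  assert (Hq3 : 0 < q ^ 3) by pos. assert (Hsq : 0 < s * q ^ 3) by now apply Rmult_lt_0_compat.
  assert (EM : sqrt M = s * q ^ 3).
  { unfold M. replace (s ^ 2 * q ^ 6) with ((s * q ^ 3) * (s * q ^ 3)) by ring. apply sqrt_square; lra. }
  rewrite EM. set (V := sqrt (v0 + 1)). assert (HV : 0 <= V <= v0 + 1).
  { split; [apply sqrt_pos|]. unfold V. rewrite <- (sqrt_square (v0 + 1)) at 2 by lra. apply sqrt_le_1_alt. nra. }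
  set (Gm := 192 * B * Rpower Np th). assert (HGm : 0 <= Gm <= 192 * B * Lam).
  { unfold Gm. split; [pos|]. apply Rmult_le_compat_l; lra. }
  set (o := s * q ^ 3 / W). assert (Ho : 0 < o) by (unfold o; now apply Rdiv_lt_0_compat).
  assert (HN : M / W ^ 2 = o * o) by (unfold M, o; field; lra).
  set (ro := sqrt o). assert (Hro : 0 < ro) by now apply sqrt_lt_R0. assert (Hroo : ro * ro = o) by (apply sqrt_sqrt; lra).
  set (r1 := sqrt (k * W)). assert (HkW0 : 0 < k * W) by pos.
  assert (Hr1 : 0 < r1) by now apply sqrt_lt_R0. assert (Hr11 : r1 * r1 = k * W) by (apply sqrt_sqrt; lra).
  set (sg := sqrt (k * W / Np)). assert (HNp : 1 <= Np) by apply Rmax_l.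
  assert (Esg : sg = r1 / sqrt Np) by (unfold sg, r1; rewrite sqrt_div_alt by lra; easy).
  (* The factor [Nm] rescues the range [W > sqrt M], where all the frequencies are too small. *)
  assert (Hphi : Nm * sg <= r1 / o /\ Nm * sg <= r1 / ro).
  { rewrite Esg. destruct (Rle_dec 1 o) as [h1|h1].
   - assert (h2 : 1 <= o * o) by nra. unfold Nm, Np. rewrite HN, Rmin_left, Rmax_right by lra. rewrite sqrt_square by lra.
    assert (Hroo1 : ro <= o) by (assert (1 <= ro) by nra; nra).
    assert (/ o <= / ro) by (apply Rinv_le_contravar; lra). unfold Rdiv. nra.
   - apply Rnot_le_lt in h1. assert (h2 : o * o <= 1) by nra. unfold Nm, Np. rewrite HN, Rmin_right, Rmax_left, sqrt_1 by lra.
    assert (ro <= 1) by nra. assert (1 <= / o) by (rewrite <- Rinv_1; apply Rinv_le_contravar; lra).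
    assert (1 <= / ro) by (rewrite <- Rinv_1; apply Rinv_le_contravar; lra).
    unfold Rdiv. rewrite Rinv_1, Rmult_1_r. split; rewrite Rmult_comm; apply Rmult_le_compat_l; lra. }
  destruct Hphi as [Hphi1 Hphi2]. assert (HNm : 0 < Nm <= 1).
  { split; [apply Rmin_pos; [lra|rewrite HN; nra]|apply Rmin_l]. }
  assert (Hqz : 0 < q * z) by nra. assert (Hiqz : 0 < / (q * z)) by now apply Rinv_0_lt_compat.
  replace (192 * B * Rpower Np th * Nm) with (Gm * Nm) by reflexivity. assert (T1 : s / q ^ 3 * (Nm * / W) <= 6 * / (q * z)).
  { apply Rle_trans with (s / q ^ 3 * (6 * q / s)).
   - mul_l. assert (0 < / W) by now apply Rinv_0_lt_compat. nra.
   - replace (s / q ^ 3 * (6 * q / s)) with (6 * / (q * q)) by (field; lra). mul_l.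
    apply Rinv_le_contravar; [easy|]. mul_l. nra. }
  assert (T2 : s * q ^ 3 * (Nm * sg * / W ^ 2) <= 3 / 2 * / (q * z)).
  { apply Rle_trans with (r1 / W).
   - apply Rle_trans with (s * q ^ 3 * (r1 / o * / W ^ 2)).
    + mul_l. mul_r; easy.
    + right. unfold o. field. lra.
   - apply Rsqr_incr_0_var; [|lra]. unfold Rsqr. replace (r1 / W * (r1 / W)) with (r1 * r1 / W / W) by (field; lra).
    rewrite Hr11. replace (k * W / W / W) with (k / W) by (field; lra). via HkW.
    replace (3 / 2 * / (q * z) * (3 / 2 * / (q * z))) with (9 / 4 * / (q ^ 2 * z ^ 2)) by (field; lra).
    unfold Rdiv. apply Rmult_le_compat_r; [|lra]. left. apply Rinv_0_lt_compat. apply Rmult_lt_0_compat; apply pow_lt; lra. }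
  (* The square of the left-hand side is at most s/q^9 <= Aq^2/q^3, and q z^2 <= q^2 makes this at
     most (Aq/(q z))^2. *)
  assert (T3 : s / q ^ 3 * (Nm * sg * / (k * W)) <= Aq * / (q * z)).
  { set (u := sqrt (s * q ^ 3)). assert (Hu : 0 < u) by now apply sqrt_lt_R0. assert (Huu : u * u = s * q ^ 3) by (apply sqrt_sqrt; lra).
   apply Rle_trans with (s / q ^ 3 * / u).
   - mul_l. apply Rle_trans with (r1 / ro * / (k * W)); [mul_r; easy|].
    rewrite <- Hr11. replace (r1 / ro * / (r1 * r1)) with (/ (ro * r1)) by (field; lra).
    apply Rinv_le_contravar; [easy|]. unfold u, ro, r1. rewrite <- sqrt_mult by lra. apply sqrt_le_1_alt.
    unfold o. replace (s * q ^ 3 / W * (k * W)) with (s * q ^ 3 * k) by (field; lra). nra.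
   - apply Rsqr_incr_0_var; [|pos]. unfold Rsqr.
    replace (s / q ^ 3 * / u * (s / q ^ 3 * / u)) with (s ^ 2 / q ^ 6 * / (u * u)) by (field; lra). rewrite Huu.
    replace (s ^ 2 / q ^ 6 * / (s * q ^ 3)) with (s * / q ^ 9) by (field; lra).
    apply Rle_trans with (Aq ^ 2 * q ^ 6 * / q ^ 9).
    + mul_r; easy.
    + replace (Aq ^ 2 * q ^ 6 * / q ^ 9) with (Aq ^ 2 * / (q ^ 2 * q)) by (field; lra).
     replace (Aq * / (q * z) * (Aq * / (q * z))) with (Aq ^ 2 * / (q ^ 2 * z ^ 2)) by (field; lra).
     mul_l. assert (0 < q ^ 2) by pos.
     apply Rinv_le_contravar; [apply Rmult_lt_0_compat; [easy|pos]|]. apply Rmult_le_compat_l; lra. }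
  replace (s ^ 2 * (V / (s * q ^ 3 * k) * (4 * (Gm * Nm) / W * (164 * k * h + 432 * sg * (2 * M * k * / s ^ 2 / W + 3))))) with
   (V * Gm * (656 * h * (s / q ^ 3 * (Nm * / W)) + 3456 * (s * q ^ 3 * (Nm * sg * / W ^ 2)) + 5184 * (s / q ^ 3 * (Nm * sg * / (k * W)))))
   by (unfold M; field; lra).
  apply Rle_trans with (V * Gm * (14304 * (h * Aq * / (q * z)))).
  - mul_l. assert (HhA : h <= h * Aq) by nra. assert (HAh : Aq <= h * Aq) by nra. set (y := / (q * z)) in *.
   assert (656 * h * (s / q ^ 3 * (Nm * / W)) <= 656 * h * (6 * y)) by nra.
   assert (h * y <= h * Aq * y) by nra. assert (Aq * y <= h * Aq * y) by nra.
   assert (1 * y <= h * Aq * y) by (apply Rmult_le_compat_r; lra). lra.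
  - replace (3 * 10 ^ 6 * B * (v0 + 1) * Lam * h * Aq / (q * z)) with ((v0 + 1) * (192 * B * Lam) * (15625 * (h * Aq * / (q * z)))) by (field; lra).
   assert (H0 : 0 <= h * Aq * / (q * z)) by pos. apply Rmult_le_compat; [pos|lra| |lra]. apply Rmult_le_compat; lra.
Qed.

(** A vector that violates the condition may be divided by its gcd: this increases none of the
    quantities involved, and coprime entries can be completed to a modular matrix. *)
Lemma well_approx alpha Delta tau E Q : 0 < tau -> ~ badly_approx alpha Delta tau E Q ->
  exists h k a b : Z, (1 <= k)%Z /\ (a * h + b * k = -1)%Z /\ IZR k <= Q /\
   Rabs (IZR h - IZR k * alpha) <= E /\
   IZR k * Rmax (Rabs (IZR h - IZR k * alpha)) (IZR k / Delta) < tau.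
Proof.
  intros Htau H. apply not_all_ex_not in H. destruct H as [v H]. apply imply_to_and in H. destruct H as [(H1 & H2 & H3) H4].
  apply Rnot_le_lt in H4. destruct (primitive_part v H1) as [h0 [k0 [g (G1 & G2 & G3 & G4 & G5)]]].
  apply rel_prime_bezout in G5. destruct G5 as [u w Huw]. exists h0, k0, (- w)%Z, (- u)%Z. split; [easy|]. split; [lia|].
  rewrite G3, G4, !mult_IZR in *. apply IZR_le in G1, G2.
  replace (IZR g * IZR h0 - IZR g * IZR k0 * alpha) with (IZR g * (IZR h0 - IZR k0 * alpha)) in * by ring.
  rewrite Rabs_mult, (Rabs_pos_eq (IZR g)) in * by lra. set (d := Rabs (IZR h0 - IZR k0 * alpha)) in *.
  assert (Hd : 0 <= d) by apply Rabs_pos. set (k := IZR k0) in *. set (G := IZR g) in *.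
  split; [nra|]. split; [nra|]. eapply Rle_lt_trans; [|exact H4]. apply Rle_trans with (k * Rmax (G * d) (G * k / Delta)).
  - mul_l. replace (G * k / Delta) with (G * (k / Delta)) by (unfold Rdiv; ring).
   rewrite RmaxRmult by lra. assert (0 <= Rmax d (k / Delta)) by (eapply Rle_trans; [exact Hd|apply Rmax_l]). nra.
  - apply Rmult_le_compat_r; [|nra]. apply Rle_trans with (G * d); [pos|apply Rmax_l].
Qed.

(** * Intervals close to one rational *)

Section DirectTotal.

Variables (psi : C -> C) (C0 kappa : R) (t : Z -> C) (p : nat) (B' B th v0 q s z x1 x2 ell Aq Lam : R) (H K a b : Z).
Hypotheses (Hp : tame_form psi C0) (Hf : fourier_expansion kappa psi t) (Hc : coef_bd t p B')
  (HB : 0 <= B) (Hth : 0 <= th <= 1)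
  (Ht : forall n, (1 <= n)%nat -> Cmod (t (Z.of_nat n)) <= B * Rpower (INR n) th /\ Cmod (t (- Z.of_nat n)%Z) <= B * Rpower (INR n) th)
  (Hv0 : 1 <= v0) (Hq : 64 <= q) (Hs : 1 <= s) (Hz : 1 <= z) (Hzq : z ^ 2 <= q) (HAq : 1 <= Aq) (HsA : s <= Aq ^ 2 * q ^ 6)
  (H01 : x1 <= x2) (Hlen : x2 - x1 <= / s ^ 2) (Hell : ell = 1 + ln (s ^ 2 * q ^ 6)) (HLam : Rpower (36 * q ^ 8) th = Lam).

Let M := s ^ 2 * q ^ 6.
Let k := IZR K.
Let d := Rabs (IZR H - k * x1).

Hypotheses (HK : (1 <= K)%Z) (Hdet : (a * H + b * K = -1)%Z) (HkQ : k <= 2 * (q * s)) (Hd : d <= 4 * q / s)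
  (Htau : k * Rmax d (k / s ^ 2) <= / (q ^ 2 * z ^ 2)).

Let c := IZR H / IZR K.
(** A bound for the distance from H/K to every point of the interval, so that w >= 1/(k rho)
    there. *)
Let rho := d / k + / s ^ 2.

(** The interval is split at H/K; if H/K lies outside it, one of the two arcs degenerates to a
    point. *)
Definition right_of_cusp : arc := ((H, K), a, (Rmax x1 c - c, Rmax x2 c - c)).
Definition left_of_cusp : arc := ((- H, - K)%Z, (- a)%Z, (c - Rmin x2 c, c - Rmin x1 c)).
Let arcs := [right_of_cusp; left_of_cusp].

Lemma cusp_basic : 1 <= k /\ 1 <= M /\ q <= M /\ 1 <= ell /\ 0 <= d /\ 0 < k * rho /\ k * rho <= 6 * q / s /\
  k * (k * rho) <= 2 / (q ^ 2 * z ^ 2) /\ 0 < s ^ 2 /\ 0 < rho /\ Rabs (x1 - c) = d / k.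
Proof.
  assert (Hk : 1 <= k) by (apply IZR_le in HK; exact HK).
  assert (hq2 : 1 <= q ^ 2) by nra. assert (hq4 : 1 <= q ^ 4) by (replace (q ^ 4) with (q ^ 2 * q ^ 2) by ring; nra).
  assert (hq6 : q <= q ^ 6) by (replace (q ^ 6) with (q * (q * q ^ 4)) by ring; nra). assert (hs2 : 1 <= s ^ 2) by nra.
  assert (h2 : q <= M) by (unfold M; nra). assert (Hd0 : 0 <= d) by apply Rabs_pos.
  assert (E : k * rho = d + k / s ^ 2) by (unfold rho; field; lra). assert (Hks : 0 < k / s ^ 2) by pos.
  assert (h3 : k / s ^ 2 <= 2 * q / s).
  { replace (2 * q / s) with (2 * (q * s) / s ^ 2) by (field; lra). mul_r; easy. }
  assert (h4 : k * d <= / (q ^ 2 * z ^ 2)).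
  { eapply Rle_trans; [|exact Htau]. mul_l; apply Rmax_l. }
  assert (h5 : k * (k / s ^ 2) <= / (q ^ 2 * z ^ 2)).
  { eapply Rle_trans; [|exact Htau]. mul_l; apply Rmax_r. }
  split; [easy|]. split; [lra|]. split; [easy|]. split.
  { rewrite Hell. fold M. pose proof (ln_nonneg M ltac:(lra)). lra. }
  split; [easy|]. split; [rewrite E; lra|]. split; [rewrite E; replace (6 * q / s) with (4 * q / s + 2 * q / s) by (field; lra); lra|].
  split; [rewrite E; unfold Rdiv in *; lra|]. split; [lra|]. split.
  { unfold rho. assert (0 <= d / k) by pos. assert (0 < / s ^ 2) by pos. lra. }
  unfold c, d. fold k. replace (x1 - IZR H / k) with (- ((IZR H - k * x1) / k)) by (field; lra).
  rewrite Rabs_Ropp, Rabs_div, (Rabs_pos_eq k) by lra. easy.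
Qed.

Lemma cusp_arcs A : In A arcs -> arc_ok A /\ arc_k A = k /\ arc_p2 A <= rho /\ arc_p2 A - arc_p1 A <= / s ^ 2.
Proof.
  destruct cusp_basic as (b1 & b2 & b3 & b4 & b5 & b6 & b7 & b8 & b9 & b10 & b11).

  assert (Hx : x1 - c <= d / k /\ c - x1 <= d / k) by (rewrite <- b11; split; [apply Rle_abs|rewrite Rabs_minus_sym; apply Rle_abs]).
  intros [<-|[<-|[]]].
  - assert (Hr1 : Rmax x1 c <= Rmax x2 c) by (apply Rle_max_compat_r; easy).
   unfold arc_ok, arc_k, arc_K, arc_a, arc_H, arc_v, arc_p1, arc_p2, right_of_cusp. cbn [fst snd].
   pose proof (Rmax_r x1 c). split; [split; [lia|split; [now exists b|lra]]|]. split; [apply Rabs_pos_eq; fold k; lra|].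
   split.
   + assert (Rmax x2 c <= c + rho); [|lra]. unfold rho. apply Rmax_lub; lra.
   + assert (Rmax x2 c <= Rmax x1 c + / s ^ 2); [|lra]. pose proof (Rmax_l x1 c). apply Rmax_lub; lra.
  - assert (Hr1 : Rmin x1 c <= Rmin x2 c) by (apply Rle_min_compat_r; easy).
   unfold arc_ok, arc_k, arc_K, arc_a, arc_H, arc_v, arc_p1, arc_p2, left_of_cusp. cbn [fst snd].
   pose proof (Rmin_r x2 c). split; [split; [lia|split; [exists (- b)%Z; lia|lra]]|].
   split; [rewrite opp_IZR, Rabs_Ropp; apply Rabs_pos_eq; fold k; lra|]. split.
   + assert (c - rho <= Rmin x1 c); [|lra]. unfold rho. apply Rmin_glb; lra.
   + assert (Rmin x2 c - / s ^ 2 <= Rmin x1 c); [|lra]. pose proof (Rmin_l x2 c). apply Rmin_glb; lra.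
Qed.

Lemma cusp_arcs_int f : (forall x, ccont f x) -> CInt f x1 x2 = csum (arc_int f) arcs.
Proof.
  intros Hfc. destruct cusp_basic as (b1 & _). assert (HK0 : IZR K <> 0) by (fold k; lra).
  assert (Hex : forall u v, u <= v -> exC f u v) by (intros; apply exC_cont; auto).
  assert (ER : arc_int f right_of_cusp = CInt f (Rmax x1 c) (Rmax x2 c)).
  { assert (Hr1 : Rmax x1 c <= Rmax x2 c) by (apply Rle_max_compat_r; easy).
   rewrite <- (CInt_shift f c) by easy. unfold arc_int. apply CInt_ext.
   - unfold arc_p1, arc_p2; simpl. lra.
   - intros y _. f_equal. unfold arc_pt, arc_H, arc_K, arc_v, right_of_cusp. cbn [fst snd]. rewrite Z.sgn_pos by lia. fold c. ring. }
  assert (EL : arc_int f left_of_cusp = CInt f (Rmin x1 c) (Rmin x2 c)).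
  { assert (Hr1 : Rmin x1 c <= Rmin x2 c) by (apply Rle_min_compat_r; easy).
   rewrite <- (CInt_reflect f c) by easy. unfold arc_int. apply CInt_ext.
   - unfold arc_p1, arc_p2; simpl. lra.
   - intros y _. f_equal. unfold arc_pt, arc_H, arc_K, arc_v, left_of_cusp. cbn [fst snd]. rewrite Z.sgn_neg by lia.
    unfold c. rewrite !opp_IZR. field. easy. }
  unfold arcs. cbn [csum fold_right]. rewrite ER, EL, Cplus_0_r.
  destruct (Rle_dec c x1) as [h1|h1]; [|destruct (Rle_dec x2 c) as [h2|h2]].
  - rewrite (Rmax_left x1 c), (Rmax_left x2 c), (Rmin_right x1 c), (Rmin_right x2 c), CInt_point by lra. ring.
  - rewrite (Rmax_right x1 c), (Rmax_right x2 c), (Rmin_left x1 c), (Rmin_left x2 c), CInt_point by lra. ring.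
  - rewrite (Rmax_right x1 c), (Rmax_left x2 c), (Rmin_left x1 c), (Rmin_right x2 c) by lra.
   rewrite (CInt_Chasles f x1 c x2) by (try lra; now apply Hex). ring.
Qed.

Lemma Lam_pos : 0 < Lam.
Proof. rewrite <- HLam. apply exp_pos. Qed.

Lemma cusp_class i : s ^ 2 * Cmod (csum (arc_int (wave psi v0 M)) (pieces (/ (k * rho)) arcs i)) <=
  2 * (3 * 10 ^ 6 * B * (v0 + 1) * Lam * (3 * ell) * Aq / (q * z) + 2 * C0 * (v0 + 1) / q).
Proof.
  destruct cusp_basic as (b1 & b2 & b3 & b4 & b5 & b6 & b7 & b8 & b9 & b10 & b11). pose proof (tame_pos _ _ Hp) as HC.
  set (R' := / (k * rho)) in *. assert (HR' : 0 < R') by now apply Rinv_0_lt_compat.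
  assert (Hi : 1 <= 2 ^ i) by (apply pow_R1_Rle; lra). set (W := R' * 2 ^ i). assert (HW : R' <= W) by (unfold W; nra).
  assert (HW1 : / W <= k * rho) by (rewrite <- (Rinv_inv (k * rho)); now apply Rinv_le_contravar).
  (* From 1/W <= k rho <= 6 q/s the stationary frequencies at this cusp are at most of order q^8,
     whence the base 36 q^8 in [Lam]. *)
  assert (HiW : 0 < / W) by pos. assert (HN : M / W ^ 2 <= 36 * q ^ 8).
  { replace (M / W ^ 2) with (M * (/ W * / W)) by (field; lra).
   apply Rle_trans with (M * ((6 * q / s) * (6 * q / s))); [|right; unfold M; field; lra].
   mul_l. apply Rmult_le_compat; lra. }
  assert (Hq8 : 1 <= q ^ 8) by (apply pow_R1_Rle; lra).
  assert (HNp : Rmax 1 (M / W ^ 2) <= 36 * q ^ 8) by (apply Rmax_lub; lra).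
  assert (Hh : forall m, INR m <= 2 * Rmax 1 (M / W ^ 2) + 1 -> harm m <= 3 * ell).
  { intros m Hm. rewrite Hell. fold M. apply harm_le_ln; [easy|].
   assert (Hq4 : 64 <= q ^ 4) by (assert (q <= q ^ 4) by (rewrite <- (pow_1 q) at 1; apply Rle_pow; [lra|lia]); lra).
   assert (q ^ 12 <= M ^ 2).
   { unfold M. replace ((s ^ 2 * q ^ 6) ^ 2) with (s ^ 4 * q ^ 12) by ring.
    assert (1 <= s ^ 4) by (apply pow_R1_Rle; lra). assert (0 < q ^ 12) by pos. nra. }
 nra. }
  set (X := 3 * 10 ^ 6 * B * (v0 + 1) * Lam * (3 * ell) * Aq / (q * z) + 2 * C0 * (v0 + 1) / q). pose proof Lam_pos as HL.
  assert (HP : forall A, In A (pieces R' arcs i) -> s ^ 2 * Cmod (arc_int (wave psi v0 M) A) <= X).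
  { intros A HA. apply pieces_in in HA; [|easy|intros; now apply cusp_arcs].
   destruct HA as [A0 (I1 & I2 & I3 & I4 & I5 & I6 & I7 & I8 & I9 & I10)]. fold W in I8, I10.
   destruct (cusp_arcs A0 I1) as (P1 & P2 & P3 & P4).
   assert (EkA : arc_k A = k) by (rewrite <- P2; unfold arc_k, arc_K; now rewrite I2).
   pose proof (cusp_int_direct psi C0 kappa t p B' B th v0 M W (/ s ^ 2) (3 * ell) A Hp Hf Hc HB Hth Ht Hv0 ltac:(lra) ltac:(lra)
    I4 I5 I8 I10 ltac:(lra) Hh) as HCI.
   pose proof (direct_bound_le B th v0 W (3 * ell) q s z Aq Lam A HB Hv0 ltac:(lra) ltac:(lra) ltac:(lra) ltac:(lra) Hz Hzq HAq HsA
    ltac:(lra) ltac:(lra)) as HDB. fold M in HDB.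
   lapply HDB; [clear HDB; intros HDB|].
   2:{ rewrite EkA. eapply Rle_trans; [|exact b8]. apply Rmult_le_compat_l; lra. }
   lapply HDB; [clear HDB; intros HDB|].
   2:{ rewrite <- HLam. apply Rle_Rpower_l; [lra|]. split; [|easy]. pose proof (Rmax_l 1 (M / W ^ 2)). lra. }
   pose proof (arc_int_approx psi C0 v0 M A W Hp ltac:(lra) ltac:(lra) I4 I5 ltac:(lra) I8 I10) as HAp.
   set (Y := arc_int (wave psi v0 M) A) in *. set (Z := cusp_int psi v0 M A) in *.
   assert (HYZ : Cmod Y <= Cmod (Y - Z)%C + Cmod Z) by (replace Y with ((Y - Z) + Z)%C at 1 by ring; apply Cmod_triangle).
   assert (A1 : s ^ 2 * (2 * C0 * (v0 + 1) / M) <= 2 * C0 * (v0 + 1) / q).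
   { replace (s ^ 2 * (2 * C0 * (v0 + 1) / M)) with (2 * C0 * (v0 + 1) * / q ^ 6) by (unfold M; field; lra).
    mul_l. apply Rinv_le_contravar; [lra|]. rewrite <- (pow_1 q) at 1. apply Rle_pow; [lra|lia]. }
   unfold X. apply Rle_trans with (s ^ 2 * (2 * C0 * (v0 + 1) / M + direct_bound B th v0 M W (/ s ^ 2) (3 * ell) A)).
   - apply Rmult_le_compat_l; lra.
   - lra. }
  assert (HX : 0 <= X).
  { unfold X. assert (0 < 2 * C0 * (v0 + 1) / q) by pos.
   assert (0 <= 3 * 10 ^ 6 * B * (v0 + 1) * Lam * (3 * ell) * Aq / (q * z)); [|lra]. apply Rmult_le_pos; [|pos].
   repeat (apply Rmult_le_pos; [|lra]). lra. }
  assert (HLl : (length (pieces R' arcs i) <= 2)%nat).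
  { unfold pieces. eapply Nat.le_trans; [apply length_filter_le|]. rewrite length_map. easy. }
  apply Rle_trans with (X * INR (length (pieces R' arcs i))).
  - rewrite <- rsum_const. apply Rle_trans with (rsum (fun A => s ^ 2 * Cmod (arc_int (wave psi v0 M) A)) (pieces R' arcs i)).
   + rewrite rsum_scal. mul_l. apply csum_norm. intros; lra.
   + now apply rsum_le.
  - rewrite (Rmult_comm 2). mul_l. change 2 with (INR 2). now apply le_INR.
Qed.

Lemma direct_total : s ^ 2 * Cmod (CInt (wave psi v0 M) x1 x2) <=
  10 ^ 8 * (B + C0) * (v0 + 1) * ell ^ 2 * Aq * (Lam / (q * z) + / q).
Proof.
  destruct cusp_basic as (b1 & b2 & b3 & b4 & b5 & b6 & b7 & b8 & b9 & b10 & b11). pose proof (tame_pos _ _ Hp) as HC.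
  pose proof Lam_pos as HL.
  assert (Hfc : forall x, ccont (wave psi v0 M) x) by (intros; apply (wave_cont psi C0); easy || lra).
  rewrite (cusp_arcs_int _ Hfc). destruct (pow2_bracket M b2) as [n [[Hn1 Hn2] HnL]].
  set (R' := / (k * rho)) in *. assert (HR' : 0 < R') by now apply Rinv_0_lt_compat.
  pose proof (arc_int_split (wave psi v0 M) arcs R' n C0 HR' ltac:(lra) Hfc ltac:(intros; apply wave_bound; easy || lra)) as HSp.
  lapply HSp; [clear HSp; intros HSp|].
  2:{ intros A HA. destruct (cusp_arcs A HA) as (P1 & P2 & P3 & P4). split; [easy|]. rewrite P2.
    replace (/ (k * R')) with rho by (unfold R'; field; lra). easy. }
  set (X := 2 * (3 * 10 ^ 6 * B * (v0 + 1) * Lam * (3 * ell) * Aq / (q * z) + 2 * C0 * (v0 + 1) / q)).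
  assert (Hcl : s ^ 2 * rsum (fun i => Cmod (csum (arc_int (wave psi v0 M)) (pieces R' arcs i))) (seq 0 n) <= INR n * X).
  { rewrite <- rsum_scal. replace (INR n) with (INR (length (seq 0 n))) by now rewrite length_seq. rewrite (Rmult_comm (INR _)), <- rsum_const.
   apply rsum_le. intros i _. apply cusp_class. }
  assert (Htl : s ^ 2 * rsum (fun A => C0 / (arc_k A * R' * 2 ^ n)) arcs <= 12 * C0 * / q).
  { apply Rle_trans with (s ^ 2 * (2 * (C0 * rho / M))).
   - mul_l. apply Rle_trans with (rsum (fun _ => C0 * rho / M) arcs); [|right; unfold arcs; simpl; ring].
    apply rsum_le. intros A HA. destruct (cusp_arcs A HA) as (P1 & P2 & P3 & P4). rewrite P2.

    replace (C0 / (k * R' * 2 ^ n)) with (C0 * rho / 2 ^ n) by (unfold R'; field; lra).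
    mul_l. apply Rinv_le_contravar; lra.
   - assert (Hrho : rho <= 6 * q / s).
    { nra. }
    apply Rle_trans with (s ^ 2 * (2 * (C0 * (6 * q / s) / M))).
    + mul_l. mul_l. mul_r. apply Rmult_le_compat_l; lra.
    + replace (s ^ 2 * (2 * (C0 * (6 * q / s) / M))) with (12 * C0 * / (s * q ^ 5)) by (unfold M; field; lra).
     mul_l. apply Rinv_le_contravar; [lra|].
     assert (q <= q ^ 5) by (rewrite <- (pow_1 q) at 1; apply Rle_pow; [lra|lia]). nra. }
  fold M in Hell. rewrite <- Hell in HnL.
  apply (Rmult_le_compat_l (s ^ 2)) in HSp; [|lra]. rewrite Rmult_plus_distr_l in HSp.
  set (y1 := Lam / (q * z)). assert (Hy1 : 0 < y1) by (apply Rdiv_lt_0_compat; [easy|nra]).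
  set (y2 := / q) in *. assert (Hy2 : 0 < y2) by (apply Rinv_0_lt_compat; lra).
  assert (EX : X = 18 * 10 ^ 6 * (B * (v0 + 1) * ell * Aq * y1) + 4 * (C0 * (v0 + 1) * y2)).
  { unfold X, y1, y2. field. lra. }
  set (u := (B + C0) * (v0 + 1) * ell * Aq). assert (Hu0 : 0 <= (B + C0) * (v0 + 1)) by pos.
  assert (Hu1 : B * (v0 + 1) * ell * Aq <= u).
  { unfold u. mul_r. mul_r. apply Rmult_le_compat_r; lra. }
  assert (Hu2 : C0 * (v0 + 1) <= u).
  { unfold u. apply Rle_trans with ((B + C0) * (v0 + 1)); [apply Rmult_le_compat_r; lra|].
   apply Rle_trans with ((B + C0) * (v0 + 1) * ell); [nra|]. assert (0 <= (B + C0) * (v0 + 1) * ell) by pos. nra. }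
  assert (Hu3 : C0 <= u) by nra. assert (Hu : 0 <= u) by lra. assert (HX : 0 <= X /\ X <= 18 * 10 ^ 6 * u * (y1 + y2)).
  { rewrite EX. split.
   - assert (0 <= B * (v0 + 1) * ell * Aq * y1) by pos. assert (0 <= C0 * (v0 + 1) * y2) by pos. lra.
   - assert (B * (v0 + 1) * ell * Aq * y1 <= u * y1) by nra. assert (C0 * (v0 + 1) * y2 <= u * y2) by nra.
    assert (0 <= u * y2) by pos. lra. }
  apply Rle_trans with (2 * ell * (18 * 10 ^ 6 * u * (y1 + y2)) + 12 * u * (y1 + y2)).
  { assert (INR n * X <= 2 * ell * (18 * 10 ^ 6 * u * (y1 + y2))) by (apply Rmult_le_compat; try lra; apply pos_INR).
   assert (12 * C0 * y2 <= 12 * u * (y1 + y2)); [|lra]. rewrite !Rmult_assoc. mul_l. apply Rmult_le_compat; lra. }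
  replace (10 ^ 8 * (B + C0) * (v0 + 1) * ell ^ 2 * Aq * (y1 + y2)) with (10 ^ 8 * ell * (u * (y1 + y2))) by (unfold u; ring).
  assert (0 <= u * (y1 + y2)) by pos. nra.
Qed.

End DirectTotal.

(** * Arbitrary intervals and the union of the two cases *)

Lemma Psi_periodic psi C0 v0 M m x : tame_form psi C0 -> 0 < v0 -> 0 < M -> Psi psi v0 M (IZR m + x) = Psi psi v0 M x.
Proof.
  intros Hp Hv HM. unfold Psi. apply CInt_ext; [lra|]. intros v Hvv. f_equal. rewrite (Rplus_comm (IZR m)).
  apply (tame_periodic _ _ Hp). apply Rdiv_lt_0_compat; lra.
Qed.

Lemma wave_shift psi C0 v0 M m x1 x2 : tame_form psi C0 -> 0 < v0 -> 0 < M -> x1 <= x2 ->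
  Cmod (CInt (wave psi v0 M) x1 x2) = Cmod (CInt (wave psi v0 M) (x1 - IZR m) (x2 - IZR m)).
Proof.
  intros Hp Hv HM Hx. assert (Hf : forall x, ccont (wave psi v0 M) x) by (intros; now apply (wave_cont psi C0)).
  rewrite <- (CInt_shift (wave psi v0 M) (IZR m)) by easy.
  assert (E : CInt (fun p => wave psi v0 M (IZR m + p)) (x1 - IZR m) (x2 - IZR m) =
   (e (- M * IZR m) * CInt (wave psi v0 M) (x1 - IZR m) (x2 - IZR m))%C).
  { apply is_CInt_unique. eapply is_CInt_ext; [lra| |apply is_CInt_scal, exC_cont; [lra|intros; apply Hf]].
   intros x _. unfold wave. rewrite (Psi_periodic psi C0), Cmult_assoc, <- e_plus by easy. f_equal. f_equal. ring. }
  now rewrite E, Cmod_mult, Cmod_e, Rmult_1_l.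
Qed.

(** The Farey dissection lives in [0, 1]. An interval of length at most 1 is cut at an integer if
    necessary and translated, which multiplies the integrals by numbers of modulus 1. *)
Lemma wave_unit_interval psi C0 v0 M len X : tame_form psi C0 -> 0 < v0 -> 0 < M -> 0 <= len <= 1 ->
  (forall x1 x2, 0 <= x1 -> x1 <= x2 -> x2 <= 1 -> x2 - x1 <= len -> Cmod (CInt (wave psi v0 M) x1 x2) <= X) ->
  forall x1 x2, x1 <= x2 -> x2 - x1 <= len -> Cmod (CInt (wave psi v0 M) x1 x2) <= 2 * X.
Proof.
  intros Hp Hv HM Hlen HX x1 x2 H1 H2.
  assert (Hf : forall x, ccont (wave psi v0 M) x) by (intros; now apply (wave_cont psi C0)).
  assert (HX0 : 0 <= X) by (eapply Rle_trans; [apply Cmod_ge_0|apply (HX 0 0); lra]).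
  destruct (archimed x1) as [a1 a2]. set (m := (up x1 - 1)%Z). assert (Hm : IZR m <= x1 < IZR m + 1) by (unfold m; rewrite minus_IZR; lra).
  destruct (Rle_dec x2 (IZR m + 1)) as [h|h].
  - rewrite (wave_shift psi C0 v0 M m) by easy. apply Rle_trans with X; [|lra]. apply HX; lra.
  - rewrite (CInt_Chasles _ x1 (IZR m + 1) x2); [|lra|lra|apply exC_cont; auto].
   via Cmod_triangle. replace (2 * X) with (X + X) by ring. apply Rplus_le_compat.
   + rewrite (wave_shift psi C0 v0 M m) by (easy || lra). apply HX; lra.
   + rewrite (wave_shift psi C0 v0 M (m + 1)) by (easy || lra). rewrite plus_IZR. apply HX; lra.
Qed.

Section Local.

Variables (psi : C -> C) (C0 kappa : R) (t : Z -> C) (p : nat) (B' B th v0 q s z ell Aq Lam : R).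
Hypotheses (Hp : tame_form psi C0) (Hf : fourier_expansion kappa psi t) (Hc : coef_bd t p B')
  (HB : 0 <= B) (Hth : 0 <= th <= 1)
  (Ht : forall n, (1 <= n)%nat -> Cmod (t (Z.of_nat n)) <= B * Rpower (INR n) th /\ Cmod (t (- Z.of_nat n)%Z) <= B * Rpower (INR n) th)
  (Hv0 : 1 <= v0) (Hq : 64 <= q) (Hs : 1 <= s) (Hqs : 4 * q ^ 3 <= s ^ 2) (Hz : 1 <= z) (Hzq : z ^ 2 <= q) (HAq : 1 <= Aq)
  (HsA : s <= Aq ^ 2 * q ^ 6) (Hell : ell = 1 + ln (s ^ 2 * q ^ 6)) (HLam : Rpower (36 * q ^ 8) th = Lam).

Let M := s ^ 2 * q ^ 6.
Definition local_bound : R :=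
  (2 * 10 ^ 9 * (v0 + 1) ^ 3 * C0 + 10 ^ 8 * (B + C0) * (v0 + 1) * Aq) * ell ^ 2 * (z ^ 2 / q + Lam / (q * z)).

Lemma wave_local x1 x2 : 0 <= x1 -> x1 <= x2 -> x2 <= 1 -> x2 - x1 <= / s ^ 2 ->
  s ^ 2 * Cmod (CInt (wave psi v0 M) x1 x2) <= local_bound.
Proof.
  intros H0 H01 H1 Hlen. pose proof (tame_pos _ _ Hp) as HC. assert (Hy1 : 0 < z ^ 2 / q) by pos.
  assert (HL : 0 < Lam) by (rewrite <- HLam; apply exp_pos). assert (Hy2 : 0 < Lam / (q * z)) by pos.
  assert (Hiq : / q <= z ^ 2 / q).
  { rewrite <- (Rmult_1_l (/ q)). mul_r; nra. }
  assert (Hell2 : 0 <= ell ^ 2) by apply pow2_ge_0. assert (Hv3 : 0 < (v0 + 1) ^ 3) by pos.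
  set (c1 := 2 * 10 ^ 9 * (v0 + 1) ^ 3 * C0) in *. set (c2 := 10 ^ 8 * (B + C0) * (v0 + 1) * Aq).
  assert (Hc1 : 0 <= c1) by (unfold c1; apply Rmult_le_pos; lra).
  assert (Hc2 : 0 <= c2) by (unfold c2; apply Rmult_le_pos; [|lra]; apply Rmult_le_pos; lra).
  unfold local_bound. fold c1 c2. set (y1 := z ^ 2 / q) in *. set (y2 := Lam / (q * z)) in *.
  destruct (classic (badly_approx x1 (s ^ 2) (/ (q ^ 2 * z ^ 2)) (4 * q / s) (2 * (q * s)))) as [Hbad|Hgood].
  - pose proof (bad_total psi C0 v0 q s z x1 x2 ell Hp Hv0 Hq Hs Hqs Hz ltac:(nra) H0 H01 H1 Hlen Hell Hbad) as HT.
   fold M y1 in HT. via HT. fold c1. apply Rmult_le_compat; [pos|lra| |lra]. apply Rmult_le_compat_r; lra.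
  - assert (Htau : 0 < / (q ^ 2 * z ^ 2)) by pos.
   destruct (well_approx _ _ _ _ _ Htau Hgood) as [H [K [a [b (K1 & K2 & K3 & K4 & K5)]]]].
   pose proof (direct_total psi C0 kappa t p B' B th v0 q s z x1 x2 ell Aq Lam H K a b Hp Hf Hc HB Hth Ht Hv0 Hq Hs Hz Hzq
    HAq HsA H01 Hlen Hell HLam K1 K2 K3 K4 ltac:(lra)) as HT.
   fold M y2 in HT. via HT.
   replace (10 ^ 8 * (B + C0) * (v0 + 1) * ell ^ 2 * Aq * (y2 + / q)) with (c2 * ell ^ 2 * (y2 + / q)) by (unfold c2; ring).
   assert (0 < / q) by pos. apply Rmult_le_compat; [pos|lra| |lra]. apply Rmult_le_compat_r; lra.
Qed.

End Local.

(** On an interval of length 1/(32 Delta) the phase (n - M) x stays below 1/16 for M <= n <= M + 2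
    Delta, so that the frequencies of the short sum do not cancel. *)
Definition short_average (psi : C -> C) (v0 M Delta alpha : R) : C :=
  (RtoC Delta * CInt (fun x => e (- M * x) * Psi psi v0 M (alpha + x))%C 0 (/ (32 * Delta)))%C.

Lemma short_average_wave psi C0 v0 M Delta alpha : tame_form psi C0 -> 0 < v0 -> 0 < M -> 0 < Delta ->
  Cmod (short_average psi v0 M Delta alpha) =
   Delta * Cmod (CInt (wave psi v0 M) alpha (alpha + / (32 * Delta))).
Proof.
  intros Hp Hv HM HD. assert (Hf : forall x, ccont (wave psi v0 M) x) by (intros; now apply (wave_cont psi C0)).
  assert (Hi : 0 < / (32 * Delta)) by pos. unfold short_average. rewrite Cmod_mult, Cmod_R, Rabs_pos_eq by lra. f_equal.
  rewrite <- (CInt_shift (wave psi v0 M) alpha) by (easy || lra).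
  replace (alpha - alpha) with 0 by ring. replace (alpha + / (32 * Delta) - alpha) with (/ (32 * Delta)) by ring.
  rewrite <- (Rmult_1_l (Cmod (CInt (fun p => wave psi v0 M (alpha + p)) _ _))), <- (Cmod_e (M * alpha)), <- Cmod_mult. f_equal.
  apply is_CInt_unique. eapply is_CInt_ext; [lra| |apply is_CInt_scal, exC_cont; [lra|]].
  - intros x _. unfold wave. rewrite Cmult_assoc, <- e_plus. f_equal. f_equal. ring.
  - intros x _. apply (ccont_comp (wave psi v0 M) (fun p => alpha + p)); [apply Hf|].
   apply continuous_Rplus; [apply continuous_const|apply continuous_id].
Qed.

Lemma short_average_trivial psi C0 v0 M Delta alpha : tame_form psi C0 -> 0 < v0 -> 0 < M -> 0 < Delta ->
  Cmod (short_average psi v0 M Delta alpha) <= C0.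
Proof.
  intros Hp Hv HM HD. rewrite (short_average_wave psi C0) by easy. pose proof (tame_pos _ _ Hp).
  assert (Hi : 0 < / (32 * Delta)) by pos. apply Rle_trans with (Delta * (C0 * (alpha + / (32 * Delta) - alpha))).
  - mul_l. apply CInt_norm_const; [lra|intros; now apply wave_bound|].
   apply exC_cont; [lra|]. intros; now apply (wave_cont psi C0).
  - replace (Delta * (C0 * (alpha + / (32 * Delta) - alpha))) with (C0 / 32) by (field; lra). lra.
Qed.

(** * From averages to short sums *)

Lemma csum_swap {A B} (f : A -> B -> C) (l : list A) (m : list B) :
  csum (fun a => csum (f a) m) l = csum (fun b => csum (fun a => f a b) l) m.
Proof.
  induction l as [|a l IH]; simpl.
  - induction m as [|b m IHm]; simpl; [easy|]. rewrite <- IHm. ring.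
  - rewrite IH, <- csum_plus. easy.
Qed.

Lemma csum_seq_shift (f : nat -> C) a N : csum f (seq a N) = csum (fun i => f (a + i)%nat) (seq 0 N).
Proof.
  induction N as [|N IH]; [easy|]. rewrite csum_seq_S, seq_S, csum_app, IH. simpl. ring.
Qed.

Lemma csum_zero {A} (f : A -> C) l : (forall x, In x l -> f x = RtoC 0) -> csum f l = RtoC 0.
Proof.
  induction l as [|x l IH]; intros H; [easy|]. simpl. rewrite H, IH; [ring|intros; apply H; now right|now left].
Qed.

Lemma csum_single (f : nat -> C) l i : NoDup l -> In i l -> (forall n, In n l -> n <> i -> f n = RtoC 0) -> csum f l = f i.
Proof.
  induction l as [|n l IH]; intros HND Hi Hf; [easy|]. inversion HND as [|? ? N1 N2]; subst. simpl. destruct Hi as [->|Hi].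
  - rewrite csum_zero; [ring|]. intros m Hm. apply Hf; [now right|]. now intros ->.
  - rewrite IH; try easy.
   + rewrite Hf; [ring|now left|]. now intros ->.
   + intros m Hm Hne. apply Hf; [now right|easy].
Qed.

(** u - u^3/6 >= u/3 up to u = 2, which covers [0, pi/2]; the slope 1/3 suffices in [one_minus_e]
    because pi >= 3. *)
Lemma sin_lower u : 0 <= u <= 2 -> u / 3 <= sin u.
Proof.
  intros Hu. destruct (pre_sin_bound u 0 ltac:(lra) ltac:(lra)) as [H _]. unfold sin_approx, sin_term in H. simpl in H. nra.
Qed.

Lemma one_minus_e x : 0 <= x <= 1 -> 2 * Rmin x (1 - x) <= Cmod (RtoC 1 - e x)%C.
Proof.
  assert (P : forall x, 0 <= x <= / 2 -> 2 * x <= Cmod (RtoC 1 - e x)%C).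
  { clear x. intros x Hx. pose proof PI2_3_2 as HP. pose proof PI_4 as HP4. unfold PI2 in HP.
   assert (Hs : PI * x / 3 <= sin (PI * x)) by (apply sin_lower; split; nra).
   assert (E : Cmod (RtoC 1 - e x)%C ^ 2 = (2 * sin (PI * x)) ^ 2).
   { rewrite Cmod2_alt. unfold e, Re, Im; simpl. replace (2 * PI * x) with (2 * (PI * x)) by ring.
    rewrite cos_2a_sin, sin_2a. pose proof (sin2_cos2 (PI * x)) as Hsc. unfold Rsqr in Hsc.
    set (S := sin (PI * x)) in *. set (Cc := cos (PI * x)) in *.
    replace ((1 + - (1 - 2 * S * S)) * ((1 + - (1 - 2 * S * S)) * 1) + (0 + - (2 * S * Cc)) * ((0 + - (2 * S * Cc)) * 1))
     with (4 * S ^ 2 * (S * S + Cc * Cc)) by ring. rewrite Hsc. ring. }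
   apply Rle_trans with (2 * sin (PI * x)); [nra|]. apply Rsqr_incr_0_var; [|pos]. unfold Rsqr. nra. }
  intros Hx. destruct (Rle_dec x (/ 2)) as [h|h].
  - rewrite Rmin_left by lra. apply P; lra.
  - rewrite Rmin_right by lra. eapply Rle_trans; [apply P; lra|]. right. replace (e (1 - x)) with (Cconj (e x)).
   + rewrite <- (Cmod_conj (RtoC 1 - e x)%C). f_equal. apply injective_projections; simpl; ring.
   + unfold Rminus. rewrite e_plus, e_opp, (e_IZR 1). ring.
Qed.

Lemma geometric x N : ((RtoC 1 - e x) * csum (fun j => e (INR j * x)) (seq 0 N) = RtoC 1 - e (INR N * x))%C.
Proof.
  induction N as [|N IH].
  - simpl. rewrite Rmult_0_l, e_0. ring.
  - rewrite csum_seq_S, Cmult_plus_distr_l, IH, S_INR, Rmult_plus_distr_r, Rmult_1_l, e_plus. ring.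
Qed.

Lemma geometric_bound x N : 0 < x < 1 -> Cmod (csum (fun j => e (INR j * x)) (seq 0 N)) <= / Rmin x (1 - x).
Proof.
  intros Hx. pose proof (one_minus_e x ltac:(lra)) as H. assert (Hm : 0 < Rmin x (1 - x)) by (apply Rmin_pos; lra).
  pose proof (geometric x N) as HG. apply (f_equal Cmod) in HG. rewrite Cmod_mult in HG.
  assert (H2 : Cmod (RtoC 1 - e (INR N * x))%C <= 2).
  { via Cmod_triangle. rewrite Cmod_opp, Cmod_e, Cmod_R, Rabs_R1. lra. }
  set (X := Cmod (csum _ _)) in *. assert (HX : 0 <= X) by apply Cmod_ge_0.
  apply Rmult_le_reg_l with (2 * Rmin x (1 - x)); [lra|]. replace (2 * Rmin x (1 - x) * / Rmin x (1 - x)) with 2 by (field; lra).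
  eapply Rle_trans; [|exact H2]. rewrite <- HG. now apply Rmult_le_compat_r.
Qed.

Lemma roots_of_unity (r : Z) (m : nat) : (Z.abs r < Z.of_nat m)%Z ->
  csum (fun j => e (IZR r * (INR j / INR m))) (seq 0 m) = if Z.eq_dec r 0 then RtoC (INR m) else RtoC 0.
Proof.
  intros Hr. assert (Hm : 0 < INR m) by pos. destruct (Z.eq_dec r 0) as [->|Hne].
  - rewrite (csum_ext _ (fun _ => RtoC 1)) by (intros; rewrite Rmult_0_l; apply e_0). clear.
   induction m as [|m IH]; [easy|]. rewrite csum_seq_S, IH, S_INR, RtoC_plus. easy.
  - set (x := IZR r / INR m). rewrite (csum_ext _ (fun j => e (INR j * x))) by (intros; f_equal; unfold x; field; lra).
   pose proof (geometric x m) as HG. replace (INR m * x) with (IZR r) in HG by (unfold x; field; lra). rewrite e_IZR in HG.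
   assert (Hx : 0 < Cmod (RtoC 1 - e x)%C).
   { assert (Hpos : forall y, 0 < y < 1 -> 0 < Cmod (RtoC 1 - e y)%C).
    { intros y Hy. eapply Rlt_le_trans; [|apply one_minus_e; lra]. assert (0 < Rmin y (1 - y)) by (apply Rmin_pos; lra). lra. }
    assert (Hab : Rabs (IZR r) < INR m) by (rewrite <- abs_IZR, INR_IZR_INZ; now apply IZR_lt). assert (Hx1 : Rabs x < 1).
    { unfold x. rewrite Rabs_div, (Rabs_pos_eq (INR m)) by lra. apply Rmult_lt_reg_r with (INR m); [easy|].
     unfold Rdiv. rewrite Rmult_assoc, Rinv_l by lra. lra. }
    assert (Hx0 : x <> 0) by (unfold x; apply Rmult_integral_contrapositive; split; [now apply not_0_IZR|apply Rinv_neq_0_compat; lra]).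
    apply Rabs_def2 in Hx1. destruct (Rlt_dec 0 x) as [h|h]; [apply Hpos; lra|].
    replace (RtoC 1 - e x)%C with (Cconj (RtoC 1 - e (- x))%C).
    + rewrite Cmod_conj. apply Hpos; lra.
    + rewrite e_opp. apply injective_projections; simpl; ring. }
   apply Cmod_gt_0 in Hx. set (S := csum _ _) in *.
   replace S with (/ (RtoC 1 - e x) * ((RtoC 1 - e x) * S))%C by (rewrite Cmult_assoc, Cinv_l by easy; apply Cmult_1_l).
   rewrite HG. ring.
Qed.

(** As m > 2 T, sampling at the points alpha + j/m separates all frequencies between -T and T, in
    particular the negative ones from those of the window. The factors [d] will be the reciprocals
    of the weights. *)
Lemma dft_extract (T m N a : nat) (cp cm d : nat -> C) alpha : (2 * T < m)%nat -> (1 <= a)%nat -> (a + N <= S T)%nat ->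
  csum (fun j => csum (fun n => cp n * e (INR n * (alpha + INR j / INR m)) + cm n * e (- INR n * (alpha + INR j / INR m))) (seq 1 T) *
   csum (fun i => d i * e (- INR i * (INR j / INR m))) (seq a N))%C (seq 0 m) =
  (RtoC (INR m) * csum (fun i => d i * (cp i * e (INR i * alpha))) (seq a N))%C.
Proof.
  intros Hm Ha HaN. set (Dl := fun (r : Z) => csum (fun j => e (IZR r * (INR j / INR m))) (seq 0 m)).
  transitivity (csum (fun i => csum (fun n => d i * (cp n * e (INR n * alpha)) * Dl (Z.of_nat n - Z.of_nat i)%Z +
   d i * (cm n * e (- INR n * alpha)) * Dl (- Z.of_nat n - Z.of_nat i)%Z)%C (seq 1 T)) (seq a N)).
  - rewrite (csum_ext _ (fun j => csum (fun i => csum (fun n =>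
    d i * (cp n * e (INR n * alpha)) * e (IZR (Z.of_nat n - Z.of_nat i) * (INR j / INR m)) +
    d i * (cm n * e (- INR n * alpha)) * e (IZR (- Z.of_nat n - Z.of_nat i) * (INR j / INR m)))%C (seq 1 T)) (seq a N))).
   + rewrite csum_swap. apply csum_ext. intros i _. rewrite csum_swap. apply csum_ext. intros n _.
    unfold Dl. now rewrite csum_plus, !csum_scal.
   + intros j _. rewrite <- csum_scal. apply csum_ext. intros i _. transitivity (d i * e (- INR i * (INR j / INR m)) *
     csum (fun n => cp n * e (INR n * (alpha + INR j / INR m)) + cm n * e (- INR n * (alpha + INR j / INR m)))%C (seq 1 T))%C; [ring|].
    rewrite <- csum_scal. apply csum_ext. intros n _. rewrite !minus_IZR, opp_IZR, <- !INR_IZR_INZ.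
    replace (INR n * (alpha + INR j / INR m)) with (INR n * alpha + INR n * (INR j / INR m)) by ring.
    replace (- INR n * (alpha + INR j / INR m)) with (- INR n * alpha + - INR n * (INR j / INR m)) by ring.
    replace ((INR n - INR i) * (INR j / INR m)) with (INR n * (INR j / INR m) + - INR i * (INR j / INR m)) by ring.
    replace ((- INR n - INR i) * (INR j / INR m)) with (- INR n * (INR j / INR m) + - INR i * (INR j / INR m)) by ring.
    rewrite !e_plus. ring.
  - rewrite <- csum_scal. apply csum_ext. intros i Hi. apply in_seq in Hi. rewrite (csum_single _ (seq 1 T) i).
   + unfold Dl. rewrite !roots_of_unity by lia. destruct (Z.eq_dec (Z.of_nat i - Z.of_nat i) 0); [|lia].
    destruct (Z.eq_dec (- Z.of_nat i - Z.of_nat i) 0); [lia|]. ring.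
   + apply seq_NoDup.
   + apply in_seq; lia.
   + intros n Hn Hne. apply in_seq in Hn. unfold Dl. rewrite !roots_of_unity by lia.
    destruct (Z.eq_dec (Z.of_nat n - Z.of_nat i) 0); [lia|]. destruct (Z.eq_dec (- Z.of_nat n - Z.of_nat i) 0); [lia|]. ring.
Qed.

Lemma abel_sum (c u : nat -> C) N g : (forall n, (n <= N)%nat -> Cmod (csum u (seq 0 n)) <= g) ->
  Cmod (csum (fun i => c i * u i)%C (seq 0 N)) <= g * (Cmod (c N) + rsum (fun i => Cmod (c (S i) - c i)%C) (seq 0 N)).
Proof.
  intros Hg. set (Sm := fun n => csum u (seq 0 n)).
  assert (E : csum (fun i => c i * u i)%C (seq 0 N) = (c N * Sm N - csum (fun i => (c (S i) - c i) * Sm (S i))%C (seq 0 N))%C).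
  { clear Hg. induction N as [|N IH]; [unfold Sm; simpl; ring|]. rewrite !csum_seq_S, IH. unfold Sm. rewrite csum_seq_S. ring. }
  rewrite E. via Cmod_triangle. rewrite Cmod_opp, Cmod_mult, Rmult_plus_distr_l. apply Rplus_le_compat.
  - rewrite Rmult_comm. mul_r; now apply Hg.
  - rewrite <- rsum_scal. apply csum_norm. intros i Hi. apply in_seq in Hi.
   rewrite Cmod_mult, Rmult_comm. mul_r; (apply Hg; lia).
Qed.

(** Summation by parts reduces the kernel at j/m to geometric sums of size at most about m/min(j, m
    - j), so that its mean over j costs only a logarithm. *)
Lemma kernel_sum (d : nat -> C) a N m Kc : (1 <= m)%nat -> (N <= m)%nat ->
  Cmod (d (a + N)%nat) + rsum (fun i => Cmod (d (a + S i)%nat - d (a + i)%nat)%C) (seq 0 N) <= Kc ->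
  rsum (fun j => Cmod (csum (fun i => d i * e (- INR i * (INR j / INR m)))%C (seq a N))) (seq 0 m) <= 5 * Kc * INR m * harm (S m).
Proof.
  intros Hm HN HKc. assert (Hm0 : 1 <= INR m) by (apply (le_INR 1); lia). assert (HK : 0 <= Kc).
  { eapply Rle_trans; [|exact HKc]. apply Rplus_le_le_0_compat; [pos|]. apply rsum_nonneg. intros; apply Cmod_ge_0. }
  set (K := fun j => Cmod (csum (fun i => d i * e (- INR i * (INR j / INR m)))%C (seq a N))).
  assert (Hj : forall j g, 0 <= g -> (forall n, (n <= N)%nat -> Cmod (csum (fun i => e (- (INR i * (INR j / INR m)))) (seq 0 n)) <= g) ->
   K j <= Kc * g).
  { intros j g Hg0 Hg. unfold K. set (b := INR j / INR m) in *.
   rewrite csum_seq_shift, (csum_ext _ (fun i => e (- (INR a * b)) * (d (a + i)%nat * e (- (INR i * b))))%C).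
   - rewrite csum_scal, Cmod_mult, Cmod_e, Rmult_1_l. via (abel_sum (fun i => d (a + i)%nat) _ N g Hg).
    rewrite Rmult_comm. now apply Rmult_le_compat_r.
   - intros i _. replace (- INR (a + i) * b) with (- (INR a * b) + - (INR i * b)) by (rewrite plus_INR; ring). rewrite e_plus. ring. }
  assert (Hh : 1 <= harm (S m)).
  { apply Rle_trans with (harm 1); [unfold harm; simpl; lra|apply harm_mono; lia]. }
  assert (HKj : forall j, In j (seq 0 m) -> K j <= Kc * ((if Nat.eq_dec j 0 then INR m else 0) + INR m * (inv_dist 0 j + inv_dist m j))).
  { intros j Hjm. apply in_seq in Hjm. pose proof (inv_dist_nonneg 0 j). pose proof (inv_dist_nonneg m j).
   destruct (Nat.eq_dec j 0) as [->|Hne].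
   - apply Rle_trans with (Kc * INR m).
    + apply Hj; [lra|]. intros n Hn. eapply Rle_trans; [apply (csum_norm _ (fun _ => 1)); intros; rewrite Cmod_e; lra|].
     rewrite rsum_const, length_seq, Rmult_1_l. apply le_INR; lia.
    + mul_l. assert (0 <= INR m * (inv_dist 0 0 + inv_dist m 0)) by pos. lra.
   - assert (Hj0 : 0 < INR j) by pos. assert (Hj1 : INR j < INR m) by (apply lt_INR; lia).
    set (b := INR j / INR m). assert (Hb : 0 < b < 1).
    { unfold b. split; [pos|]. apply Rmult_lt_reg_r with (INR m); [lra|]. unfold Rdiv. rewrite Rmult_assoc, Rinv_l by lra. lra. }
    apply Rle_trans with (Kc * / Rmin b (1 - b)).
    + apply Hj; [left; apply Rinv_0_lt_compat, Rmin_pos; lra|]. intros n Hn. rewrite <- Cmod_conj, csum_conj.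
     rewrite (csum_ext _ (fun i => e (INR i * b))); [now apply geometric_bound|].
     intros i _. rewrite <- e_opp. f_equal. unfold b. ring.
    + mul_l. rewrite Rplus_0_l. assert (E1 : INR m * inv_dist 0 j = / b).
     { unfold inv_dist. destruct (Nat.eq_dec j 0); [lia|]. simpl (INR 0). rewrite Rminus_0_l, Rabs_Ropp, Rabs_pos_eq by lra. unfold b. field. lra. }
     assert (E2 : INR m * inv_dist m j = / (1 - b)).
     { unfold inv_dist. destruct (Nat.eq_dec j m); [lia|]. rewrite Rabs_pos_eq by lra. unfold b. field. lra. }
     rewrite Rmult_plus_distr_l, E1, E2. assert (0 < / b) by pos. assert (0 < / (1 - b)) by pos.
     unfold Rmin. destruct (Rle_dec _ _); lra. }
  eapply Rle_trans; [apply rsum_le; exact HKj|]. rewrite rsum_scal, rsum_plus, rsum_scal, rsum_plus.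
  assert (S0 : rsum (fun j => if Nat.eq_dec j 0 then INR m else 0) (seq 0 m) <= INR m).
  { apply (rsum_single (seq 0 m) 0%nat); [lra|apply seq_NoDup| |].
   - intros y _ Hy. destruct (Nat.eq_dec y 0); easy.
   - intros y. destruct (Nat.eq_dec y 0); lra. }
  assert (S1 : rsum (inv_dist 0) (seq 0 m) <= 2 * harm (S m)).
  { eapply Rle_trans; [apply (sum_inv_dist m 0); lia|]. mul_l; (apply harm_mono; lia). }
  assert (S2 : rsum (inv_dist m) (seq 0 m) <= 2 * harm (S m)).
  { eapply Rle_trans; [|apply (sum_inv_dist (S m) m); lia]. rewrite seq_S, rsum_app.
   assert (0 <= rsum (fun i => if Nat.eq_dec i m then 0 else / Rabs (INR m - INR i)) [(0 + m)%nat]).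
   { apply rsum_nonneg. intros y _. apply (inv_dist_nonneg m y). }
   unfold inv_dist at 1. lra. }
  replace (5 * Kc * INR m * harm (S m)) with (Kc * (INR m * harm (S m) + INR m * (2 * harm (S m) + 2 * harm (S m)))) by ring.
  mul_l. apply Rplus_le_compat.
  - via S0. nra.
  - apply Rmult_le_compat_l; lra.
Qed.

(** * The averages as trigonometric polynomials in alpha *)

Definition bump_kernel (kappa v0 M : R) (n : nat) (v : R) : R :=
  bump v0 v * (sqrt (v / M) * K_imag kappa (2 * PI * INR n * (v / M))).

Definition bump_transform (kappa v0 M : R) (n : nat) : C :=
  CInt (fun v => RtoC (bump_kernel kappa v0 M n v)) v0 (v0 + 1).

Definition time_window (M Delta r : R) : C :=
  (RtoC Delta * CInt (fun x => e ((r - M) * x)) 0 (/ (32 * Delta)))%C.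

Section Expansion.

Variables (psi : C -> C) (C0 kappa : R) (t : Z -> C) (p : nat) (B' v0 M Delta : R).
Hypotheses (Hp : tame_form psi C0) (Hf : fourier_expansion kappa psi t) (Hc : coef_bd t p B')
  (Hv0 : 1 <= v0) (HM : 1 <= M) (HD : 1 <= Delta).

Lemma bump_kernel_cont n v : (1 <= n)%nat -> 0 < v -> continuous (bump_kernel kappa v0 M n) v.
Proof.
  intros Hn Hv. assert (Hn1 : 0 < INR n) by pos. pose proof PI_RGT_0. assert (Hy : 0 < v / M) by pos.
  assert (Hlin : continuous (fun v => v / M) v) by (cont).
  apply continuous_Rmult; [apply bump_cont|]. apply continuous_Rmult.
  - apply (continuous_comp (fun v => v / M) sqrt); [easy|]. apply continuity_pt_filterlim, continuity_pt_sqrt. lra.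
  - apply (continuous_comp (fun v => 2 * PI * INR n * (v / M)) (K_imag kappa)).
   + cont.
   + apply K_imag_cont. apply Rmult_lt_0_compat; [nra|easy].
Qed.

Lemma bump_kernel_exC n : (1 <= n)%nat -> exC (fun v => RtoC (bump_kernel kappa v0 M n v)) v0 (v0 + 1).
Proof. intros Hn. apply exC_cont; [lra|]. intros v Hv. apply ccont_RtoC, bump_kernel_cont; [easy|lra]. Qed.

Definition tail_bound : R := sqrt (v0 + 1) * (4 * B' * INR (fact (p + 2)) * M ^ (p + 2)).

Lemma tail_bound_nonneg : 0 <= tail_bound.
Proof.
  destruct Hc as [HB _]. unfold tail_bound. pose proof (INR_fact_lt_0 (p + 2)). assert (0 < M ^ (p + 2)) by pos.
  apply Rmult_le_pos; [pos|]. apply Rmult_le_pos; [|lra]. apply Rmult_le_pos; lra.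
Qed.

(** Integration over v turns the Bessel factor into [bump_transform], which depends on n alone. The
    heights are at least 1/M, whence the power of M in the tail. *)
Lemma Psi_expand x T : (1 <= T)%nat ->
  Cmod (Psi psi v0 M x - csum (fun n => bump_transform kappa v0 M n *
   (t (Z.of_nat n) * e (INR n * x) + t (- Z.of_nat n)%Z * e (- INR n * x)))%C (seq 1 T))%C <= tail_bound / INR T.
Proof.
  intros HT. set (cf := fun n => (t (Z.of_nat n) * e (INR n * x) + t (- Z.of_nat n)%Z * e (- INR n * x))%C).
  replace (tail_bound / INR T) with (tail_bound / INR T * (v0 + 1 - v0)) by ring.
  apply (is_CInt_norm_const (fun v => RtoC (bump v0 v) * psi (x, v / M)%R - RtoC (bump v0 v) * psiT kappa t T x (v / M))%C v0 (v0 + 1)); [lra| |].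
  - intros v Hv. rewrite Cmult_minus. assert (Hy : 0 < v / M) by pos.
   pose proof (bump_range v0 v) as Hb. rewrite Cmod_mult, Cmod_R, Rabs_pos_eq by lra.
   pose proof (psiT_tail kappa psi t p B' x (v / M) T Hf Hc Hy HT) as HPT.
   match goal with |- _ * ?m <= _ => apply Rle_trans with (1 * m); [mul_r; lra|] end. rewrite Rmult_1_l. via HPT. mul_r.
   destruct Hc as [HB _]. assert (Hvm : v / M <= v0 + 1) by (apply Rcomplements.Rle_div_l; [lra|]; nra).
   unfold tail_bound. apply Rmult_le_compat; [pos| |now apply sqrt_le_1_alt|].
   + pos.
   + unfold Rdiv at 1. mul_l. rewrite <- pow_inv. apply pow_incr. split; [pos|].
    replace (/ (v / M)) with (M * / v) by (field; lra). rewrite <- (Rmult_1_r M) at 2. mul_l.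
    rewrite <- Rinv_1. apply Rinv_le_contravar; lra.
  - apply is_CInt_minus; [apply (Psi_int psi C0); easy || lra|].
   rewrite (csum_ext _ (fun n => cf n * bump_transform kappa v0 M n)%C) by (intros; unfold cf; ring).
   apply is_CInt_ext with (f := fun v => csum (fun n => cf n * RtoC (bump_kernel kappa v0 M n v))%C (seq 1 T)); [lra| |].
   + intros v Hv. unfold psiT. rewrite <- !csum_scal. apply csum_ext. intros n _. destruct (abs_IZR_nat n) as [E1 E2].
    unfold fourier_term, bump_kernel, cf. rewrite E1, E2, opp_IZR, <- INR_IZR_INZ, !RtoC_mult. ring.
   + apply (is_CInt_csum (fun n v => cf n * RtoC (bump_kernel kappa v0 M n v))%C (fun n => cf n * bump_transform kappa v0 M n)%C). intros n Hn. apply in_seq in Hn.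
    apply is_CInt_scal, bump_kernel_exC. lia.
Qed.

Lemma window_exC r : exC (fun x => e ((r - M) * x)) 0 (/ (32 * Delta)).
Proof.
  assert (Hi : 0 < / (32 * Delta)) by pos. apply exC_cont; [lra|]. intros x _. apply (ccont_e (fun x => (r - M) * x)). cont.
Qed.

Lemma short_average_expand alpha T : (1 <= T)%nat ->
  Cmod (short_average psi v0 M Delta alpha - csum (fun n =>
   (t (Z.of_nat n) * (bump_transform kappa v0 M n * time_window M Delta (INR n))) * e (INR n * alpha) +
   (t (- Z.of_nat n)%Z * (bump_transform kappa v0 M n * time_window M Delta (- INR n))) * e (- INR n * alpha))%C (seq 1 T))%C <= tail_bound / INR T.
Proof.
  intros HT. assert (HT1 : 1 <= INR T) by (apply (le_INR 1); lia). pose proof tail_bound_nonneg as Htb.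
  assert (Hi : 0 < / (32 * Delta)) by pos. set (g := fun x => csum (fun n => bump_transform kappa v0 M n *
   (t (Z.of_nat n) * e (INR n * x) + t (- Z.of_nat n)%Z * e (- INR n * x)))%C (seq 1 T)).
  set (I := csum (fun n => t (Z.of_nat n) * bump_transform kappa v0 M n * e (INR n * alpha) * CInt (fun x => e ((INR n - M) * x)) 0 (/ (32 * Delta)) +
   t (- Z.of_nat n)%Z * bump_transform kappa v0 M n * e (- INR n * alpha) * CInt (fun x => e ((- INR n - M)%R * x)) 0 (/ (32 * Delta)))%C (seq 1 T)).
  assert (HI : is_CInt (fun x => e (- M * x) * g (alpha + x)%R)%C 0 (/ (32 * Delta)) I).
  { eapply is_CInt_ext; [lra| |apply (is_CInt_csum (fun n x => t (Z.of_nat n) * bump_transform kappa v0 M n * e (INR n * alpha) * e ((INR n - M) * x) +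
    t (- Z.of_nat n)%Z * bump_transform kappa v0 M n * e (- INR n * alpha) * e ((- INR n - M)%R * x))%C)].
   - intros x _. cbv beta. unfold g. rewrite <- csum_scal. apply csum_ext. intros n _.
    replace ((INR n - M) * x) with (INR n * x + - M * x) by ring. replace ((- INR n - M) * x) with (- INR n * x + - M * x) by ring.
    replace (INR n * (alpha + x)) with (INR n * alpha + INR n * x) by ring. replace (- INR n * (alpha + x)) with (- INR n * alpha + - INR n * x) by ring.
    rewrite !e_plus. ring.
   - intros n _. apply is_CInt_plus; apply is_CInt_scal, window_exC. }
  match goal with |- Cmod (_ - ?S)%C <= _ => replace S with (RtoC Delta * I)%C end.
  2:{ unfold I. rewrite <- csum_scal. apply csum_ext. intros n _. unfold time_window. ring. }
  unfold short_average. rewrite Cmult_minus. rewrite Cmod_mult, Cmod_R, Rabs_pos_eq by lra.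
  assert (HE : 0 <= tail_bound / INR T) by pos. apply Rle_trans with (Delta * (tail_bound / INR T * (/ (32 * Delta) - 0))).
  - mul_l.
   apply (is_CInt_norm_const (fun x => e (- M * x) * Psi psi v0 M (alpha + x)%R - e (- M * x) * g (alpha + x)%R)%C 0 (/ (32 * Delta))); [lra| |].
   + intros x _. rewrite Cmult_minus. rewrite Cmod_mult, Cmod_e, Rmult_1_l. now apply Psi_expand.
   + apply is_CInt_minus; [|exact HI]. apply exC_cont; [lra|]. intros x _. apply ccont_mult.
    * apply (ccont_e (fun x => - M * x)). cont.
    * apply (ccont_comp (Psi psi v0 M) (fun x => alpha + x)); [apply (Psi_cont psi C0); easy || lra|].
     apply continuous_Rplus; [apply continuous_const|apply continuous_id].
  - replace (Delta * (tail_bound / INR T * (/ (32 * Delta) - 0))) with (tail_bound / INR T / 32) by (field; lra). lra.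
Qed.

Lemma window_bound r : Cmod (time_window M Delta r) <= / 32.
Proof.
  assert (Hi : 0 < / (32 * Delta)) by pos. unfold time_window. rewrite Cmod_mult, Cmod_R, Rabs_pos_eq by lra.
  apply Rle_trans with (Delta * (1 * (/ (32 * Delta) - 0))); [|right; field; lra].
  mul_l. apply CInt_norm_const; [lra|intros; rewrite Cmod_e; lra|apply window_exC].
Qed.

Lemma window_diff r r' : Cmod (time_window M Delta r - time_window M Delta r')%C <= Rabs (r - r') / (100 * Delta).
Proof.
  assert (Hi : 0 < / (32 * Delta)) by pos. unfold time_window. rewrite Cmult_minus.
  rewrite Cmod_mult, Cmod_R, Rabs_pos_eq by lra. set (dr := Rabs (r - r')). assert (Hdr : 0 <= dr) by apply Rabs_pos.
  pose proof PI_4. pose proof PI_RGT_0. apply Rle_trans with (Delta * (8 * dr * / (32 * Delta) * (/ (32 * Delta) - 0))).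
  - mul_l.
   apply (is_CInt_norm_const (fun x => e ((r - M) * x) - e ((r' - M) * x))%C 0 (/ (32 * Delta))); [lra| |apply is_CInt_minus; apply window_exC].
   intros x Hx. via e_lip. replace ((r - M) * x - (r' - M) * x) with ((r - r') * x) by ring.
   rewrite Rabs_mult, (Rabs_pos_eq x) by lra. fold dr. replace (8 * dr * / (32 * Delta)) with (8 * (dr * / (32 * Delta))) by ring.
   apply Rmult_le_compat; [lra|pos|lra|]. apply Rmult_le_compat_l; lra.
  - replace (Delta * (8 * dr * / (32 * Delta) * (/ (32 * Delta) - 0))) with (dr * / Delta * (8 / 1024)) by (field; lra).
   replace (dr / (100 * Delta)) with (dr * / Delta * (1 / 100)) by (field; lra).
   apply Rmult_le_compat_l; [|lra]. apply Rmult_le_pos; [easy|pos].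
Qed.

(** At r = M the value is 1/32, and by [window_diff] it changes by at most 2/100 on the range. *)
Lemma window_lower r : M <= r <= M + 2 * Delta -> / 100 <= Cmod (time_window M Delta r).
Proof.
  intros Hr. pose proof (window_diff M r) as HD1. assert (E : time_window M Delta M = RtoC (/ 32)).
  { unfold time_window. rewrite (is_CInt_unique _ 0 (/ (32 * Delta)) (RtoC (/ (32 * Delta) - 0) * RtoC 1)%C).
   - rewrite <- !RtoC_mult. f_equal. field. lra.
   - eapply is_CInt_ext; [pos| |apply is_CInt_const]. intros x _. rewrite Rminus_diag, Rmult_0_l, e_0. reflexivity. }
  rewrite Rabs_left1 in HD1 by lra. assert (HD2 : - (M - r) / (100 * Delta) <= 2 / 100).
  { apply Rcomplements.Rle_div_l; [lra|]. lra. }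
  assert (H32 : / 32 <= Cmod (time_window M Delta M - time_window M Delta r)%C + Cmod (time_window M Delta r)).
  { eapply Rle_trans; [|apply Cmod_triangle]. right.
   replace (time_window M Delta M - time_window M Delta r + time_window M Delta r)%C with (time_window M Delta M) by ring.
   rewrite E, Cmod_R, Rabs_pos_eq; lra. }
  lra.
Qed.

Lemma transform_bound n : M <= INR n -> Cmod (bump_transform kappa v0 M n) <= 2 * sqrt (v0 + 1) / sqrt M.
Proof.
  intros Hn. assert (Hn1 : (1 <= n)%nat) by (apply INR_le; simpl; lra). pose proof PI2_3_2 as HP. unfold PI2 in HP.
  assert (HsM : 0 < sqrt M) by pos.
  replace (2 * sqrt (v0 + 1) / sqrt M) with (2 * sqrt (v0 + 1) / sqrt M * (v0 + 1 - v0)) by ring.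
  apply CInt_norm_const; [lra| |now apply bump_kernel_exC]. intros v Hv.
  rewrite Cmod_R. unfold bump_kernel. pose proof (bump_range v0 v) as Hb. pose proof (sqrt_pos (v / M)).
  rewrite !Rabs_mult, (Rabs_pos_eq (bump v0 v)), (Rabs_pos_eq (sqrt (v / M))) by lra. assert (Hy : 0 < v / M) by pos.
  assert (Harg : 1 <= INR n * (v / M)).
  { replace (INR n * (v / M)) with (v * (INR n / M)) by (field; lra).
   assert (1 <= INR n / M) by (apply Rmult_le_reg_r with M; [lra|]; unfold Rdiv; rewrite Rmult_assoc, Rinv_l by lra; lra). nra. }
  assert (HK : Rabs (K_imag kappa (2 * PI * INR n * (v / M))) <= 2).
  { eapply Rle_trans; [apply (K_term_bound kappa n (v / M) 1 Hn1 Hy); lia|]. simpl.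
   apply Rmult_le_reg_r with (INR n * (v / M)); [lra|]. unfold Rdiv at 1. rewrite Rmult_1_r, Rmult_1_r, Rmult_assoc, Rinv_l by lra. lra. }
  assert (Hs : sqrt (v / M) <= sqrt (v0 + 1) / sqrt M).
  { rewrite sqrt_div_alt by lra. mul_r. apply sqrt_le_1_alt; lra. }
  assert (Hsk : sqrt (v / M) * Rabs (K_imag kappa (2 * PI * INR n * (v / M))) <= sqrt (v0 + 1) / sqrt M * 2).
  { nra. }
  assert (0 <= sqrt (v / M) * Rabs (K_imag kappa (2 * PI * INR n * (v / M)))) by pos.
  replace (2 * sqrt (v0 + 1) / sqrt M) with (1 * (sqrt (v0 + 1) / sqrt M * 2)) by (field; lra). apply Rmult_le_compat; lra.
Qed.

Lemma transform_diff n : M <= INR n ->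
  Cmod (bump_transform kappa v0 M (S n) - bump_transform kappa v0 M n)%C <= 32 * (v0 + 1) * sqrt (v0 + 1) / (M * sqrt M).
Proof.
  intros Hn. assert (Hn1 : (1 <= n)%nat) by (apply INR_le; simpl; lra). pose proof PI2_3_2 as HP. unfold PI2 in HP. pose proof PI_4.
  assert (HsM : 0 < sqrt M) by pos.
  replace (32 * (v0 + 1) * sqrt (v0 + 1) / (M * sqrt M)) with (32 * (v0 + 1) * sqrt (v0 + 1) / (M * sqrt M) * (v0 + 1 - v0)) by ring.
  apply (is_CInt_norm_const (fun v => RtoC (bump_kernel kappa v0 M (S n) v) - RtoC (bump_kernel kappa v0 M n v))%C v0 (v0 + 1)); [lra| |].
  - intros v Hv. rewrite <- RtoC_minus, Cmod_R. unfold bump_kernel. pose proof (bump_range v0 v) as Hb. pose proof (sqrt_pos (v / M)).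
   rewrite <- !Rmult_minus_distr_l. rewrite !Rabs_mult, (Rabs_pos_eq (bump v0 v)), (Rabs_pos_eq (sqrt (v / M))) by lra.

   assert (Harg : 1 <= INR n * (v / M)).
   { replace (INR n * (v / M)) with (v * (INR n / M)) by (field; lra).
    assert (1 <= INR n / M) by (apply Rmult_le_reg_r with M; [lra|]; unfold Rdiv; rewrite Rmult_assoc, Rinv_l by lra; lra). nra. }
   set (X := 2 * PI * INR n * (v / M)). set (Z := 2 * PI * INR (S n) * (v / M)). assert (HX : 1 <= X) by (unfold X; nra).
   assert (HZX : Z - X = 2 * PI * (v / M)) by (unfold Z, X; rewrite S_INR; ring).
   assert (Hvm : v / M <= (v0 + 1) / M) by (mul_r; lra).
   assert (HK : Rabs (K_imag kappa Z - K_imag kappa X) <= 32 * ((v0 + 1) / M)).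
   { rewrite Rabs_minus_sym. eapply Rle_trans; [apply (K_imag_lip kappa X Z 1); try lia; nra|]. rewrite HZX.
    apply Rle_trans with (4 * (8 * ((v0 + 1) / M))); [|lra]. apply Rmult_le_compat; [|nra| |nra].
    - pos.
    - apply Rmult_le_reg_r with (X ^ 2); [pos|]. unfold Rdiv. rewrite Rmult_assoc, Rinv_l by nra. simpl. nra. }
   assert (Hs : sqrt (v / M) <= sqrt (v0 + 1) / sqrt M).
   { rewrite sqrt_div_alt by lra. mul_r. apply sqrt_le_1_alt; lra. }
   assert (Hsk : sqrt (v / M) * Rabs (K_imag kappa Z - K_imag kappa X) <= sqrt (v0 + 1) / sqrt M * (32 * ((v0 + 1) / M))).
   { apply Rmult_le_compat; auto using Rabs_pos. }
   assert (0 <= sqrt (v / M) * Rabs (K_imag kappa Z - K_imag kappa X)) by pos.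
   replace (32 * (v0 + 1) * sqrt (v0 + 1) / (M * sqrt M)) with (1 * (sqrt (v0 + 1) / sqrt M * (32 * ((v0 + 1) / M)))) by (field; lra).
   apply Rmult_le_compat; lra.
  - apply is_CInt_minus; apply bump_kernel_exC; lia.
Qed.

(** 1/12 is the 1/2 of [K_imag_lower] times the integral 1/6 of the bump. *)
Definition kernel_floor : R := exp (- (24 * (v0 + 1)) * cosh 1) / 12.

(** For these n the argument of K lies between v >= kappa^2 and 24 (v0 + 1), where K is bounded
    below by a positive constant. *)
Lemma transform_lower n : kappa ^ 2 <= v0 -> M <= INR n <= 3 * M -> kernel_floor / sqrt M <= Cmod (bump_transform kappa v0 M n).
Proof.
  intros Hkap Hn. assert (Hn1 : (1 <= n)%nat) by (apply INR_le; simpl; lra). pose proof PI2_3_2 as HP. unfold PI2 in HP. pose proof PI_4.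
  assert (HsM : 0 < sqrt M) by pos. set (c := / 2 * exp (- (24 * (v0 + 1)) * cosh 1) / sqrt M).

  eapply Rle_trans; [|apply re_le_Cmod]. eapply Rle_trans; [|apply Rle_abs]. destruct (bump_kernel_exC n Hn1) as [HI _].
  change (kernel_floor / sqrt M <= RInt (V := R_CompleteNormedModule) (bump_kernel kappa v0 M n) v0 (v0 + 1)).
  set (F := fun v : R => c * ((v - v0) ^ 2 / 2 - (v - v0) ^ 3 / 3)).
  assert (HF : is_RInt (V := R_NormedModule) (fun v => c * ((v - v0) * (v0 + 1 - v))) v0 (v0 + 1) (kernel_floor / sqrt M)).
  { replace (kernel_floor / sqrt M) with (minus (F (v0 + 1)) (F v0)).
   - apply (is_RInt_derive (V := R_CompleteNormedModule) F).
    + intros v _. unfold F. auto_derive; [easy|field].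
    + intros v _. apply (ex_derive_continuous (fun v => c * ((v - v0) * (v0 + 1 - v)))). auto_derive; easy.
   - unfold F, c, kernel_floor, minus, plus, opp; simpl. field. lra. }
  apply (is_RInt_le (fun v => c * ((v - v0) * (v0 + 1 - v))) (bump_kernel kappa v0 M n) v0 (v0 + 1)); [lra|exact HF|exact HI|].
  intros v Hv. unfold bump_kernel. rewrite bump_inside by lra.

  assert (Hnv : v <= INR n * (v / M)).
  { replace (INR n * (v / M)) with (v * (INR n / M)) by (field; lra).
   assert (1 <= INR n / M) by (apply Rmult_le_reg_r with M; [lra|]; unfold Rdiv; rewrite Rmult_assoc, Rinv_l by lra; lra). nra. }
  assert (Hnv2 : INR n * (v / M) <= 3 * (v0 + 1)).
  { replace (INR n * (v / M)) with (INR n / M * v) by (field; lra). apply Rmult_le_compat; try lra.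
   - pos.
   - apply Rcomplements.Rle_div_l; [lra|]; lra. }
  set (X := 2 * PI * INR n * (v / M)). assert (HX : v <= X <= 24 * (v0 + 1)) by (unfold X; split; nra).
  pose proof (K_imag_lower kappa X ltac:(lra) ltac:(lra)) as HK.
  assert (Hch : 0 < cosh 1) by (unfold cosh; pose proof (exp_pos 1); pose proof (exp_pos (- (1))); lra).
  assert (Hexp : exp (- (24 * (v0 + 1)) * cosh 1) <= exp (- X * cosh 1)) by (apply exp_mono; nra).
  assert (Hs : / sqrt M <= sqrt (v / M)).
  { rewrite sqrt_div_alt by lra. unfold Rdiv. rewrite <- (Rmult_1_l (/ sqrt M)) at 1.
   mul_r. rewrite <- sqrt_1. apply sqrt_le_1_alt; lra. }
  rewrite (Rmult_comm c). mul_l. unfold c, Rdiv. rewrite Rmult_comm. pose proof (exp_pos (- (24 * (v0 + 1)) * cosh 1)).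
  apply Rmult_le_compat; [pos|lra|easy|lra].
Qed.

End Expansion.

(** Multiplied by sqrt M, this bounds the size plus the total variation of the reciprocal weights
    over the window. *)
Definition inverse_variation (v0 : R) : R :=
  100 / kernel_floor v0 + 2 * 10 ^ 4 * sqrt (v0 + 1) * (v0 + 2) / kernel_floor v0 ^ 2.

Lemma kernel_floor_pos v0 : 0 < kernel_floor v0.
Proof. unfold kernel_floor. pose proof (exp_pos (- (24 * (v0 + 1)) * cosh 1)). lra. Qed.

(** * Division by the weights *)

Section Inversion.

Variables (psi : C -> C) (C0 kappa : R) (t : Z -> C) (p : nat) (B' v0 M Delta X : R).
Hypotheses (Hp : tame_form psi C0) (Hf : fourier_expansion kappa psi t) (Hc : coef_bd t p B')
  (Hv0 : 1 <= v0) (HM : 1 <= M) (HD : 1 <= Delta) (HDM : Delta <= M) (Hkap : kappa ^ 2 <= v0)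
  (HX : forall alpha, Cmod (short_average psi v0 M Delta alpha) <= X).

Let wt (n : nat) : C := (bump_transform kappa v0 M n * time_window M Delta (INR n))%C.
Let fl := kernel_floor v0.

Lemma weight_lower n : M <= INR n <= M + 2 * Delta -> fl / (100 * sqrt M) <= Cmod (wt n).
Proof.
  intros Hn. assert (HsM : 0 < sqrt M) by pos. pose proof (kernel_floor_pos v0) as Hfl. fold fl in Hfl.
  unfold wt. rewrite Cmod_mult. replace (fl / (100 * sqrt M)) with (fl / sqrt M * / 100) by (field; lra).
  apply Rmult_le_compat; [pos|lra| |].
  - apply transform_lower; try easy; lra.
  - apply window_lower; try easy; lra.
Qed.

Lemma weight_diff n : M <= INR n -> Cmod (wt (S n) - wt n)%C <= sqrt (v0 + 1) * (v0 + 2) / (sqrt M * Delta).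
Proof.
  intros Hn. assert (HsM : 0 < sqrt M) by pos. set (V := sqrt (v0 + 1)). assert (HV : 0 < V) by (apply sqrt_lt_R0; lra).
  unfold wt. set (u' := bump_transform kappa v0 M (S n)). set (u := bump_transform kappa v0 M n).
  set (w' := time_window M Delta (INR (S n))). set (w := time_window M Delta (INR n)).
  replace (u' * w' - u * w)%C with (u' * (w' - w) + (u' - u) * w)%C by ring. via Cmod_triangle. rewrite !Cmod_mult.
  assert (T1 : Cmod u' <= 2 * V / sqrt M) by (apply transform_bound; try easy; rewrite S_INR; lra).
  assert (T2 : Cmod (w' - w)%C <= / (100 * Delta)).
  { eapply Rle_trans; [apply window_diff; easy|]. rewrite S_INR. replace (INR n + 1 - INR n) with 1 by ring. rewrite Rabs_R1. right; unfold Rdiv; ring. }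
  assert (T3 : Cmod (u' - u)%C <= 32 * (v0 + 1) * V / (M * sqrt M)) by (now apply transform_diff).
  assert (T4 : Cmod w <= / 32) by (now apply window_bound).
  apply Rle_trans with (2 * V / sqrt M * / (100 * Delta) + 32 * (v0 + 1) * V / (M * sqrt M) * / 32).
  - apply Rplus_le_compat; apply Rmult_le_compat; auto using Cmod_ge_0.
  - replace (V * (v0 + 2) / (sqrt M * Delta)) with (V / sqrt M * / Delta + (v0 + 1) * (V / sqrt M * / Delta)) by (field; lra).
   assert (HVM : 0 < V / sqrt M) by now apply Rdiv_lt_0_compat. assert (H1 : 0 < V / sqrt M * / Delta) by pos.
   replace (2 * V / sqrt M * / (100 * Delta)) with (V / sqrt M * / Delta * (1 / 50)) by (field; lra).
   replace (32 * (v0 + 1) * V / (M * sqrt M) * / 32) with ((v0 + 1) * (V / sqrt M * / M)) by (field; lra).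
   apply Rplus_le_compat; [lra|]. mul_l. mul_l. apply Rinv_le_contravar; lra.
Qed.

(** A kernel with coefficients 1/[wt] picks the short sum out of the averages at alpha + j/m. Its
    mean size is governed by the variation of 1/[wt], which is O(sqrt M): the weights are at least
    of order 1/sqrt M and change by O(1/(sqrt M Delta)) in each of at most 2 Delta steps. *)
Lemma short_sum_average (a N T : nat) alpha : M <= INR a -> INR (a + N) <= M + 2 * Delta -> (a + N <= S T)%nat -> (1 <= T)%nat ->
  Cmod (csum (fun i => t (Z.of_nat i) * e (INR i * alpha))%C (seq a N)) <=
   (X + tail_bound p B' v0 M / INR T) * (5 * (inverse_variation v0 * sqrt M) * harm (2 * T + 2)).
Proof.
  intros Ha HaN HNT HT. assert (HsM : 0 < sqrt M) by pos. pose proof (kernel_floor_pos v0) as Hfl. fold fl in Hfl.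
  assert (Ha1 : (1 <= a)%nat) by (apply INR_le; simpl; lra). set (m := (2 * T + 1)%nat). set (d := fun i => (/ wt i)%C).
  set (V := sqrt (v0 + 1)). assert (HV : 0 < V) by (apply sqrt_lt_R0; lra).
  assert (HNr : INR N <= 2 * Delta) by (rewrite plus_INR in HaN; lra).
  assert (Hlow : forall i, (i <= N)%nat -> fl / (100 * sqrt M) <= Cmod (wt (a + i)%nat)).
  { intros i Hi. apply weight_lower. assert (INR (a + i) <= INR (a + N)) by (apply le_INR; lia).
   assert (INR a <= INR (a + i)) by (apply le_INR; lia). lra. }
  assert (Hc0 : 0 < fl / (100 * sqrt M)) by pos. assert (Hne : forall i, (i <= N)%nat -> wt (a + i)%nat <> RtoC 0).
  { intros i Hi. apply Cmod_gt_0. specialize (Hlow i Hi). lra. }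
  assert (Hinv : forall i, (i <= N)%nat -> Cmod (d (a + i)%nat) <= 100 * sqrt M / fl).
  { intros i Hi. unfold d. rewrite Cmod_inv by now apply Hne. replace (100 * sqrt M / fl) with (/ (fl / (100 * sqrt M))) by (field; lra).
   apply Rinv_le_contravar; [easy|now apply Hlow]. }
  assert (HKc : Cmod (d (a + N)%nat) + rsum (fun i => Cmod (d (a + S i)%nat - d (a + i)%nat)%C) (seq 0 N) <= inverse_variation v0 * sqrt M).
  { unfold inverse_variation. fold fl V.
   replace ((100 / fl + 2 * 10 ^ 4 * V * (v0 + 2) / fl ^ 2) * sqrt M) with (100 * sqrt M / fl + 10 ^ 4 * V * (v0 + 2) * sqrt M / (Delta * fl ^ 2) * (2 * Delta)) by (field; lra).
   apply Rplus_le_compat; [now apply Hinv|]. assert (Hcc : 0 <= 10 ^ 4 * V * (v0 + 2) * sqrt M / (Delta * fl ^ 2)).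
   { pos. }
   apply Rle_trans with (10 ^ 4 * V * (v0 + 2) * sqrt M / (Delta * fl ^ 2) * INR N); [|apply Rmult_le_compat_l; lra].
   replace (INR N) with (INR (length (seq 0 N))) by now rewrite length_seq. rewrite <- rsum_const. apply rsum_le. intros i Hi. apply in_seq in Hi.
   replace (a + S i)%nat with (S (a + i)) by lia.
   assert (Hn1 := Hne i ltac:(lia)). assert (Hn2 := Hne (S i) ltac:(lia)). replace (a + S i)%nat with (S (a + i)) in Hn2 by lia.
   unfold d. replace (/ wt (S (a + i)) - / wt (a + i)%nat)%C with (- ((wt (S (a + i)) - wt (a + i)%nat) * (/ wt (S (a + i)) * / wt (a + i)%nat)))%C.
   2:{ field. split; assumption. }
   rewrite Cmod_opp, !Cmod_mult.
   pose proof (Hinv i ltac:(lia)) as I1. pose proof (Hinv (S i) ltac:(lia)) as I2. replace (a + S i)%nat with (S (a + i)) in I2 by lia. unfold d in I1, I2.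
   assert (Hai : M <= INR (a + i)) by (assert (INR a <= INR (a + i)) by (apply le_INR; lia); lra).
   pose proof (weight_diff (a + i) Hai) as I3. fold V in I3.
   apply Rle_trans with (V * (v0 + 2) / (sqrt M * Delta) * (100 * sqrt M / fl * (100 * sqrt M / fl))).
   - apply Rmult_le_compat; auto using Cmod_ge_0.
    + pos.
    + apply Rmult_le_compat; auto using Cmod_ge_0.
   - right. field. lra. }
  assert (Hm1 : 0 < INR m) by pos. pose proof (dft_extract T m N a (fun n => t (Z.of_nat n) * wt n)%C
   (fun n => t (- Z.of_nat n)%Z * (bump_transform kappa v0 M n * time_window M Delta (- INR n)))%C d alpha ltac:(lia) Ha1 HNT) as HX1.
  set (Sm := csum (fun i => t (Z.of_nat i) * e (INR i * alpha))%C (seq a N)).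
  rewrite (csum_ext (fun i => d i * (t (Z.of_nat i) * wt i * e (INR i * alpha)))%C (fun i => t (Z.of_nat i) * e (INR i * alpha))%C) in HX1.
  2:{ intros i Hi. apply in_seq in Hi. assert (Hn := Hne (i - a)%nat ltac:(lia)). replace (a + (i - a))%nat with i in Hn by lia.
    unfold d. field. exact Hn. }
  fold Sm in HX1.
  assert (HB : INR m * Cmod Sm <= INR m * ((X + tail_bound p B' v0 M / INR T) * (5 * (inverse_variation v0 * sqrt M) * harm (S m)))).
  { replace (INR m * Cmod Sm) with (Cmod (RtoC (INR m) * Sm)%C) by (rewrite Cmod_mult, Cmod_R, Rabs_pos_eq; lra).
   rewrite <- HX1. eapply Rle_trans.
   - apply (csum_norm _ (fun j => (X + tail_bound p B' v0 M / INR T) * Cmod (csum (fun i => d i * e (- INR i * (INR j / INR m)))%C (seq a N)))).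
    intros j _. rewrite Cmod_mult. mul_r.
    pose proof (short_average_expand psi C0 kappa t p B' v0 M Delta Hp Hf Hc Hv0 HM HD (alpha + INR j / INR m) T HT) as HE.
    specialize (HX (alpha + INR j / INR m)). match goal with |- Cmod ?y <= _ => set (Y := y) end.
    match type of HE with Cmod (?z - _)%C <= _ => set (Z := z) in * end.
    change (Cmod (Z - Y)%C <= tail_bound p B' v0 M / INR T) in HE.
    replace Y with (Z - (Z - Y))%C by ring. via Cmod_triangle. rewrite Cmod_opp. lra.
   - rewrite rsum_scal. replace (INR m * ((X + tail_bound p B' v0 M / INR T) * (5 * (inverse_variation v0 * sqrt M) * harm (S m)))) with
     ((X + tail_bound p B' v0 M / INR T) * (5 * (inverse_variation v0 * sqrt M) * INR m * harm (S m))) by ring.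
    apply Rmult_le_compat_l.
    + assert (0 <= X) by (eapply Rle_trans; [apply Cmod_ge_0|apply (HX 0)]).
     assert (0 <= tail_bound p B' v0 M / INR T); [|lra]. apply Rmult_le_pos; [now apply (tail_bound_nonneg t)|pos].
    + apply kernel_sum; [lia|lia|exact HKc]. }
  apply Rmult_le_reg_l in HB; [|easy]. replace (2 * T + 2)%nat with (S m) by lia. exact HB.
Qed.

End Inversion.

(** * Truncation and the bound for short sums *)

Lemma sum_n_m_csum (f : nat -> C) a N : (1 <= a)%nat -> sum_n_m (G := C_AbelianMonoid) f a (pred (a + N)) = csum f (seq a N).
Proof.
  intros Ha. induction N as [|N IH].
  - rewrite sum_n_m_zero by lia. reflexivity.
  - replace (pred (a + S N)) with (S (pred (a + N))) by lia. rewrite sum_n_Sm by lia. rewrite IH, seq_S, csum_app.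
   replace (S (pred (a + N))) with (a + N)%nat by lia. simpl. now rewrite Cplus_0_r.
Qed.

(** The end point a + N is one more than the last index, hence at most M + Delta + 1 <= M + 2 Delta;
    this is why the weights are controlled up to M + 2 Delta. *)
Lemma short_sum_csum t M Delta alpha : 1 <= M -> 1 <= Delta -> exists a N : nat,
  M <= INR a /\ INR (a + N) <= M + 2 * Delta /\
  short_sum t M Delta alpha = csum (fun i => t (Z.of_nat i) * e (INR i * alpha))%C (seq a N).
Proof.
  intros HM HD. set (a := Z.to_nat (Zceil M)). set (b := Z.to_nat (Zfloor (M + Delta))).
  destruct (Zceil_bound M) as [c1 c2]. destruct (Zfloor_bound (M + Delta)) as [f1 f2].
  assert (Ha0 : (0 <= Zceil M)%Z) by (apply le_IZR; lra).
  assert (Hb0 : (0 <= Zfloor (M + Delta))%Z) by (apply Z.lt_succ_r, lt_IZR; rewrite succ_IZR; lra).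
  assert (Ea : INR a = IZR (Zceil M)) by (unfold a; rewrite INR_IZR_INZ, Z2Nat.id; easy).
  assert (Eb : INR b = IZR (Zfloor (M + Delta))) by (unfold b; rewrite INR_IZR_INZ, Z2Nat.id; easy).
  assert (Hab : (a < b + 2)%nat) by (apply INR_lt; rewrite plus_INR; simpl; lra).
  assert (Ha1 : (1 <= a)%nat) by (apply INR_le; simpl; lra). exists a, (b + 1 - a)%nat. split; [lra|]. split.
  - replace (a + (b + 1 - a))%nat with (S b) by lia. rewrite S_INR. lra.
  - unfold short_sum. fold a b. rewrite <- sum_n_m_csum by easy. f_equal. lia.
Qed.

Lemma short_sum_reduction kappa psi t p B' C0 v0 : fourier_expansion kappa psi t -> coef_bd t p B' -> tame_form psi C0 ->
  1 <= v0 -> kappa ^ 2 <= v0 -> exists C1, 0 < C1 /\ forall M Delta alpha X, 1 <= M -> 1 <= Delta <= M ->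
   (forall beta, Cmod (short_average psi v0 M Delta beta) <= X) ->
   Cmod (short_sum t M Delta alpha) <= C1 * (1 + ln M) * (X * sqrt M + 1).
Proof.
  intros Hf Hc Hp Hv Hk. pose proof (proj1 Hc) as HB'. pose proof (INR_fact_lt_0 (p + 2)) as HF.
  pose proof (kernel_floor_pos v0) as Hfl. set (V := sqrt (v0 + 1)). assert (HV : 0 < V) by (apply sqrt_lt_R0; lra).
  set (ct := V * (4 * B' * INR (fact (p + 2)))). assert (Hct : 0 < ct) by (unfold ct; apply Rmult_lt_0_compat; [easy|pos]).
  assert (HIv : 0 < inverse_variation v0).
  { unfold inverse_variation. fold V. assert (0 < 100 / kernel_floor v0) by pos.
   assert (0 < 2 * 10 ^ 4 * V * (v0 + 2) / kernel_floor v0 ^ 2); [|lra].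
   apply Rdiv_lt_0_compat; [|pos]. apply Rmult_lt_0_compat; [|lra]. lra. }
  set (Iv := inverse_variation v0) in *. pose proof (pos_INR p) as Hpr.
  exists (5 * Iv * (INR p + 14) * (1 + ct)). split; [apply Rmult_lt_0_compat; [pos|]; lra|].
  intros M Delta alpha X HM HD HX. assert (HX0 : 0 <= X) by (eapply Rle_trans; [apply Cmod_ge_0|apply (HX 0)]).
  destruct (short_sum_csum t M Delta alpha HM (proj1 HD)) as [a [N (A1 & A2 & A3)]]. rewrite A3.

  assert (HMM : M <= M ^ (p + 4)) by (rewrite <- (pow_1 M) at 1; apply Rle_pow; [lra|lia]).
  (* Large enough that the tail, of order M^(p + 2)/T, stays bounded after multiplication by sqrt M,
     and still a power of M, so that the harmonic sum is O(1 + log M). *)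
  set (T := Z.to_nat (up (3 * M ^ (p + 4)))). assert (HT : 3 * M ^ (p + 4) <= INR T <= 3 * M ^ (p + 4) + 1).
  { apply nat_ceil. lra. }
  assert (HaT : (a + N <= S T)%nat) by (apply INR_le; rewrite S_INR; lra).
  assert (HT1 : (1 <= T)%nat) by (apply INR_le; simpl; lra).
  via (short_sum_average psi C0 kappa t p B' v0 M Delta X Hp Hf Hc Hv HM (proj1 HD) (proj2 HD) Hk HX a N T alpha A1 A2 HaT HT1).
  assert (HsM : 1 <= sqrt M) by (rewrite <- sqrt_1; apply sqrt_le_1_alt; easy).
  assert (HsMM : sqrt M * sqrt M = M) by (apply sqrt_sqrt; lra). assert (HlM : 0 <= ln M) by (apply ln_nonneg; lra).
  assert (Hh : harm (2 * T + 2) <= (INR p + 14) * (1 + ln M)).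
  { eapply Rle_trans; [apply harm_ln; lia|].
   assert (E : INR (2 * T + 2) <= 10 * M ^ (p + 4)) by (rewrite plus_INR, mult_INR; simpl (INR 2); lra).
   assert (H10 : ln 10 <= 10) by (rewrite <- (ln_exp 10) at 2; apply Rcomplements.ln_le; [lra|]; generalize (exp_ineq1 10); lra).
   assert (ln (INR (2 * T + 2)) <= 10 + (INR p + 4) * ln M).
   { apply Rle_trans with (ln (10 * M ^ (p + 4))).
    - apply Rcomplements.ln_le; [pos|easy].
    - rewrite ln_mult, ln_pow, plus_INR by lra. simpl (INR 4). lra. }
   nra. }
  assert (Htail : tail_bound p B' v0 M / INR T * sqrt M <= ct).
  { unfold tail_bound. fold V. replace (V * (4 * B' * INR (fact (p + 2)) * M ^ (p + 2)) / INR T * sqrt M) with (ct * (M ^ (p + 2) * sqrt M / INR T)) by (unfold ct; field; lra).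
   rewrite <- (Rmult_1_r ct) at 2. mul_l. apply Rcomplements.Rle_div_l; [lra|].
   assert (E : M ^ (p + 4) = M ^ (p + 2) * M ^ 2) by (rewrite <- pow_add; f_equal; lia).
 assert (sqrt M <= M ^ 2) by nra. nra. }
  fold Iv. pose proof (harm_nonneg (2 * T + 2)) as Hh0.
  replace ((X + tail_bound p B' v0 M / INR T) * (5 * (Iv * sqrt M) * harm (2 * T + 2))) with
   (5 * Iv * (X * sqrt M + tail_bound p B' v0 M / INR T * sqrt M) * harm (2 * T + 2)) by ring.
  assert (HtB : 0 <= tail_bound p B' v0 M / INR T * sqrt M).
  { apply Rmult_le_pos; [|lra]. apply Rmult_le_pos; [now apply (tail_bound_nonneg t)|pos]. }
  assert (HXs : 0 <= X * sqrt M) by pos. replace (5 * Iv * (INR p + 14) * (1 + ct) * (1 + ln M) * (X * sqrt M + 1)) with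
   (5 * Iv * ((1 + ct) * (X * sqrt M + 1)) * ((INR p + 14) * (1 + ln M))) by ring.
  apply Rmult_le_compat; try easy.
  - pos.
  - mul_l. nra.
Qed.

Lemma short_sum_trivial t M Delta alpha B th : 1 <= M -> 1 <= Delta <= M -> 0 <= B -> 0 <= th ->
  (forall n, (1 <= n)%nat -> Cmod (t (Z.of_nat n)) <= B * Rpower (INR n) th) ->
  Cmod (short_sum t M Delta alpha) <= 2 * Delta * (B * Rpower (3 * M) th).
Proof.
  intros HM HD HB Hth Ht. destruct (short_sum_csum t M Delta alpha HM (proj1 HD)) as [a [N (A1 & A2 & A3)]]. rewrite A3.
  rewrite plus_INR in A2. apply Rle_trans with (B * Rpower (3 * M) th * INR (length (seq a N))).
  - rewrite <- rsum_const. apply csum_norm. intros i Hi. apply in_seq in Hi.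
   assert (Hi1 : INR a <= INR i) by (apply le_INR; lia). assert (Hi2 : INR i <= INR a + INR N) by (rewrite <- plus_INR; apply le_INR; lia).
   rewrite Cmod_mult, Cmod_e, Rmult_1_r. eapply Rle_trans; [apply Ht; apply INR_le; simpl; lra|].
   mul_l. apply Rle_Rpower_l; lra.
  - rewrite length_seq, Rmult_comm. mul_r; lra.
Qed.

(** * Choice of the parameters *)

Lemma log_absorb eps x : 0 < eps <= 1 -> 0 <= x -> 1 + x <= exp (eps * x) / eps.
Proof.
  intros He Hx. apply Rmult_le_reg_r with eps; [lra|]. unfold Rdiv. rewrite Rmult_assoc, Rinv_l by lra.
  destruct (Req_dec x 0) as [->|Hne]; [rewrite Rmult_0_r, exp_0; lra|]. pose proof (exp_ineq1 (eps * x) ltac:(nra)). nra.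
Qed.

(* [mu = ln M] and [delta = ln Delta]. *)
Lemma short_average_bound kappa psi t p B' C0 v0 B theta eps1 A : fourier_expansion kappa psi t -> coef_bd t p B' -> tame_form psi C0 ->
  1 <= v0 -> 0 <= B -> 0 <= theta < 1 / 6 -> 0 < eps1 <= 1 / 12 ->
  (forall n, (1 <= n)%nat -> Cmod (t (Z.of_nat n)) <= B * Rpower (INR n) (theta + eps1) /\ Cmod (t (- Z.of_nat n)%Z) <= B * Rpower (INR n) (theta + eps1)) ->
  exists C2, 0 < C2 /\ forall mu delta beta, 0 <= delta <= mu -> 64 <= exp ((mu - delta) / 6) ->
   4 * exp ((mu - delta) / 2) <= exp delta -> exp delta <= A * exp (2 / 3 * mu) ->
   Cmod (short_average psi v0 (exp mu) (exp delta) beta) <= C2 * (1 + mu) ^ 2 * exp ((theta - 1 / 6) * (mu - delta) + 4 / 3 * eps1 * mu).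
Proof.
  intros Hf Hc Hp Hv HB Hth He Ht. pose proof (tame_pos _ _ Hp) as HC.
  set (Aq := Rmax 1 A). assert (HAq : 1 <= Aq /\ A <= Aq) by (split; [apply Rmax_l|apply Rmax_r]).
  set (c0 := 2 * 10 ^ 9 * (v0 + 1) ^ 3 * C0 + 10 ^ 8 * (B + C0) * (v0 + 1) * Aq). assert (Hc0 : 0 < c0).
  { unfold c0. assert (0 < 2 * 10 ^ 9 * (v0 + 1) ^ 3 * C0) by pos.
   assert (0 <= 10 ^ 8 * (B + C0) * (v0 + 1) * Aq) by pos. lra. }
  exists (2 * c0 * 37). split; [lra|]. intros mu delta beta Hmu Hq Hqs HA.
  set (nu := mu - delta) in *. assert (Hnu : 0 <= nu) by (unfold nu; lra).
  (* In these terms q^6 = M/Delta, s^2 = Delta and z = q^(2 theta). *)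
  set (q := exp (nu / 6)) in *. set (s := exp (delta / 2)). set (z := exp (theta * nu / 3)).
  assert (Epow : forall x n, exp x ^ n = exp (INR n * x)).
  { intros x n. induction n as [|n IH]; [simpl; now rewrite Rmult_0_l, exp_0|].
   change (exp x ^ S n) with (exp x * exp x ^ n). rewrite IH, <- exp_plus, S_INR. f_equal. ring. }
  assert (Es2 : s ^ 2 = exp delta) by (unfold s; rewrite Epow; f_equal; simpl; lra).
  assert (Eq3 : q ^ 3 = exp (nu / 2)) by (unfold q; rewrite Epow; f_equal; simpl; lra).
  assert (EM : s ^ 2 * q ^ 6 = exp mu) by (rewrite Es2; unfold q; rewrite Epow, <- exp_plus; f_equal; unfold nu; simpl; lra).
  assert (Hexp1 : forall x, 0 <= x -> 1 <= exp x) by (intros x Hx; rewrite <- exp_0; now apply exp_mono).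
  assert (Htn : 0 <= theta * nu) by pos. assert (Htn2 : theta * nu <= 1 / 6 * nu) by nra.
  assert (Hs1 : 1 <= s) by (apply Hexp1; lra). assert (Hz1 : 1 <= z) by (apply Hexp1; lra).
  assert (Ez2 : z ^ 2 = exp (2 * theta * nu / 3)) by (unfold z; rewrite Epow; f_equal; simpl; lra).
  assert (Hz2 : z ^ 2 <= q) by (rewrite Ez2; apply exp_mono; lra). assert (HsA : s <= Aq ^ 2 * q ^ 6).
  { (* s^6 <= A^3 M^2 = A^3 s^4 q^12 *)
   assert (h1 : exp delta <= Aq * exp (2 / 3 * mu)) by (via HA; mul_r; lra).
   assert (h2 : exp delta ^ 3 <= (Aq * exp (2 / 3 * mu)) ^ 3) by (apply pow_incr; split; [pos|easy]).
   rewrite Rpow_mult_distr, !Epow in h2. simpl (INR 3) in h2.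
   assert (Eq6 : q ^ 6 = exp nu) by (unfold q; rewrite Epow; f_equal; simpl; lra).
   apply Rsqr_incr_0_var; [|apply Rmult_le_pos; [pos|pos]]. unfold Rsqr.
   replace (s * s) with (exp delta) by (rewrite <- Es2; ring). rewrite Eq6.
   replace (Aq ^ 2 * exp nu * (Aq ^ 2 * exp nu)) with (Aq ^ 3 * Aq * exp (2 * nu)).
   2:{ replace (2 * nu) with (nu + nu) by ring. rewrite exp_plus. ring. }
   assert (h3 : exp delta <= Aq ^ 3 * exp (2 * nu)).
   { apply Rmult_le_reg_r with (exp (2 * delta)); [pos|]. rewrite Rmult_assoc, <- !exp_plus.
    replace (2 * nu + 2 * delta) with ((2 + 1) * (2 / 3 * mu)) by (unfold nu; field).
    replace (delta + 2 * delta) with ((2 + 1) * delta) by ring. replace (2 + 1) with (1 + 1 + 1) by ring. exact h2. }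

 nra. }
  set (th := theta + eps1) in *. set (Lam := Rpower (36 * q ^ 8) th).
  assert (Hell : 1 + mu = 1 + ln (s ^ 2 * q ^ 6)) by (rewrite EM, ln_exp; easy).

  assert (HLam : Lam <= 36 * exp (4 / 3 * th * nu)).
  { unfold Lam, Rpower. rewrite ln_mult by pos.
   replace (q ^ 8) with (exp (4 / 3 * nu)) by (unfold q; rewrite Epow; f_equal; simpl; lra).
   rewrite ln_exp. replace (th * (ln 36 + 4 / 3 * nu)) with (th * ln 36 + 4 / 3 * th * nu) by ring. rewrite exp_plus.
   mul_r. rewrite <- (exp_ln 36) at 2 by lra. apply exp_mono.
   assert (0 <= ln 36) by (apply ln_nonneg; lra). unfold th. nra. }
  set (EE := exp ((theta - 1 / 6) * nu + 4 / 3 * eps1 * mu)).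
  assert (Hen : eps1 * nu <= eps1 * mu) by (apply Rmult_le_compat_l; unfold nu; lra). assert (Hen0 : 0 <= eps1 * nu) by pos.
  assert (HY : z ^ 2 / q + Lam / (q * z) <= 37 * EE).
  { assert (Y1 : z ^ 2 / q <= EE).
   { rewrite Ez2. unfold Rdiv, q. rewrite <- exp_Ropp, <- exp_plus. apply exp_mono. lra. }
   assert (Y2 : Lam / (q * z) <= 36 * EE); [|lra]. unfold q, z. rewrite <- exp_plus. unfold Rdiv. rewrite <- exp_Ropp.
   apply Rle_trans with (36 * exp (4 / 3 * th * nu) * exp (- (nu / 6 + theta * nu * / 3))).
   - mul_r; exact HLam.
   - rewrite Rmult_assoc, <- exp_plus. mul_l. apply exp_mono. unfold th. lra. }
  rewrite (short_average_wave psi C0) by pos. set (LB := local_bound C0 B v0 q z (1 + mu) Aq Lam).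
  assert (HLB : LB <= c0 * (1 + mu) ^ 2 * (37 * EE)).
  { unfold LB, local_bound. fold c0. apply Rmult_le_compat_l; [|exact HY]. apply Rmult_le_pos; [lra|pos]. }
  assert (Hd1 : 1 <= exp delta) by (apply Hexp1; lra).
  assert (Hdi : 0 < / exp delta <= 1) by (split; [pos|rewrite <- Rinv_1; apply Rinv_le_contravar; lra]).
  assert (HW : Cmod (CInt (wave psi v0 (exp mu)) beta (beta + / (32 * exp delta))) <= 2 * (LB / exp delta)).
  { apply (wave_unit_interval psi C0 v0 (exp mu) (/ exp delta)); try easy; try lra; try apply exp_pos.
   - intros x1 x2 h0 h1 h2 h3.
    pose proof (wave_local psi C0 kappa t p B' B th v0 q s z (1 + mu) Aq Lam Hp Hf Hc HB ltac:(unfold th; lra) Ht Hv Hq Hs1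
     ltac:(rewrite Eq3, Es2; exact Hqs) Hz1 Hz2 (proj1 HAq) HsA Hell eq_refl x1 x2 h0 h1 h2 ltac:(rewrite Es2; exact h3)) as HL.
    rewrite EM, Es2 in HL. fold LB in HL. apply Rmult_le_reg_l with (exp delta); [lra|].
    replace (exp delta * (LB / exp delta)) with LB by (field; lra). exact HL.
   - assert (0 < / (32 * exp delta)) by pos. lra.
   - replace (beta + / (32 * exp delta) - beta) with (/ (32 * exp delta)) by ring. apply Rinv_le_contravar; lra. }
  apply Rle_trans with (exp delta * (2 * (LB / exp delta))); [apply Rmult_le_compat_l; lra|].
  replace (exp delta * (2 * (LB / exp delta))) with (2 * LB) by (field; lra).
  replace (2 * c0 * 37 * (1 + mu) ^ 2 * EE) with (2 * (c0 * (1 + mu) ^ 2 * (37 * EE))) by ring. lra.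
Qed.

Theorem theorem1 (psi : C -> C) (kappa : R) (t : Z -> C) (theta : R)
  (hpsi : maass_cusp_form kappa psi)
  (hfourier : fourier_expansion kappa psi t)
  (hparity : even_or_odd t)
  (htheta0 : 0 <= theta)
  (htheta : admissible_exponent t theta) :
  forall eps : R, 0 < eps ->
  forall A : R,
  exists B : R,
  forall M Delta alpha : R,
    1 <= M -> 1 <= Delta <= M -> Delta <= A * Rpower M (2 / 3) ->
    Cmod (short_sum t M Delta alpha)
      <= B * Rpower Delta (1 / 6 - theta) * Rpower M (1 / 3 + theta + eps).
Proof.
  intros eps Heps A. destruct (coef_bd_exists t theta htheta0 hparity htheta) as [p [B' Hc]].
  destruct (maass_form_tame kappa psi t p B' hpsi hfourier Hc) as [C0 Hp]. pose proof (tame_pos _ _ Hp) as HC.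
  set (v0 := kappa ^ 2 + 1). assert (Hk2 : 0 <= kappa ^ 2) by apply pow2_ge_0.
  assert (Hv : 1 <= v0) by (unfold v0; lra). assert (Hk : kappa ^ 2 <= v0) by (unfold v0; lra).
  destruct (short_sum_reduction kappa psi t p B' C0 v0 hfourier Hc Hp Hv Hk) as [C1 [HC1 Hred]].
  set (eps' := Rmin eps 1). assert (He' : 0 < eps' <= 1 /\ eps' <= eps).
  { unfold eps'. split; [split; [apply Rmin_pos; lra|apply Rmin_r]|apply Rmin_l]. }
  (* The coefficients cost the exponent 4/3 eps1 and the cube of the logarithm costs eps'/4;
     together this is less than eps'. *)
  set (eps1 := eps' / 12). assert (He1 : 0 < eps1 <= 1 / 12) by (unfold eps1; lra).
  destruct (htheta eps1 (proj1 He1)) as [Bt0 HBt0]. set (Bt := Rabs Bt0). assert (HBt : 0 <= Bt) by apply Rabs_pos.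
  assert (Ht : forall n, (1 <= n)%nat -> Cmod (t (Z.of_nat n)) <= Bt * Rpower (INR n) (theta + eps1) /\
   Cmod (t (- Z.of_nat n)%Z) <= Bt * Rpower (INR n) (theta + eps1)).
  { intros n Hn. rewrite (parity_Cmod t n hparity Hn).
   assert (E : Cmod (t (Z.of_nat n)) <= Bt * Rpower (INR n) (theta + eps1)); [|split; exact E].
   eapply Rle_trans; [apply HBt0; lia|]. rewrite <- INR_IZR_INZ. mul_r; apply Rle_abs. }
  assert (Hlog : forall x, 0 <= x -> (1 + x) ^ 3 <= exp (eps' / 4 * x) / (eps' / 12) ^ 3).
  { intros x Hx. pose proof (log_absorb (eps' / 12) x ltac:(lra) Hx) as HL.
   replace (exp (eps' / 4 * x) / (eps' / 12) ^ 3) with ((exp (eps' / 12 * x) / (eps' / 12)) ^ 3).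
   - apply pow_incr; lra.
   - replace (eps' / 4 * x) with (eps' / 12 * x + eps' / 12 * x + eps' / 12 * x) by field. rewrite !exp_plus. field. lra. }
  set (Ke := / (eps' / 12) ^ 3) in *. assert (HKe : 0 < Ke) by (apply Rinv_0_lt_compat, pow_lt; lra).
  (* The right-hand side without its constant is [exp (mu/2 + (theta - 1/6)(mu - delta) + eps mu)]. *)
  assert (Hshape : forall mu delta, 0 <= delta <= mu ->
   Rpower (exp delta) (1 / 6 - theta) * Rpower (exp mu) (1 / 3 + theta + eps) = exp (mu / 2 + (theta - 1 / 6) * (mu - delta) + eps * mu)).
  { intros mu delta H. unfold Rpower. rewrite !ln_exp, <- exp_plus. f_equal. field. }
  assert (Hsqrt : forall mu, sqrt (exp mu) = exp (mu / 2)).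
  { intros mu. replace (exp mu) with (exp (mu / 2) * exp (mu / 2)) by (rewrite <- exp_plus; f_equal; field). apply sqrt_square. left; apply exp_pos. }
  assert (Hgoal : exists B, forall mu delta alpha, 0 <= delta <= mu -> exp delta <= A * exp (2 / 3 * mu) ->
   Cmod (short_sum t (exp mu) (exp delta) alpha) <= B * exp (mu / 2 + (theta - 1 / 6) * (mu - delta) + eps * mu)).
  2:{ destruct Hgoal as [B HB]. exists B. intros M Delta alpha HM HD HA.
    specialize (HB (ln M) (ln Delta) alpha). rewrite <- Hshape, !exp_ln in HB; try lra.
    - rewrite Rmult_assoc. apply HB; [|exact HA]. split; [rewrite <- ln_1|]; apply Rcomplements.ln_le; lra.
    - split; [rewrite <- ln_1|]; apply Rcomplements.ln_le; lra. }
  assert (Hexp1 : forall x, 0 <= x -> 1 <= exp x) by (intros x Hx; rewrite <- exp_0; now apply exp_mono).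
   (* The bound O(1) for the averages suffices if (M/Delta)^(theta - 1/6) is bounded below. This
      covers theta >= 1/6, with c = 1, and bounded M/Delta. *)
   assert (Htriv : forall c, 1 <= c -> forall mu delta alpha, 0 <= delta <= mu ->
   exp (mu / 2) <= c * exp (mu / 2 + (theta - 1 / 6) * (mu - delta)) ->
   Cmod (short_sum t (exp mu) (exp delta) alpha) <= C1 * (C0 + 1) * Ke * c * exp (mu / 2 + (theta - 1 / 6) * (mu - delta) + eps * mu)).
  { intros c Hc1 mu delta alpha H Hcm. assert (Hd1 : 1 <= exp delta) by (apply Hexp1; lra). assert (Hm1 : 1 <= exp mu) by (apply Hexp1; lra).
   via (Hred (exp mu) (exp delta) alpha C0 Hm1).
   - split; [easy|apply exp_mono; lra].
   - intros beta. apply (short_average_trivial psi C0); easy || lra.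
   - rewrite ln_exp, Hsqrt, exp_plus. set (E := exp (mu / 2 + (theta - 1 / 6) * (mu - delta))) in *.
    assert (Hh1 : 1 <= exp (mu / 2)) by (apply Hexp1; lra). assert (Hl : 1 + mu <= Ke * exp (eps * mu)).
    { apply Rle_trans with ((1 + mu) ^ 3); [nra|]. eapply Rle_trans; [apply Hlog; lra|]. unfold Rdiv. rewrite Rmult_comm.
     fold Ke. mul_l. apply exp_mono. nra. }
    apply Rle_trans with (C1 * (Ke * exp (eps * mu)) * ((C0 + 1) * (c * E))); [|right; ring].
    apply Rmult_le_compat; [pos|nra|apply Rmult_le_compat_l; lra|]. nra. }
  destruct (Rle_dec (1 / 6) theta) as [Hbig|Hsmall].
  - exists (C1 * (C0 + 1) * Ke * 1). intros mu delta alpha H _. apply Htriv; [lra|easy|]. rewrite Rmult_1_l. apply exp_mono.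
   assert (0 <= (theta - 1 / 6) * (mu - delta)) by pos. lra.
  - destruct (short_average_bound kappa psi t p B' C0 v0 Bt theta eps1 A hfourier Hc Hp Hv HBt ltac:(lra) He1 Ht) as [C2 [HC2 Hav]].
   set (b1 := C1 * (C0 + 1) * Ke * 64). set (b2 := 24 * Bt). set (b3 := C1 * Ke * (C2 + 1)).
   assert (Hb1 : 0 <= b1) by (unfold b1; apply Rmult_le_pos; [|lra]; apply Rmult_le_pos; [|lra]; apply Rmult_le_pos; lra).
   assert (Hb2 : 0 <= b2) by (unfold b2; lra).
   assert (Hb3 : 0 <= b3) by (unfold b3; apply Rmult_le_pos; [|lra]; apply Rmult_le_pos; lra).
   exists (b1 + b2 + b3). intros mu delta alpha H HA.
   assert (Hd1 : 1 <= exp delta) by (apply Hexp1; lra). assert (Hm1 : 1 <= exp mu) by (apply Hexp1; lra).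
   set (E := exp (mu / 2 + (theta - 1 / 6) * (mu - delta) + eps * mu)). assert (HE : 0 < E) by apply exp_pos.
   assert (Hem : 0 <= eps' * mu <= eps * mu) by nra.
   assert (Htn : - (1 / 6 * (mu - delta)) <= (theta - 1 / 6) * (mu - delta)).
   { nra. }
   destruct (Rlt_dec (exp ((mu - delta) / 6)) 64) as [Hq|Hq]; [|destruct (Rlt_dec (exp delta) (4 * exp ((mu - delta) / 2))) as [Hs|Hs]].
   (* Here (M/Delta)^(1/6) < 64, so the saving that is given up is at most a factor 64. *)
   + apply Rle_trans with (b1 * E); [|apply Rmult_le_compat_r; lra]. apply Htriv; [lra|easy|].
    apply Rle_trans with (exp ((mu - delta) / 6) * exp (mu / 2 + (theta - 1 / 6) * (mu - delta))).
    * rewrite <- exp_plus. apply exp_mono. lra.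
    * mul_r; lra.
   (* Here Delta < 4 (M/Delta)^(1/2), hence Delta << M^(1/3), and the sum of |t(n)| is already small
      enough. *)
   + apply Rle_trans with (b2 * E); [|apply Rmult_le_compat_r; lra].
    eapply Rle_trans; [apply (short_sum_trivial t (exp mu) (exp delta) alpha Bt (theta + eps1)); try lra|].
    * split; [easy|apply exp_mono; lra].
    * intros n Hn. now apply Ht.
    * assert (HR : Rpower (3 * exp mu) (theta + eps1) <= 3 * exp ((theta + eps1) * mu)).
     { unfold Rpower. rewrite ln_mult, ln_exp by lra. rewrite Rmult_plus_distr_l, exp_plus.
      mul_r. rewrite <- (exp_ln 3) at 2 by lra. apply exp_mono. assert (0 <= ln 3) by (apply ln_nonneg; lra). nra. }
     assert (HD : exp delta * exp ((theta + eps1) * mu) <= 4 * E).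
     { assert (Hd3 : exp delta <= 4 * exp (mu / 3)).
      { (* [Delta^(3/2) < 4 M^(1/2)] *)
       assert (h1 : exp (3 / 2 * delta) <= 4 * exp (mu / 2)).
       { apply Rmult_le_reg_r with (exp (- (delta / 2))); [pos|]. rewrite Rmult_assoc, <- !exp_plus.
        replace (3 / 2 * delta + - (delta / 2)) with delta by field. replace (mu / 2 + - (delta / 2)) with ((mu - delta) / 2) by field. lra. }
       destruct (Rle_dec delta (mu / 3)) as [h|h]; [apply exp_mono in h; pose proof (exp_pos (mu / 3)); lra|].
       apply Rle_trans with (exp (3 / 2 * delta) * exp (- (mu / 6))).
       - rewrite <- exp_plus. apply exp_mono. lra.
       - apply Rle_trans with (4 * exp (mu / 2) * exp (- (mu / 6))); [mul_r; easy|].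
        rewrite Rmult_assoc, <- exp_plus. right. f_equal. f_equal. field. }
      apply Rle_trans with (4 * exp (mu / 3) * exp ((theta + eps1) * mu)); [mul_r; easy|].
      rewrite Rmult_assoc, <- exp_plus. mul_l. apply exp_mono.
      assert (0 <= (1 / 6 - theta) * delta) by pos. unfold eps1. lra. }
     apply Rle_trans with (2 * exp delta * (Bt * (3 * exp ((theta + eps1) * mu)))).
     -- mul_l. apply Rmult_le_compat_l; lra.
     -- unfold b2. replace (2 * exp delta * (Bt * (3 * exp ((theta + eps1) * mu)))) with (6 * Bt * (exp delta * exp ((theta + eps1) * mu))) by ring.
      apply Rle_trans with (6 * Bt * (4 * E)); [apply Rmult_le_compat_l; lra|lra].
   + apply Rle_trans with (b3 * E); [|apply Rmult_le_compat_r; lra].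
    set (X := C2 * (1 + mu) ^ 2 * exp ((theta - 1 / 6) * (mu - delta) + 4 / 3 * eps1 * mu)).
    via (Hred (exp mu) (exp delta) alpha X Hm1).
    * split; [easy|apply exp_mono; lra].
    * intros beta. apply Hav; try easy; lra.
    * rewrite ln_exp, Hsqrt. unfold X. set (F := exp (mu / 2 + (theta - 1 / 6) * (mu - delta) + 4 / 3 * eps1 * mu)).
     replace (C2 * (1 + mu) ^ 2 * exp ((theta - 1 / 6) * (mu - delta) + 4 / 3 * eps1 * mu) * exp (mu / 2)) with (C2 * (1 + mu) ^ 2 * F).
     2:{ symmetry. unfold F. rewrite Rmult_assoc, <- exp_plus. f_equal. f_equal. field. }
     (* F >= 1 absorbs the additive 1 of the reduction to averages. *)
     assert (HF : 1 <= F) by (apply Hexp1; assert (0 <= eps1 * mu) by pos; lra). assert (Hl : (1 + mu) ^ 3 * F <= Ke * E).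
     { apply Rle_trans with (exp (eps' / 4 * mu) * Ke * F); [mul_r; eapply Rle_trans; [apply Hlog; lra|right; reflexivity]|].
      replace (exp (eps' / 4 * mu) * Ke * F) with (Ke * (exp (eps' / 4 * mu) * F)) by ring. mul_l.
      unfold F. rewrite <- exp_plus. apply exp_mono. unfold eps1. lra. }
     apply Rle_trans with (C1 * ((C2 + 1) * ((1 + mu) ^ 3 * F))).
     -- rewrite Rmult_assoc. mul_l. assert (h1 : 1 <= (1 + mu) ^ 2 * F) by nra.
      replace ((C2 + 1) * ((1 + mu) ^ 3 * F)) with ((1 + mu) * (C2 * ((1 + mu) ^ 2 * F) + (1 + mu) ^ 2 * F)) by ring.
      apply Rmult_le_compat_l; lra.
     -- unfold b3. replace (C1 * Ke * (C2 + 1) * E) with (C1 * ((C2 + 1) * (Ke * E))) by ring.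
      mul_l. apply Rmult_le_compat_l; lra.
Qed.
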